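(* The solution to the forward-backward stochastic differential equations $$0=Ru+B'p+\bar B'q,$$ $$dx=[Ax+Bu]dt+[\bar Ax+\bar Bu]dw,\quad x(t_0)=x_0,$$ $$dp=-[A'p+\bar A'q+Qx]dt+q\,dw,\quad p(T)=Hx(T)$$ is homogeneous, i.e. $\Theta(t):=p(t)-P(t)x(t)=0$, if and only if the Riccati equation $$0=\dot P+A'P+\bar A'P\bar A+PA+Q-\Gamma_0'\Upsilon_0^{\dagger}\Gamma_0,\qquad P(T)=H,$$ is regular, i.e. $\mathrm{Range}\,(\Gamma_0(t))\subseteq\mathrm{Range}\,(\Upsilon_0(t))$.
   Context: Let $w$ be a standard one-dimensional Brownian motion generating the filtration $(\mathcal F_t)$. $M'$ is the transpose and $M^{\dagger}$ the Moore-Penrose inverse of $M$. $A(t),\bar A(t)\in\mathbb R^{n\times n}$, $B(t),\bar B(t)\in\mathbb R^{n\times m}$ are deterministic; $Q(t)\in\mathbb R^{n\times n}$, $R(t)\in\mathbb R^{m\times m}$, $H\in\mathbb R^{n\times n}$ are symmetric and deterministic. $\Upsilon_0=R+\bar B'P\bar B$ and $\Gamma_0=B'P+\bar B'P\bar A$, where $P$ is the solution of the displayed Riccati equation. The system is the maximum-principle system of the problem of minimizing $J(t_0,x_0;u)=E\int_{t_0}^T[x'Qx+u'Ru]dt+E\,x'(T)Hx(T)$ over $\mathcal F_t$-adapted square-integrable controls $u$, subject to the displayed state equation. Standing convexity assumption: $J(t_0,0;u)\ge0$ for all such $u$.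
   Formalization: Added: coefficients bounded measurable, P symmetric, and the gain Υ0†Γ0 square integrable on [t0,T] (otherwise P may be non-unique and the claim false); regularity means the range inclusion for almost every t; homogeneous means a solution exists for every x0 and all have Θ=0. *)

(* Defs.v *)
From HB Require Import structures.
From mathcomp Require Import all_boot all_order all_algebra.
From mathcomp Require Import all_classical all_reals all_analysis.
Set Implicit Arguments.
Unset Strict Implicit.
Unset Printing Implicit Defensive.
Import Order.TTheory GRing.Theory Num.Theory.
Import numFieldNormedType.Exports.
Local Open Scope classical_set_scope.
Local Open Scope ring_scope.

Definition penrose (R : realType) (k l : nat) (M : 'M[R]_(k, l))
    (X : 'M[R]_(l, k)) : Prop :=
  [/\ M *m X *m M = M, X *m M *m X = X,
      (M *m X)^T = M *m X & (X *m M)^T = X *m M].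

Definition mpinv (R : realType) (k l : nat) (M : 'M[R]_(k, l)) :
  'M[R]_(l, k) := xget 0 [set X | penrose M X].

Lemma row_free_gram (R : realType) (k l : nat) (F : 'M[R]_(k, l)) :
  row_free F -> F *m F^T \in unitmx.
Proof.
move=> fF; rewrite -row_free_unit; apply: inj_row_free => v vFF.
have vF0 : v *m F = 0.
  have : (v *m F) *m (v *m F)^T = 0.
    by rewrite trmx_mul mulmxA -(mulmxA v) vFF mul0mx.
  move/matrixP => /(_ 0 0); rewrite !mxE => /eqP.
  under eq_bigr do rewrite [X in _ * X]mxE -expr2.
  rewrite psumr_eq0 => [/allP h|i _]; last exact: sqr_ge0.
  apply/rowP => i; rewrite [RHS]mxE; apply/eqP.
  by move: (h i (mem_index_enum i)); rewrite /= sqrf_eq0.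
by apply: (row_free_inj fF); rewrite vF0 mul0mx.
Qed.

Lemma penrose_uniq (R : realType) (k l : nat) (M : 'M[R]_(k, l)) X Y :
  penrose M X -> penrose M Y -> X = Y.
Proof.
move=> [MXM XMX MXt XMt] [MYM YMY MYt YMt].
have e1 : M *m X = M *m Y.
  have -> : M *m X = (M *m Y)^T *m (M *m X)^T.
    by rewrite MXt MYt mulmxA MYM.
  by rewrite -trmx_mul mulmxA MXM MYt.
have e2 : X *m M = Y *m M.
  have -> : X *m M = (X *m M)^T *m (Y *m M)^T.
    by rewrite XMt YMt -mulmxA (mulmxA M) MYM.
  by rewrite -trmx_mul -mulmxA (mulmxA M) MXM YMt.
by rewrite -XMX -mulmxA e1 mulmxA e2 YMY.
Qed.

Lemma penrose_factor (R : realType) (k l r : nat) (C : 'M[R]_(k, r))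
    (F : 'M[R]_(r, l)) :
  C^T *m C \in unitmx -> F *m F^T \in unitmx ->
  penrose (C *m F) (F^T *m invmx (F *m F^T) *m (invmx (C^T *m C) *m C^T)).
Proof.
move=> uC uF; set X := _ *m (_ *m C^T).
have MX : C *m F *m X = C *m (invmx (C^T *m C) *m C^T).
  rewrite /X -mulmxA; congr (_ *m _).
  by rewrite !mulmxA mulmxV // mul1mx.
have XM : X *m (C *m F) = F^T *m invmx (F *m F^T) *m F.
  rewrite /X -[LHS]mulmxA; congr (_ *m _).
  by rewrite mulmxA -(mulmxA _ C^T) mulVmx // mul1mx.
split.
- rewrite MX mulmxA; congr (_ *m _).
  by rewrite -!mulmxA mulVmx // mulmx1.
- rewrite XM /X -!mulmxA; congr (_ *m (_ *m _)).
  by rewrite (mulmxA F) (mulmxA (F *m F^T)) mulmxV // mul1mx.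
- by rewrite MX !trmx_mul trmx_inv trmx_mul !trmxK -mulmxA.
- by rewrite XM !trmx_mul trmx_inv trmx_mul !trmxK -mulmxA.
Qed.

Lemma mpinvP (R : realType) (k l : nat) (M : 'M[R]_(k, l)) :
  penrose M (mpinv M).
Proof.
rewrite /mpinv; case: xgetP => [X _ //|] /= noX.
have uF : row_base M *m (row_base M)^T \in unitmx.
  exact/row_free_gram/row_base_free.
have uC : (col_base M)^T *m col_base M \in unitmx.
  rewrite -[X in _ *m X]trmxK; apply: row_free_gram.
  by rewrite /row_free mxrank_tr; exact: col_base_full.
have := penrose_factor uC uF; rewrite mulmx_base.
by move/noX.
Qed.

Section stochastic.
Context d (Omega : measurableType d) (R : realType).
Variables (Pr : probability Omega R) (w : R -> Omega -> R).

(* Generators of F_t: the events of w_s, 0 <= s <= t, and the null events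
   (usual augmentation). *)
Definition filtration_gen (t : R) : set (set Omega) :=
  [set E | (exists s : R, 0 <= s <= t /\
              exists2 B : set R, measurable B & E = w s @^-1` B)
           \/ (measurable E /\ Pr E = 0%E)].

Definition filtration (t : R) : set (set Omega) := <<s filtration_gen t >>.

Definition filtration_type (t : R) := g_sigma_algebraType (filtration_gen t).

Definition brownian_motion : Prop :=
  [/\ forall t, 0 <= t -> measurable_fun setT (w t),
      {ae Pr, forall omega, w 0 omega = 0},
      {ae Pr, forall omega,
         {within `[0, +oo[%classic, continuous (fun t => w t omega)}},
      (forall (s t : R) (B : set R), 0 <= s -> s < t -> measurable B ->
         Pr [set omega | B (w t omega - w s omega)]
         = normal_prob 0 (Num.sqrt (t - s)) B)
    & (forall (s t : R) (A : set Omega) (B : set R), 0 <= s -> s < t ->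
         filtration s A -> measurable B ->
         Pr (A `&` [set omega | B (w t omega - w s omega)])
         = (Pr A * Pr [set omega | B (w t omega - w s omega)%R])%E)].

Definition progressive (t0 T : R) (y : R -> Omega -> R) : Prop :=
  forall t, t0 <= t <= T ->
    measurable_fun (`[t0, t]%classic `*` [set: filtration_type t])
      (fun z : measurableTypeR R * filtration_type t => y z.1 z.2).

Definition L2_process (t0 T : R) (k : nat) (y : R -> Omega -> 'cV[R]_k) :
    Prop :=
  forall i, progressive t0 T (fun s omega => y s omega i 0) /\
    (\int[Pr]_omega \int[lebesgue_measure]_(s in `[t0, T])
       ((y s omega i 0) ^+ 2)%:E < +oo)%E.

(* Simple process equal to [sp_val j] on ]sp_time j, sp_time j.+1],
   j < sp_size, and to 0 elsewhere. *)
Record simple_process (a b : R) := SimpleProcess {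
  sp_size : nat;
  sp_time : nat -> R;
  sp_val : nat -> Omega -> R;
  sp_time_le : forall j, (j < sp_size)%N -> sp_time j <= sp_time j.+1;
  sp_time_ge : a <= sp_time 0;
  sp_time_last : sp_time sp_size <= b;
  sp_val_meas : forall j, (j < sp_size)%N ->
    measurable_fun [set: filtration_type (sp_time j)]
      (sp_val j : filtration_type (sp_time j) -> R);
  sp_val_bnd : forall j, (j < sp_size)%N ->
    exists c : R, forall omega, `|sp_val j omega| <= c }.

Definition sp_path a b (f : simple_process a b) (s : R) (omega : Omega) : R :=
  \sum_(j < sp_size f)
    sp_val f j omega * \1_(`]sp_time f j, sp_time f j.+1]%classic) s.

Definition sp_ito a b (f : simple_process a b) (omega : Omega) : R :=
  \sum_(j < sp_size f) sp_val f j omega *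
    (w (sp_time f j.+1) omega - w (sp_time f j) omega).

(* [I] is a version of the integral of [f dw] over [a, b], i.e. the limit in
   L^2(Omega) of the integrals of simple processes converging to [f] in
   L^2([a, b] x Omega). *)
Definition is_ito_integral (a b : R) (f : R -> Omega -> R) (I : Omega -> R) :
    Prop :=
  measurable_fun setT I /\
  exists phi : nat -> simple_process a b,
    ((fun k => \int[Pr]_omega \int[lebesgue_measure]_(s in `[a, b])
        ((sp_path (phi k) s omega - f s omega) ^+ 2)%:E) @ \oo --> 0)%E /\
    ((fun k => \int[Pr]_omega
        ((sp_ito (phi k) omega - I omega) ^+ 2)%:E) @ \oo --> 0)%E.

(* dy = b dt + sigma dw on [t0, T]: for each t, almost surely,
   y(t) - y(t0) - int_t0^t b ds = int_t0^t sigma dw.  Processes are identified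
   up to modification, so that continuity of paths is not required. *)
Definition ito_equation (t0 T : R) (k : nat)
    (y b sigma : R -> Omega -> 'cV[R]_k) : Prop :=
  forall t, t0 <= t <= T -> forall i,
    is_ito_integral t0 t (fun s omega => sigma s omega i 0)
      (fun omega => y t omega i 0 - y t0 omega i 0 -
         \int[lebesgue_measure]_(s in `[t0, t]) b s omega i 0).

End stochastic.

Record lq_data (R : realType) (n m : nat) := LQData {
  lqA : R -> 'M[R]_n;
  lqAbar : R -> 'M[R]_n;
  lqB : R -> 'M[R]_(n, m);
  lqBbar : R -> 'M[R]_(n, m);
  lqQ : R -> 'M[R]_n;
  lqR : R -> 'M[R]_m;
  lqH : 'M[R]_n }.

Definition bounded_measurable (R : realType) (t0 T : R) (k l : nat)
    (M : R -> 'M[R]_(k, l)) : Prop :=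
  forall i j, measurable_fun `[t0, T]%classic (fun t => M t i j) /\
    exists c : R, forall t, t0 <= t <= T -> `|M t i j| <= c.

Definition lq_coefficients (R : realType) (n m : nat) (t0 T : R)
    (D : lq_data R n m) : Prop :=
  [/\ [/\ bounded_measurable t0 T (lqA D), bounded_measurable t0 T (lqAbar D),
          bounded_measurable t0 T (lqB D) & bounded_measurable t0 T (lqBbar D)],
      bounded_measurable t0 T (lqQ D), bounded_measurable t0 T (lqR D)
    & [/\ forall t, t0 <= t <= T -> (lqQ D t)^T = lqQ D t,
          forall t, t0 <= t <= T -> (lqR D t)^T = lqR D t
        & (lqH D)^T = lqH D]].

Section lq.
Context d (Omega : measurableType d) (R : realType).
Variables (Pr : probability Omega R) (w : R -> Omega -> R).
Variables (n m : nat) (t0 T : R) (D : lq_data R n m).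

Definition state_equation (x0 : 'cV[R]_n) (x : R -> Omega -> 'cV[R]_n)
    (u : R -> Omega -> 'cV[R]_m) : Prop :=
  ito_equation Pr w t0 T x
    (fun t omega => lqA D t *m x t omega + lqB D t *m u t omega)
    (fun t omega => lqAbar D t *m x t omega + lqBbar D t *m u t omega) /\
  {ae Pr, forall omega, x t0 omega = x0}.

Definition cost (x : R -> Omega -> 'cV[R]_n) (u : R -> Omega -> 'cV[R]_m) :
    \bar R :=
  (\int[Pr]_omega \int[lebesgue_measure]_(t in `[t0, T])
      (((x t omega)^T *m lqQ D t *m x t omega) 0 0 +
       ((u t omega)^T *m lqR D t *m u t omega) 0 0)%:E +
   \int[Pr]_omega (((x T omega)^T *m lqH D *m x T omega) 0 0)%:E)%E.

Definition convexity : Prop :=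
  forall (u : R -> Omega -> 'cV[R]_m) (x : R -> Omega -> 'cV[R]_n),
    L2_process Pr w t0 T u -> L2_process Pr w t0 T x ->
    state_equation 0 x u -> (0 <= cost x u)%E.

Definition fbsde_solution (x0 : 'cV[R]_n)
    (x p q : R -> Omega -> 'cV[R]_n) (u : R -> Omega -> 'cV[R]_m) : Prop :=
  [/\ [/\ L2_process Pr w t0 T x, L2_process Pr w t0 T p,
          L2_process Pr w t0 T q & L2_process Pr w t0 T u],
      {ae lebesgue_measure, forall t : R, t0 <= t <= T ->
         {ae Pr, forall omega,
            0 = lqR D t *m u t omega + (lqB D t)^T *m p t omega
                + (lqBbar D t)^T *m q t omega}},
      state_equation x0 x u,
      ito_equation Pr w t0 T p
        (fun t omega => - ((lqA D t)^T *m p t omega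
           + (lqAbar D t)^T *m q t omega + lqQ D t *m x t omega))
        q
    & {ae Pr, forall omega, p T omega = lqH D *m x T omega}].

(* x0 is arbitrary; speaking of the solution presupposes that there is one. *)
Definition homogeneous (P : R -> 'M[R]_n) : Prop :=
  (forall x0, exists x p q u, fbsde_solution x0 x p q u) /\
  (forall x0 x p q u, fbsde_solution x0 x p q u ->
     forall t, t0 <= t <= T ->
       {ae Pr, forall omega, p t omega - P t *m x t omega = 0}).

End lq.

Section riccati.
Variables (R : realType) (n m : nat) (t0 T : R) (D : lq_data R n m).
Variable (P : R -> 'M[R]_n).

Definition Upsilon0 (t : R) : 'M[R]_m :=
  lqR D t + (lqBbar D t)^T *m P t *m lqBbar D t.

Definition Gamma0 (t : R) : 'M[R]_(m, n) :=
  (lqB D t)^T *m P t + (lqBbar D t)^T *m P t *m lqAbar D t.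

Definition riccati_rhs (t : R) : 'M[R]_n :=
  (lqA D t)^T *m P t + (lqAbar D t)^T *m P t *m lqAbar D t + P t *m lqA D t
  + lqQ D t - (Gamma0 t)^T *m mpinv (Upsilon0 t) *m Gamma0 t.

(* Caratheodory solution of 0 = P' + riccati_rhs, P(T) = H, with values in the
   symmetric matrices. *)
Definition riccati_solution : Prop :=
  [/\ forall t, t0 <= t <= T -> (P t)^T = P t,
      forall i j, lebesgue_measure.-integrable `[t0, T]%classic
        (fun t => (riccati_rhs t i j)%:E)
    & forall t, t0 <= t <= T -> forall i j,
        P t i j = lqH D i j
          + \int[lebesgue_measure]_(s in `[t, T]) riccati_rhs s i j].

(* Without this integrability of the feedback gain a regular Riccati equation
   may have several solutions, and p = P x may fail for one of them:
   n = m = 1, A = Abar = Bbar = 0, B = 1, Q = 2, R(t) = (T - t)^2, H = 0,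
   P(t) = - 2 (T - t), x(t) = T - t, p(t) = (T - t)^2. *)
Definition square_integrable_gain : Prop :=
  forall i j,
    measurable_fun `[t0, T]%classic
      (fun t => (mpinv (Upsilon0 t) *m Gamma0 t) i j) /\
    lebesgue_measure.-integrable `[t0, T]%classic
      (fun t => (((mpinv (Upsilon0 t) *m Gamma0 t) i j) ^+ 2)%:E).

Definition regular : Prop :=
  {ae lebesgue_measure, forall t : R, t0 <= t <= T ->
     range (fun v : 'cV[R]_n => Gamma0 t *m v)
       `<=` range (fun v : 'cV[R]_m => Upsilon0 t *m v)}.

End riccati.

(* Main.v *)
Require Import Defs.
From HB Require Import structures.
From mathcomp Require Import all_boot all_order all_algebra.
From mathcomp Require Import all_classical all_reals all_analysis.
From mathcomp Require Import measurable_realfun.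
From mathcomp Require Import ring lra.
Set Implicit Arguments.
Unset Strict Implicit.
Unset Printing Implicit Defensive.
Import Order.TTheory GRing.Theory Num.Theory.
Import numFieldNormedType.Exports.
Local Open Scope classical_set_scope.
Local Open Scope ring_scope.

(** Let K = - Upsilon0^+ Gamma0 and L = Gamma0 + Upsilon0 K = (1 - Upsilon0 Upsilon0^+) Gamma0; the
    Riccati equation is regular iff L = 0 almost everywhere.  Polarize the cost into a bilinear form
    J on pairs (state, control).  On [t1, T], the product formula evaluates J in two ways: the
    costate equation gives J((x,u), (eta,zeta)) = E p(t1)' eta(t1), and the Riccati equation gives
    J((x,u), (eta, K eta)) = E x(t1)' P(t1) eta(t1) + E int u' L eta.

    If L = 0, the closed loop u = K x together with p = P x and q = P (Abar x + Bbar u) solves the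
    system.  For an arbitrary solution, comparing the two evaluations for the closed loop eta that
    starts at time t1 from Theta(t1) gives E |Theta(t1)|^2 = 0.

    Conversely, let X be a homogeneous solution starting from c, Phi the closed loop starting from c,
    and y = X - Phi.  The two evaluations give J(y, y) = 0; as J is nonnegative on pairs starting
    from 0, also J(y, eta) = 0 for all such eta.  If eta is driven by the control K eta + L Phi this
    says E int |L Phi|^2 = 0, hence L E[Phi] = 0.  When c runs over a basis, E[Phi] is the fundamental
    matrix of a linear differential equation, so it is invertible and L = 0.

    The stochastic calculus takes place in L^2: every identity between Ito integrals follows from the
    isometry, since the squared distance of the two sides is the squared norm of a zero integrand. *)

(** * Square-integrable functions *)

(** The gain $K$ is only square integrable in time, so the closed loop is a linear equation with
    possibly unbounded coefficients, and $P$ is absolutely continuous with derivative in $L^2$. This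
    fixes the classes of objects: deterministic factors in $L^2(dt)$ multiply processes bounded in
    mean square uniformly in time, and the Picard iteration is measured in the clock
    $\int|\mathrm{coefficients}|^2dt$ instead of $t$. Processes are known up to modification and
    equations time by time, so the product formula is established in expectation, where a stochastic
    integral enters only through the isometry or through its orthogonality to the past.

    The algebraic fact behind the converse is the Penrose identity $K'L=0$: controls of feedback
    form are orthogonal to $L\Phi$, so comparing the two evaluations isolates what the gain does not
    produce. Since $J(y,y)=0$, the cost of $c\,\eta+y$ is a parabola in $c$ without constant term;
    nonnegativity forces its linear coefficient $2J(y,\eta)=-2E\int|L\Phi|^2$ to vanish. *)

Section L2_space.
Context d (T : measurableType d) (R : realType) (mu : {measure set T -> \bar R}).
Implicit Types f g h : T -> R.

(** Functions, not classes modulo null sets: a process on time times $\Omega$ must be evaluated at a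
    fixed time, which a class does not allow. *)
Definition sqint f := measurable_fun setT f /\
  (\int[mu]_x ((f x) ^+ 2)%:E < +oo)%E.

Definition ip f g : R := \int[mu]_x (f x * g x).

Lemma sqint_meas f : sqint f -> measurable_fun setT f. Proof. by case. Qed.

(** Domination of $|fg|$ by $f^2+g^2$, read off from $(f\pm g)^2\ge0$. *)
Lemma sqint_mul f g : sqint f -> sqint g ->
  mu.-integrable setT (EFin \o (fun x => f x * g x)).
Proof.
move=> [mf If] [mg Ig].
apply: (@le_integrable _ _ _ mu setT measurableT _
   (fun x => (f x ^+ 2)%:E + (g x ^+ 2)%:E)%E).
- by apply/measurable_EFinP; exact: measurable_funM.
- move=> x _ /=; rewrite lee_fin [leRHS]ger0_norm ?addr_ge0 ?sqr_ge0//.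
  have := sqr_ge0 (f x - g x); have := sqr_ge0 (f x + g x).
  by case: (ger0P (f x * g x)) => _; nra.
- have mf2 : measurable_fun setT (fun x => (f x ^+ 2)%:E).
    by apply/measurable_EFinP; exact: measurable_funX.
  have mg2 : measurable_fun setT (fun x => (g x ^+ 2)%:E).
    by apply/measurable_EFinP; exact: measurable_funX.
  apply: integrableD => //; apply/integrableP; split=> //.
  + by under eq_integral do rewrite gee0_abs ?lee_fin ?sqr_ge0//.
  + by under eq_integral do rewrite gee0_abs ?lee_fin ?sqr_ge0//.
Qed.

Lemma sqintP f : sqint f <-> measurable_fun setT f /\
  mu.-integrable setT (EFin \o (fun x => f x * f x)).
Proof.
split=> [sf|[mf /integrableP[_ If]]]; first by split; [exact: sqint_meas|exact: sqint_mul].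
split=> //; apply: le_lt_trans If; apply: ge0_le_integral => //=.
- by move=> x _; rewrite lee_fin sqr_ge0.
- by apply/measurable_EFinP; exact: measurable_funX.
- by apply/measurable_EFinP; apply: measurableT_comp => //; exact: measurable_funM.
- by move=> x _; rewrite lee_fin expr2 ler_norm.
Qed.

Lemma sqint_mulr f g : sqint f -> sqint g ->
  mu.-integrable setT (fun x => (f x * g x)%:E).
Proof. exact: sqint_mul. Qed.

Lemma sqintD f g : sqint f -> sqint g -> sqint (fun x => f x + g x).
Proof.
move=> sf sg; have [[mf _] [mg _]] := (sf, sg).
apply/sqintP; split; first exact: measurable_funD.
rewrite [X in integrable _ _ X](_ : _ = (fun x => (f x * f x)%:E + 2%:E * (f x * g x)%:E
  + (g x * g x)%:E)%E); last first.
  by apply/funext => x /=; rewrite -EFinM -!EFinD; congr EFin; ring.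
apply: integrableD => //; last exact: sqint_mulr.
by apply: integrableD => //; last apply: integrableZl => //; exact: sqint_mulr.
Qed.

Lemma sqintZ k f : sqint f -> sqint (fun x => k * f x).
Proof.
move=> sf; have [mf _] := sf; apply/sqintP; split; first exact: measurable_funM.
rewrite [X in integrable _ _ X](_ : _ = (fun x => (k ^+ 2)%:E * (f x * f x)%:E)%E); last first.
  by apply/funext => x /=; rewrite -EFinM; congr EFin; ring.
by apply: integrableZl => //; exact: sqint_mulr.
Qed.

Lemma sqintN f : sqint f -> sqint (fun x => - f x).
Proof. by move/(@sqintZ (-1)); under eq_fun do rewrite mulN1r. Qed.

Lemma sqintB f g : sqint f -> sqint g -> sqint (fun x => f x - g x).
Proof. by move=> sf sg; apply: sqintD => //; exact: sqintN. Qed.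

Lemma sqint0 : sqint (fun=> 0).
Proof. by apply/sqintP; split=> //; rewrite mulr0; exact: integrable0. Qed.

Lemma sqint_sum (I : Type) (r : seq I) (F : I -> T -> R) :
  (forall i, sqint (F i)) -> sqint (fun x => \sum_(i <- r) F i x).
Proof.
move=> sF; elim: r => [|i r ih]; first by under eq_fun do rewrite big_nil; exact: sqint0.
by under eq_fun do rewrite big_cons; exact: sqintD.
Qed.

Lemma sqint_le f g : measurable_fun setT f -> sqint g ->
  (forall x, `|f x| <= `|g x|) -> sqint f.
Proof.
move=> mf [mg Ig] fg; split=> //; apply: le_lt_trans Ig.
apply: ge0_le_integral => //.
- by move=> x _; rewrite lee_fin sqr_ge0.
- by apply/measurable_EFinP; exact: measurable_funX.
- by apply/measurable_EFinP; exact: measurable_funX.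
- by move=> x _; rewrite lee_fin -(real_normK (num_real (f x))) -(real_normK (num_real (g x))) ler_sqr ?nnegrE.
Qed.

Lemma sqint_ae f g : measurable_fun setT g -> ae_eq mu setT f g -> sqint f -> sqint g.
Proof.
move=> mg fg [mf If]; split=> //.
rewrite -(_ : \int[mu]_x ((f x) ^+ 2)%:E = \int[mu]_x ((g x) ^+ 2)%:E)%E //.
apply: ge0_ae_eq_integral => //.
- by apply/measurable_EFinP; exact: measurable_funX.
- by apply/measurable_EFinP; exact: measurable_funX.
- by move=> x _; rewrite lee_fin sqr_ge0.
- by move=> x _; rewrite lee_fin sqr_ge0.
- by apply: filterS fg => x /= ->.
Qed.

Lemma ipC f g : ip f g = ip g f.
Proof. by rewrite /ip; under eq_Rintegral do rewrite mulrC. Qed.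

Lemma ipDl f g h : sqint f -> sqint g -> sqint h ->
  ip (fun x => f x + g x) h = ip f h + ip g h.
Proof.
move=> sf sg sh; rewrite /ip -RintegralD//; try exact: sqint_mul.
by apply: eq_Rintegral => x _; rewrite mulrDl.
Qed.

Lemma ipZl k f h : sqint f -> sqint h -> ip (fun x => k * f x) h = k * ip f h.
Proof.
move=> sf sh; rewrite /ip -RintegralZl//; try exact: sqint_mul.
by apply: eq_Rintegral => x _; rewrite mulrA.
Qed.

Lemma ipNl f h : sqint f -> sqint h -> ip (fun x => - f x) h = - ip f h.
Proof. by move=> sf sh; rewrite -mulN1r -ipZl//; under [in RHS]eq_fun do rewrite mulN1r. Qed.

Lemma ipBl f g h : sqint f -> sqint g -> sqint h ->
  ip (fun x => f x - g x) h = ip f h - ip g h.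
Proof. by move=> sf sg sh; rewrite ipDl// ?ipNl//; exact: sqintN. Qed.

Lemma ipDr f g h : sqint f -> sqint g -> sqint h ->
  ip h (fun x => f x + g x) = ip h f + ip h g.
Proof. by move=> *; rewrite ipC ipDl// ipC (ipC g). Qed.

Lemma ipZr k f h : sqint f -> sqint h -> ip h (fun x => k * f x) = k * ip h f.
Proof. by move=> *; rewrite ipC ipZl// ipC. Qed.

Lemma ipBr f g h : sqint f -> sqint g -> sqint h ->
  ip h (fun x => f x - g x) = ip h f - ip h g.
Proof. by move=> *; rewrite ipC ipBl// ipC (ipC g). Qed.

Lemma ip_ge0 f : 0 <= ip f f.
Proof. by apply: Rintegral_ge0 => x _; rewrite -expr2 sqr_ge0. Qed.

Lemma ip0l f : ip (fun=> 0) f = 0.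
Proof. by rewrite /ip; under eq_Rintegral do rewrite mul0r; rewrite Rintegral_cst// mul0r. Qed.

Lemma ip0r f : ip f (fun=> 0) = 0.
Proof. by rewrite ipC ip0l. Qed.

Lemma ip_suml (I : Type) (r : seq I) (F : I -> T -> R) h :
  (forall i, sqint (F i)) -> sqint h ->
  ip (fun x => \sum_(i <- r) F i x) h = \sum_(i <- r) ip (F i) h.
Proof.
move=> sF sh; elim: r => [|i r ih].
  by rewrite big_nil; under eq_fun do rewrite big_nil; rewrite ip0l.
under eq_fun do rewrite big_cons.
by rewrite ipDl// ?ih ?big_cons//; exact: sqint_sum.
Qed.

Lemma ip_sumr (I : Type) (r : seq I) (F : I -> T -> R) h :
  (forall i, sqint (F i)) -> sqint h ->
  ip h (fun x => \sum_(i <- r) F i x) = \sum_(i <- r) ip h (F i).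
Proof. by move=> sF sh; rewrite ipC ip_suml//; apply: eq_bigr => i _; rewrite ipC. Qed.

Lemma ipE f g : sqint f -> sqint g -> (ip f g)%:E = (\int[mu]_x (f x * g x)%:E)%E.
Proof. by move=> sf sg; rewrite /ip /Rintegral fineK//; apply: integrable_fin_num => //; exact: sqint_mul. Qed.

Lemma ip_sqE f : sqint f -> (ip f f)%:E = (\int[mu]_x (f x ^+ 2)%:E)%E.
Proof. by move=> sf; rewrite ipE//; under eq_integral do rewrite -expr2. Qed.

Lemma eq_ip f f' g g' : (forall x, f x * g x = f' x * g' x) -> ip f g = ip f' g'.
Proof. by move=> h; apply: eq_Rintegral => x _; rewrite h. Qed.

Lemma ae_ip f f' g g' : measurable_fun setT f -> measurable_fun setT f' ->
  measurable_fun setT g -> measurable_fun setT g' ->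
  {ae mu, forall x, f x * g x = f' x * g' x} -> ip f g = ip f' g'.
Proof.
move=> mf mf' mg mg' h; rewrite /ip /Rintegral; congr fine.
apply: ae_eq_integral => //.
- by apply/measurable_EFinP; exact: measurable_funM.
- by apply/measurable_EFinP; exact: measurable_funM.
- by apply: filterS h => x /= ->.
Qed.

(** The polynomial $t\mapsto|f+tg|^2$ is nonnegative ([key]); it is evaluated at one well-chosen
    $t$. *)
Lemma cauchy_schwarz f g : sqint f -> sqint g -> ip f g ^+ 2 <= ip f f * ip g g.
Proof.
move=> sf sg.
have key t : 0 <= ip f f + 2 * t * ip f g + t ^+ 2 * ip g g.
  have := ip_ge0 (fun x => f x + t * g x).
  have st := sqintZ t sg.
  rewrite ipDl ?ipDr ?ipZl ?ipZr ?(ipC g f)//; try exact: sqintD.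
  by move/le_trans; apply; rewrite le_eqVlt; apply/orP; left; apply/eqP; ring.
have [g0|g0] := eqVneq (ip g g) 0.
  rewrite g0 mulr0; have [->|fg0] := eqVneq (ip f g) 0; first by rewrite expr0n.
  (* With $|g|=0$ the polynomial is affine in $t$, and this $t$ would give it the value $-1$. *)
  have := key (- (ip f f + 1) / (2 * ip f g)).
  rewrite g0 mulr0 addr0.
  have -> : 2 * (- (ip f f + 1) / (2 * ip f g)) * ip f g = - (ip f f + 1).
    by field.
  by rewrite opprD addrA subrr add0r lerNr oppr0 ler10.
have gp : 0 < ip g g by rewrite lt_neqAle eq_sym g0 ip_ge0.
(* The minimiser of the polynomial. *)
have := key (- ip f g / ip g g).
rewrite -(pmulr_lge0 _ gp).
have -> : (ip f f + 2 * (- ip f g / ip g g) * ip f g + (- ip f g / ip g g) ^+ 2 * ip g g) * ip g g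
  = ip f f * ip g g - ip f g ^+ 2 by field.
by rewrite subr_ge0.
Qed.

Lemma ip_eq0_ae f : sqint f -> ip f f = 0 -> {ae mu, forall x, f x = 0}.
Proof.
move=> sf f0; have := ipE sf sf; rewrite f0 => /esym h.
have mf2 : measurable_fun setT (fun x => (f x * f x)%:E).
  by apply/measurable_EFinP; apply: measurable_funM; exact: sqint_meas sf.
have := (ae_eq_integral_abs mu measurableT mf2).1.
under eq_integral do rewrite gee0_abs ?lee_fin -?expr2 ?sqr_ge0//.
under [X in X = _ -> _]eq_integral do rewrite expr2.
move=> /(_ h); apply: filterS => x /= /(_ I) [] /eqP.
by rewrite mulf_eq0 orbb => /eqP.
Qed.

(** Parallelogram law with $|f-g|^2$ dropped. The factor 2 is the price for working with squared
    norms instead of norms; later constants absorb it. *)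
Lemma ip_sub_sq_le f g : sqint f -> sqint g ->
  ip (fun x => f x + g x) (fun x => f x + g x) <= 2 * ip f f + 2 * ip g g.
Proof.
move=> sf sg; have := ip_ge0 (fun x => f x - g x).
rewrite ipBl ?ipBr ?ipDl ?ipDr ?(ipC g f)//; try exact: sqintB; try exact: sqintD.
lra.
Qed.

End L2_space.

(** * Convergence in mean square *)

Section L2_limits.
Context d (T : measurableType d) (R : realType) (mu : {measure set T -> \bar R}).
Implicit Types f g h : T -> R.
Local Notation sqint := (sqint mu).
Local Notation ip := (ip mu).

Definition sqd f g := ip (fun x => f x - g x) (fun x => f x - g x).

Lemma sqd_ge0 f g : 0 <= sqd f g. Proof. exact: ip_ge0. Qed.

Lemma sqdC f g : sqd f g = sqd g f.
Proof. by apply: eq_ip => x; ring. Qed.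

Lemma sqdE f g : sqint f -> sqint g -> sqd f g = ip f f - 2 * ip f g + ip g g.
Proof.
move=> sf sg; rewrite /sqd ipBl ?ipBr ?(ipC mu g f)//; try exact: sqintB.
by ring.
Qed.

Lemma sqd_triangle f g h : sqint f -> sqint g -> sqint h ->
  sqd f h <= 2 * sqd f g + 2 * sqd g h.
Proof.
move=> sf sg sh.
have := ip_sub_sq_le (sqintB sf sg) (sqintB sg sh).
by apply: le_trans; rewrite le_eqVlt; apply/orP; left; apply/eqP; apply: eq_ip => x; ring.
Qed.

Lemma ip_norm_le f g : sqint f -> sqint g ->
  `|ip f g| <= Num.sqrt (ip f f * ip g g).
Proof.
move=> sf sg; rewrite -sqrtr_sqr ler_sqrt; first exact: cauchy_schwarz.
by rewrite mulr_ge0 ?ip_ge0.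
Qed.

(** Joint continuity of the inner product, by which the isometry passes from simple processes to
    their limits. *)
Lemma ip_cvg (f_ g_ : nat -> T -> R) f g : (forall k, sqint (f_ k)) -> (forall k, sqint (g_ k)) ->
  sqint f -> sqint g ->
  sqd (f_ k) f @[k --> \oo] --> 0 -> sqd (g_ k) g @[k --> \oo] --> 0 ->
  ip (f_ k) (g_ k) @[k --> \oo] --> ip f g.
Proof.
move=> sf_ sg_ sf sg cf cg.
apply/subr_cvg0.
(* Cauchy-Schwarz bounds for the three terms of $\langle f_k-f,g_k-g\rangle+\langle
   f_k-f,g\rangle+\langle f,g_k-g\rangle$. *)
pose B k := Num.sqrt (sqd (f_ k) f * sqd (g_ k) g) + Num.sqrt (sqd (f_ k) f * ip g g)
  + Num.sqrt (ip f f * sqd (g_ k) g).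
have B0 : B k @[k --> \oo] --> 0.
  rewrite /B -[X in _ --> X]add0r; apply: cvgD.
    rewrite -[X in _ --> X]add0r; apply: cvgD.
      rewrite -(@sqrtr0 R); apply: continuous_cvg; first exact: sqrt_continuous.
      by rewrite -[X in _ --> X](mulr0 0); exact: cvgM.
    rewrite -(@sqrtr0 R); apply: continuous_cvg; first exact: sqrt_continuous.
    by rewrite -[X in _ --> X](mul0r (ip g g)); apply: cvgMr_tmp.
  rewrite -(@sqrtr0 R); apply: continuous_cvg; first exact: sqrt_continuous.
  by rewrite -[X in _ --> X](mulr0 (ip f f)); apply: cvgMl_tmp.
apply: (@squeeze_cvgr _ _ _ _ (fun k => - B k) B) => //; last by rewrite -oppr0; exact: cvgN.
near=> k; rewrite -ler_norml.
have sd1 := sqintB (sf_ k) sf; have sd2 := sqintB (sg_ k) sg.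
have -> : ip (f_ k) (g_ k) - ip f g = ip (fun x => f_ k x - f x) (fun x => g_ k x - g x)
  + ip (fun x => f_ k x - f x) g + ip f (fun x => g_ k x - g x).
  rewrite !ipBr ?ipBl//; ring.
apply: (le_trans (ler_normD _ _)); apply: lerD; last exact: ip_norm_le.
by apply: (le_trans (ler_normD _ _)); apply: lerD; exact: ip_norm_le.
Unshelve. all: by end_near. Qed.

(** A sequence of extended reals tending to 0 is finite at some index $k$; there $f=f_k-(f_k-f)$ is
    a difference of square-integrable functions. *)
Lemma sqint_lim (f_ : nat -> T -> R) f : (forall k, sqint (f_ k)) -> measurable_fun setT f ->
  ((fun k => \int[mu]_x ((f_ k x - f x) ^+ 2)%:E) @ \oo --> 0)%E ->
  sqint f /\ sqd (f_ k) f @[k --> \oo] --> 0.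
Proof.
move=> sf_ mf c0.
have sf : sqint f.
  have /fine_cvgP[[k _ /(_ k (leqnn k)) /= hk] _] := c0.
  have {}hk : (\int[mu]_x ((f_ k x - f x) ^+ 2)%:E < +oo)%E by rewrite ltey_eq hk.
  have s1 : sqint (fun x => f_ k x - f x).
    by split => //; apply: measurable_funB => //; exact: sqint_meas (sf_ k).
  have := sqintB (sf_ k) s1.
  by under eq_fun do rewrite opprB addrC subrK.
split=> //.
have /fine_cvg : (fun k => (sqd (f_ k) f)%:E) @ \oo --> 0%:E.
  rewrite (_ : (fun k => _) = fun k => (\int[mu]_x ((f_ k x - f x) ^+ 2)%:E)%E)//.
  by apply/funext => k; rewrite ip_sqE//; exact: sqintB.
by [].
Qed.

Lemma sqd_cvgE (f_ : nat -> T -> R) f : (forall k, sqint (f_ k)) -> sqint f ->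
  sqd (f_ k) f @[k --> \oo] --> 0 ->
  ((fun k => \int[mu]_x ((f_ k x - f x) ^+ 2)%:E) @ \oo --> 0)%E.
Proof.
move=> sf_ sf c0.
rewrite (_ : (fun k => _) = fun k => (sqd (f_ k) f)%:E); last first.
  by apply/funext => k; rewrite ip_sqE//; exact: sqintB.
by apply: cvg_EFin => //; exact: nearW.
Qed.

Lemma sqd_eq0 f g : sqint f -> sqint g -> sqd f g = 0 -> {ae mu, forall x, f x = g x}.
Proof.
move=> sf sg h; have := ip_eq0_ae (sqintB sf sg) h.
by apply: filterS => x /eqP; rewrite subr_eq0 => /eqP.
Qed.

Lemma sqd_ae f f' g g' : sqint f -> measurable_fun setT f' -> sqint g -> measurable_fun setT g' ->
  {ae mu, forall x, f x = f' x} -> {ae mu, forall x, g x = g' x} -> sqd f g = sqd f' g'.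
Proof.
move=> [mf _] mf' [mg _] mg' hf hg.
apply: ae_ip; try by apply: measurable_funB.
by apply: filterS2 hf hg => x -> ->.
Qed.

End L2_limits.

(** * Brownian filtration and progressive processes *)

Section processes.
Context d (Omega : measurableType d) (R : realType).
Variables (Pr : probability Omega R) (w : R -> Omega -> R).
Hypothesis hw : brownian_motion Pr w.
Local Notation F := (filtration_type Pr w).

(** Extension by 0 outside $[a,b]$ puts processes on different intervals into one space, functions
    on $\mathbb R\times\Omega$ with the product measure, where their inner products make sense. *)
Definition cut (T : Type) (a b : R) (f : R -> T -> R) : R * T -> R :=
  fun z => if a <= z.1 <= b then f z.1 z.2 else 0.

Lemma filtration_measurable (t : R) (A : set Omega) : 0 <= t ->
  filtration Pr w t A -> measurable A.
Proof.
move=> t0; apply: smallest_sub; first exact: sigma_algebra_measurable.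
move=> E [[s [/andP[s0 st] [B mB ->]]]|[]//].
have [mw _ _ _ _] := hw.
by rewrite -[X in measurable X]setTI; apply: mw.
Qed.

Lemma filtration_le (s t : R) : s <= t -> filtration Pr w s `<=` filtration Pr w t.
Proof.
move=> st; apply: sub_smallest2r; last first.
  move=> E [[r [/andP[r0 rs] h]]|h]; [left|by right].
  by exists r; rewrite r0 (le_trans rs st).
exact: smallest_sigma_algebra.
Qed.

Lemma measurable_F_le (s t : R) (f : Omega -> R) : s <= t ->
  measurable_fun [set: F s] (f : F s -> R) -> measurable_fun [set: F t] (f : F t -> R).
Proof.
by move=> st mf _ B mB; apply: (filtration_le st); apply: mf.
Qed.

Lemma measurable_F (t : R) (f : Omega -> R) : 0 <= t ->
  measurable_fun [set: F t] (f : F t -> R) -> measurable_fun [set: Omega] f.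
Proof.
by move=> t0 mf _ B mB; apply: (filtration_measurable t0); apply: mf.
Qed.

Lemma measurable_w (s t : R) : 0 <= s <= t ->
  measurable_fun [set: F t] (w s : F t -> R).
Proof.
move=> st _ B mB; rewrite setTI; apply: sub_gen_smallest; left.
by exists s; split => //; exists B.
Qed.

Lemma cutE (T : Type) (a b : R) (f : R -> T -> R) :
  cut a b f = (fun z => f z.1 z.2) \_ (`[a, b]%classic `*` [set: T]).
Proof.
apply/funext => z; rewrite /cut patchE; case: ifPn => h.
  by rewrite mem_set//=; split => //=; rewrite in_itv.
by rewrite memNset//= => -[/=]; rewrite in_itv/= (negbTE h).
Qed.

Lemma progressiveP (a b : R) (f : R -> Omega -> R) :
  progressive Pr w a b f <-> forall t, a <= t <= b ->
    measurable_fun [set: measurableTypeR R * F t] (cut a t (f : R -> F t -> R)).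
Proof.
split=> h t tab; have := h t tab.
  move=> mf; rewrite cutE; apply/measurable_restrict => //; last by rewrite setTI.
  exact: measurableX.
move=> mf; rewrite cutE in mf.
move/(@measurable_restrict _ _ _ _ _ _) : mf; rewrite setTI.
by apply => //; exact: measurableX.
Qed.

Lemma progressiveW (a b a' b' : R) (f : R -> Omega -> R) :
  a <= a' -> b' <= b ->
  progressive Pr w a b f -> progressive Pr w a' b' f.
Proof.
move=> aa bb h t /andP[a't tb']; apply: measurable_funS (h t _).
- exact: measurableX.
- move=> [x y] [/=]; rewrite !in_itv/= => /andP[ax xt] _; split=> //=.
  by rewrite xt (le_trans aa).
- by rewrite (le_trans aa a't) (le_trans tb').
Qed.

Lemma progressive_section (a b t : R) (f : R -> Omega -> R) :
  a <= t <= b -> progressive Pr w a b f ->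
  measurable_fun [set: F t] (f t : F t -> R).
Proof.
move=> tab /progressiveP /(_ t tab) mf.
have -> : (f t : F t -> R) = cut a t (f : R -> F t -> R) \o (fun y => (t : measurableTypeR R, y)).
  by apply/funext => y /=; rewrite /cut/= lexx; case/andP: tab => ->.
apply: measurableT_comp mf _; exact: pair1_measurable.
Qed.

Lemma measurable_cut (a b : R) (f : R -> Omega -> R) : 0 <= b ->
  progressive Pr w a b f ->
  measurable_fun [set: measurableTypeR R * Omega] (cut a b f).
Proof.
move=> b0 mf; have [ab|ba] := leP a b; last first.
  rewrite (_ : cut _ _ _ = cst 0)//; apply/funext => z; rewrite /cut.
  by case: ifPn => // /andP[/le_trans h /h]; rewrite leNgt ba.
have /progressiveP/(_ b) := mf; rewrite ab lexx => /(_ isT) {}mf.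
have -> : cut a b f = cut a b (f : R -> F b -> R) \o (fun z : measurableTypeR R * Omega => (z.1, z.2 : F b)) by [].
apply: (measurableT_comp mf).
apply: measurable_fun_pair => //=.
(* The identity of $\Omega$ is measurable from the ambient $\sigma$-algebra to $\mathcal F_b$,
   because $b\ge0$. *)
apply: (@measurable_comp _ _ _ _ _ _ setT (fun x : Omega => x : F b)) => //.
  by move=> _ B mB; rewrite setTI; apply: (filtration_measurable b0).
exact: measurable_snd.
Qed.

End processes.

(** * Brownian increments *)

Section density.
Context d (T : measurableType d) (R : realType).
Variables (nu mu : {measure set T -> \bar R}) (p : T -> R).
Hypotheses (mp : measurable_fun setT p) (p0 : forall x, 0 <= p x).
Hypothesis nuE : forall A, measurable A -> nu A = (\int[mu]_(x in A) (p x)%:E)%E.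
Local Open Scope ereal_scope.

Import HBNNSimple.

Let ind (E : set T) : measurable E ->
  \int[nu]_x (\1_E x)%:E = \int[mu]_x ((\1_E x)%:E * (p x)%:E).
Proof.
move=> mE; rewrite integral_indic// setIT nuE// [LHS]integral_mkcond/=.
apply: eq_integral => x _; rewrite patchE indicE.
by case: ifPn => xE; rewrite ?mul1e ?mul0e.
Qed.

Let sfun (f : {nnsfun T >-> R}) :
  \int[nu]_x (f x)%:E = \int[mu]_x ((f x)%:E * (p x)%:E).
Proof.
under [LHS]eq_integral do rewrite fimfunE -fsumEFin//.
rewrite [LHS]ge0_integral_fsum//; last 2 first.
  - by move=> r; exact/measurable_EFinP/measurableT_comp.
  - by move=> n x _; rewrite EFinM nnfun_muleindic_ge0.
under [RHS]eq_integral.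
  move=> x xD; rewrite fimfunE -fsumEFin// ge0_mule_fsuml; last first.
    by move=> r; rewrite EFinM nnfun_muleindic_ge0.
  over.
rewrite [RHS]ge0_integral_fsum//; last 2 first.
  - move=> r; rewrite -[X in measurable_fun _ X]/(fun x => _).
    apply: emeasurable_funM; last exact/measurable_EFinP.
    by apply/measurable_EFinP; do 2 apply/measurableT_comp => //.
  - move=> n x _; rewrite EFinM mule_ge0//; last by rewrite lee_fin.
    by rewrite nnfun_muleindic_ge0.
apply: eq_fsbigr => r _.
rewrite integralZl_indic_nnsfun//= ind//.
under [RHS]eq_integral do rewrite EFinM -muleA.
have [r0|r0] := ltP r 0%R.
  rewrite preimage_nnfun0// !indic0.
  under eq_integral do rewrite mul0e; rewrite integral0 mule0.
  by under eq_integral do rewrite mul0e mule0; rewrite integral0.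
rewrite ge0_integralZl//.
- by apply: emeasurable_funM; apply/measurable_EFinP.
- by move=> x _; rewrite mule_ge0// lee_fin.
Qed.

(** Indicators ([ind]), then nonnegative simple functions ([sfun]), then monotone limits. *)
Lemma integral_density (f : T -> \bar R) : measurable_fun setT f ->
  (forall x, 0 <= f x) -> \int[nu]_x f x = \int[mu]_x (f x * (p x)%:E).
Proof.
move=> mf f0.
pose f_ := nnsfun_approx measurableT mf.
transitivity (limn (fun n => \int[nu]_x (f_ n x)%:E)).
  rewrite -monotone_convergence//=.
  - apply: eq_integral => ? /[!inE] xD; apply/esym/cvg_lim => //=.
    exact: cvg_nnsfun_approx.
  - by move=> n; exact/measurable_EFinP/measurable_funTS.
  - by move=> n ? _; rewrite lee_fin.
  - by move=> ? _ ? ? mn; rewrite lee_fin; exact/lefP/nd_nnsfun_approx.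
rewrite [LHS](_ : _ = limn (fun n => \int[mu]_x ((f_ n x)%:E * (p x)%:E))); last first.
  by apply: congr_lim; apply/funext => n; exact: sfun.
rewrite -monotone_convergence//=.
- apply: eq_integral => x _; apply/cvg_lim => //.
  by apply: cvgeZr => //; exact: cvg_nnsfun_approx.
- by move=> n; apply: emeasurable_funM; apply/measurable_EFinP.
- by move=> n x _; rewrite mule_ge0// lee_fin.
- move=> x _ a b ab; apply: lee_wpmul2r; first by rewrite lee_fin.
  by rewrite lee_fin; exact/lefP/nd_nnsfun_approx.
Qed.

End density.

(** * Variance of a centered normal law *)

Section gaussian_moments.
Context (R : realType) (s : R).
Hypothesis s0 : 0 < s.
Local Notation leb := (@lebesgue_measure R).
Local Notation N := (normal_prob 0 s).
Local Notation p := (normal_pdf 0 s).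

Let pE x : p x = normal_peak s * expR (- x ^+ 2 / (s ^+ 2 *+ 2)).
Proof. by rewrite normal_pdfE ?gt_eqF// /normal_fun subr0. Qed.

Let mp : measurable_fun setT p.
Proof. exact: measurable_normal_pdf. Qed.

Lemma integral_normal (f : R -> \bar R) : measurable_fun setT f ->
  (forall x, 0 <= f x)%E -> (\int[N]_x f x = \int[leb]_x (f x * (p x)%:E))%E.
Proof. by move=> mf f0; apply: integral_density => // x; exact: normal_pdf_ge0. Qed.

Lemma integral_normalR (f : R -> R) : measurable_fun setT f ->
  (forall x, 0 <= f x) -> (\int[N]_x (f x)%:E = \int[leb]_x ((f x)%:E * (p x)%:E))%E.
Proof. by move=> mf f0; apply: integral_normal; [exact/measurable_EFinP|move=> x; rewrite lee_fin]. Qed.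

Lemma integral_normalN (f : R -> R) : measurable_fun setT f ->
  (forall x, 0 <= f x) -> (\int[N]_x (f (- x))%:E = \int[N]_x (f x)%:E)%E.
Proof.
move=> mf f0.
have mN : measurable_fun [set: measurableTypeR R] (-%R : measurableTypeR R -> measurableTypeR R) by exact: oppr_measurable.
have mfN : measurable_fun setT (fun x : R => f (- x)) by exact: (measurableT_comp mf mN).
rewrite !integral_normalR//.
transitivity (\int[pushforward leb (-%R : measurableTypeR R -> measurableTypeR R)]_x ((f x)%:E * (p x)%:E))%E.
  rewrite (@ge0_integral_pushforward _ _ _ _ R _ mN leb setT (fun x : R => ((f x)%:E * (p x)%:E)%E) measurableT).
  - by apply: eq_integral => x _ /=; rewrite !pE sqrrN.
  - by apply: emeasurable_funM; apply/measurable_EFinP.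
  - by move=> x _; rewrite mule_ge0// lee_fin ?f0// normal_pdf_ge0.
apply: eq_measure_integral => A mA _.
exact: lebesgue_measureN.
Qed.

(** The antiderivative of $x\,p(x)$, because $p'(x)=-x\,p(x)/s^2$. *)
Let F (x : R) := - s ^+ 2 * p x.

Let dF (x : R) : is_derive x 1 F (x * p x).
Proof.
rewrite /F (_ : (fun _ => _) = fun x => - s ^+ 2 * (normal_peak s * expR (- x ^+ 2 / (s ^+ 2 *+ 2)))); last first.
  by apply/funext => y; rewrite pE.
apply: is_derive_eq.
have s_neq0 : s != 0 by rewrite gt_eqF.
rewrite pE scaler0 add0r /GRing.scale /= mulr1.
move: (expR _) => e; rewrite -(mulr_natr (s ^+ 2)); field.
by [].
Qed.

Lemma normal_tail (y : R) : 0 <= y ->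
  (\int[leb]_(x in `[y, +oo[) (x * p x)%:E = (s ^+ 2 * p y)%:E)%E.
Proof.
move=> y0.
rewrite (@ge0_continuous_FTC2y _ _ F _ 0).
- by rewrite sub0e -EFinN /F mulNr opprK.
- by move=> x yx; rewrite mulr_ge0// ?normal_pdf_ge0// (le_trans y0).
- apply: continuous_subspaceT => x; apply: continuousM; first exact: cvg_id.
  by apply: continuous_normal_pdf; rewrite gt_eqF.
- rewrite /F -[X in _ --> X](mulr0 (- s ^+ 2)); apply: cvgMl_tmp.
  rewrite (_ : (normal_pdf 0 s) = fun x => normal_peak s * expR (- x ^+ 2 / (s ^+ 2 *+ 2))); last first.
    by apply/funext => x; rewrite pE.
  rewrite -[X in _ --> X](mulr0 (normal_peak s)); apply: cvgMl_tmp.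
  rewrite (_ : (fun _ => _) = fun x => expR (- ((s ^+ 2 *+ 2)^-1 * x ^+ 2))); last first.
    by apply/funext => x; rewrite mulNr mulrC.
  apply: (cvg_comp (fun x : R => (s ^+ 2 *+ 2)^-1 * x ^+ 2) (fun x => expR (- x)));
    last exact: cvgr_expR.
  apply: gt0_cvgMry; last exact: cvgr_expr2.
  by rewrite invr_gt0 pmulrn_lgt0// exprn_gt0.
- by move=> x _; have [] := dF x.
- apply: cvg_at_right_filter; apply: differentiable_continuous; apply/derivable1_diffP.
  by have [] := dF y.
- by move=> x _; rewrite derive1E; have [_ ->] := dF x.
Qed.

(** Write $x^2p(x)=\int_0^x x\,p(x)\,dy$ for $x\ge0$ and exchange the integrals: the inner one
    becomes the tail $\int_y^\infty x\,p(x)\,dx=s^2p(y)$, whose integral over $y\ge0$ is $s^2/2$.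
    Symmetry doubles it. *)
Lemma normal_variance : (\int[N]_x (x ^+ 2)%:E = (s ^+ 2)%:E)%E.
Proof.
rewrite integral_normalR; [|exact: measurable_funX|by move=> x; exact: sqr_ge0].
under eq_integral do rewrite -EFinM.
have cp : continuous p by apply: continuous_normal_pdf; rewrite gt_eqF.
have cxp : continuous (fun x : R => x ^+ 2 * p x).
  by move=> x; apply: (@cvgM _ _ (nbhs x) _ (fun y : R => y ^+ 2) p); [exact: exprn_continuous|exact: cp].
rewrite ge0_symfun_integralT; last 3 first.
- by move=> x; rewrite mulr_ge0 ?sqr_ge0// normal_pdf_ge0.
- exact: cxp.
- by move=> x /=; rewrite !pE sqrrN.
have half : (\int[leb]_(x in [set x | (0 <= x)%R]) (p x)%:E = 2^-1%:E)%E.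
  have := @integral_normal_pdf R 0 s; rewrite ge0_symfun_integralT//; last 2 first.
  - by move=> x; rewrite normal_pdf_ge0.
  - by move=> x /=; rewrite !pE sqrrN.
  move: (\int[leb]_(x in _) _)%E => [r|//|//].
  - by rewrite -EFinM => -[] h; congr EFin; lra.
  - by rewrite gt0_muley// lte_fin.
  - by rewrite gt0_muleNy// lte_fin.
rewrite -set_itvcy in half *.
(* The integrand on the wedge $0\le y\le x$, with $x$ in [z.1] and $y$ in [z.2]. *)
pose g (z : measurableTypeR R * measurableTypeR R) : R :=  z.1 * p z.1 * (if 0 <= z.2 then if z.2 <= z.1 then 1 else 0 else 0).
have mg : measurable_fun setT g.
  apply: measurable_funM; first by apply: measurable_funM => //; exact: measurableT_comp.
  apply: measurable_fun_ifT => //; first exact: measurable_fun_ler.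
  by apply: measurable_fun_ifT => //; exact: measurable_fun_ler.
have g0 z : 0 <= g z.
  rewrite /g; case: ifPn => [z20|]; last by rewrite mulr0.
  case: ifPn => [/(le_trans z20) z10|]; last by rewrite mulr0.
  by rewrite mulr1 mulr_ge0// normal_pdf_ge0.
have cst_ind (c a b : R) : 0 <= c -> a <= b ->
  (\int[leb]_(y in `[a, b]) c%:E = (c * (b - a))%:E)%E.
  move=> c0 ab; rewrite integral_cst//= lebesgue_measure_itv/= lte_fin.
  move: ab; rewrite le_eqVlt => /predU1P[->|ab]; last by rewrite ab -EFinB -EFinM.
  by rewrite ltxx mule0 subrr mulr0.
transitivity (2%:E * \int[leb]_x \int[leb]_y (g (x, y))%:E)%E.
  congr (_ * _)%E; rewrite integral_mkcond/=; apply: eq_integral => x _.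
  rewrite patchE; case: ifPn; rewrite ?inE ?notin_setE/= in_itv/= andbT => x0.
    transitivity (\int[leb]_(y in `[0%R, (x : R)%R]) ((x : R) * p x)%:E)%E.
      rewrite cst_ind// ?mulr_ge0 ?normal_pdf_ge0//; congr EFin; ring.
    rewrite integral_mkcond/=; apply: eq_integral => y _; rewrite patchE /g/=.
    case: ifPn; rewrite ?inE ?notin_setE/= in_itv/=; first by move=> /andP[-> ->]; rewrite mulr1.
    by case: ifPn; rewrite ?mulr0//=; case: ifPn; rewrite ?mulr0//= => -> _ /negP.
  under eq_integral => y _.
    rewrite (_ : g _ = 0); first over.
    rewrite /g/=; case: ifPn => [y0|]; rewrite ?mulr0//.
    by case: ifPn => [/(le_trans y0)|]; rewrite ?mulr0//.
  by rewrite integral0.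
rewrite (fubini_tonelli (fun z : measurableTypeR R * measurableTypeR R => (g z)%:E)); last 2 first.
- exact/measurable_EFinP.
- by move=> z; rewrite lee_fin.
transitivity (2%:E * ((s ^+ 2)%:E * \int[leb]_(y in `[0%R, +oo[) (p y)%:E))%E; last first.
  by rewrite half -!EFinM; congr EFin; field.
congr (_ * _)%E.
rewrite -ge0_integralZl//; last 3 first.
- exact/measurable_EFinP/measurable_funTS.
- by move=> x _; rewrite lee_fin normal_pdf_ge0.
- by rewrite lee_fin sqr_ge0.
rewrite [RHS]integral_mkcond/=; apply: eq_integral => y _.
rewrite patchE; case: ifPn; rewrite ?inE ?notin_setE/= in_itv/= andbT => y0.
  rewrite -EFinM -normal_tail// [RHS]integral_mkcond/=; apply: eq_integral => x _.
  rewrite patchE; case: ifPn; rewrite ?inE ?notin_setE/= in_itv/= andbT => xy; rewrite /g/= y0.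
    by rewrite xy mulr1.
  by move/negP/negbTE : xy => ->; rewrite mulr0.
under eq_integral => x _.
  rewrite (_ : g _ = 0); first over.
  by rewrite /g/=; move/negP/negbTE : y0 => ->; rewrite mulr0.
by rewrite integral0.
Qed.

End gaussian_moments.

(** * Independence of the past and the increments *)

Section independence.
Context d d1 d2 (T : measurableType d) (T1 : measurableType d1) (T2 : measurableType d2)
  (R : realType).
Variables (P : probability T R) (X : {mfun T >-> T1}) (Y : {mfun T >-> T2})
  (N : probability T2 R).
Hypothesis XY : forall A B, measurable A -> measurable B ->
  P ((X @^-1` A) `&` (Y @^-1` B)) = (P (X @^-1` A) * N B)%E.
Local Open Scope ereal_scope.

(** The joint law of $(X,Y)$ agrees on rectangles with the product of the law of $X$ and [N], hence
    everywhere; Tonelli does the rest. [N] is a separate measure so that the Gaussian law of an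
    increment can be inserted directly. *)
Lemma ge0_integral_indep (f : T1 -> \bar R) (g : T2 -> \bar R) :
  measurable_fun setT f -> (forall x, 0 <= f x) ->
  measurable_fun setT g -> (forall x, 0 <= g x) ->
  \int[P]_x (f (X x) * g (Y x)) = \int[P]_x f (X x) * \int[N]_y g y.
Proof.
move=> mf f0 mg g0.
pose Z x := (X x, Y x).
have mZ : measurable_fun setT Z by exact: measurable_fun_pair.
pose ZZ : {mfun T >-> (T1 * T2)%type} := HB.pack Z (isMeasurableFun.Build _ _ _ _ _ mZ).
have E A : measurable A -> (distribution P X \x N) A = distribution P ZZ A.
  by apply: product_measure_unique => B C mB mC; rewrite -XY.
have mfg : measurable_fun setT (fun z : T1 * T2 => f z.1 * g z.2).
  by apply: emeasurable_funM; exact: measurableT_comp.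
have fg0 z : 0 <= f z.1 * g z.2 by exact: mule_ge0.
transitivity (\int[distribution P ZZ]_z (f z.1 * g z.2)).
  by rewrite ge0_integral_distribution.
transitivity (\int[distribution P X \x N]_z (f z.1 * g z.2)).
  by apply: eq_measure_integral => A mA _; exact/esym/E.
rewrite fubini_tonelli1//= /fubini_F/=.
under eq_integral do rewrite ge0_integralZl//.
rewrite ge0_integralZr//; first by rewrite ge0_integral_distribution.
exact: integral_ge0.
Qed.

End independence.

Section increments.
Context d (Omega : measurableType d) (R : realType).
Variables (Pr : probability Omega R) (w : R -> Omega -> R).
Hypothesis hw : brownian_motion Pr w.
Local Notation F := (filtration_type Pr w).

Lemma measurable_increment (s t : R) : 0 <= s <= t ->
  measurable_fun [set: F t] ((fun x => w t x - w s x) : F t -> R).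
Proof.
move=> /andP[s0 st]; apply: measurable_funB; apply: measurable_w.
  by rewrite (le_trans s0 st) lexx.
by rewrite s0 st.
Qed.

Lemma increment_indep (s t : R) (f : Omega -> \bar R) (g : R -> \bar R) :
  0 <= s -> s < t ->
  measurable_fun [set: F s] (f : F s -> \bar R) -> (forall x, 0 <= f x)%E ->
  measurable_fun setT g -> (forall x, 0 <= g x)%E ->
  (\int[Pr]_x (f x * g (w t x - w s x)%R) =
   \int[Pr]_x f x * \int[normal_prob 0 (Num.sqrt (t - s))]_y g y)%E.
Proof.
move=> s0 st mf f0 mg g0.
have mX : measurable_fun [set: Omega] (id : Omega -> F s).
  by move=> _ B mB; rewrite setTI; apply: (filtration_measurable hw s0).
have mY : measurable_fun [set: Omega] ((fun x => w t x - w s x) : Omega -> measurableTypeR R).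
  apply: (@measurable_F _ _ _ _ _ hw t); first by rewrite (le_trans s0)// ltW.
  by apply: measurable_increment; rewrite s0 ltW.
(* The identity, seen as a random variable with values in $(\Omega,\mathcal F_s)$, carries all
   $\mathcal F_s$-measurable functions at once. *)
pose X : {mfun Omega >-> F s} := HB.pack (id : Omega -> F s) (isMeasurableFun.Build _ _ _ _ _ mX).
pose Y : {mfun Omega >-> measurableTypeR R} := HB.pack ((fun x => w t x - w s x) : Omega -> measurableTypeR R) (isMeasurableFun.Build _ _ _ _ _ mY).
have := @ge0_integral_indep _ _ _ _ _ _ R Pr X Y (normal_prob 0 (Num.sqrt (t - s))) _ f g mf f0 mg g0.
apply => A B mA mB.
have [_ _ _ hN hI] := hw.
have := hI s t A B s0 st mA mB.
have := hN s t B s0 st mB.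
rewrite /X /Y/= preimage_id.
have -> : (fun x => w t x - w s x) @^-1` B = [set omega | B (w t omega - w s omega)] by [].
by move=> <- ->.
Qed.

End increments.

Definition rpos (R : realType) (x : R) := Num.max x 0.

Section rpos.
Context (R : realType).
Lemma rpos_ge0 (x : R) : 0 <= rpos x. Proof. by rewrite /rpos le_max lexx orbT. Qed.
Lemma rpos_sub (x : R) : x = rpos x - rpos (- x).
Proof. by rewrite /rpos; case: (lerP x 0); case: (lerP (- x) 0) => *; lra. Qed.
Lemma rpos_le (x : R) : `|rpos x| <= `|x|.
Proof. by rewrite /rpos; case: (lerP x 0) => h; rewrite ?normr0. Qed.
Lemma measurable_rpos d (T : measurableType d) (f : T -> R) : measurable_fun setT f ->
  measurable_fun setT (fun x => rpos (f x)).
Proof. by move=> mf; apply: measurable_maxr. Qed.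
Lemma sqint_rpos d (T : measurableType d) (mu : {measure set T -> \bar R}) (f : T -> R) :
  sqint mu f -> sqint mu (fun x => rpos (f x)).
Proof.
move=> sf; apply: (@sqint_le _ _ _ _ _ f) => //; last by move=> x; exact: rpos_le.
by apply: measurable_rpos; exact: sqint_meas sf.
Qed.
End rpos.

(** * Mean and covariance of weighted increments *)

Section increment_moments.
Context d (Omega : measurableType d) (R : realType).
Variables (Pr : probability Omega R) (w : R -> Omega -> R).
Hypothesis hw : brownian_motion Pr w.
Local Notation F := (filtration_type Pr w).
Local Notation Dw s t := (fun x => w t x - w s x).

Lemma measurable_Dw (s t : R) : 0 <= s <= t -> measurable_fun [set: Omega] (Dw s t).
Proof.
move=> st; apply: (@measurable_F _ _ _ _ _ hw t); last exact: measurable_increment.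
by case/andP: st; apply: le_trans.
Qed.

Lemma bounded_sqint (f : Omega -> R) (c : R) : measurable_fun setT f -> (forall x, `|f x| <= c) ->
  sqint Pr f.
Proof.
move=> mf fc; apply: (@sqint_le _ _ _ _ _ (cst c)) => //; last first.
  by move=> x /=; rewrite (le_trans (fc x))// ler_norm.
by split=> //=; rewrite integral_cst//= probability_setT mule1 ltry.
Qed.

(** An equality of extended integrals: a nonnegative weight may have infinite mean, and both sides
    are then compared as they stand. *)
Lemma Dw_sq (f : Omega -> R) (s t : R) : 0 <= s <= t ->
  measurable_fun [set: F s] (f : F s -> R) -> (forall x, 0 <= f x) ->
  (\int[Pr]_x (f x * (w t x - w s x) ^+ 2)%:E = (t - s)%:E * \int[Pr]_x (f x)%:E)%E.
Proof.
move=> /andP[s0]; rewrite le_eqVlt => /predU1P[<- mf f0|st mf f0].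
  by rewrite subrr mul0e; under eq_integral do rewrite subrr expr0n mulr0; rewrite integral0.
under eq_integral do rewrite EFinM.
rewrite (@increment_indep _ _ _ _ _ hw s t (fun x => (f x)%:E) (fun x => (x ^+ 2)%:E))//.
- rewrite normal_variance ?sqrtr_gt0 ?subr_gt0// sqr_sqrtr ?subr_ge0 1?ltW//.
  by rewrite muleC.
- exact/measurable_EFinP.
- by apply/measurable_EFinP; exact: measurable_funX.
- by move=> x; rewrite lee_fin sqr_ge0.
Qed.

Lemma Dw_sqint (s t : R) : 0 <= s <= t -> sqint Pr (Dw s t).
Proof.
move=> st; split; first exact: measurable_Dw.
have -> : (\int[Pr]_x ((w t x - w s x) ^+ 2)%:E = \int[Pr]_x (1 * (w t x - w s x) ^+ 2)%:E)%E.
  by apply: eq_integral => x _; rewrite mul1r.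
rewrite (@Dw_sq (fun=> 1))//.
by rewrite (integral_cst Pr measurableT 1%E) /= probability_setT !mule1 ltry.
Qed.

(** The normal law is symmetric, so the positive and negative parts of the increment have equal
    integrals against a nonnegative $\mathcal F_s$-measurable weight ([main]); a signed weight is
    then split into its own two parts. Independence is available for nonnegative integrands, whence
    the two splittings. *)
Lemma Dw_mean (f : Omega -> R) (s t : R) : 0 <= s <= t ->
  measurable_fun [set: F s] (f : F s -> R) -> sqint Pr f -> ip Pr f (Dw s t) = 0.
Proof.
move=> st.
have sD := Dw_sqint st.
move: (st) => /andP[s0]; rewrite le_eqVlt => /predU1P[e|lst].
  by move=> _ _; subst t; under eq_fun do rewrite subrr; rewrite ip0r.
have sDN : sqint Pr (fun x => - (w t x - w s x)) by exact: sqintN.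
have mfun_pos : measurable_fun [set: R] (fun x : R => (rpos x)%:E).
  by apply/measurable_EFinP; exact: measurable_rpos.
have main g : measurable_fun [set: F s] (g : F s -> R) -> sqint Pr g -> (forall x, 0 <= g x) ->
    ip Pr g (fun x => rpos (w t x - w s x)) = ip Pr g (fun x => rpos (- (w t x - w s x))).
  move=> mg sg g0; rewrite /ip /Rintegral; congr fine.
  under eq_integral do rewrite EFinM.
  under [RHS]eq_integral do rewrite EFinM.
  rewrite (@increment_indep _ _ _ _ _ hw s t (fun x => (g x)%:E) (fun x => (rpos x)%:E))//; last first.
  - by move=> x; rewrite lee_fin rpos_ge0.
  - exact/measurable_EFinP.
  rewrite (@increment_indep _ _ _ _ _ hw s t (fun x => (g x)%:E) (fun x => (rpos (- x))%:E))//; last first.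
  - by move=> x; rewrite lee_fin rpos_ge0.
  - by apply/measurable_EFinP/measurable_rpos; exact: oppr_measurable.
  - exact/measurable_EFinP.
  rewrite (@integral_normalN R _ _ (@rpos R))//; first by rewrite sqrtr_gt0 subr_gt0.
  - exact: measurable_rpos.
  - exact: rpos_ge0.
have main2 g : measurable_fun [set: F s] (g : F s -> R) -> sqint Pr g -> (forall x, 0 <= g x) ->
    ip Pr g (Dw s t) = 0.
  move=> mg sg g0.
  rewrite (_ : Dw s t = fun x => rpos (w t x - w s x) - rpos (- (w t x - w s x))); last first.
    by apply/funext => x; exact: rpos_sub.
  by rewrite ipBr ?main ?subrr//; exact: sqint_rpos.
move=> mf sf.
rewrite (_ : f = fun x => rpos (f x) - rpos (- f x)); last by apply/funext => x; exact: rpos_sub.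
rewrite ipBl ?main2 ?subrr//.
all: try (by move=> x; exact: rpos_ge0).
- apply: (@measurable_rpos _ _ (F s)); exact: measurable_funN.
- by apply: sqint_rpos; exact: sqintN.
- exact: measurable_rpos.
- exact: sqint_rpos.
- exact: sqint_rpos.
- by apply: sqint_rpos; exact: sqintN.
Qed.

(** The admissible values of a simple process on a cell starting at time $s$. *)
Definition bF (s : R) (f : Omega -> R) := measurable_fun [set: F s] (f : F s -> R) /\
  exists c, forall x, `|f x| <= c.

Lemma bF_sqint s f : 0 <= s -> bF s f -> sqint Pr f.
Proof. by move=> s0 [mf [c fc]]; apply: bounded_sqint fc; exact: (measurable_F hw s0 mf). Qed.

Lemma bF_mul s f g : bF s f -> bF s g -> bF s (fun x => f x * g x).
Proof.
move=> [mf [c fc]] [mg [e ge]]; split; first exact: measurable_funM.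
by exists (c * e) => x; rewrite normrM ler_pM.
Qed.

Lemma bF_le s t f : s <= t -> bF s f -> bF t f.
Proof. by move=> st [mf h]; split=> //; exact: measurable_F_le st mf. Qed.

Lemma sqint_bmul (f g : Omega -> R) c : measurable_fun setT f -> (forall x, `|f x| <= c) ->
  sqint Pr g -> sqint Pr (fun x => f x * g x).
Proof.
move=> mf fc sg; apply: (@sqint_le _ _ _ _ _ (fun x => c * g x)); last first.
- by move=> x; rewrite !normrM ler_wpM2r// (le_trans (fc x))// ler_norm.
- exact: sqintZ.
- by apply: measurable_funM => //; exact: sqint_meas sg.
Qed.

Lemma bF_Dw_sqint r s t f : 0 <= r -> bF r f -> 0 <= s <= t -> sqint Pr (fun x => f x * (w t x - w s x)).
Proof.
move=> r0 [mf [c fc]] st; apply: sqint_bmul fc _; last exact: Dw_sqint.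
exact: (measurable_F hw r0 mf).
Qed.

(** The conditional variance of the increment is $t-s$. The weight $fg$ is signed and is split into
    parts to reach the nonnegative formula [Dw_sq]. *)
Lemma ip_Dw_Dw (f g : Omega -> R) (s t : R) : 0 <= s <= t -> bF s f -> bF s g ->
  ip Pr (fun x => f x * (w t x - w s x)) (fun x => g x * (w t x - w s x)) = (t - s) * ip Pr f g.
Proof.
move=> st bf bg; have s0 : 0 <= s by case/andP: st.
pose h x := f x * g x.
have bh : bF s h by exact: bF_mul.
have [mh [c hc]] := bh.
have s1 : sqint Pr (cst 1) by apply: (@bounded_sqint _ 1) => // x; rewrite normr1.
have main k : bF s k -> (forall x, 0 <= k x) ->
   ip Pr (fun x => k x * (w t x - w s x)) (fun x => w t x - w s x) = (t - s) * ip Pr k (cst 1).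
  move=> bk k0; have sk := bF_sqint s0 bk; have [mk _] := bk.
  apply/eqP; rewrite -eqe; apply/eqP.
  have sDw := Dw_sqint st; have skD := bF_Dw_sqint s0 bk st.
  rewrite EFinM !ipE//.
  under [in RHS]eq_integral do rewrite /= mulr1.
  rewrite -Dw_sq//.
  by apply: eq_integral => x _; rewrite -mulrA -expr2.
have bp k : bF s k -> bF s (fun x => rpos (k x)).
  move=> [mk [e ke]]; split; first exact: measurable_rpos.
  by exists e => x; apply: le_trans (ke x); exact: rpos_le.
have bn k : bF s k -> bF s (fun x => - k x).
  move=> [mk [e ke]]; split; first exact: measurable_funN.
  by exists e => x; rewrite normrN.
pose D (k : Omega -> R) x := k x * (w t x - w s x).
have sD k : bF s k -> sqint Pr (D k) by move=> bk; exact: (bF_Dw_sqint s0).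
have bh1 := bp _ bh; have bh2 := bp _ (bn _ bh).
transitivity (ip Pr (fun x => D (fun x => rpos (h x)) x - D (fun x => rpos (- h x)) x) (Dw s t)).
  by apply: eq_ip => x; rewrite /D [in RHS]/= -mulrBl -rpos_sub /h; ring.
rewrite ipBl; [|exact: sD|exact: sD|exact: Dw_sqint].
rewrite !main//; try by move=> x; exact: rpos_ge0.
rewrite -mulrBr -ipBl//; [|exact: bF_sqint bh1|exact: bF_sqint bh2].
by congr (_ * _); apply: eq_ip => x; rewrite -rpos_sub mulr1.
Qed.

(** Split $w_b-w_s$ at $a$: the piece after $a$ is orthogonal to everything known at time $a$. *)
Lemma ip_increments_same (s a b : R) (f g : Omega -> R) : 0 <= s ->
bF s f -> bF s g -> s <= a -> a <= b ->
ip Pr (fun x => f x * (w a x - w s x)) (fun x => g x * (w b x - w s x)) = (a - s) * ip Pr f g.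
Proof.
move=> s0 bf bg sa ab.
have a0 : 0 <= a by exact: le_trans sa.
transitivity (ip Pr (fun x => f x * (w a x - w s x)) (fun x => g x * (w a x - w s x)) +
   ip Pr (fun x => f x * (w a x - w s x)) (fun x => g x * (w b x - w a x))).
  rewrite -ipDr//; try by [apply: (bF_Dw_sqint s0); rewrite ?s0|apply: (bF_Dw_sqint s0); rewrite ?a0].
  by apply: eq_ip => x; ring.
rewrite ip_Dw_Dw ?s0//.
rewrite -[RHS]addr0; congr (_ + _).
rewrite -(@Dw_mean (fun x => g x * (f x * (w a x - w s x))) a b) ?a0//.
- by apply: eq_ip => x; ring.
- have [mf _] := bF_le sa bf; have [mg _] := bF_le sa bg.
  do 2 apply: measurable_funM => //.
  by apply: measurable_increment; rewrite s0.
- have [mg [c gc]] := bg; apply: sqint_bmul gc _; first exact: (measurable_F hw s0 mg).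
  by apply: (bF_Dw_sqint s0) => //; rewrite s0.
Qed.

(** Length of the overlap of $]s,t]$ and $]s',t']$. *)
Definition itvlen (s t s' t' : R) := Num.max 0 (Num.min t t' - Num.max s s').

(** After ordering $s\le s'$, the part of the first increment before $s'$ is known at time $s'$ and
    orthogonal to the second increment; only the overlap contributes. *)
Lemma ip_increments (f g : Omega -> R) (s t s' t' : R) : 0 <= s <= t -> 0 <= s' <= t' ->
  bF s f -> bF s' g ->
  ip Pr (fun x => f x * (w t x - w s x)) (fun x => g x * (w t' x - w s' x)) =
  itvlen s t s' t' * ip Pr f g.
Proof.
wlog ss' : f g s t s' t' / s <= s'.
  move=> H st st' bf bg; have [ss'|/ltW ss'] := leP s s'; first exact: H.
  by rewrite ipC (H g f s' t' s t ss')// (ipC Pr g f) /itvlen (minC t') (maxC s').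
move=> st st' bf bg.
have [s0 t0] := andP st; have [s0' t0'] := andP st'.
have bf' : bF s' f by exact: bF_le ss' bf.
(* The interval $]s,t]$ is cut at $s'$ into $]s,v]$ and $]s',t_1]$, the latter empty when $t\le
   s'$. *)
pose v := Num.min t s'; pose t1 := Num.max t s'.
have v1 : s <= v by rewrite /v le_min t0 ss'.
have v2 : v <= s' by rewrite /v ge_min lexx orbT.
have t12 : s' <= t1 by rewrite /t1 le_max lexx orbT.
have E x : w t x - w s x = (w v x - w s x) + (w t1 x - w s' x).
  by rewrite /v /t1; case: (leP t s') => h; rewrite ?minElt; ring.
have sg : sqint Pr (fun x => g x * (w t' x - w s' x)) by exact: (bF_Dw_sqint s0').
have sf1 : sqint Pr (fun x => f x * (w v x - w s x)) by apply: (bF_Dw_sqint s0); rewrite ?s0.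
have sf2 : sqint Pr (fun x => f x * (w t1 x - w s' x)) by apply: (bF_Dw_sqint s0); rewrite ?s0'.
transitivity (ip Pr (fun x => f x * (w v x - w s x)) (fun x => g x * (w t' x - w s' x)) +
  ip Pr (fun x => f x * (w t1 x - w s' x)) (fun x => g x * (w t' x - w s' x))).
  by rewrite -ipDl//; apply: eq_ip => x; rewrite E; ring.
have -> : ip Pr (fun x => f x * (w v x - w s x)) (fun x => g x * (w t' x - w s' x)) = 0.
  rewrite -(@Dw_mean (fun x => g x * (f x * (w v x - w s x))) s' t' st').
  - by apply: eq_ip => x; ring.
  - have [mf _] := bf'; have [mg _] := bg.
    do 2 apply: measurable_funM => //.
    by apply: (measurable_F_le v2); apply: measurable_increment; rewrite s0.
  - have [mg [c gc]] := bg; apply: sqint_bmul gc _ => //; exact: (measurable_F hw s0' mg).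
rewrite add0r /itvlen (max_r ss').
have key := ip_increments_same s0'.
have [tt'|/ltW tt'] := leP t1 t'.
  rewrite key//; congr (_ * _).
  move: tt'; rewrite /t1; case: (leP t s') => h h2; case: (leP t t') => h3; rewrite /Num.max; case: ifPn; lra.
rewrite ipC key// (ipC _ g f); congr (_ * _).
move: tt'; rewrite /t1; case: (leP t s') => h h2; case: (leP t t') => h3; rewrite /Num.max; case: ifPn; lra.
Qed.

End increment_moments.

(** * Ito integrals *)

Section product_space.
Context d1 d2 (T1 : measurableType d1) (T2 : measurableType d2) (R : realType).
Variables (m1 : {sigma_finite_measure set T1 -> \bar R})
  (m2 : {sigma_finite_measure set T2 -> \bar R}).

Lemma integrable_tensor (u : T1 -> R) (v : T2 -> R) :
  m1.-integrable setT (EFin \o u) -> m2.-integrable setT (EFin \o v) ->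
  (m1 \x m2)%E.-integrable setT (EFin \o (fun z => u z.1 * v z.2)).
Proof.
move=> iu iv.
have mu : measurable_fun setT u by apply/measurable_EFinP; exact: measurable_int iu.
have mv : measurable_fun setT v by apply/measurable_EFinP; exact: measurable_int iv.
apply/integrable12ltyP.
  by apply/measurable_EFinP; apply: measurable_funM; exact: measurableT_comp.
under eq_integral => x _.
  under eq_integral => y _ do rewrite /= normrM EFinM.
  rewrite ge0_integralZl//; last first.
    by apply/measurable_EFinP; exact: measurableT_comp.
  over.
move: iu iv => /integrableP[_ iu] /integrableP[_ iv].
rewrite ge0_integralZr//=.
- by apply: lte_mul_pinfty => //; [exact: integral_ge0|rewrite ge0_fin_numE//; exact: integral_ge0].
- by apply/measurable_EFinP; exact: measurableT_comp.
- exact: integral_ge0.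
Qed.

Lemma Rintegral_tensor (u : T1 -> R) (v : T2 -> R) :
  m1.-integrable setT (EFin \o u) -> m2.-integrable setT (EFin \o v) ->
  \int[(m1 \x m2)%E]_z (u z.1 * v z.2) = (\int[m1]_x u x) * (\int[m2]_y v y).
Proof.
move=> iu iv; rewrite /Rintegral -integral12_prod_meas1/=; last exact: integrable_tensor.
rewrite -fineM; [|exact: integrable_fin_num|exact: integrable_fin_num]; congr fine.
rewrite /fubini_F/= -[X in (_ * X)%E]fineK; last exact: integrable_fin_num.
rewrite -integralZr//.
apply: eq_integral => x _; rewrite fineK; last exact: integrable_fin_num.
by under eq_integral do rewrite EFinM; rewrite integralZl.
Qed.

Lemma sqint_tensor (u : T1 -> R) (v : T2 -> R) : sqint m1 u -> sqint m2 v ->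
  sqint (m1 \x m2)%E (fun z => u z.1 * v z.2).
Proof.
move=> /sqintP[mu iu] /sqintP[mv iv]; apply/sqintP; split.
  by apply: measurable_funM; exact: measurableT_comp.
apply: eq_integrable (integrable_tensor iu iv) => // z _ /=.
by congr EFin; ring.
Qed.

Lemma ip_tensor (u u' : T1 -> R) (v v' : T2 -> R) : sqint m1 u -> sqint m2 v ->
  sqint m1 u' -> sqint m2 v' ->
  ip (m1 \x m2)%E (fun z => u z.1 * v z.2) (fun z => u' z.1 * v' z.2) = ip m1 u u' * ip m2 v v'.
Proof.
move=> su sv su' sv'; rewrite /ip -Rintegral_tensor; try exact: sqint_mul.
by apply: eq_Rintegral => z _; ring.
Qed.

End product_space.

(** * Isometry on simple processes *)

Section simple_processes.
Context d (Omega : measurableType d) (R : realType).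
Variables (Pr : probability Omega R) (w : R -> Omega -> R).
Hypothesis hw : brownian_motion Pr w.
Local Notation leb := (@lebesgue_measure R).
Local Notation M := (leb \x Pr)%E.
Local Notation F := (filtration_type Pr w).

Definition spz a b (f : simple_process Pr w a b) : measurableTypeR R * Omega -> R :=
  fun z => sp_path f z.1 z.2.

Section bounds.
Variables (a b : R) (f : simple_process Pr w a b).
Hypothesis a0 : 0 <= a.

Lemma sp_time_mono i j : (i <= j <= sp_size f)%N -> sp_time f i <= sp_time f j.
Proof.
move=> /andP[ij jn]; elim: j ij jn => [|j ih]; first by rewrite leqn0 => /eqP ->.
rewrite leq_eqVlt => /predU1P[->//|]; rewrite ltnS => ij jn.
by apply: (le_trans (ih ij (ltnW jn))); exact: sp_time_le.
Qed.

Lemma sp_time_bounds j : (j <= sp_size f)%N -> a <= sp_time f j <= b.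
Proof.
move=> jn; rewrite (le_trans (sp_time_ge f)) ?sp_time_mono//=.
by rewrite (le_trans _ (sp_time_last f))// sp_time_mono// jn leqnn.
Qed.

Lemma sp_time_ge0 j : (j <= sp_size f)%N -> 0 <= sp_time f j.
Proof. by move/sp_time_bounds => /andP[/(le_trans a0)]. Qed.

Lemma sp_step j : (j < sp_size f)%N -> 0 <= sp_time f j <= sp_time f j.+1.
Proof. by move=> jn; rewrite sp_time_ge0 ?sp_time_le// ltnW. Qed.

Lemma sp_val_bF j : (j < sp_size f)%N -> bF Pr w (sp_time f j) (sp_val f j).
Proof. by move=> jn; split; [exact: sp_val_meas|exact: sp_val_bnd]. Qed.

Lemma sp_ito_sqint : sqint Pr (sp_ito f).
Proof.
by apply: sqint_sum => j; apply: (bF_Dw_sqint hw (sp_time_ge0 (ltnW (ltn_ord j))));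
  [exact: sp_val_bF|exact: sp_step].
Qed.

End bounds.

Lemma indic_sqint (s t : R) : sqint leb (\1_(`]s, t]%classic) : measurableTypeR R -> R).
Proof.
split; first exact: measurable_indic.
rewrite (_ : (fun x => _) = fun x => (\1_(`]s, t]%classic) x)%:E); last first.
  by apply/funext => x; rewrite indicE; case: (_ \in _); rewrite ?expr1n ?expr0n.
rewrite integral_indic//= setIT lebesgue_measure_itv/=.
by case: ifP => _; rewrite ?ltry// -EFinB ltry.
Qed.

Lemma ip_indic (s t s' t' : R) : s <= t -> s' <= t' ->
  ip leb (\1_(`]s, t]%classic)) (\1_(`]s', t']%classic)) = itvlen s t s' t'.
Proof.
move=> st st'; rewrite /ip /Rintegral.
rewrite (_ : (fun x => _) = fun x => (\1_(`]Num.max s s', Num.min t t']%classic) x)%:E); last first.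
  apply/funext => x; rewrite !indicE -natrM mulnb; congr ((nat_of_bool _)%:R%:E).
  apply/andP/idP; rewrite !inE/= !in_itv/= gt_max le_min.
    by move=> [/andP[-> ->] /andP[-> ->]].
  by move=> /andP[/andP[-> ->] /andP[-> ->]].
rewrite integral_indic//= setIT lebesgue_measure_itv/= lte_fin /itvlen.
case: ifPn => [h|]; first by apply/esym/max_r; rewrite subr_ge0 ltW.
by rewrite -leNgt => h; apply/esym/max_l; rewrite subr_le0.
Qed.

Lemma spzE a b (f : simple_process Pr w a b) :
  spz f = fun z => \sum_(j < sp_size f)
     (\1_(`]sp_time f j, sp_time f j.+1]%classic) z.1 * sp_val f j z.2).
Proof. by apply/funext => z; apply: eq_bigr => j _; rewrite mulrC. Qed.

Lemma spz_sqint a b (f : simple_process Pr w a b) : 0 <= a -> sqint M (spz f).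
Proof.
move=> a0; rewrite spzE; apply: sqint_sum => j; apply: sqint_tensor; first exact: indic_sqint.
apply: (bF_sqint hw); last by apply: sp_val_bF; exact: ltn_ord.
by apply: sp_time_ge0 => //; exact/ltnW/ltn_ord.
Qed.

(** Both sides are bilinear, and term by term the covariance of two weighted increments is the
    overlap of their time cells times the inner product of the weights. The processes may live on
    different intervals, so the orthogonality of integrals over disjoint intervals is included. *)
Lemma sp_isometry a b a' b' (f : simple_process Pr w a b) (g : simple_process Pr w a' b') :
  0 <= a -> 0 <= a' -> ip Pr (sp_ito f) (sp_ito g) = ip M (spz f) (spz g).
Proof.
move=> a0 a0'.
have sf (j : 'I_(sp_size f)) : sqint M (fun z => \1_(`]sp_time f j, sp_time f j.+1]%classic) z.1 * sp_val f j z.2).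
  apply: sqint_tensor; first exact: indic_sqint.
  apply: (bF_sqint hw); last by apply: sp_val_bF; exact: ltn_ord.
  by apply: sp_time_ge0 => //; exact/ltnW/ltn_ord.
have sg (j : 'I_(sp_size g)) : sqint M (fun z => \1_(`]sp_time g j, sp_time g j.+1]%classic) z.1 * sp_val g j z.2).
  apply: sqint_tensor; first exact: indic_sqint.
  apply: (bF_sqint hw); last by apply: sp_val_bF; exact: ltn_ord.
  by apply: sp_time_ge0 => //; exact/ltnW/ltn_ord.
rewrite !spzE /sp_ito !ip_suml; last 4 first.
- exact: sf.
- by apply: sqint_sum; exact: sg.
- by move=> j; apply: (bF_Dw_sqint hw (sp_time_ge0 a0 (ltnW (ltn_ord j))));
    [exact: sp_val_bF|exact: sp_step].
- exact: sp_ito_sqint.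
apply: eq_bigr => i _; rewrite !ip_sumr; last 4 first.
- exact: sg.
- exact: sf.
- by move=> j; apply: (bF_Dw_sqint hw (sp_time_ge0 a0' (ltnW (ltn_ord j))));
    [exact: sp_val_bF|exact: sp_step].
- by apply: (bF_Dw_sqint hw (sp_time_ge0 a0 (ltnW (ltn_ord i))));
    [exact: sp_val_bF|exact: sp_step].
apply: eq_bigr => j _.
have ti := sp_step a0 (ltn_ord i); have tj := sp_step a0' (ltn_ord j).
have vi := sp_val_bF (ltn_ord i); have vj := sp_val_bF (ltn_ord j).
have [ti0 _] := andP ti; have [tj0 _] := andP tj.
rewrite (ip_increments hw ti tj vi vj) ip_tensor; last 4 first.
- exact: indic_sqint.
- exact: (bF_sqint hw ti0 vi).
- exact: indic_sqint.
- exact: (bF_sqint hw tj0 vj).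
by rewrite ip_indic; [|case/andP: ti|case/andP: tj].
Qed.

(** The variable [xi] is known at time $a$, hence can be absorbed into each weight [sp_val f j]. *)
Lemma sp_mean a b (f : simple_process Pr w a b) (xi : Omega -> R) : 0 <= a ->
  measurable_fun [set: F a] (xi : F a -> R) -> sqint Pr xi ->
  ip Pr xi (sp_ito f) = 0.
Proof.
move=> a0 mxi sxi; rewrite ip_sumr//; last first.
  by move=> j; apply: (bF_Dw_sqint hw (sp_time_ge0 a0 (ltnW (ltn_ord j))));
    [exact: sp_val_bF|exact: sp_step].
rewrite big1// => j _.
have ti := sp_step a0 (ltn_ord j); have vi := sp_val_bF (ltn_ord j).
have [ti0 _] := andP ti.
rewrite -(@Dw_mean _ _ _ _ _ hw (fun x => sp_val f j x * xi x) _ _ ti).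
- by apply: eq_ip => x; ring.
- have [mv _] := vi; apply: measurable_funM => //.
  by apply: measurable_F_le mxi; have /andP[] := sp_time_bounds (ltnW (ltn_ord j)).
- have [mv [c hc]] := vi; apply: (sqint_bmul _ hc sxi).
  exact: (measurable_F hw ti0 mv).
Qed.

Lemma sp_ito_measurable a b (f : simple_process Pr w a b) : 0 <= a ->
  measurable_fun [set: F b] (sp_ito f : F b -> R).
Proof.
move=> a0.
apply: (@measurable_sum _ (F b) R setT _ _ (fun j : 'I_(sp_size f) => (fun x => sp_val f j x *
    (w (sp_time f j.+1) x - w (sp_time f j) x)) : F b -> R)) => j.
have [mv _] := sp_val_bF (ltn_ord j).
have ti := sp_step a0 (ltn_ord j).
have /andP[_ h1] := sp_time_bounds (ltnW (ltn_ord j)).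
have /andP[_ h2] := sp_time_bounds (ltn_ord j).
apply: measurable_funM; first exact: measurable_F_le mv.
by apply: (measurable_F_le h2); apply: measurable_increment.
Qed.

End simple_processes.

Lemma sqint_aeT d (T : measurableType d) (R : realType) (mu : {measure set T -> \bar R})
    (f g : T -> R) : measurable_fun setT g -> {ae mu, forall x, f x = g x} ->
  sqint mu f -> sqint mu g.
Proof. by move=> mg fg; apply: sqint_ae mg _; apply: filterS fg. Qed.

Lemma sqdxx d (T : measurableType d) (R : realType) (mu : {measure set T -> \bar R}) (f : T -> R) :
  sqd mu f f = 0.
Proof.
rewrite /sqd (_ : (fun x => _) = fun=> 0) ?ip0l//.
by apply/funext => x; rewrite subrr.
Qed.

(** * Isometry and mean of the Ito integral *)

Section ito_integral.
Context d (Omega : measurableType d) (R : realType).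
Variables (Pr : probability Omega R) (w : R -> Omega -> R).
Hypothesis hw : brownian_motion Pr w.
Local Notation leb := (@lebesgue_measure R).
Local Notation M := (leb \x Pr)%E.
Local Notation F := (filtration_type Pr w).
Local Notation is_ito := (is_ito_integral Pr w).

Definition mcut a b (f : R -> Omega -> R) :=
  measurable_fun [set: measurableTypeR R * Omega] (cut a b f).

Definition scut a b (f : R -> Omega -> R) := sqint M (cut a b f).

Lemma iterated_sqE a b (f : R -> Omega -> R) : mcut a b f ->
  (\int[Pr]_omega \int[leb]_(s in `[a, b]) ((f s omega) ^+ 2)%:E =
   \int[M]_z (cut a b f z ^+ 2)%:E)%E.
Proof.
move=> mf; rewrite fubini_tonelli2/=; last 2 first.
- by apply/measurable_EFinP; exact: measurable_funX.
- by move=> z; rewrite lee_fin sqr_ge0.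
apply: eq_integral => omega _; rewrite integral_mkcond/=; apply: eq_integral => s _.
rewrite patchE /cut/=; case: ifPn; rewrite ?inE ?notin_setE/= in_itv/=.
  by move=> ->.
by move/negP/negbTE => ->; rewrite expr0n.
Qed.

Lemma spz_sub_cut a b (phi : simple_process Pr w a b) f :
  (fun z => spz phi z - cut a b f z) = cut a b (fun s omega => sp_path phi s omega - f s omega).
Proof.
apply/funext => z; rewrite /cut /spz; case: ifPn => // h; rewrite subr0 /sp_path.
rewrite big1// => j _; rewrite indicE memNset ?mulr0//=.
rewrite in_itv/= => /andP[h1 h2]; move/negP: h; apply.
have /andP[/le_trans ha _] := sp_time_bounds (ltnW (ltn_ord j)).
have /andP[_ hb] := sp_time_bounds (ltn_ord j).
by rewrite (le_trans h2 hb) (ha _ (ltW h1)).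
Qed.

(** The iterated integral of the definition becomes a squared distance in $L^2(\mathbb
    R\times\Omega)$. That integrand and integral lie in $L^2$ follows from the convergence and is
    recorded here once for all. *)
Lemma itoP a b f I : 0 <= a -> mcut a b f ->
  is_ito a b f I <-> [/\ scut a b f, sqint Pr I &
    exists phi : nat -> simple_process Pr w a b,
      sqd M (spz (phi k)) (cut a b f) @[k --> \oo] --> 0 /\
      sqd Pr (sp_ito (phi k)) I @[k --> \oo] --> 0].
Proof.
move=> a0 mf.
have E (phi : simple_process Pr w a b) :
    (\int[Pr]_omega \int[leb]_(s in `[a, b]) ((sp_path phi s omega - f s omega) ^+ 2)%:E =
    \int[M]_z ((spz phi z - cut a b f z) ^+ 2)%:E)%E.
  rewrite iterated_sqE; last first.
    rewrite /mcut -spz_sub_cut; apply: measurable_funB => //; exact: sqint_meas (spz_sqint hw phi a0).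
  by apply: eq_integral => z _; rewrite -spz_sub_cut.
split=> [[mI [phi [h1 h2]]]|[sf sI [phi [h1 h2]]]].
  have h1' : ((fun k => \int[M]_z ((spz (phi k) z - cut a b f z) ^+ 2)%:E) @ \oo --> 0)%E.
    by rewrite (_ : (fun _ => _) = (fun k => \int[Pr]_omega \int[leb]_(s in `[a, b]) ((sp_path (phi k) s omega - f s omega) ^+ 2)%:E)%E)//;
      apply/funext => k; rewrite E.
  have [sf c1] := sqint_lim (fun k => spz_sqint hw (phi k) a0) mf h1'.
  have [sI c2] := sqint_lim (fun k => sp_ito_sqint hw (phi k) a0) mI h2.
  by split=> //; exists phi.
split; first exact: sqint_meas sI.
exists phi; split; last by apply: sqd_cvgE => // k; exact: (sp_ito_sqint hw).
rewrite (_ : (fun _ => _) = (fun k => \int[M]_z ((spz (phi k) z - cut a b f z) ^+ 2)%:E)%E); last first.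
  by apply/funext => k; rewrite E.
by apply: sqd_cvgE => // k; exact: (spz_sqint hw).
Qed.

Lemma ito_sqint a b f I : 0 <= a -> mcut a b f -> is_ito a b f I -> sqint Pr I.
Proof. by move=> a0 mf /(itoP I a0 mf)[]. Qed.

Lemma ito_isometry a b a' b' f f' I I' : 0 <= a -> 0 <= a' -> mcut a b f -> mcut a' b' f' ->
  is_ito a b f I -> is_ito a' b' f' I' ->
  ip Pr I I' = ip M (cut a b f) (cut a' b' f').
Proof.
move=> a0 a0' mf mf' /(itoP I a0 mf)[sf sI [phi [h1 h2]]] /(itoP I' a0' mf')[sf' sI' [phi' [h1' h2']]].
have c1 := ip_cvg (fun k => sp_ito_sqint hw (phi k) a0) (fun k => sp_ito_sqint hw (phi' k) a0') sI sI' h2 h2'.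
have c2 := ip_cvg (fun k => spz_sqint hw (phi k) a0) (fun k => spz_sqint hw (phi' k) a0') sf sf' h1 h1'.
rewrite -(cvg_lim (@Rhausdorff R) c1) -(cvg_lim (@Rhausdorff R) c2).
by congr (limn _); apply/funext => k; exact: (sp_isometry hw).
Qed.

Lemma ito_mean a b f I xi : 0 <= a -> mcut a b f -> is_ito a b f I ->
  measurable_fun [set: F a] (xi : F a -> R) -> sqint Pr xi -> ip Pr xi I = 0.
Proof.
move=> a0 mf /(itoP I a0 mf)[sf sI [phi [h1 h2]]] mxi sxi.
have c0 : sqd Pr xi xi @[k --> \oo] --> 0.
  by rewrite sqdxx; exact: cvg_cst.
have c1 := ip_cvg (fun=> sxi) (fun k => sp_ito_sqint hw (phi k) a0) sxi sI c0 h2.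
rewrite -(cvg_lim (@Rhausdorff R) c1) -[RHS](@lim_cst _ (@Rhausdorff R) _ (\oo : set_system nat)).
by congr (limn _); apply/funext => k; exact: (sp_mean hw).
Qed.

Lemma ito_ae a b f f' I I' : 0 <= a -> mcut a b f -> mcut a b f' ->
  {ae M, forall z, cut a b f z = cut a b f' z} ->
  measurable_fun setT I' -> {ae Pr, forall x, I x = I' x} ->
  is_ito a b f I -> is_ito a b f' I'.
Proof.
move=> a0 mf mf' ff' mI' II' /(itoP I a0 mf)[sf sI [phi [h1 h2]]].
apply/(itoP _ a0 mf'); split.
- exact: (sqint_aeT mf' ff' sf).
- exact: (sqint_aeT mI' II' sI).
- exists phi; split.
  + rewrite (_ : (fun _ => _) = (fun k => sqd M (spz (phi k)) (cut a b f)))//.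
    apply/funext => k; have sk := spz_sqint hw (phi k) a0.
    by apply/esym/sqd_ae => //; [exact: sqint_meas sk|exact: nearW].
  + rewrite (_ : (fun _ => _) = (fun k => sqd Pr (sp_ito (phi k)) I))//.
    apply/funext => k; have sk := sp_ito_sqint hw (phi k) a0.
    by apply/esym/sqd_ae => //; [exact: sqint_meas sk|exact: nearW].
Qed.

End ito_integral.

Lemma ae_mono d (T : measurableType d) (R : realType) (mu : set T -> \bar R) (P Q : T -> Prop) :
  (forall x, P x -> Q x) -> {ae mu, forall x, P x} -> {ae mu, forall x, Q x}.
Proof.
move=> PQ [N [mN N0 sN]]; exists N; split=> // x /= nQ.
by apply: sN => /= /PQ.
Qed.

(** * Averages over short intervals *)

Section averages.
Context (R : realType).
Local Notation leb := (@lebesgue_measure R).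

Lemma bounded_locally_integrable (g : R -> R) (c : R) : measurable_fun setT g ->
  (forall x, `|g x| <= c) -> locally_integrable setT g.
Proof.
move=> mg gc; split => //; first exact: openT.
move=> K _ cK; have mK := compact_measurable cK.
have Kfin : (leb K < +oo)%E by exact: compact_finite_measure.
apply: (@le_lt_trans _ _ (\int[leb]_(x in K) c%:E)%E).
  apply: ge0_le_integral => //.
  - by apply/measurable_EFinP; apply: measurableT_comp => //; exact: measurable_funTS.
  - by move=> x _; rewrite lee_fin.
rewrite integral_cst//; apply: lte_mul_pinfty => //.
by rewrite lee_fin (le_trans _ (gc 0)).
Qed.

(** Lebesgue differentiation along intervals that trail $s$ by up to two steps: they may miss $s$,
    but shrink nicely to it. *)
Lemma avg_cvg (g : R -> R) (c : R) (tau : R -> nat -> R) (h : nat -> R) :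
  measurable_fun setT g -> (forall x, `|g x| <= c) ->
  (forall n, 0 < h n) -> h n @[n --> \oo] --> 0 ->
  (forall s n, s - h n <= tau s n <= s) ->
  {ae leb, forall s, (h n)^-1 * \int[leb]_(y in `[tau s n - h n, tau s n]) g y @[n --> \oo] --> g s}.
Proof.
move=> mg gc h0 hcv htau.
pose E s n : set R := `[tau s n - h n, tau s n]%classic.
have muE s n : leb (E s n) = (h n)%:E.
  rewrite lebesgue_measure_itv/= lte_fin ltrBlDr ltrDl h0 -EFinB; congr EFin; ring.
have nE s : nicely_shrinking s (E s).
  split=> [n|]; first exact: measurable_itv.
  (* The interval lies in $[s-2h,s]$, hence in the ball of radius $3h$; the measure $6h$ of the ball
     is 6 times that of the interval. *)
  have h3 n : 0 < 3 * h n by rewrite mulr_gt0.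
  exists (6, fun n => PosNum (h3 n)) => /=; split => //.
  - rewrite -[X in _ --> X](mulr0 3); exact: cvgMl_tmp.
  - move=> n x; rewrite /E/= in_itv/= => /andP[x1 x2].
    have /andP[t1 t2] := htau s n; have := h0 n.
    by rewrite /ball/= ltr_norml => hn; apply/andP; split; lra.
  - move=> n; rewrite muE lebesgue_measure_ball/=; last by rewrite ltW.
    rewrite -EFinM lee_fin; have := h0 n; lra.
have lg := bounded_locally_integrable mg gc.
have := lebesgue_differentiation lg.
apply: ae_mono => s hs.
have := nice_lebesgue_differentiation nE lg hs.
move=> /fine_cvg.
rewrite (_ : fine \o _ = fun n => (h n)^-1 * \int[leb]_(y in `[tau s n - h n, tau s n]) g y)//.
apply/funext => n /=; rewrite muE /Rintegral inver gt_eqF// fineM//.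
apply: integrable_fin_num; first exact: measurable_itv.
apply: measurable_bounded_integrable.
- exact: measurable_itv.
- by apply: (@le_lt_trans _ _ (h n)%:E); [rewrite le_eqVlt; apply/orP; left; apply/eqP; exact: muE|exact: ltry].
- exact: measurable_funTS.
- exists c; split; first exact: num_real.
  by move=> x cx y _; rewrite /= (le_trans (gc y))// ltW.
Qed.

End averages.

Lemma leb_itv (R : realType) (s t : R) : s <= t -> (@lebesgue_measure R) `[s, t]%classic = (t - s)%:E.
Proof.
move=> st; rewrite lebesgue_measure_itv/= lte_fin; case: ltP => [_|ts]; first by rewrite -EFinB.
by rewrite (_ : s = t) ?subrr//; apply/eqP; rewrite eq_le st.
Qed.

Lemma leb_itv_lty (R : realType) (s t : R) : ((@lebesgue_measure R) `[s, t]%classic < +oo)%E.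
Proof.
rewrite lebesgue_measure_itv/= lte_fin; case: ifP => _; last exact: ltry.
by rewrite -EFinB ltry.
Qed.

Lemma leb_bounded_integrable (R : realType) (g : R -> R) (c s t : R) : measurable_fun setT g ->
  (forall x, `|g x| <= c) -> (@lebesgue_measure R).-integrable `[s, t] (EFin \o g).
Proof.
move=> mg gc; apply: measurable_bounded_integrable.
- exact: measurable_itv.
- exact: leb_itv_lty.
- exact: measurable_funTS.
- exists c; split; first exact: num_real.
  by move=> x cx y _; rewrite /= (le_trans (gc y))// ltW.
Qed.

Section parametric_integral.
Context d1 d2 (T1 : measurableType d1) (T2 : measurableType d2) (R : realType).
Variable m1 : {sigma_finite_measure set T1 -> \bar R}.

(** Difference of the Tonelli integrals of the two parts of [h], made real by [fine]. Where such an
    integral is infinite the value is the default of [fine], and the result is still measurable. *)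
Lemma measurable_Rintegral_param (h : T1 * T2 -> R) : measurable_fun setT h ->
  measurable_fun setT (fun y => \int[m1]_x h (x, y)).
Proof.
move=> mh; apply: (measurableT_comp (@fine_measurable R setT measurableT)).
have mE : measurable_fun setT (EFin \o h) by exact/measurable_EFinP.
rewrite (_ : (fun y => _) = (fun y => \int[m1]_x (EFin \o h)^\+ (x, y) - \int[m1]_x (EFin \o h)^\- (x, y))%E).
  apply: emeasurable_funB.
    by apply: (@measurable_fun_fubini_tonelli_G _ _ _ _ _ m1 ((EFin \o h)^\+)%E) => //; exact: measurable_funepos.
  by apply: (@measurable_fun_fubini_tonelli_G _ _ _ _ _ m1 ((EFin \o h)^\-)%E) => //; exact: measurable_funeneg.
apply/funext => y; rewrite integralE; congr (_ - _)%E; apply: eq_integral => x _ /=.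
- by rewrite !funeposE.
- by rewrite !funenegE.
Qed.

End parametric_integral.

(** * Density of simple processes *)

Section approximation.
Context d (Omega : measurableType d) (R : realType).
Variables (Pr : probability Omega R) (w : R -> Omega -> R).
Hypothesis hw : brownian_motion Pr w.
Local Notation leb := (@lebesgue_measure R).
Local Notation F := (filtration_type Pr w).

Lemma sp_path_at a b (phi : simple_process Pr w a b) j s x : (j < sp_size phi)%N ->
  sp_time phi j < s <= sp_time phi j.+1 -> sp_path phi s x = sp_val phi j x.
Proof.
move=> jn sj; rewrite /sp_path (bigD1 (Ordinal jn))//= big1 ?addr0 => [|k kj].
  by rewrite indicE mem_set ?mulr1//= in_itv.
rewrite indicE memNset ?mulr0//= in_itv/= => /andP[k1 k2].
have {}kj : (k : nat) != j by apply: contra kj => /eqP kj; apply/eqP/val_inj.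
case/andP: sj => s1 s2; move: kj; rewrite neq_ltn => /orP[kj|kj].
  have := @sp_time_mono _ _ _ _ _ _ _ phi k.+1 j; rewrite kj ltnW// => /(_ isT).
  by rewrite leNgt (lt_le_trans s1 k2).
have := @sp_time_mono _ _ _ _ _ _ _ phi j.+1 k; rewrite kj ltnW ?ltn_ord// => /(_ isT).
by rewrite leNgt (lt_le_trans k1 s2).
Qed.

Section grid.
Variables (a b : R) (f : R -> Omega -> R) (c : R).
Hypotheses (a0 : 0 <= a) (ab : a < b) (pf : progressive Pr w a b f).
Hypothesis (fc : forall s omega, `|f s omega| <= c).

Let c0 : 0 <= c. Proof. by apply: le_trans (fc 0 point). Qed.

(** The grid has [n.+1] cells, so that the denominator never vanishes. *)
Definition mesh (n : nat) : R := (b - a) / n.+1%:R.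

Lemma mesh_gt0 n : 0 < mesh n.
Proof. by rewrite divr_gt0// subr_gt0. Qed.

Definition gridt n j := a + mesh n * j%:R.

Lemma gridt_last n : gridt n n.+1 = b.
Proof. by rewrite /gridt /mesh divfK ?subrKC// pnatr_eq0. Qed.

Lemma gridt_mono n i j : (i <= j)%N -> gridt n i <= gridt n j.
Proof. move=> ij; rewrite lerD2l; apply: ler_wpM2l; first exact/ltW/mesh_gt0.
by rewrite ler_nat. Qed.

Lemma gridtS n j : gridt n j.+1 = gridt n j + mesh n.
Proof. by rewrite /gridt -natr1 mulrDr mulr1 addrA. Qed.

Lemma gridt_ge n j : a <= gridt n j.
Proof. by rewrite /gridt lerDl mulr_ge0// ltW// mesh_gt0. Qed.

Lemma gridt_le n j : (j <= n.+1)%N -> gridt n j <= b.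
Proof. by move=> jn; rewrite -(gridt_last n) gridt_mono. Qed.

Let mu0 : measurable_fun [set: measurableTypeR R * F b] (cut a b (f : R -> F b -> R)).
Proof. by move/progressiveP : pf; apply; rewrite lexx ltW. Qed.

Lemma measurable_cut_section x : measurable_fun setT (fun s => cut a b f (s, x)).
Proof.
have -> : (fun s => cut a b f (s, x)) = cut a b (f : R -> F b -> R) \o (fun s : measurableTypeR R => (s, x : F b)) by [].
apply: measurableT_comp mu0 _; exact: pair2_measurable.
Qed.

Lemma cut_bounded z : `|cut a b f z| <= c.
Proof. by rewrite /cut; case: ifPn => _; rewrite ?normr0. Qed.

(* The average over the preceding cell is known at the left end of a cell. *)
Definition prev_avg n j (x : Omega) : R :=
  (mesh n)^-1 * \int[leb]_(y in `[gridt n j - mesh n, gridt n j]) cut a b f (y, x).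

Lemma Rintegral_itv_bound (g : R -> R) (s t : R) : s <= t -> measurable_fun setT g ->
  (forall x, `|g x| <= c) -> `|\int[leb]_(y in `[s, t]) g y| <= c * (t - s).
Proof.
move=> st mg gc.
have ig := leb_bounded_integrable s t mg gc.
apply: (le_trans (le_normr_Rintegral _ ig)) => //.
apply: (@le_trans _ _ (\int[leb]_(y in `[s, t]) c)).
  apply: le_Rintegral => //.
  - exact: (integrable_norm ig).
  - by apply: (@leb_bounded_integrable R (cst c) c) => // x /=; rewrite ger0_norm.
by rewrite Rintegral_cst// [X in fine X](leb_itv st).
Qed.

Lemma prev_avg_bound n j x : `|prev_avg n j x| <= c.
Proof.
rewrite /prev_avg normrM ger0_norm; last by rewrite invr_ge0 ltW// mesh_gt0.
rewrite ler_pdivrMl ?mesh_gt0// mulrC.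
have := @Rintegral_itv_bound (fun y => cut a b f (y, x)) (gridt n j - mesh n) (gridt n j).
rewrite subKr; apply.
- by rewrite gerBl ltW// mesh_gt0.
- exact: measurable_cut_section.
- by move=> y; exact: cut_bounded.
Qed.

Lemma prev_avg_measurable n j : (j <= n.+1)%N ->
  measurable_fun [set: F (gridt n j)] (prev_avg n j : F (gridt n j) -> R).
Proof.
move=> jn; set t := gridt n j.
have tab : a <= t <= b by rewrite gridt_ge gridt_le.
have /progressiveP/(_ t tab) mt := pf.
apply: measurable_funM => //.
(* Cut at $t$ instead of $b$: on the averaging window both cuts agree, and this one is jointly
   measurable for $\mathcal F_t$. *)
pose g (z : measurableTypeR R * F t) : R := cut a t (f : R -> F t -> R) z * \1_(`[t - mesh n, t]%classic) z.1.
have mg : measurable_fun setT g.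
  by apply: measurable_funM => //; apply: measurableT_comp.
have := measurable_Rintegral_param leb mg.
rewrite (_ : (fun y : F t => \int[leb]_x g (x, y)) = fun x => \int[leb]_(y in `[t - mesh n, t]) cut a b f (y, x))//.
apply/funext => x; rewrite [RHS]Rintegral_mkcond; apply: eq_Rintegral => y _.
rewrite /g patchE/= indicE; case: ifPn => yt; rewrite ?mulr1 ?mulr0//.
move: yt; rewrite inE/= in_itv/= /cut/= => /andP[_ yt].
 have /andP[_ tb] := tab.
by rewrite yt (le_trans yt tb).
Qed.

Program Definition gridsp n : simple_process Pr w a b :=
  @SimpleProcess _ _ _ Pr w a b n.+1 (gridt n) (prev_avg n) _ _ _ _ _.
Next Obligation. by move=> n j _; exact: gridt_mono. Qed.
Next Obligation. by move=> n; exact: gridt_ge. Qed.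
Next Obligation. by move=> n; rewrite gridt_last. Qed.
Next Obligation. by move=> n j jn; apply: prev_avg_measurable; exact: ltnW. Qed.
Next Obligation. by move=> n j _; exists c => x; exact: prev_avg_bound. Qed.

Lemma grid_cell n s : a < s <= b -> exists2 j, (j < n.+1)%N & gridt n j < s <= gridt n j.+1.
Proof.
move=> /andP[sa sb].
have ex : exists j, s <= gridt n j.+1 by exists n; rewrite gridt_last.
exists (ex_minn ex); case: ex_minnP => j sj jmin.
  by rewrite ltnS; apply: jmin; rewrite gridt_last.
rewrite sj andbT ltNge; apply/negP; case: j sj jmin => [|j] sj jmin.
  by rewrite /gridt mulr0 addr0 leNgt sa.
by move=> /jmin; rewrite ltnn.
Qed.

(** At time $s$ the path is the average over the cell preceding the one that contains $s$, an
    interval that ends within one mesh before $s$; [avg_cvg] applies with this end point as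
    $\tau$. *)
Lemma gridsp_cvg x : {ae leb, forall s : R, a < s <= b ->
  sp_path (gridsp n) s x @[n --> \oo] --> f s x}.
Proof.
have /choice[tau htau] : forall s : R, exists tau : nat -> R, forall n, s - mesh n <= tau n <= s /\
    (a < s <= b -> sp_path (gridsp n) s x =
      (mesh n)^-1 * \int[leb]_(y in `[tau n - mesh n, tau n]) cut a b f (y, x)).
  move=> s.
  suff H : forall n, exists t, s - mesh n <= t <= s /\
    (a < s <= b -> sp_path (gridsp n) s x =
      (mesh n)^-1 * \int[leb]_(y in `[t - mesh n, t]) cut a b f (y, x)).
    by have [tau htau] := choice H; exists tau.
  move=> n.
  have [sab|sab] := boolP (a < s <= b); last first.
    (* Default for $s$ outside $]a,b]$, where only the bound on $\tau$ is claimed. *)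
    by exists s; rewrite lexx andbT gerBl (ltW (mesh_gt0 n)).
  have [j jn sj] := grid_cell n sab; exists (gridt n j); split.
    by case/andP: sj => s1 s2; rewrite lerBlDr -gridtS s2 ltW.
  by move=> _; rewrite (@sp_path_at _ _ (gridsp n) j).
have mcv : mesh n @[n --> \oo] --> 0.
  rewrite -[X in _ --> X](mulr0 (b - a)); apply: cvgMl_tmp.
  exact: cvg_harmonic.
have := avg_cvg (measurable_cut_section x) (fun s => cut_bounded (s, x)) mesh_gt0 mcv
  (fun s n => (htau s n).1).
apply: ae_mono => s hs sab.
have <- : cut a b f (s, x) = f s x.
  by rewrite /cut/=; case/andP: sab => /ltW -> ->.
rewrite (_ : (fun n => _) = fun n => (mesh n)^-1 * \int[leb]_(y in `[tau s n - mesh n, tau s n]) cut a b f (y, x))//.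
by apply/funext => n; rewrite (htau s n).2.
Qed.

End grid.
End approximation.

Section approximation_L2.
Context d (Omega : measurableType d) (R : realType).
Variables (Pr : probability Omega R) (w : R -> Omega -> R).
Hypothesis hw : brownian_motion Pr w.
Local Notation leb := (@lebesgue_measure R).
Local Notation M := (leb \x Pr)%E.

Lemma indic_integrable (a b c : R) :
  leb.-integrable setT (fun s => (c * \1_(`[a, b]%classic) s)%:E).
Proof.
under eq_fun do rewrite EFinM.
apply: integrableZl => //; apply: integrable_indic_itv.
Qed.

(** Dominated convergence twice, in time for fixed $\omega$ ([J0]) and then in $\omega$: the squared
    error is at most $(2c)^2$ and lives on $[a,b]$. *)
Lemma approx_bounded (a b : R) (f : R -> Omega -> R) (c : R) : 0 <= a -> a < b ->
  progressive Pr w a b f -> (forall s x, `|f s x| <= c) ->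
  exists phi : nat -> simple_process Pr w a b,
    sqd M (spz (phi n)) (cut a b f) @[n --> \oo] --> 0.
Proof.
move=> a0 ab pf fc.
have c0 : 0 <= c by apply: le_trans (fc 0 point).
pose phi := gridsp ab pf fc; exists phi.
have mf := measurable_cut hw (le_trans a0 (ltW ab)) pf.
have sphi n := spz_sqint hw (phi n) a0.
pose dz n z := spz (phi n) z - cut a b f z.
have mdz n : measurable_fun setT (dz n).
  by apply: measurable_funB => //; exact: sqint_meas (sphi n).
have mdz2 n : measurable_fun setT (fun z => (dz n z ^+ 2)%:E).
  by apply/measurable_EFinP; exact: measurable_funX.
have phib n s x : `|spz (phi n) (s, x)| <= c.
  have [sab|sab] := boolP (a < s <= b).
    have [j jn sj] := grid_cell n sab.
    by rewrite /spz/= (@sp_path_at _ _ _ _ _ _ _ (phi n) j)//; exact: (prev_avg_bound ab pf fc).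
  rewrite /spz/= /sp_path big1 ?normr0// => j _; rewrite indicE memNset ?mulr0//=.
  rewrite in_itv/= => /andP[h1 h2]; move/negP: sab; apply.
  have /andP[/le_lt_trans ha _] := sp_time_bounds (ltnW (ltn_ord j)).
  have /andP[_ hb] := sp_time_bounds (ltn_ord j).
  by rewrite (le_trans h2 hb) (ha _ h1).
have dzb n s x : `|dz n (s, x) ^+ 2| <= 4 * c ^+ 2 * \1_(`[a, b]%classic) s.
  rewrite ger0_norm ?sqr_ge0// /dz; have := spz_sub_cut (phi n) f.
  move=> /(congr1 (fun g => g (s, x))) ->; rewrite /cut/= indicE.
  case: ifPn => sab; last by rewrite expr0n/= mulr_ge0// mulr_ge0// sqr_ge0.
  rewrite mem_set/= ?in_itv//= mulr1.
  have := phib n s x; have := fc s x; rewrite /spz/= !ler_norml => /andP[? ?] /andP[? ?]; nra.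
have J0 x : (fun n => (\int[leb]_s (dz n (s, x) ^+ 2)%:E)%E) @ \oo --> 0%E.
  have := @dominated_convergence _ _ _ leb setT measurableT (fun n s => (dz n (s, x) ^+ 2)%:E)
     (fun=> 0%E) (fun s => (4 * c ^+ 2 * \1_(`[a, b]%classic) s)%:E).
  case.
  - by move=> n; apply: (measurableT_comp (mdz2 n)); exact: pair2_measurable.
  - exact: measurable_cst.
  - have [N [mN N0 sN]] := gridsp_cvg ab pf fc x.
    (* Cells are open on the left, so the simple paths are 0 at time $a$; this point joins the null
       set. *)
    exists (N `|` [set a]); split.
    + by apply: measurableU => //; exact: measurable_set1.
    + by rewrite measureU0//; exact: lebesgue_measure_set1.
    + move=> s /= hs; have [->|sa] := eqVneq s a; [by right|left].
      apply: sN => /= h; apply: hs => _.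
      have [sab|sab] := boolP (a < s <= b).
        have {}h := h sab.
        have -> : (0 = ((f s x - f s x) ^+ 2)%:E)%E by rewrite subrr expr0n.
        apply: cvg_EFin; first exact: nearW.
        apply: (@continuous_cvg _ _ _ _ _ (fun n => sp_path (phi n) s x - cut a b f (s, x)) (fun y : R => y ^+ 2)).
          exact: exprn_continuous.
        have -> : cut a b f (s, x) = f s x by rewrite /cut/=; case/andP: sab => /ltW -> ->.
        by apply: cvgB => //; exact: cvg_cst.
      have e n : dz n (s, x) = 0.
        have := spz_sub_cut (phi n) f => /(congr1 (fun g => g (s, x))); rewrite /dz => ->.
        rewrite /cut/=; case: ifPn => // /andP[as_ sb].
        by move: sab; rewrite sb andbT -leNgt => sa'; move: sa; rewrite eq_le sa' as_.
      by under eq_fun do rewrite e expr0n/=; exact: cvg_cst.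
  - exact: indic_integrable.
  - by apply: aeW => s n _; rewrite lee_fin; exact: dzb.
  move=> _ _; rewrite integral0; exact.
have JE n : (\int[M]_z (dz n z ^+ 2)%:E = \int[Pr]_x \int[leb]_s (dz n (s, x) ^+ 2)%:E)%E.
  by rewrite fubini_tonelli2//= => z; rewrite lee_fin sqr_ge0.
have : (fun n => (\int[M]_z (dz n z ^+ 2)%:E)%E) @ \oo --> 0%E.
  under eq_fun do rewrite JE.
  have := @dominated_convergence _ _ _ Pr setT measurableT (fun n x => (\int[leb]_s (dz n (s, x) ^+ 2)%:E)%E)
     (fun=> 0%E) (cst (\int[leb]_s (4 * c ^+ 2 * \1_(`[a, b]%classic) s)%:E)%E).
  case.
  - move=> n; apply: (@measurable_fun_fubini_tonelli_G _ _ _ _ _ leb (fun z => (dz n z ^+ 2)%:E)) => //.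
    by move=> z; rewrite lee_fin sqr_ge0.
  - exact: measurable_cst.
  - by apply: aeW => x _; exact: J0.
  - have := integrable_fin_num measurableT (indic_integrable a b (4 * c ^+ 2)).
    case: (\int[leb]_s _)%E => // r _.
    by apply: finite_measure_integrable_cst.
  - apply: aeW => x n _; rewrite gee0_abs; last by apply: integral_ge0 => s _; rewrite lee_fin sqr_ge0.
    apply: ge0_le_integral => //.
    + by move=> s _; rewrite lee_fin sqr_ge0.
    + by apply: (measurableT_comp (mdz2 n)); exact: pair2_measurable.
    + exact: measurable_int (indic_integrable a b _).
    + by move=> s _; rewrite lee_fin (le_trans _ (dzb n s x))// ler_norm.
  by move=> _ _; rewrite integral0; exact.
move=> h.
by have [] := sqint_lim sphi mf h.
Qed.

Definition clip (c x : R) := Num.max (- c) (Num.min c x).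

Lemma clipP (c x : R) : 0 <= c -> [/\ `|clip c x| <= c, `|clip c x| <= `|x| & `|clip c x - x| <= `|x|].
Proof.
move=> c0; rewrite /clip; have [h1|h1] := leP c x; have [h2|h2] := leP (- c) _;
  split; rewrite ?ler_norml; try (apply/andP; split); case: (ger0P x) => h4; lra.
Qed.

Lemma clip_bound (c x : R) : 0 <= c -> `|clip c x| <= c.
Proof. by move=> /(clipP x)[]. Qed.

Lemma clip_dist (c x : R) : 0 <= c -> `|clip c x - x| <= `|x|.
Proof. by move=> /(clipP x)[]. Qed.

Lemma clip_le (c x : R) : 0 <= c -> `|clip c x| <= `|x|.
Proof. by move=> /(clipP x)[]. Qed.

Lemma clip_id c x : `|x| <= c -> clip c x = x.
Proof. by rewrite ler_norml /clip => /andP[h1 h2]; rewrite (min_r h2) (max_r h1). Qed.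

Lemma measurable_clip d' (T : measurableType d') (c : R) (f : T -> R) D :
  measurable_fun D f -> measurable_fun D (fun x => clip c (f x)).
Proof. by move=> mf; apply: measurable_maxr => //; exact: measurable_minr. Qed.

Lemma cvg_eventually0 (u : nat -> R) N : (forall n, (N <= n)%N -> u n = 0) ->
  u n @[n --> \oo] --> 0.
Proof. by move=> h; apply: cvg_near_cst; exists N. Qed.

(** At each point the truncation is eventually exact, and the squared error stays below $g^2$. *)
Lemma clip_cvg_L2 d' (T : measurableType d') (mu : {measure set T -> \bar R}) (g : T -> R) :
  sqint mu g -> sqd mu (fun x => clip n%:R (g x)) g @[n --> \oo] --> 0.
Proof.
move=> sg; have mg := sqint_meas sg.
have sc n : sqint mu (fun x => clip n%:R (g x)).
  by apply: (sqint_le (measurable_clip _ mg) sg) => x; exact: clip_le.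
suff : (fun n => (\int[mu]_x ((clip n%:R (g x) - g x) ^+ 2)%:E)%E) @ \oo --> 0%E.
  by move=> h; have [] := sqint_lim sc mg h.
have := @dominated_convergence _ _ _ mu setT measurableT (fun n x => ((clip n%:R (g x) - g x) ^+ 2)%:E)
     (fun=> 0%E) (fun x => (g x * g x)%:E).
case.
- move=> n; apply/measurable_EFinP; apply: measurable_funX; apply: measurable_funB => //.
  exact: measurable_clip.
- exact: measurable_cst.
- apply: aeW => x _; apply: cvg_EFin; first exact: nearW.
  apply: (@cvg_eventually0 _ (Num.bound `|g x|)) => n hn.
  rewrite clip_id ?subrr ?expr0n//.
  apply: (le_trans (ltW (archi_boundP (normr_ge0 (g x))))).
  by rewrite ler_nat.
- exact: sqint_mulr.
- apply: aeW => x n _; rewrite lee_fin ger0_norm ?sqr_ge0// -expr2.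
  by rewrite -(real_normK (num_real (_ - _))) -(real_normK (num_real (g x))) ler_sqr ?nnegrE// clip_dist.
by move=> _ _; rewrite integral0; exact.
Qed.

Lemma progressive_clip a b c f : progressive Pr w a b f ->
  progressive Pr w a b (fun s x => clip c (f s x)).
Proof. by move=> pf t tab; apply: measurable_clip; exact: pf. Qed.

Lemma cut_clip a b c (f : R -> Omega -> R) : 0 <= c ->
  cut a b (fun s x => clip c (f s x)) = fun z => clip c (cut a b f z).
Proof.
by move=> c0; apply/funext => z; rewrite /cut; case: ifPn => // _; rewrite clip_id// normr0.
Qed.

Lemma cut_point_ae a (f : R -> Omega -> R) : {ae M, forall z, cut a a f z = 0}.
Proof.
exists ([set a] `*` setT); split.
- by apply: measurableX => //; exact: measurable_set1.
- have -> : (leb \x Pr)%E ([set a] `*` setT) = (leb [set a] * Pr setT)%E.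
    by apply: (product_measure1E leb Pr (measurable_set1 a) measurableT).
  by rewrite [X in (X * _)%E](lebesgue_measure_set1 a) mul0e.
- move=> z /=; rewrite /cut; case: ifPn => // /andP[az za] _.
  by split => //; apply/eqP; rewrite eq_le za.
Qed.

Program Definition sp_nil a b (ab : a <= b) : simple_process Pr w a b :=
  @SimpleProcess _ _ _ Pr w a b 0 (fun=> a) (fun=> fun=> 0) _ _ _ _ _.
Next Obligation. by []. Qed.
Next Obligation. by []. Qed.
Next Obligation. by []. Qed.
Next Obligation. by []. Qed.
Next Obligation. by []. Qed.

Lemma approx_L2 a b (f : R -> Omega -> R) e : 0 <= a -> a <= b ->
  progressive Pr w a b f -> scut Pr a b f -> 0 < e ->
  exists phi : simple_process Pr w a b, sqd M (spz phi) (cut a b f) < e.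
Proof.
move=> a0; rewrite le_eqVlt => /predU1P[<-|ab] pf sf e0.
  exists (sp_nil (lexx a)); rewrite (_ : sqd _ _ _ = 0)//.
  rewrite -[RHS](sqdxx M (cst 0)); apply: sqd_ae.
  - exact: (spz_sqint hw _ a0).
  - exact: measurable_cst.
  - exact: sf.
  - exact: measurable_cst.
  - by apply: aeW => z; rewrite /spz /sp_path big_ord0.
  - exact: cut_point_ae.
have b0 := le_trans a0 (ltW ab).
(* Truncation and discretization each cost less than $e/4$, because [sqd_triangle] doubles both. *)
have := clip_cvg_L2 sf => /cvgrPdist_lt /(_ (e / 4)); rewrite divr_gt0// => /(_ isT).
move=> [n _ /(_ n (leqnn n)) /=]; rewrite sub0r normrN ger0_norm ?sqd_ge0// => hn.
have pc := progressive_clip n%:R pf.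
have [phi /cvgrPdist_lt /(_ (e / 4))] := approx_bounded a0 ab pc (fun s x => clip_bound (f s x) (ler0n R n)).
rewrite divr_gt0// => /(_ isT) [m _ /(_ m (leqnn m)) /=].
rewrite sub0r normrN ger0_norm ?sqd_ge0// => hm.
exists (phi m).
have sphi := spz_sqint hw (phi m) a0.
have sc : sqint M (cut a b (fun s x => clip n%:R (f s x))).
  apply: (sqint_le (measurable_cut hw b0 pc) sf) => z.
  by rewrite cut_clip// clip_le.
have := sqd_triangle sphi sc sf; rewrite {2}cut_clip//; lra.
Qed.

End approximation_L2.

(** * Completeness along fast Cauchy sequences *)

Section fast_limit.
Context (R : realType).

(** The upper limit exists for every sequence, so a limit that exists only almost everywhere becomes
    a function measurable for whatever $\sigma$-algebra makes the terms measurable, with no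
    exceptional set to remove. This is what preserves adaptedness and progressive measurability. *)
Definition rlim (u : nat -> R) : R := fine (limn_esup (fun k => (u k)%:E)).

Lemma rlimE (u : nat -> R) l : u n @[n --> \oo] --> l -> rlim u = l.
Proof.
move=> ul; have h : (fun k => (u k)%:E) @ \oo --> l%:E by apply: cvg_EFin => //; exact: nearW.
have hc : cvgn (fun k => (u k)%:E) by apply/cvg_ex; exists l%:E.
by rewrite /rlim is_cvg_limn_esupE// (cvg_lim _ h).
Qed.

Lemma measurable_rlim d (T : measurableType d) D (X : nat -> T -> R) :
  (forall k, measurable_fun D (X k)) -> measurable_fun D (fun x => rlim (fun k => X k x)).
Proof.
move=> mX; apply: (@measurableT_comp _ _ _ _ _ _ (@fine R)); first exact: fine_measurable.
by apply: (@measurable_fun_limn_esup _ _ _ D (fun k x => (X k x)%:E)) => k; exact/measurable_EFinP.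
Qed.

Lemma cvg_of_geometric_steps (u : nat -> R) c : (forall k, `|u k.+1 - u k| <= c * 2^-1 ^+ k) ->
  cvgn u.
Proof.
move=> hu.
have h : cvgn (series (fun k => u k.+1 - u k)).
  apply: normed_cvg; apply: (@series_le_cvg _ _ (geometric c 2^-1)).
  - by move=> n /=.
  - by move=> n; apply: le_trans (hu n).
  - by move=> n; exact: hu.
  - by apply: is_cvg_geometric_series; rewrite ger0_norm ?invr_ge0// invf_lt1// ltr1n.
have -> : u = fun n => u 0%N + series (fun k => u k.+1 - u k) n.
  by apply/funext => n; rewrite seriesEnat/= telescope_sumr// addrC subrK.
by apply: is_cvgD => //; exact: is_cvg_cst.
Qed.

Context d (T : measurableType d) (mu : {measure set T -> \bar R}).

(** Induction through the doubled triangle inequality: $2C8^{-k}+2\cdot4C8^{-k-1}=3C8^{-k}$, below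
    the claimed bound. The ratio $1/8$ beats the factor 2 and leaves room for the weights $4^k$ of
    [fast_ae_cvg]. *)
Lemma fast_sqd (X : nat -> T -> R) C : (forall k, sqint mu (X k)) ->
  (forall k, sqd mu (X k.+1) (X k) <= C * 8^-1 ^+ k) ->
  forall m k, sqd mu (X k) (X (k + m)%N) <= 4 * C * 8^-1 ^+ k.
Proof.
move=> sX hX; elim=> [|m ih] k.
  rewrite addn0 sqdxx; have := le_trans (sqd_ge0 _ _ _) (hX k).
  by rewrite -mulrA => h; rewrite mulr_ge0.
have := sqd_triangle (sX k) (sX k.+1) (sX (k + m.+1)%N).
rewrite -addSnnS; have := ih k.+1; have := hX k; rewrite sqdC exprS.
have := le_trans (sqd_ge0 _ _ _) (hX k); lra.
Qed.

(** The sum $S$ of $4^k|X_{k+1}-X_k|^2$ has integral at most $\sum_kC2^{-k}=2C$, so it is finite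
    almost everywhere; there $|X_{k+1}-X_k|\le\sqrt S\,2^{-k}$. *)
Lemma fast_ae_cvg (X : nat -> T -> R) C : (forall k, sqint mu (X k)) ->
  (forall k, sqd mu (X k.+1) (X k) <= C * 8^-1 ^+ k) ->
  {ae mu, forall x, cvgn (fun k => X k x)}.
Proof.
move=> sX hX.
pose g k x := ((4 ^+ k * (X k.+1 x - X k x) ^+ 2)%:E)%E.
have mX k : measurable_fun setT (X k) by exact: sqint_meas (sX k).
have mg k : measurable_fun setT (g k).
  by apply/measurable_EFinP; apply: measurable_funM => //; apply: measurable_funX; exact: measurable_funB.
have g0 k x : (0 <= g k x)%E by rewrite lee_fin; apply: mulr_ge0; [exact: exprn_ge0|exact: sqr_ge0].
pose S x := (\sum_(k <oo) g k x)%E.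
have mS : measurable_fun setT S.
  by apply: (ge0_emeasurable_sum (P := xpredT)) => // k x _ _; exact: g0.
have C0 : 0 <= C by have := le_trans (sqd_ge0 _ _ _) (hX 0%N); rewrite expr0 mulr1.
have IS : (\int[mu]_x S x <= (2 * C)%:E)%E.
  rewrite integral_nneseries//.
  apply: lime_le; first by apply: is_cvg_nneseries => k _ _; apply: integral_ge0 => x _; exact: g0.
  apply: nearW => n.
  apply: (@le_trans _ _ (\sum_(0 <= k < n) (C * 2^-1 ^+ k)%:E)%E).
    apply: lee_sum => k _; rewrite /g.
    under eq_integral do rewrite EFinM.
    have mq : measurable_fun setT (fun x => ((X k.+1 x - X k x) ^+ 2)%:E).
      by apply/measurable_EFinP; apply: measurable_funX; exact: measurable_funB.
    have q0 x : [set: T] x -> (0 <= ((X k.+1 x - X k x) ^+ 2)%:E)%E.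
      by move=> _; rewrite lee_fin sqr_ge0.
    have k0 : (0 <= (4 ^+ k : R)%:E)%E by rewrite lee_fin exprn_ge0.
    rewrite (ge0_integralZl mu measurableT mq q0 k0).
    rewrite -ip_sqE; last exact: sqintB.
    rewrite -EFinM lee_fin; have := hX k; rewrite /sqd => h.
    apply: (le_trans (ler_wpM2l _ h)); first by rewrite exprn_ge0.
    rewrite mulrCA -exprMn (_ : 4 * 8^-1 = 2^-1 :> R)//.
    by field.
  rewrite sumEFin lee_fin -mulr_sumr mulrC.
  have -> : \sum_(0 <= k < n) 2^-1 ^+ k = 2 - 2 * 2^-1 ^+ n :> R.
    elim: n => [|n ih]; first by rewrite big_geq// expr0; ring.
    by rewrite big_nat_recr//= ih exprS; field.
  by apply: ler_wpM2r => //; rewrite gerBl mulr_ge0// exprn_ge0// invr_ge0.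
have iS : mu.-integrable setT S.
  apply/integrableP; split => //.
  under eq_integral => x _ do rewrite gee0_abs ?nneseries_ge0//.
  by apply: (le_lt_trans IS); rewrite ltry.
have := integrable_ae measurableT iS; apply: ae_mono => x /(_ I) Sx.
apply: (@cvg_of_geometric_steps _ (Num.sqrt (fine (S x)))) => k.
have hk : 4 ^+ k * (X k.+1 x - X k x) ^+ 2 <= fine (S x).
  rewrite -lee_fin fineK//.
  have := @nneseries_lim_ge R (g ^~ x) xpredT 0 k.+1; rewrite big_nat_recr//= => h.
  apply: le_trans (h _) => //; rewrite leeDr//; apply: sume_ge0 => //.
rewrite exprVn ler_pdivlMr ?exprn_gt0//.
rewrite -(ger0_norm (exprn_ge0 k (ler0n R 2))) -normrM -sqrtr_sqr.
apply: ler_wsqrtr; apply: le_trans hk.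
rewrite exprMn -exprM mulnC exprM (_ : 2 ^+ 2 = 4 :> R) 1?mulrC//.
by rewrite -natrX.
Qed.

Lemma limn_einf_le (u : nat -> \bar R) b k : (forall l, (k <= l)%N -> u l <= b)%E ->
  (limn_einf u <= b)%E.
Proof.
move=> h; rewrite limn_einf_lim; apply: lime_le; first exact: is_cvg_einfs.
apply: nearW => n; apply: (@le_trans _ _ (u (maxn n k))); last by apply: h; rewrite leq_maxr.
by apply: ereal_inf_lbound; exists (maxn n k) => //=; rewrite leq_maxl.
Qed.

(** Fatou, applied to $|X_k-X_l|^2$ as $l\to\infty$, hands the rate over to the limit. The limit is
    given explicitly, so that its measurability for smaller $\sigma$-algebras can be read off. *)
Lemma fast_limit (X : nat -> T -> R) C : (forall k, sqint mu (X k)) ->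
  (forall k, sqd mu (X k.+1) (X k) <= C * 8^-1 ^+ k) ->
  let Y := fun x => rlim (fun k => X k x) in
  sqint mu Y /\ forall k, sqd mu (X k) Y <= 4 * C * 8^-1 ^+ k.
Proof.
move=> sX hX Y.
have mX k : measurable_fun setT (X k) by exact: sqint_meas (sX k).
have mY : measurable_fun setT Y by exact: measurable_rlim.
have XY := fast_ae_cvg sX hX.
have main k : (\int[mu]_x ((X k x - Y x) ^+ 2)%:E <= (4 * C * 8^-1 ^+ k)%:E)%E.
  pose g l x := (((X k x - X l x) ^+ 2)%:E)%E.
  have mg l : measurable_fun setT (g l).
    by apply/measurable_EFinP; apply: measurable_funX; exact: measurable_funB.
  have g0 l x : (0 <= g l x)%E by rewrite lee_fin sqr_ge0.
  rewrite (_ : \int[mu]_x ((X k x - Y x) ^+ 2)%:E = \int[mu]_x limn_einf (g ^~ x))%E; last first.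
    apply: ge0_ae_eq_integral => //.
    - by apply/measurable_EFinP; apply: measurable_funX; exact: measurable_funB.
    - rewrite (_ : (fun x => _) = (fun x => - limn_esup (fun l => - g l x))%E); last first.
        by apply/funext => x; rewrite limn_esupN oppeK.
      apply: measurableT_comp => //.
      by apply: measurable_fun_limn_esup => l; exact: measurableT_comp.
    - by move=> x _; rewrite lee_fin sqr_ge0.
    - move=> x _; rewrite limn_einf_lim; apply: lime_ge; first exact: is_cvg_einfs.
      by apply: nearW => n; apply: le_ereal_inf_tmp => _ [l _ <-]; exact: g0.
    - apply: ae_mono XY => x cX _.
      have hl : g l x @[l --> \oo] --> ((X k x - Y x) ^+ 2)%:E.
        apply: cvg_EFin; first exact: nearW.
        apply: (@continuous_cvg _ _ _ _ _ (fun l => X k x - X l x) (fun y : R => y ^+ 2)).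
          exact: exprn_continuous.
        apply: cvgB; first exact: cvg_cst.
        have [l hl] := (cvg_ex _).1 cX.
        by rewrite /Y (rlimE hl).
      by rewrite is_cvg_limn_einfE; [rewrite (cvg_lim _ hl)|apply/cvg_ex; eexists; exact: hl].
  have := fatou mu measurableT mg (fun n x _ => g0 n x); move/le_trans; apply.
  apply: (@limn_einf_le _ _ k) => l kl; rewrite -ip_sqE; last exact: sqintB.
  by rewrite lee_fin -(subnKC kl); exact: fast_sqd.
have sY : sqint mu Y.
  have s1 : sqint mu (fun x => X 0%N x - Y x).
    split; first exact: measurable_funB.
    by apply: le_lt_trans (main 0%N) _; rewrite ltry.
  by have := sqintB (sX 0%N) s1; under eq_fun do rewrite opprB addrC subrK.
split=> // k; rewrite -lee_fin /sqd ip_sqE//; exact: sqintB.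
Qed.

End fast_limit.

(** * Existence of the integral and progressive versions *)

Section progressive_versions.
Context d (Omega : measurableType d) (R : realType).
Variables (Pr : probability Omega R) (w : R -> Omega -> R).
Hypothesis hw : brownian_motion Pr w.
Local Notation leb := (@lebesgue_measure R).
Local Notation M := (leb \x Pr)%E.
Local Notation F := (filtration_type Pr w).
Local Notation prog := (progressive Pr w).
Local Notation is_ito := (is_ito_integral Pr w).

Lemma eighth_gt0 k : 0 < 8^-1 ^+ k :> R.
Proof. by rewrite exprn_gt0. Qed.

Lemma eighth_small (x c : R) : (forall k, x <= c * 8^-1 ^+ k) -> x <= 0.
Proof.
move=> h.
have : c * 8^-1 ^+ k @[k --> \oo] --> c * 0.
  apply: cvgMl_tmp; apply: cvg_expr; rewrite ger0_norm ?invr_ge0// invf_lt1// ltr1n//.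
rewrite mulr0 => h0; rewrite -(cvg_lim (@Rhausdorff R) h0).
by apply: limr_ge; [apply/cvg_ex; eexists; exact: h0|exact: nearW].
Qed.

(** Take simple processes within $8^{-k}$ of the integrand: by isometry their integrals form a fast
    Cauchy sequence, and the [rlim] of these integrals is $\mathcal F_b$-measurable along with
    them. *)
Lemma ito_exists a b f : 0 <= a -> a <= b -> prog a b f -> scut Pr a b f ->
  exists I, is_ito a b f I /\ measurable_fun [set: F b] (I : F b -> R).
Proof.
move=> a0 ab pf sf.
have /choice[phi hphi] : forall k, exists phi : simple_process Pr w a b,
    sqd M (spz phi) (cut a b f) < 8^-1 ^+ k.
  by move=> k; apply: (approx_L2 hw) => //; exact: eighth_gt0.
have si k := sp_ito_sqint hw (phi k) a0.
have sz k := spz_sqint hw (phi k) a0.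
(* The triangle inequality gives $2\cdot8^{-k-1}+2\cdot8^{-k}\le3\cdot8^{-k}$. *)
have step k : sqd Pr (sp_ito (phi k.+1)) (sp_ito (phi k)) <= 3 * 8^-1 ^+ k.
  rewrite (_ : sqd _ _ _ = sqd M (spz (phi k.+1)) (spz (phi k))); last first.
    by rewrite !sqdE// !(sp_isometry hw).
  have := sqd_triangle (sz k.+1) sf (sz k); rewrite (sqdC M (cut a b f)).
  have := hphi k; have := hphi k.+1; rewrite exprS; have := eighth_gt0 k; lra.
have [sY hY] := fast_limit si step.
exists (fun x => rlim (fun k => sp_ito (phi k) x)); split; last first.
  apply: (@measurable_rlim _ _ (F b) setT (fun k => sp_ito (phi k) : F b -> R)) => k.
  exact: sp_ito_measurable.
apply/(itoP hw _ a0 (sqint_meas sf)); split=> //; exists phi.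
have c8 c : c * 8^-1 ^+ k @[k --> \oo] --> (0:R).
  rewrite -[X in _ --> X](mulr0 c).
  by apply: cvgMl_tmp; apply: cvg_expr; rewrite ger0_norm ?invr_ge0// invf_lt1// ltr1n//.
split.
- apply: (@squeeze_cvgr _ _ _ _ (fun=> 0) (fun k => 1 * 8^-1 ^+ k)); [|exact: cvg_cst|exact: c8].
  by apply: nearW => k; rewrite sqd_ge0 mul1r ltW.
- apply: (@squeeze_cvgr _ _ _ _ (fun=> 0) (fun k => 4 * 3 * 8^-1 ^+ k)); [|exact: cvg_cst|exact: c8].
  by apply: nearW => k; rewrite sqd_ge0 hY.
Qed.

(** A variable known at time $r$ and switched on after $r$: at earlier times the process is 0,
    whatever [xi] is. *)
Lemma prog_cst_itv a b (r : R) (itv : set R) (xi : Omega -> R) : measurable itv ->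
  (forall s, itv s -> r <= s) ->
  measurable_fun [set: F r] (xi : F r -> R) -> prog a b (fun s x => \1_itv s * xi x).
Proof.
move=> mI rI mxi t tab.
have [rt|tr] := leP r t.
  apply: measurable_funM.
    apply: (@measurable_comp _ _ _ _ _ _ setT) => //.
    exact: measurable_funTS.
  apply: (@measurable_comp _ _ _ _ _ _ setT (xi : F t -> R)) => //.
    exact: (measurable_F_le rt).
  exact: measurable_funTS.
have h : measurable_fun (`[a, t]%classic `*` [set: F t]) (cst (0 : R)).
  by move=> mD; exact: measurable_cst.
apply: eq_measurable_fun h => z; rewrite inE => -[/=]; rewrite in_itv/= => /andP[_ zt] _.
rewrite indicE memNset ?mul0r//= => /rI rz.
by move: tr; rewrite ltNge (le_trans rz zt).
Qed.

Lemma progD a b f g : prog a b f -> prog a b g -> prog a b (fun s x => f s x + g s x).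
Proof. by move=> pf pg t tab; apply: measurable_funD; [exact: pf|exact: pg]. Qed.

Lemma prog_sum a b (I : Type) (r : seq I) (f : I -> R -> Omega -> R) :
  (forall i, prog a b (f i)) -> prog a b (fun s x => \sum_(i <- r) f i s x).
Proof.
move=> pf; elim: r => [|i r ih] t tab.
  have -> : (fun z : measurableTypeR R * F t => \sum_(i <- [::]) f i z.1 z.2) = cst 0.
    by apply/funext => z; rewrite big_nil.
  by move=> mD; exact: measurable_cst.
have -> : (fun z : measurableTypeR R * F t => \sum_(j <- i :: r) f j z.1 z.2) =
  (fun z => f i z.1 z.2 + \sum_(j <- r) f j z.1 z.2).
  by apply/funext => z; rewrite big_cons.
by apply: measurable_funD; [exact: pf|exact: ih].
Qed.

(** Freeze the process at the left end of each cell of a grid so fine that the mean-square error is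
    at most $8^{-k}$. These step processes are progressive, and so is their [rlim], which agrees
    with $Y_t$ almost surely at each fixed $t$. *)
Lemma progressive_version a b (Y : R -> Omega -> R) : 0 <= a -> a < b ->
  (forall t, a <= t <= b -> measurable_fun [set: F t] (Y t : F t -> R)) ->
  (forall t, a <= t <= b -> sqint Pr (Y t)) ->
  (forall e, 0 < e -> exists2 dl, 0 < dl & forall s t, a <= s -> s <= t -> t <= b ->
     t - s < dl -> sqd Pr (Y t) (Y s) <= e) ->
  exists Z, prog a b Z /\ forall t, a <= t <= b -> {ae Pr, forall x, Y t x = Z t x}.
Proof.
move=> a0 ab mY sY hY.
have /choice[N hN] : forall k, exists N, forall s t, a <= s -> s <= t -> t <= b ->
    t - s <= mesh a b N -> sqd Pr (Y t) (Y s) <= 8^-1 ^+ k.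
  move=> k; have [dl dl0 hdl] := hY _ (eighth_gt0 k).
  have : mesh a b n @[n --> \oo] --> 0.
    by rewrite -[X in _ --> X](mulr0 (b - a)); apply: cvgMl_tmp; exact: cvg_harmonic.
  move=> /cvgrPdist_lt /(_ _ dl0)[n _ /(_ n (leqnn n))] /=.
  rewrite sub0r normrN ger0_norm ?(ltW (mesh_gt0 ab n))// => hn.
  exists n => s t as_ st tb tsn; apply: hdl => //; exact: le_lt_trans hn.
pose I k j : set R := `[gridt a b (N k) j, gridt a b (N k) j.+1[%classic.
(* Cells are closed on the left; the extra cell starting at $b$, the last of the [(N k).+2], takes
   care of $s=b$. *)
pose Z k s x := \sum_(j < (N k).+2) (\1_(I k j) s * Y (gridt a b (N k) j) x).
have tj k (j : 'I_(N k).+2) : a <= gridt a b (N k) j <= b.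
  by rewrite gridt_ge// gridt_le// -ltnS.
have pZ k : prog a b (Z k).
  apply: prog_sum => j; apply: (@prog_cst_itv a b (gridt a b (N k) j) (I k j)); first exact: measurable_itv.
  - by move=> s; rewrite /I/= in_itv/= => /andP[].
  - exact: mY (tj k j).
have ZE k s : a <= s <= b -> exists2 j, a <= gridt a b (N k) j /\ gridt a b (N k) j <= s <= gridt a b (N k) j + mesh a b (N k)
    & Z k s = Y (gridt a b (N k) j).
  move=> /andP[as_ sb].
  have ex : exists j, s < gridt a b (N k) j.+1.
    exists (N k).+1; rewrite gridtS gridt_last; apply: (le_lt_trans sb).
    by rewrite ltrDl mesh_gt0.
  exists (ex_minn ex).
    case: ex_minnP => j sj jmin; split; first exact: gridt_ge.
    rewrite -gridtS (ltW sj) andbT leNgt; apply/negP.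
    case: j sj jmin => [|j] sj jmin; first by rewrite /gridt mulr0 addr0 ltNge as_.
    by move=> /jmin; rewrite ltnn.
  case: ex_minnP => j sj jmin; apply/funext => x; rewrite /Z.
  have jN : (j < (N k).+2)%N.
    rewrite ltnS; apply: jmin; rewrite gridtS gridt_last; apply: (le_lt_trans sb).
    by rewrite ltrDl mesh_gt0.
  have js : gridt a b (N k) j <= s.
    rewrite leNgt; apply/negP.
    case: j sj jmin jN => [|j] sj jmin jN; first by rewrite /gridt mulr0 addr0 ltNge as_.
    by move=> /jmin; rewrite ltnn.
  rewrite (bigD1 (Ordinal jN))//= big1 ?addr0 => [|i ij].
    by rewrite indicE mem_set ?mul1r// /I/= in_itv/= js.
  rewrite indicE memNset ?mul0r// /I/= in_itv/= => /andP[i1 i2].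
  have {}ij : (i : nat) != j by apply: contra ij => /eqP ij; apply/eqP/val_inj.
  move: ij; rewrite neq_ltn => /orP[ij|ij].
    by have := gridt_mono ab (N k) ij; rewrite leNgt (le_lt_trans js i2).
  by have := gridt_mono ab (N k) ij; rewrite leNgt (le_lt_trans i1 sj).
have YZ k t : a <= t <= b -> sqd Pr (Y t) (Z k t) <= 8^-1 ^+ k /\ sqint Pr (Z k t).
  move=> tab; have [j [aj /andP[jt tj']] ->] := ZE k t tab.
  have /andP[_ tb] := tab; split; first by apply: hN => //; lra.
  by apply: sY; rewrite aj (le_trans jt tb).
pose W t x := rlim (fun k => Z k t x).
exists W; split.
  move=> t tab; apply: (@measurable_rlim R _ (measurableTypeR R * F t)%type _
    (fun k (z : measurableTypeR R * F t) => Z k z.1 z.2)) => k; exact: pZ.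
move=> t tab; have st := sY t tab.
have sZ k : sqint Pr (Z k t) by have [] := YZ k t tab.
have step k : sqd Pr (Z k.+1 t) (Z k t) <= 3 * 8^-1 ^+ k.
  have := sqd_triangle (sZ k.+1) st (sZ k); rewrite (sqdC Pr _ (Y t)).
  have [h1 _] := YZ k t tab; have [h2 _] := YZ k.+1 t tab; move: h2; rewrite exprS.
  have := eighth_gt0 k; lra.
have [sW hW] := fast_limit sZ step.
apply: (sqd_eq0 st sW); apply/eqP; rewrite eq_le sqd_ge0 andbT.
(* Here $26=2\cdot1+2\cdot12$: the distance from $Y_t$ to $Z_k$ is at most $8^{-k}$, that from $Z_k$
   to the limit at most $4\cdot3\cdot8^{-k}$. *)
apply: (@eighth_small _ 26) => k.
have := sqd_triangle st (sZ k) sW; have [h1 _] := YZ k t tab; have := hW k; rewrite /W; lra.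
Qed.

End progressive_versions.

(** * Ito processes *)

Section indicator_of_interval.
Context (R : realType).

Lemma indicc_in (a b s : R) : a <= s <= b -> \1_(`[a, b]%classic) s = 1 :> R.
Proof. by move=> sab; rewrite indicE mem_set//= in_itv. Qed.

Lemma indicc_out (a b s : R) : ~~ (a <= s <= b) -> \1_(`[a, b]%classic) s = 0 :> R.
Proof. by move=> sab; rewrite indicE memNset//= in_itv/=; exact/negP. Qed.

End indicator_of_interval.

(** * Fubini for real integrals and integration by parts *)

Section real_fubini.
Context d1 d2 (T1 : measurableType d1) (T2 : measurableType d2) (R : realType).
Variables (m1 : {sigma_finite_measure set T1 -> \bar R})
  (m2 : {sigma_finite_measure set T2 -> \bar R}).
Variable h : T1 * T2 -> R.
Hypothesis ih : (m1 \x m2)%E.-integrable setT (EFin \o h).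

Let mh : measurable_fun setT h.
Proof. by apply/measurable_EFinP; exact: measurable_int ih. Qed.

Lemma measurable_Rintegral_param2 : measurable_fun setT (fun x => \int[m2]_y h (x, y)).
Proof.
have mh' : measurable_fun setT (fun z : T2 * T1 => h (z.2, z.1)).
  apply: (measurableT_comp mh); apply: measurable_fun_pair.
    exact: measurable_snd.
  exact: measurable_fst.
exact: (measurable_Rintegral_param m2 mh').
Qed.

(** The real inner integral is the extended one wherever the section is integrable, that is almost
    everywhere; elsewhere [fine] gives a default. *)
Lemma Rfubini1 : \int[(m1 \x m2)%E]_z h z = \int[m1]_x \int[m2]_y h (x, y).
Proof.
rewrite /Rintegral -integral12_prod_meas1//; congr fine.
apply: ae_eq_integral => //.
- exact: measurable_fubini_F ih.
- apply/measurable_EFinP; exact: measurable_Rintegral_param2.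
- have := ae_integrable1 ih; apply: ae_mono => x hx _.
  by rewrite fineK//; exact: integrable_fin_num.
Qed.

Lemma Rfubini2 : \int[(m1 \x m2)%E]_z h z = \int[m2]_y \int[m1]_x h (x, y).
Proof.
rewrite /Rintegral -integral21_prod_meas1//; congr fine.
apply: ae_eq_integral => //.
- exact: measurable_fubini_G ih.
- apply/measurable_EFinP; exact: (measurable_Rintegral_param m1 mh).
- have := ae_integrable2 ih; apply: ae_mono => x hx _.
  by rewrite fineK//; exact: integrable_fin_num.
Qed.

Lemma Rfubini1_integrable : m1.-integrable setT (EFin \o (fun x => \int[m2]_y h (x, y))).
Proof.
have ih1 := integrable_fubini_F ih; apply/integrableP; split.
  by apply/measurable_EFinP; exact: measurable_Rintegral_param2.
have /integrableP[_] := ih1; apply: le_lt_trans; apply: ge0_le_integral => //.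
- by apply: measurableT_comp => //; apply/measurable_EFinP; exact: measurable_Rintegral_param2.
- by apply: measurableT_comp => //; exact: measurable_int ih1.
- move=> s _; rewrite /= /Rintegral /fubini_F/=.
  set I := (X in (`|fine X|)%:E); have -> : I = (\int[m2]_y (h (s, y))%:E)%E by [].
  by case: integral => [r| |]//=; rewrite ?lee_fin// normr0 ?leey.
Qed.

Lemma Rfubini2_integrable : m2.-integrable setT (EFin \o (fun y => \int[m1]_x h (x, y))).
Proof.
apply/integrableP; split.
  apply/measurable_EFinP; exact: (measurable_Rintegral_param m1 mh).
have h2 := (integrable21ltyP m1 m2 (measurable_int _ ih)).1 ih.
have mh' : measurable_fun setT (fun z => (`|h z|)%:E).
  by apply/measurable_EFinP; exact: measurableT_comp.
apply: le_lt_trans h2.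
apply: ge0_le_integral => //.
- apply: measurableT_comp => //; apply/measurable_EFinP; exact: (measurable_Rintegral_param m1 mh).
- exact: (@measurable_fun_fubini_tonelli_G _ _ _ _ _ m1 (fun z => (`|h z|)%:E)).
- move=> y _; rewrite /= /Rintegral.
  set I := (X in (`|fine X|)%:E); apply: (@le_trans _ _ `|I|%E).
    by case: I => [r| |]//=; rewrite ?lee_fin// normr0 ?leey.
  apply: le_abse_integral => //.
  by apply/measurable_EFinP; apply: (measurableT_comp mh); exact: pair2_measurable.
Qed.

End real_fubini.

Section time_integrals.
Context (R : realType).
Local Notation leb := (@lebesgue_measure R).

Lemma Rintegral0 d (T : measurableType d) (mu : {measure set T -> \bar R}) (D : set T) :
  \int[mu]_(x in D) (0 : R) = 0.
Proof. by rewrite /Rintegral integral0. Qed.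

Lemma Rintegral_indic_itv (f : R -> R) a t :
  \int[leb]_(s in `[a, t]) f s = \int[leb]_s (f s * \1_(`[a, t]%classic) s).
Proof.
rewrite Rintegral_mkcond; apply: eq_Rintegral => s _; rewrite patchE indicE.
by case: ifPn => _; rewrite ?mulr1 ?mulr0.
Qed.

Lemma integrable_indic_mul (f : R -> R) a t : leb.-integrable `[a, t] (EFin \o f) ->
  leb.-integrable setT (EFin \o (fun s => f s * \1_(`[a, t]%classic) s)).
Proof.
move=> h; have := (@integrable_mkcond _ _ R leb `[a, t]%classic (EFin \o f) (measurable_itv _)).1 h.
apply: eq_integrable => // s _ /=; rewrite patchE indicE.
by case: ifPn => _; rewrite ?mulr1 ?mulr0.
Qed.

Lemma integrable_itvW (f : R -> R) a t a' t' : a <= a' -> t' <= t ->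
  leb.-integrable `[a, t] (EFin \o f) -> leb.-integrable `[a', t'] (EFin \o f).
Proof.
move=> aa tt; apply: integrableS; [exact: measurable_itv|exact: measurable_itv|].
by move=> s /=; rewrite !in_itv/= => /andP[h1 h2]; rewrite (le_trans aa h1) (le_trans h2 tt).
Qed.

(** Integration by parts for primitives: the square $[a,t]^2$ is cut along its diagonal, and each
    triangle gives one term. *)
Lemma triangular_fubini (f g : R -> R) a t :
  leb.-integrable `[a, t] (EFin \o f) -> leb.-integrable `[a, t] (EFin \o g) ->
  (\int[leb]_(s in `[a, t]) f s) * (\int[leb]_(s in `[a, t]) g s) =
  \int[leb]_(s in `[a, t]) (f s * \int[leb]_(r in `[a, s]) g r) +
  \int[leb]_(s in `[a, t]) (g s * \int[leb]_(r in `[a, s]) f r).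
Proof.
move=> iF iG.
pose f' s := f s * \1_(`[a, t]%classic) s; pose g' s := g s * \1_(`[a, t]%classic) s.
have if' : leb.-integrable setT (EFin \o f') by exact: integrable_indic_mul.
have ig' : leb.-integrable setT (EFin \o g') by exact: integrable_indic_mul.
have mf' : measurable_fun setT f' by apply/measurable_EFinP; exact: measurable_int if'.
have mg' : measurable_fun setT g' by apply/measurable_EFinP; exact: measurable_int ig'.
pose H (z : measurableTypeR R * measurableTypeR R) : R := f' z.1 * g' z.2.
have iH : (leb \x leb)%E.-integrable setT (EFin \o H) by exact: (integrable_tensor (m1 := leb) (m2 := leb)).
pose I1 (z : measurableTypeR R * measurableTypeR R) : R := if z.2 <= z.1 then 1 else 0.
have mI1 : measurable_fun setT I1.
  by apply: measurable_fun_ifT => //; exact: measurable_fun_ler.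
have mH : measurable_fun setT H by apply/measurable_EFinP; exact: measurable_int iH.
have iH1 : (leb \x leb)%E.-integrable setT (EFin \o (fun z => H z * I1 z)).
  apply: le_integrable iH => //.
    by apply/measurable_EFinP; exact: measurable_funM.
  move=> z _ /=; rewrite lee_fin normrM /I1; case: ifP => _; rewrite ?normr1 ?normr0 ?mulr1 ?mulr0//.
have iH2 : (leb \x leb)%E.-integrable setT (EFin \o (fun z => H z * (1 - I1 z))).
  apply: le_integrable iH => //.
    by apply/measurable_EFinP; apply: measurable_funM => //; exact: measurable_funB.
  move=> z _ /=; rewrite lee_fin normrM /I1; case: ifP => _; rewrite ?subrr ?subr0 ?normr1 ?normr0 ?mulr1 ?mulr0//.
rewrite !Rintegral_indic_itv -(Rintegral_tensor if' ig').
have -> : \int[(leb \x leb)%E]_z (f' z.1 * g' z.2) =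
   \int[(leb \x leb)%E]_z (H z * I1 z) + \int[(leb \x leb)%E]_z (H z * (1 - I1 z)).
  by rewrite -RintegralD//; apply: eq_Rintegral => z _; rewrite /H; ring.
congr (_ + _).
- rewrite (Rfubini1 iH1)/=; apply: eq_Rintegral => s _.
  rewrite [RHS]mulrAC -/(f' s) Rintegral_indic_itv.
  have [sat|sat] := boolP (a <= s <= t); last first.
    have f0 : f' s = 0 by rewrite /f' indicE memNset ?mulr0//= in_itv/=; exact/negP.
    rewrite f0 mul0r -[RHS](Rintegral0 leb setT); apply: eq_Rintegral => r _.
    by rewrite /H/= f0 !mul0r.
  have /andP[as_ st] := sat.
  rewrite -RintegralZl//; last exact/integrable_indic_mul/(integrable_itvW (lexx a) st iG).
  apply: eq_Rintegral => r _; rewrite /H /I1 /g' /= -!mulrA; congr (_ * (_ * _)).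
  rewrite !indicE; case: ifPn => [rs|]; rewrite ?mulr1 ?mulr0.
    congr (_ * (nat_of_bool _)%:R); apply/idP/idP; rewrite !inE/= !in_itv/= => /andP[-> h]//=.
    by rewrite (le_trans rs st).
  by move=> rs; rewrite memNset ?mulr0//= in_itv/= => /andP[_ h]; rewrite h in rs.
- rewrite (Rfubini2 iH2)/=; apply: eq_Rintegral => s _.
  rewrite [RHS]mulrAC -/(g' s).
  have [sat|sat] := boolP (a <= s <= t); last first.
    have g0 : g' s = 0 by rewrite /g' indicE memNset ?mulr0//= in_itv/=; exact/negP.
    rewrite g0 mul0r -[RHS](Rintegral0 leb setT); apply: eq_Rintegral => r _.
    by rewrite /H/= g0 mulr0 !mul0r.
  have /andP[as_ st] := sat.
  have iFs := integrable_itvW (lexx a) st iF.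
  (* The diagonal belongs to the first triangle, so the second one produces the half-open interval
     $[a,s[$; the missing end point is null. *)
  have iFo : leb.-integrable `[a, s[ (EFin \o f).
    apply: integrableS iFs; [exact: measurable_itv|exact: measurable_itv|].
    by move=> r /=; rewrite !in_itv/= => /andP[-> /ltW].
  rewrite -(Rintegral_itv_bndo_bndc iFo) Rintegral_mkcond -RintegralZl//; last first.
    by have := (@integrable_mkcond _ _ R leb `[a, s[%classic (EFin \o f) (measurable_itv _)).1 iFo;
      apply: eq_integrable => // r _; rewrite /= !patchE; case: ifP.
  apply: eq_Rintegral => r _; rewrite /H /I1 /f' /= patchE mulrAC mulrC; congr (_ * _).
  rewrite indicE -mulrA; case: ifPn => [sr|]; rewrite ?subrr ?subr0 ?mulr0 ?mulr1.
    by case: ifPn => //; rewrite inE/= in_itv/= => /andP[_]; rewrite ltNge sr.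
  rewrite -ltNge => rs; case: ifPn; rewrite ?inE ?notin_setE/= in_itv/= rs ?andbT => ra.
    by rewrite mem_set ?mulr1//= in_itv/= ra (le_trans (ltW rs) st).
  by rewrite memNset ?mulr0//= in_itv/= => /andP[/ra].
Qed.

End time_integrals.

Lemma ae_eq_Rintegral d (T : measurableType d) (R : realType) (mu : {measure set T -> \bar R})
    (f g : T -> R) : measurable_fun setT f -> measurable_fun setT g ->
  {ae mu, forall x, f x = g x} -> \int[mu]_x f x = \int[mu]_x g x.
Proof.
move=> mf mg fg; rewrite /Rintegral; congr fine; apply: ae_eq_integral => //.
- exact/measurable_EFinP.
- exact/measurable_EFinP.
- by apply: ae_mono fg => x -> _.
Qed.

Lemma ae_mono2 d (T : measurableType d) (R : realType) (mu : {measure set T -> \bar R})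
    (P Q S : T -> Prop) :
  (forall x, P x -> Q x -> S x) -> {ae mu, forall x, P x} -> {ae mu, forall x, Q x} ->
  {ae mu, forall x, S x}.
Proof. by move=> h; apply: filterS2. Qed.

(** * Time integrals of processes *)

Section measurable_time_integral.
Context d (Omega : measurableType d) (R : realType).
Local Notation leb := (@lebesgue_measure R).

Definition tint (a t : R) (f : R -> Omega -> R) (x : Omega) : R :=
  \int[leb]_(s in `[a, t]) f s x.

Lemma tintE a t (f : R -> Omega -> R) x : tint a t f x = \int[leb]_s cut a t f (s, x).
Proof.
rewrite /tint Rintegral_mkcond; apply: eq_Rintegral => s _; rewrite patchE /cut/=.
case: ifPn; rewrite ?inE ?notin_setE/= in_itv/=; first by move=> ->.
by move/negP/negbTE => ->.
Qed.

(** With the kernel $1_{r\le s}$ the variable upper limit becomes a parameter of a single integral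
    over the line. *)
Lemma measurable_cut_tint a t (f : R -> Omega -> R) :
  measurable_fun [set: measurableTypeR R * Omega] (cut a t f) ->
  measurable_fun [set: measurableTypeR R * Omega] (cut a t (fun s x => tint a s f x)).
Proof.
move=> mf.
pose h (z : measurableTypeR R * (measurableTypeR R * Omega)) : R :=
  cut a t f (z.1, z.2.2) * (if z.1 <= z.2.1 then 1 else 0).
have m1 : measurable_fun setT (fun z : measurableTypeR R * (measurableTypeR R * Omega) => z.2.1).
  by apply: measurableT_comp measurable_snd; exact: measurable_fst.
have m2 : measurable_fun setT (fun z : measurableTypeR R * (measurableTypeR R * Omega) => z.2.2).
  by apply: measurableT_comp measurable_snd; exact: measurable_snd.
have mh : measurable_fun setT h.
  apply: measurable_funM.
    apply: (measurableT_comp mf); apply: measurable_fun_pair => //.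
  by apply: measurable_fun_ifT => //; apply: measurable_fun_ler => //; exact: measurable_fst.
have mk := measurable_Rintegral_param leb mh.
rewrite (_ : cut a t _ = fun z => \1_(`[a, t]%classic) z.1 * \int[leb]_r h (r, z)).
  by apply: measurable_funM => //; apply: measurableT_comp.
apply/funext => z; rewrite {1}/cut indicE; case: ifPn => zat; last first.
  by rewrite memNset ?mul0r//= in_itv/=; exact/negP.
rewrite mem_set/= ?in_itv// mul1r tintE; apply: eq_Rintegral => r _.
have /andP[az zt] := zat.
rewrite /h /cut/=; case: (lerP r z.1) => rz; rewrite ?andbT ?andbF ?mulr0//.
by rewrite (le_trans rz zt) andbT mulr1.
Qed.

End measurable_time_integral.

Section time_integral_processes.
Context d (Omega : measurableType d) (R : realType).
Variables (Pr : probability Omega R) (w : R -> Omega -> R).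
Hypothesis hw : brownian_motion Pr w.
Local Notation leb := (@lebesgue_measure R).
Local Notation M := (leb \x Pr)%E.
Local Notation F := (filtration_type Pr w).
Local Notation prog := (progressive Pr w).

Definition sL2 a b f := prog a b f /\ scut Pr a b f.

Lemma cut_cut a b a' b' (f : R -> Omega -> R) z : a <= a' -> b' <= b ->
  cut a' b' f z = cut a b f z * \1_(`[a', b']%classic) z.1.
Proof.
move=> aa bb; rewrite /cut indicE; case: ifPn => h.
  rewrite mem_set/= ?in_itv// mulr1; case/andP: h => h1 h2.
  by rewrite (le_trans aa h1) (le_trans h2 bb).
by rewrite memNset ?mulr0//= in_itv/=; exact/negP.
Qed.

Lemma scutW a b a' b' f : a <= a' -> b' <= b -> scut Pr a b f -> scut Pr a' b' f.
Proof.
move=> aa bb sf; apply: (sqint_le _ sf); last first.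
  move=> z; rewrite (cut_cut f z aa bb) normrM indicE.
  by case: (_ \in _); rewrite ?normr1 ?normr0 ?mulr1 ?mulr0.
rewrite (_ : cut _ _ _ = fun z => cut a b f z * \1_(`[a', b']%classic) z.1); last first.
  by apply/funext => z; exact: cut_cut.
by apply: measurable_funM; [exact: sqint_meas sf|apply: measurableT_comp].
Qed.

Lemma sL2W a b a' b' f : a <= a' -> b' <= b -> sL2 a b f -> sL2 a' b' f.
Proof. by move=> aa bb [pf sf]; split; [exact: progressiveW pf|exact: scutW sf]. Qed.

Lemma indicc_sqint (s t : R) : sqint leb (\1_(`[s, t]%classic) : measurableTypeR R -> R).
Proof.
split; first exact: measurable_indic.
rewrite (_ : (fun x => _) = fun x => (\1_(`[s, t]%classic) x)%:E); last first.
  by apply/funext => x; rewrite indicE; case: (_ \in _); rewrite ?expr1n ?expr0n.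
by rewrite integral_indic//= setIT; exact: leb_itv_lty.
Qed.

Lemma cut_cstE a t (xi : Omega -> R) :
  cut a t (fun=> xi) = fun z => \1_(`[a, t]%classic) z.1 * xi z.2.
Proof.
apply/funext => z; rewrite /cut indicE; case: ifPn => h.
  by rewrite mem_set ?mul1r//= in_itv.
by rewrite memNset ?mul0r//= in_itv/=; exact/negP.
Qed.

Lemma sqint_cut_cst a t (xi : Omega -> R) : sqint Pr xi -> scut Pr a t (fun=> xi).
Proof.
by move=> sxi; rewrite /scut cut_cstE; apply: sqint_tensor => //; exact: indicc_sqint.
Qed.

Lemma sqint_cst (c : R) : sqint Pr (fun=> c).
Proof. by apply: (@bounded_sqint _ _ _ _ _ `|c|). Qed.

Lemma cut_integrable a t f : scut Pr a t f -> M.-integrable setT (EFin \o cut a t f).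
Proof.
move=> sf; have := sqint_mul sf (sqint_cut_cst a t (sqint_cst 1)).
apply: eq_integrable => // z _ /=.
by rewrite /cut; case: ifP => _; rewrite ?mulr1 ?mulr0.
Qed.

Lemma scut_ae a t f : scut Pr a t f ->
  {ae Pr, forall x, leb.-integrable setT (EFin \o (fun s => cut a t f (s, x)))}.
Proof. by move=> sf; apply: (ae_mono _ (ae_integrable2 (cut_integrable sf))). Qed.

Lemma integrable_cutE a t (f : R -> Omega -> R) x :
  leb.-integrable setT (EFin \o (fun s => cut a t f (s, x))) <->
  leb.-integrable `[a, t] (EFin \o (fun s => f s x)).
Proof.
have E : (EFin \o (fun s => cut a t f (s, x))) = (EFin \o (fun s => f s x)) \_ `[a, t].
  apply/funext => s; rewrite patchE /cut/=.
  case: ifPn => h; first by rewrite mem_set//= in_itv.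
  by rewrite memNset//= in_itv/=; exact/negP.
rewrite E; apply: iff_sym; apply: (@integrable_mkcond _ _ R leb); exact: measurable_itv.
Qed.

Lemma tint_measurable a t f : scut Pr a t f -> measurable_fun setT (tint a t f).
Proof.
move=> sf; rewrite (_ : tint a t f = fun x => \int[leb]_s cut a t f (s, x)); last first.
  by apply/funext => x; exact: tintE.
apply: (measurable_Rintegral_param leb); exact: sqint_meas sf.
Qed.

Lemma tint_F a t f : prog a t f -> a <= t -> measurable_fun [set: F t] (tint a t f : F t -> R).
Proof.
move=> pf at_; rewrite (_ : tint a t f = fun x => \int[leb]_s cut a t f (s, x)); last first.
  by apply/funext => x; exact: tintE.
have /progressiveP/(_ t) := pf; rewrite at_ lexx => /(_ isT) mf.
exact: (@measurable_Rintegral_param _ _ _ (F t) R leb).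
Qed.

(** Cauchy-Schwarz against the indicator of $[a,t]$. The right side is an extended real, so the
    bound also covers paths outside $L^2$. *)
Lemma tint_sq_le a t (f : R -> Omega -> R) x : measurable_fun setT (fun s => cut a t f (s, x)) ->
  (((tint a t f x) ^+ 2)%:E <= (t - a)%:E * \int[leb]_s (cut a t f (s, x) ^+ 2)%:E)%E.
Proof.
move=> mf; have [at_|ta] := ltP a t; last first.
  rewrite (_ : tint a t f x = 0).
    have -> : (\int[leb]_s (cut a t f (s, x) ^+ 2)%:E = 0)%E.
      rewrite (ae_eq_integral (cst 0%E))//.
      - by rewrite integral0.
      - by apply/measurable_EFinP; exact: measurable_funX.
      - exists [set a]; split; [exact: measurable_set1|exact: lebesgue_measure_set1|].
        move=> s /= hs; apply: contrapT => sa; apply: hs => _; rewrite /cut/=.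
        case: ifPn => [/andP[h1 h2]|]; last by rewrite expr0n.
        by exfalso; apply: sa; apply/eqP; rewrite eq_le h1 (le_trans h2 ta).
    by rewrite expr0n mule0.
  rewrite tintE -[RHS](Rintegral0 leb setT); apply: ae_eq_Rintegral => //.
  exists [set a]; split; [exact: measurable_set1|exact: lebesgue_measure_set1|].
  move=> s /= hs; apply: contrapT => sa; apply: hs; rewrite /cut/=.
  case: ifPn => [/andP[h1 h2]|] //.
  by exfalso; apply: sa; apply/eqP; rewrite eq_le h1 (le_trans h2 ta).
have I0 : (0 <= \int[leb]_s (cut a t f (s, x) ^+ 2)%:E)%E.
  by apply: integral_ge0 => s _; rewrite lee_fin sqr_ge0.
have [|] := ltP (\int[leb]_s (cut a t f (s, x) ^+ 2)%:E)%E +oo%E; last first.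
  rewrite leye_eq => /eqP ->; rewrite gt0_muley ?leey// lte_fin subr_gt0//.
move=> Ioo.
have sf : sqint leb (fun s => cut a t f (s, x)) by split.
rewrite -(ip_sqE sf) -EFinM lee_fin.
have := cauchy_schwarz sf (indicc_sqint a t).
have -> : ip leb (\1_(`[a, t]%classic)) (\1_(`[a, t]%classic)) = t - a.
  transitivity (\int[leb]_(s in `[a, t]) 1).
    rewrite Rintegral_indic_itv; apply: eq_Rintegral => s _; rewrite indicE.
    by case: (_ \in _); rewrite ?mulr1 ?mulr0.
  by rewrite Rintegral_cst// mul1r [X in fine X](leb_itv (ltW at_)).
rewrite mulrC; congr (_ ^+ 2 <= _).
rewrite tintE; apply: eq_Rintegral => s _; rewrite /cut/= indicE.
case: ifPn => h; last by rewrite mul0r.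
by rewrite mem_set/= ?in_itv// mulr1.
Qed.

Lemma cut_section a t f x : scut Pr a t f -> measurable_fun setT (fun s => cut a t f (s, x)).
Proof.
move=> sf; apply: (measurableT_comp (sqint_meas sf)); exact: pair2_measurable.
Qed.

Lemma scut_sqE a t f : scut Pr a t f ->
  (ip M (cut a t f) (cut a t f))%:E = (\int[Pr]_x \int[leb]_s (cut a t f (s, x) ^+ 2)%:E)%E.
Proof.
move=> sf; rewrite ip_sqE// fubini_tonelli2//=.
- by apply/measurable_EFinP; apply: measurable_funX; exact: sqint_meas sf.
- by move=> z; rewrite lee_fin sqr_ge0.
Qed.

Lemma measurable_sq_section a t f : scut Pr a t f ->
  measurable_fun setT (fun x => \int[leb]_s (cut a t f (s, x) ^+ 2)%:E)%E.
Proof.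
move=> sf; apply: (@measurable_fun_fubini_tonelli_G _ _ _ _ _ leb (fun z => (cut a t f z ^+ 2)%:E)).
- by apply/measurable_EFinP; apply: measurable_funX; exact: sqint_meas sf.
- by move=> z; rewrite lee_fin sqr_ge0.
Qed.

Lemma tint_sqint a t f : a <= t -> scut Pr a t f -> sqint Pr (tint a t f) /\
  ip Pr (tint a t f) (tint a t f) <= (t - a) * ip M (cut a t f) (cut a t f).
Proof.
move=> at_ sf; have mt := tint_measurable sf.
have h : (\int[Pr]_x ((tint a t f x) ^+ 2)%:E <= ((t - a) * ip M (cut a t f) (cut a t f))%:E)%E.
  rewrite EFinM scut_sqE// -ge0_integralZl//.
  - apply: ge0_le_integral => //.
    + by move=> x _; rewrite lee_fin sqr_ge0.
    + by apply/measurable_EFinP; exact: measurable_funX.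
    + by apply: emeasurable_funM => //; exact: measurable_sq_section.
    + by move=> x _; apply: tint_sq_le; exact: cut_section.
  - exact: measurable_sq_section.
  - by move=> x _; apply: integral_ge0 => s _; rewrite lee_fin sqr_ge0.
  - by rewrite lee_fin subr_ge0.
have st : sqint Pr (tint a t f) by split=> //; apply: (le_lt_trans h); rewrite ltry.
by split=> //; rewrite -lee_fin ip_sqE.
Qed.

Lemma tint_split a s t (f : R -> Omega -> R) x : a <= s -> s <= t -> leb.-integrable `[a, t] (EFin \o (fun r => f r x)) ->
  tint a t f x = tint a s f x + tint s t f x.
Proof.
move=> as_ st iF; apply/eqP; rewrite addrC -subr_eq; apply/eqP.
have h1 : (BLeft a <= BRight s)%O by rewrite bnd_simp.
have h2 : (BRight s <= BRight t)%O by rewrite bnd_simp.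
rewrite /tint (Rintegral_itvB iF h1 h2) Rintegral_itv_obnd_cbnd//.
by apply: integrableS iF; [exact: measurable_itv|exact: measurable_itv|
   move=> r /=; rewrite !in_itv/= => /andP[/ltW/(le_trans as_) -> ->]].
Qed.

Lemma ip_tint a t f xi : scut Pr a t f -> sqint Pr xi ->
  ip Pr (tint a t f) xi = ip M (cut a t f) (cut a t (fun=> xi)).
Proof.
move=> sf sxi; have sc := sqint_cut_cst a t sxi.
rewrite [RHS](Rfubini2 (sqint_mul sf sc)).
apply: ae_eq_Rintegral.
- by apply: measurable_funM; [exact: tint_measurable|exact: sqint_meas sxi].
- apply: (@measurable_Rintegral_param _ _ _ _ _ leb (fun z => cut a t f z * cut a t (fun=> xi) z)).
  by apply: measurable_funM; [exact: sqint_meas sf|exact: sqint_meas sc].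
apply: ae_mono (scut_ae sf) => x ix; rewrite tintE -RintegralZr//.
by apply: eq_Rintegral => s _; rewrite /cut/=; case: ifP => _; rewrite ?mul0r.
Qed.

Lemma scut_tint a t f : a <= t -> scut Pr a t f -> scut Pr a t (fun s x => tint a s f x).
Proof.
move=> at_ sf; have mc := measurable_cut_tint (sqint_meas sf); split=> //.
rewrite fubini_tonelli1//=; last 2 first.
- by apply/measurable_EFinP; exact: measurable_funX.
- by move=> z; rewrite lee_fin sqr_ge0.
rewrite /fubini_F/=.
pose C := (t - a) * ip M (cut a t f) (cut a t f).
apply: (@le_lt_trans _ _ (\int[leb]_s (C%:E * (\1_(`[a, t]%classic) s)%:E))%E); last first.
  have C0 : 0 <= C by rewrite mulr_ge0 ?ip_ge0// subr_ge0.
  rewrite ge0_integralZl//.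
  - rewrite integral_indic//= setIT; apply: lte_mul_pinfty => //; exact: leb_itv_lty.
  - by apply/measurable_EFinP; exact: measurable_indic.
apply: ge0_le_integral => //.
- by move=> s _; apply: integral_ge0 => x _; rewrite lee_fin sqr_ge0.
- apply: (@measurable_fun_fubini_tonelli_F _ _ _ _ _ Pr (fun z => (cut a t (fun s x => tint a s f x) z ^+ 2)%:E)).
  + by apply/measurable_EFinP; exact: measurable_funX.
  + by move=> z; rewrite lee_fin sqr_ge0.
- by apply: emeasurable_funM => //; apply/measurable_EFinP; exact: measurable_indic.
move=> s _; rewrite indicE; have [sat|sat] := boolP (a <= s <= t); last first.
  rewrite (eq_integral (cst 0%E)); last by move=> y _; rewrite /cut/= (negbTE sat) expr0n.
  rewrite integral0 memNset/=; last by rewrite in_itv/=; exact/negP.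
  by rewrite mule0.
rewrite (eq_integral (fun y => (tint a s f y ^+ 2)%:E)); last first.
  by move=> y _; rewrite /cut/= sat.
rewrite mem_set/= ?in_itv// mule1.
have /andP[as_ st] := sat.
have [sT hT] := tint_sqint as_ (scutW (lexx a) st sf).
rewrite -ip_sqE// lee_fin; apply: (le_trans hT); rewrite /C.
apply: ler_pM; rewrite ?subr_ge0 ?ip_ge0 ?lerD2r//.
apply: le_Rintegral => //.
- have sfs := scutW (lexx a) st sf; exact: (sqint_mul sfs sfs).
- exact: (sqint_mul sf sf).
- move=> z _; rewrite (cut_cut f z (lexx a) st) indicE; case: (_ \in _); rewrite ?mulr1 ?mulr0//.
  by rewrite -expr2 sqr_ge0.
Qed.

(** [triangular_fubini] along almost every path, integrated over $\Omega$. *)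
Lemma ip_tint_tint a t f g : a <= t -> scut Pr a t f -> scut Pr a t g ->
  ip Pr (tint a t f) (tint a t g) =
  ip M (cut a t f) (cut a t (fun s x => tint a s g x)) +
  ip M (cut a t g) (cut a t (fun s x => tint a s f x)).
Proof.
move=> at_ sf sg.
have sF := scut_tint at_ sf; have sG := scut_tint at_ sg.
rewrite [ip M (cut a t f) _](Rfubini2 (sqint_mul sf sG)).
rewrite [ip M (cut a t g) _](Rfubini2 (sqint_mul sg sF)).
have i1 := ae_integrable2 (sqint_mul sf sG).
have i2 := ae_integrable2 (sqint_mul sg sF).
have m1 : measurable_fun setT (fun y => \int[leb]_x (cut a t f (x, y) * cut a t (fun s x => tint a s g x) (x, y))).
  apply: (@measurable_Rintegral_param _ _ _ _ _ leb (fun z => cut a t f z * cut a t (fun s x => tint a s g x) z)).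
  by apply: measurable_funM; [exact: sqint_meas sf|exact: sqint_meas sG].
have m2 : measurable_fun setT (fun y => \int[leb]_x (cut a t g (x, y) * cut a t (fun s x => tint a s f x) (x, y))).
  apply: (@measurable_Rintegral_param _ _ _ _ _ leb (fun z => cut a t g z * cut a t (fun s x => tint a s f x) z)).
  by apply: measurable_funM; [exact: sqint_meas sg|exact: sqint_meas sF].
have I f' g' : scut Pr a t f' -> scut Pr a t g' -> Pr.-integrable setT (EFin \o (fun y => \int[leb]_x (cut a t f' (x, y) * cut a t g' (x, y)))).
  by move=> s1 s2; exact: Rfubini2_integrable (sqint_mul s1 s2).
rewrite -(RintegralD measurableT (I _ _ sf sG) (I _ _ sg sF)).
apply: ae_eq_Rintegral.
- by apply: measurable_funM; exact: tint_measurable.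
- exact: (measurable_funD m1 m2).
apply: ae_mono2 (scut_ae sf) (scut_ae sg) => x.
move=> /integrable_cutE if_ /integrable_cutE ig_.
rewrite /tint triangular_fubini//; congr (_ + _); rewrite Rintegral_mkcond; apply: eq_Rintegral => s _;
  rewrite patchE /cut/=; case: ifPn; rewrite ?inE ?notin_setE/= in_itv/=.
- by move=> ->.
- by move/negP/negbTE => ->; rewrite mul0r.
- by move=> ->.
- by move/negP/negbTE => ->; rewrite mul0r.
Qed.

End time_integral_processes.

Section ito_processes.
Context d (Omega : measurableType d) (R : realType).
Variables (Pr : probability Omega R) (w : R -> Omega -> R).
Hypothesis hw : brownian_motion Pr w.
Local Notation leb := (@lebesgue_measure R).
Local Notation M := (leb \x Pr)%E.
Local Notation F := (filtration_type Pr w).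
Local Notation is_ito := (is_ito_integral Pr w).
Local Notation prog := (progressive Pr w).
Local Notation sL2 := (sL2 Pr w).

(** The squared distance of the two sides expands into inner products of integrals, which the
    isometry turns into those of the integrands, where the relation holds. The three intervals may
    differ, so linearity and additivity over intervals come from one statement. *)
Lemma ito_comb al a1 b1 f1 I1 a2 b2 f2 I2 a3 b3 f3 I3 : 0 <= a1 -> 0 <= a2 -> 0 <= a3 ->
  is_ito a1 b1 f1 I1 -> is_ito a2 b2 f2 I2 -> is_ito a3 b3 f3 I3 ->
  scut Pr a1 b1 f1 -> scut Pr a2 b2 f2 -> scut Pr a3 b3 f3 ->
  {ae M, forall z, cut a3 b3 f3 z = al * cut a1 b1 f1 z + cut a2 b2 f2 z} ->
  {ae Pr, forall x, I3 x = al * I1 x + I2 x}.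
Proof.
move=> a10 a20 a30 h1 h2 h3 s1 s2 s3 E.
have [[m1 m2] m3] := (sqint_meas s1, sqint_meas s2, sqint_meas s3).
have [[S1 S2] S3] := (ito_sqint hw a10 m1 h1, ito_sqint hw a20 m2 h2, ito_sqint hw a30 m3 h3).
have SZ : sqint Pr (fun x => al * I1 x + I2 x) by apply: sqintD => //; exact: sqintZ.
apply: (sqd_eq0 S3 SZ).
have sZ : sqint M (fun z => al * cut a1 b1 f1 z + cut a2 b2 f2 z).
  by apply: sqintD => //; exact: sqintZ.
transitivity (sqd M (cut a3 b3 f3) (fun z => al * cut a1 b1 f1 z + cut a2 b2 f2 z)).
  have S1' := sqintZ al S1; have s1' := sqintZ al s1.
  rewrite !sqdE// !ipDr// !ipDl// !ipZr// !ipZl//.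
  rewrite (ito_isometry hw a30 a30 m3 m3 h3 h3) (ito_isometry hw a30 a10 m3 m1 h3 h1).
  rewrite (ito_isometry hw a30 a20 m3 m2 h3 h2) (ito_isometry hw a10 a10 m1 m1 h1 h1).
  rewrite (ito_isometry hw a10 a20 m1 m2 h1 h2) (ito_isometry hw a20 a10 m2 m1 h2 h1).
  by rewrite (ito_isometry hw a20 a20 m2 m2 h2 h2).
have E1 : {ae M, forall z, cut a3 b3 f3 z = cut a3 b3 f3 z} by exact: aeW.
have E2 : {ae M, forall z, al * cut a1 b1 f1 z + cut a2 b2 f2 z = cut a3 b3 f3 z}.
  by apply: (ae_mono _ E) => z ->.
by rewrite (sqd_ae s3 m3 sZ m3 E1 E2) sqdxx.
Qed.

Lemma ito_lin a b al f g I J : 0 <= a -> a <= b -> sL2 a b f -> sL2 a b g ->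
  is_ito a b f I -> is_ito a b g J ->
  is_ito a b (fun s x => al * f s x + g s x) (fun x => al * I x + J x).
Proof.
move=> a0 ab [pf sf] [pg sg] hI hJ.
have cE : cut a b (fun s x => al * f s x + g s x) = fun z => al * cut a b f z + cut a b g z.
  by apply/funext => z; rewrite /cut; case: ifP; rewrite ?mulr0 ?addr0.
have sh : scut Pr a b (fun s x => al * f s x + g s x).
  by rewrite /scut cE; apply: sqintD => //; exact: sqintZ.
have ph : prog a b (fun s x => al * f s x + g s x).
  apply: progD => // t tab; apply: measurable_funM; last exact: pf.
  exact: measurable_cst.
have [K [hK _]] := ito_exists hw a0 ab ph sh.
have [[mf mg] mh] := (sqint_meas sf, sqint_meas sg, sqint_meas sh).
have mK := sqint_meas (ito_sqint hw a0 mh hK).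
apply: (ito_ae hw a0 mh mh _ _ _ hK).
- by apply: aeW.
- by apply: measurable_funD; [apply: measurable_funM => //|];
    [exact: sqint_meas (ito_sqint hw a0 mf hI)|exact: sqint_meas (ito_sqint hw a0 mg hJ)].
- apply: (ito_comb a0 a0 a0 hI hJ hK sf sg sh).
  by apply: aeW => z; rewrite cE.
Qed.

Lemma ito_restrict a s b f I J : 0 <= a -> a <= s -> s <= b -> sL2 a b f ->
  is_ito a b f I -> is_ito a s f J -> is_ito s b f (fun x => I x - J x).
Proof.
move=> a0 as_ sb sf hI hJ.
have s0 := le_trans a0 as_.
have [pf1 sf1] := sL2W (lexx a) sb sf; have [pf2 sf2] := sL2W as_ (lexx b) sf.
have [K [hK _]] := ito_exists hw s0 sb pf2 sf2.
have mI := sqint_meas (ito_sqint hw a0 (sqint_meas sf.2) hI).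
have mJ := sqint_meas (ito_sqint hw a0 (sqint_meas sf1) hJ).
(* The two pieces add up to the whole except on the slice at time $s$, which is counted twice. *)
have E : {ae M, forall z, cut a b f z = 1 * cut a s f z + cut s b f z}.
  apply: (ae_mono _ (cut_point_ae Pr s (fun=> fun=> 1))) => z.
  rewrite /cut mul1r; have [zs|sz|->] := ltgtP z.1 s.
  - by rewrite (le_trans (ltW zs) sb)/= addr0.
  - by rewrite (le_trans as_ (ltW sz))/= add0r.
  - by rewrite /= => /eqP; rewrite oner_eq0.
apply: (ito_ae hw s0 (sqint_meas sf2) (sqint_meas sf2) _ _ _ hK); first exact: aeW.
- exact: measurable_funB.
have := ito_comb a0 s0 a0 hJ hK hI sf1 sf2 sf.2 E.
by apply: ae_mono => x ->; rewrite mul1r addrAC subrr add0r.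
Qed.

(** Square integrability of $X_a$ is listed because membership of $X$ in $L^2$ of time times
    $\Omega$ says nothing about one given time; the equation then extends it to every $X_t$. *)
Definition itop a b (X be si : R -> Omega -> R) :=
  [/\ sL2 a b X, sL2 a b be, sL2 a b si, sqint Pr (X a)
    & forall t, a <= t <= b ->
      is_ito a t si (fun x => X t x - X a x - tint a t be x)].

Lemma cut_mul a b (f g : R -> Omega -> R) :
  (fun z => cut a b f z * cut a b g z) = cut a b (fun s x => f s x * g s x).
Proof. by apply/funext => z; rewrite /cut; case: ifP; rewrite ?mulr0. Qed.

Lemma itop_sqint a b X be si t : 0 <= a -> itop a b X be si -> a <= t <= b -> sqint Pr (X t).
Proof.
move=> a0 [_ sb ss sXa h] /andP[at_ tb].
have [sb' ss'] := ((sL2W (lexx a) tb sb).2, (sL2W (lexx a) tb ss).2).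
have := ito_sqint hw a0 (sqint_meas ss') (h t _); rewrite at_ tb => /(_ isT) sI.
have [st _] := tint_sqint at_ sb'.
have := sqintD (sqintD sI st) sXa.
apply: sqint_aeT; last by apply: aeW => x; rewrite !subrK.
have := sqint_meas (sqintD (sqintD sI st) sXa).
by congr (measurable_fun _ _); apply/funext => x; rewrite !subrK.
Qed.

Lemma itop_F a b X be si t : itop a b X be si -> a <= t <= b ->
  measurable_fun [set: F t] (X t : F t -> R).
Proof. by move=> [[pX _] _ _ _ _] tab; exact: (progressive_section tab pX). Qed.

Lemma itop_restrict a s b X be si : 0 <= a -> a <= s -> s <= b ->
  itop a b X be si -> itop s b X be si.
Proof.
move=> a0 as_ sb hX; have sXs := itop_sqint a0 hX; have [sX sbe ssi sXa h] := hX.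
split.
- exact: sL2W sX.
- exact: sL2W sbe.
- exact: sL2W ssi.
- by apply: sXs; rewrite as_.
move=> t /andP[st tb].
have at_ := le_trans as_ st.
have h1 : is_ito a t si (fun x => X t x - X a x - tint a t be x) by apply: h; rewrite at_.
have h2 : is_ito a s si (fun x => X s x - X a x - tint a s be x) by apply: h; rewrite as_.
have hr := ito_restrict a0 as_ st (sL2W (lexx a) tb ssi) h1 h2.
have s0 := le_trans a0 as_.
have ms := sqint_meas (sL2W as_ tb ssi).2.
have sbt := (sL2W (lexx a) tb sbe).2.
apply: (ito_ae hw s0 ms ms _ _ _ hr); first exact: aeW.
- apply: measurable_funB; last exact: tint_measurable (sL2W as_ tb sbe).2.
  apply: measurable_funB; first by apply: sqint_meas; apply: sXs; rewrite at_.
  by apply: sqint_meas; apply: sXs; rewrite as_.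
apply: (ae_mono _ (scut_ae sbt)) => x /integrable_cutE ix.
by rewrite (tint_split as_ st ix); ring.
Qed.

Lemma sL2_lin a b al f g : sL2 a b f -> sL2 a b g -> sL2 a b (fun s x => al * f s x + g s x).
Proof.
move=> [pf sf] [pg sg]; split.
  apply: progD => // t tab; apply: measurable_funM; last exact: pf.
  exact: measurable_cst.
rewrite /scut (_ : cut _ _ _ = fun z => al * cut a b f z + cut a b g z).
  by apply: sqintD => //; exact: sqintZ.
by apply/funext => z; rewrite /cut; case: ifP; rewrite ?mulr0 ?addr0.
Qed.

Lemma sL2_sum a b (I : Type) (r : seq I) (f : I -> R -> Omega -> R) : (forall i, sL2 a b (f i)) ->
  sL2 a b (fun s x => \sum_(i <- r) f i s x).
Proof.
move=> sf; split; first by apply: prog_sum => i; exact: (sf i).1.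
rewrite /scut (_ : cut _ _ _ = fun z => \sum_(i <- r) cut a b (f i) z).
  by apply: sqint_sum => i; exact: (sf i).2.
by apply/funext => z; rewrite /cut; case: ifP => // _; rewrite big1.
Qed.

Lemma tint_lin a t al (f g : R -> Omega -> R) x :
  leb.-integrable `[a, t] (EFin \o (fun s => f s x)) ->
  leb.-integrable `[a, t] (EFin \o (fun s => g s x)) ->
  tint a t (fun s x => al * f s x + g s x) x = al * tint a t f x + tint a t g x.
Proof.
move=> ix iy.
have ix' : leb.-integrable `[a, t] (EFin \o (fun s => al * f s x)).
  by apply: (@integrableZl _ _ _ leb _ (measurable_itv `[a, t]) al _ ix).
by rewrite /tint RintegralD// RintegralZl.
Qed.

Lemma itop_lin a b al X be si Y be' si' : 0 <= a -> itop a b X be si -> itop a b Y be' si' ->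
  itop a b (fun s x => al * X s x + Y s x) (fun s x => al * be s x + be' s x)
    (fun s x => al * si s x + si' s x).
Proof.
move=> a0 hX hY; have sXt := itop_sqint a0 hX; have sYt := itop_sqint a0 hY.
have [sX sbe ssi sXa h] := hX; have [sY sbe' ssi' sYa h'] := hY.
split; try exact: sL2_lin.
- by apply: sqintD => //; exact: sqintZ.
move=> t tab; have /andP[at_ tb] := tab.
have W f := @sL2W _ _ _ Pr w a b a t f (lexx a) tb.
have := ito_lin al a0 at_ (W _ ssi) (W _ ssi') (h t tab) (h' t tab).
have ms := sqint_meas (sL2_lin al (W _ ssi) (W _ ssi')).2.
apply: (ito_ae hw a0 ms ms); first exact: aeW.
- apply: measurable_funB; last exact: tint_measurable (sL2_lin al (W _ sbe) (W _ sbe')).2.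
  have sZ s : a <= s <= b -> sqint Pr (fun x => al * X s x + Y s x).
    by move=> sab; apply: sqintD (sYt s sab); apply: sqintZ; exact: sXt.
  by apply: measurable_funB; apply: sqint_meas; apply: sZ => //; rewrite lexx (le_trans at_ tb).
apply: (ae_mono2 _ (scut_ae (W _ sbe).2) (scut_ae (W _ sbe').2)) => x.
move=> /integrable_cutE ix /integrable_cutE iy.
by rewrite tint_lin//; ring.
Qed.

End ito_processes.

(** * Product formula in expectation *)

Section product_formula.
Context d (Omega : measurableType d) (R : realType).
Variables (Pr : probability Omega R) (w : R -> Omega -> R).
Hypothesis hw : brownian_motion Pr w.
Local Notation leb := (@lebesgue_measure R).
Local Notation M := (leb \x Pr)%E.
Local Notation F := (filtration_type Pr w).
Local Notation is_ito := (is_ito_integral Pr w).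
Local Notation sL2 := (sL2 Pr w).

Local Notation itop := (itop Pr w).

(** Expand both factors at time $b$ into initial value, drift integral and stochastic integral.
    Initial values are orthogonal to stochastic integrals, the two stochastic integrals give the
    bracket term by isometry, the two drift integrals are handled by [ip_tint_tint], and a drift
    integral against a stochastic one by [mart]. *)
Lemma product_formula a b X be si Z ga ta : 0 <= a -> a <= b ->
  itop a b X be si -> itop a b Z ga ta ->
  ip Pr (X b) (Z b) = ip Pr (X a) (Z a) + ip M (cut a b be) (cut a b Z)
    + ip M (cut a b X) (cut a b ga) + ip M (cut a b si) (cut a b ta).
Proof.
move=> a0 ab; have bab : a <= b <= b by rewrite ab lexx.
(* E[(int g ds) J_b] = E int g_s J_s ds because J is a martingale. *)
have mart X' be' si' g : itop a b X' be' si' -> sL2 a b g ->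
    ip Pr (tint a b g) (fun x => X' b x - X' a x - tint a b be' x) =
    ip M (cut a b g) (cut a b (fun s x => X' s x - X' a x - tint a s be' x)).
  move=> hX sg; have [sX sbe ssi sXa h] := hX.
  pose J s x := X' s x - X' a x - tint a s be' x.
  have sJ t : a <= t <= b -> sqint Pr (J t).
    move=> tab; apply: (ito_sqint hw a0 _ (h t tab)).
    by case/andP: tab => _ tb; exact: sqint_meas (sL2W (lexx a) tb ssi).2.
  have sJb : sqint Pr (J b) by apply: sJ; rewrite ab lexx.
  have scJ : scut Pr a b J.
    rewrite /scut (_ : cut a b J = fun z => cut a b X' z - cut a b (fun=> X' a) z - cut a b (fun s x => tint a s be' x) z).
      apply: sqintB; last exact: scut_tint sbe.2.
      by apply: sqintB; [exact: sX.2|exact: sqint_cut_cst].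
    by apply/funext => z; rewrite /cut; case: ifP; rewrite ?subr0.
  have scb := sqint_cut_cst a b sJb.
  change (ip Pr (tint a b g) (J b) = ip M (cut a b g) (cut a b J)).
  rewrite (ip_tint sg.2 sJb).
  apply/eqP; rewrite -subr_eq0 -(ipBr scb scJ sg.2).
  set D := fun z => _; have sD : sqint M D := sqintB scb scJ.
  apply/eqP; rewrite [LHS](Rfubini1 (sqint_mul sg.2 sD)).
  have mgD : measurable_fun setT (fun z => cut a b g z * D z).
    by apply: measurable_funM; [exact: sqint_meas sg.2|exact: sqint_meas sD].
  rewrite -[RHS](Rintegral0 leb setT).
  have iDf := Rfubini1 (sqint_mul sg.2 sD).
  apply: ae_eq_Rintegral; [exact: (measurable_Rintegral_param2 (sqint_mul sg.2 sD))|exact: measurable_cst|].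
  have aes : {ae leb, forall s, Pr.-integrable setT (EFin \o (fun x => cut a b g (s, x) * cut a b g (s, x)))}.
    by apply: (ae_mono _ (ae_integrable1 (sqint_mul sg.2 sg.2))).
  apply: (ae_mono _ aes) => s is_.
  have [/andP[as_ sb]|sab] := boolP (a <= s <= b); last first.
    by rewrite -[RHS](Rintegral0 Pr setT); apply: eq_Rintegral => x _; rewrite /cut/= (negbTE sab) mul0r.
  have sab : a <= s <= b by rewrite as_.
  have s0 := le_trans a0 as_.
  have mgs : measurable_fun [set: F s] (g s : F s -> R) := progressive_section sab sg.1.
  have sgs : sqint Pr (g s).
    apply/sqintP; split; first exact: measurable_F mgs.
    by move: is_; congr (integrable _ _ _); apply/funext => x; rewrite /cut/= sab.
  have h2 := ito_restrict hw a0 as_ sb ssi (h b bab) (h s sab).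
  rewrite -(ito_mean hw s0 (sqint_meas (sL2W as_ (lexx b) ssi).2) h2 mgs sgs).
  by apply: eq_Rintegral => x _; rewrite /D /cut/= sab.
move=> hX hZ.
have [sX sbe ssi sXa h] := hX; have [sZ sga sta sZa h'] := hZ.
pose I x := X b x - X a x - tint a b be x; pose J x := Z b x - Z a x - tint a b ga x.
have hI : is_ito a b si I by exact: h.
have hJ : is_ito a b ta J by exact: h'.
have [ms mt] := (sqint_meas ssi.2, sqint_meas sta.2).
have sI : sqint Pr I := ito_sqint hw a0 ms hI.
have sJ : sqint Pr J := ito_sqint hw a0 mt hJ.
have [sB _] := tint_sqint ab sbe.2; have [sC _] := tint_sqint ab sga.2.
have XE : X b = fun x => X a x + tint a b be x + I x by apply/funext => x; rewrite /I; ring.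
have ZE : Z b = fun x => Z a x + tint a b ga x + J x by apply/funext => x; rewrite /J; ring.
have sXB := sqintD sXa sB; have sZC := sqintD sZa sC.
rewrite XE ZE ipDr//; last exact: sqintD.
rewrite !(ipDl _ sI)// !(ipDl sXa)// !(ipDr sZa)//.
have aab : a <= a <= b by rewrite lexx.
rewrite (ito_mean hw a0 mt hJ (itop_F hX aab) sXa).
rewrite (ipC Pr I (Z a)) (ito_mean hw a0 ms hI (itop_F hZ aab) sZa).
rewrite (ito_isometry hw a0 a0 ms mt hI hJ) (mart _ _ _ _ hZ sbe).
rewrite (ipC Pr I) (mart _ _ _ _ hX sga) (ipC Pr (X a) (tint _ _ _)).
rewrite !(ip_tint sga.2 sXa) (ip_tint sbe.2 sZa) (ip_tint_tint ab sbe.2 sga.2).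
have expand (Y g : R -> Omega -> R) : cut a b (fun s x => Y s x - Y a x - tint a s g x) =
    fun z => cut a b Y z - cut a b (fun=> Y a) z - cut a b (fun s x => tint a s g x) z.
  by apply/funext => z; rewrite /cut; case: ifP; rewrite ?subr0.
have [scX scZ] := (sqint_cut_cst a b sXa, sqint_cut_cst a b sZa).
have [stb stg] := (scut_tint ab sbe.2, scut_tint ab sga.2).
have [[[sX2 sZ2] sbe2] sga2] := ( sX.2, sZ.2, sbe.2, sga.2).
rewrite !expand (ipBr (sqintB sZ2 scZ) stg sbe2) (ipBr sZ2 scZ sbe2).
rewrite (ipBr (sqintB sX2 scX) stb sga2) (ipBr sX2 scX sga2).
by rewrite (ipC M (cut a b X) (cut a b ga)); ring.
Qed.

End product_formula.

(** * Ito processes with prescribed coefficients *)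

Section sde_step.
Context d (Omega : measurableType d) (R : realType).
Variables (Pr : probability Omega R) (w : R -> Omega -> R).
Hypothesis hw : brownian_motion Pr w.
Local Notation leb := (@lebesgue_measure R).
Local Notation M := (leb \x Pr)%E.
Local Notation F := (filtration_type Pr w).
Local Notation is_ito := (is_ito_integral Pr w).
Local Notation prog := (progressive Pr w).
Local Notation sL2 := (sL2 Pr w).
Local Notation itop := (itop Pr w).

Definition cutd (a b : R) (f : R -> R) : measurableTypeR R -> R :=
  fun s => \1_(`[a, b]%classic) s * f s.

Definition dL2 a b f := sqint leb (cutd a b f).

Lemma cutd_in a b f s : a <= s <= b -> cutd a b f s = f s.
Proof. by move=> sab; rewrite /cutd indicE mem_set ?mul1r//= in_itv. Qed.

Lemma cutd_out a b f s : ~~ (a <= s <= b) -> cutd a b f s = 0.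
Proof. by move=> sab; rewrite /cutd indicE memNset ?mul0r//= in_itv/=; exact/negP. Qed.

Lemma prog_det a b f : measurable_fun setT (cutd a b f) -> prog a b (fun s _ => f s).
Proof.
move=> mf t /andP[at_ tb].
apply: (@eq_measurable_fun _ _ _ _ _ (fun z : measurableTypeR R * F t => cutd a b f z.1)).
  by move=> z; rewrite inE/= in_itv/= => -[/andP[h1 h2] _]; rewrite cutd_in// h1 (le_trans h2).
by apply: measurable_funTS; apply: (measurableT_comp mf).
Qed.

Lemma progM a b f g : prog a b f -> prog a b g -> prog a b (fun s x => f s x * g s x).
Proof. by move=> pf pg t tab; apply: measurable_funM; [exact: pf|exact: pg]. Qed.

(** By Tonelli the squared norm is $\int f^2\,EX_s^2\,ds$. So an unbounded [f] in $L^2(dt)$ may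
    multiply a process bounded in mean square uniformly in time, which is the situation of the
    feedback gain. *)
Lemma scut_mul_det a b f (X : R -> Omega -> R) C : dL2 a b f ->
  mcut a b (fun s x => f s * X s x) ->
  (forall s, a <= s <= b -> sqint Pr (X s)) ->
  (forall s, a <= s <= b -> ip Pr (X s) (X s) <= C) ->
  scut Pr a b (fun s x => f s * X s x) /\
  ip M (cut a b (fun s x => f s * X s x)) (cut a b (fun s x => f s * X s x)) =
  \int[leb]_s (cutd a b f s ^+ 2 * ip Pr (X s) (X s)).
Proof.
move=> sf mfX sX hC.
have E s : (\int[Pr]_x (cut a b (fun s x => (f s * X s x)%R) (s, x) ^+ 2)%:E =
    (cutd a b f s ^+ 2 * ip Pr (X s) (X s))%:E)%E.
  have [sab|sab] := boolP (a <= s <= b); last first.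
    rewrite (eq_integral (cst 0%E)) => [|x _].
      by rewrite integral0 cutd_out// expr0n mul0r.
    by rewrite /cut/= (negbTE sab) expr0n.
  rewrite EFinM (ip_sqE (sX s sab)) cutd_in// -ge0_integralZl//.
  - by apply: eq_integral => x _; rewrite /cut/= sab exprMn EFinM.
  - by apply/measurable_EFinP; apply: measurable_funX; exact: sqint_meas (sX s sab).
  - by move=> x _; rewrite lee_fin sqr_ge0.
  - by rewrite lee_fin sqr_ge0.
have ft : (\int[M]_z (cut a b (fun s x => f s * X s x)%R z ^+ 2)%:E =
    \int[leb]_s (cutd a b f s ^+ 2 * ip Pr (X s) (X s))%:E)%E.
  rewrite fubini_tonelli1//=; last 2 first.
  - by apply/measurable_EFinP; exact: measurable_funX.
  - by move=> z; rewrite lee_fin sqr_ge0.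
  by apply: eq_integral => s _; rewrite -E.
have s1 : scut Pr a b (fun s x => f s * X s x).
  split=> //; rewrite ft.
  apply: (@le_lt_trans _ _ (\int[leb]_s (`|C|%:E * (cutd a b f s ^+ 2)%:E))%E).
    apply: ge0_le_integral => //.
    - by move=> s _; rewrite lee_fin mulr_ge0 ?sqr_ge0 ?ip_ge0.
    - rewrite (_ : (fun s => _) = fun s => \int[Pr]_x (cut a b (fun s x => f s * X s x)%R (s, x) ^+ 2)%:E)%E; last first.
        by apply/funext => s; rewrite E.
      apply: (@measurable_fun_fubini_tonelli_F _ _ _ _ _ Pr (fun z => (cut a b (fun s x => f s * X s x) z ^+ 2)%:E)).
      + by apply/measurable_EFinP; exact: measurable_funX.
      + by move=> z; rewrite lee_fin sqr_ge0.
    - apply: emeasurable_funM => //; apply/measurable_EFinP; apply: measurable_funX; exact: sqint_meas sf.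
    - move=> s _; have [sab|sab] := boolP (a <= s <= b); last first.
        by rewrite cutd_out// expr0n/= mul0r mule0.
      rewrite -EFinM lee_fin mulrC ler_wpM2r ?sqr_ge0//.
      exact: le_trans (hC s sab) (ler_norm _).
  rewrite ge0_integralZl//.
  - by apply: lte_mul_pinfty => //; exact: sf.2.
  - by apply/measurable_EFinP; apply: measurable_funX; exact: sqint_meas sf.
  - by move=> s _; rewrite lee_fin sqr_ge0.
by split=> //; apply: EFin_inj; rewrite (ip_sqE s1) ft /Rintegral fineK// -ft -(ip_sqE s1).
Qed.

Lemma indicc_dL2 a b c : dL2 a b (fun=> c).
Proof.
rewrite /dL2 (_ : cutd a b (fun=> c) = fun s => c * \1_(`[a, b]%classic) s); last first.
  by apply/funext => s; rewrite /cutd mulrC.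
exact/sqintZ/indicc_sqint.
Qed.

Lemma scut_bounded a b (X : R -> Omega -> R) C : mcut a b X ->
  (forall s, a <= s <= b -> sqint Pr (X s)) ->
  (forall s, a <= s <= b -> ip Pr (X s) (X s) <= C) -> scut Pr a b X.
Proof.
move=> mX sX hC; have E : X = fun s x => 1 * X s x.
  by apply/funext => s; apply/funext => x; rewrite mul1r.
rewrite E; apply: (scut_mul_det (indicc_dL2 a b 1) _ sX hC).1.
by rewrite -E.
Qed.

Lemma ip_cut_le a b a' b' (f : R -> Omega -> R) : a <= a' -> b' <= b -> scut Pr a b f ->
  ip M (cut a' b' f) (cut a' b' f) <= ip M (cut a b f) (cut a b f).
Proof.
move=> aa bb sf; have sf' := scutW aa bb sf.
apply: le_Rintegral => //; [exact: (sqint_mul sf' sf')|exact: (sqint_mul sf sf)|].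
move=> z _; rewrite (cut_cut f z aa bb) indicE; case: (_ \in _); rewrite ?mulr1 ?mulr0//.
by rewrite -expr2 sqr_ge0.
Qed.

(** The isometry evaluates the stochastic part exactly, and Cauchy-Schwarz in time puts the factor
    $t-s$ on the drift. *)
Lemma increment_bound s t be si I : 0 <= s -> s <= t -> sL2 s t be -> sL2 s t si ->
  is_ito s t si I ->
  let D := fun x => tint s t be x + I x in
  sqint Pr D /\ ip Pr D D <= 2 * ((t - s) * ip M (cut s t be) (cut s t be))
    + 2 * ip M (cut s t si) (cut s t si).
Proof.
move=> s0 st [pb sb] [ps ss] hI D.
have sI := ito_sqint hw s0 (sqint_meas ss) hI.
have [sB hB] := tint_sqint st sb.
split; first exact: sqintD.
apply: (le_trans (ip_sub_sq_le sB sI)).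
rewrite (ito_isometry hw s0 s0 (sqint_meas ss) (sqint_meas ss) hI hI) lerD2r.
by rewrite ler_pM2l.
Qed.

(** Absolute continuity of the integral on the slabs $[s,t]\times\Omega$, whose measure is $t-s$. *)
Lemma ip_cut_uniformly_continuous a b (f : R -> Omega -> R) e : scut Pr a b f -> 0 < e ->
  exists2 dl, 0 < dl & forall s t, a <= s -> s <= t -> t <= b -> t - s < dl ->
    ip M (cut s t f) (cut s t f) <= e.
Proof.
move=> sf e0.
have [dl [dl0 h]] := integral_normr_continuous (sqint_mul sf sf) e0.
exists dl => // s t as_ st tb std.
pose A : set (measurableTypeR R * Omega) := `[s, t]%classic `*` setT.
have mI : measurable (`[s, t]%classic : set (measurableTypeR R)) by exact: measurable_itv.
have mA : measurable A by exact: measurableX.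
have MA : (M A = (t - s)%:E)%E.
  transitivity (leb `[s, t]%classic * Pr setT)%E; first exact: (product_measure1E leb Pr mI measurableT).
  by rewrite (leb_itv st) probability_setT mule1.
have hA : (M A < dl%:E)%E by rewrite MA lte_fin.
have := h A mA hA => /ltW; apply: le_trans.
rewrite le_eqVlt; apply/orP; left; apply/eqP.
rewrite [RHS]Rintegral_mkcond; apply: eq_Rintegral => z _; rewrite patchE.
rewrite /cut; case: ifPn => h1; case: ifPn => h2.
- move: h1 => /andP[h3 h4]; rewrite (le_trans as_ h3) (le_trans h4 tb)/=.
  by rewrite -expr2 ger0_norm ?sqr_ge0.
- by exfalso; move/negP: h2; apply; rewrite mem_set//; split => //=; rewrite in_itv.
- by exfalso; move/negP: h1; apply; move: h2; rewrite inE => -[/=]; rewrite in_itv.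
- by rewrite mulr0.
Qed.

Lemma tint_point a (be : R -> Omega -> R) x : tint a a be x = 0.
Proof. by rewrite /tint set_itv1 Rintegral_set1. Qed.

(** For each $t$ a stochastic integral is picked separately, so the choices at different times are
    not jointly measurable; mean-square continuity and [progressive_version] repair this. *)
Lemma sde_step a b (xi : Omega -> R) be si : 0 <= a -> a < b ->
  measurable_fun [set: F a] (xi : F a -> R) -> sqint Pr xi -> sL2 a b be -> sL2 a b si ->
  exists X, itop a b X be si /\ {ae Pr, forall x, X a x = xi x}.
Proof.
move=> a0 ab mxi sxi sbe ssi.
have W f t := @sL2W _ _ _ Pr w a b a t f (lexx a).
have b0 := le_trans a0 (ltW ab).
have /choice[I hI] : forall t, exists I, a <= t <= b ->
    is_ito a t si I /\ measurable_fun [set: F t] (I : F t -> R).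
  move=> t; have [/andP[at_ tb]|tab] := boolP (a <= t <= b); last by exists (fun=> 0).
  have [ps ss] := W si t tb ssi.
  by have [J hJ] := ito_exists hw a0 at_ ps ss; exists J.
have sI t : a <= t <= b -> sqint Pr (I t).
  move=> tab; have /andP[_ tb] := tab.
  exact: (ito_sqint hw a0 (sqint_meas (W si t tb ssi).2) (hI t tab).1).
pose Y t x := xi x + (tint a t be x + I t x).
have sB t : a <= t <= b -> sqint Pr (tint a t be).
  by move=> /andP[at_ tb]; exact: (tint_sqint at_ (W be t tb sbe).2).1.
have sY t : a <= t <= b -> sqint Pr (Y t).
  by move=> tab; apply: sqintD => //; apply: sqintD; [exact: sB|exact: sI].
have mY t : a <= t <= b -> measurable_fun [set: F t] (Y t : F t -> R).
  move=> tab; have /andP[at_ tb] := tab.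
  apply: measurable_funD; first exact: measurable_F_le mxi.
  apply: measurable_funD; last exact: (hI t tab).2.
  exact: (tint_F (W be t tb sbe).1 at_).
have inc s t : a <= s -> s <= t -> t <= b ->
    sqd Pr (Y t) (Y s) <= 2 * ((t - s) * ip M (cut s t be) (cut s t be))
      + 2 * ip M (cut s t si) (cut s t si).
  move=> as_ st tb; have s0 := le_trans a0 as_.
  have tab : a <= t <= b by rewrite (le_trans as_ st).
  have sab : a <= s <= b by rewrite as_ (le_trans st tb).
  have hr := ito_restrict hw a0 as_ st (W si t tb ssi) (hI t tab).1 (hI s sab).1.
  have [sD hD] := increment_bound s0 st (sL2W as_ tb sbe) (sL2W as_ tb ssi) hr.
  move: hD; congr (_ <= _); apply/esym.
  have mYY : measurable_fun setT (fun x => Y t x - Y s x).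
    by apply: measurable_funB; apply: sqint_meas; exact: sY.
  have E : {ae Pr, forall x, Y t x - Y s x = tint s t be x + (I t x - I s x)}.
    apply: (ae_mono _ (scut_ae (W be t tb sbe).2)) => x /integrable_cutE ix.
    by rewrite /Y (tint_split as_ st ix); ring.
  apply: (ae_ip mYY (sqint_meas sD) mYY (sqint_meas sD)).
  by apply: (ae_mono _ E) => x ->.
have modulus e : 0 < e -> exists2 dl, 0 < dl & forall s t, a <= s -> s <= t -> t <= b ->
    t - s < dl -> sqd Pr (Y t) (Y s) <= e.
  move=> e0.
  pose B := ip M (cut a b be) (cut a b be).
  have B0 : 0 <= B := ip_ge0 M (cut a b be).
  have e40 : 0 < e / 4 by rewrite divr_gt0.
  have [d1 d10 hd1] := ip_cut_uniformly_continuous ssi.2 e40.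
  (* The first entry bounds the stochastic part by $e/4$, the second one the drift part; the factors
     2 in [inc] then add up to $e$. The summand 1 keeps the denominator positive. *)
  exists (Num.min d1 (e / (4 * (B + 1)))); first by rewrite lt_min d10 divr_gt0// mulr_gt0// ltr_wpDl.
  move=> s t as_ st tb; rewrite lt_min => /andP[h1 h2].
  apply: (le_trans (inc s t as_ st tb)).
  have h3 := hd1 s t as_ st tb h1.
  have h4 := ip_cut_le as_ tb sbe.2; rewrite -/B in h4.
  have h5 : (t - s) * ip M (cut s t be) (cut s t be) <= e / (4 * (B + 1)) * (B + 1).
    by apply: ler_pM; rewrite ?subr_ge0 ?ip_ge0 ?(ltW h2)// (le_trans h4)// lerDl.
  move: h5; rewrite (_ : e / (4 * (B + 1)) * (B + 1) = e / 4); first by lra.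
  by field; rewrite gt_eqF// ltr_wpDl.
have [Z [pZ hZ]] := progressive_version a0 ab mY sY modulus.
have aab : a <= a <= b by rewrite lexx ltW.
have sZ t : a <= t <= b -> sqint Pr (Z t).
  move=> tab; apply: (sqint_aeT _ (hZ t tab) (sY t tab)).
  by apply: (measurable_F hw _ (progressive_section tab pZ)); case/andP: tab => /(le_trans a0).
have Ia : {ae Pr, forall x, I a x = 0}.
  apply: ip_eq0_ae; first exact: sI.
  have ss := sqint_meas (W si a (ltW ab) ssi).2.
  rewrite (ito_isometry hw a0 a0 ss ss (hI a aab).1 (hI a aab).1).
  rewrite -(ip0l M (cut a a si)); apply: ae_ip => //.
  by apply: (ae_mono _ (cut_point_ae Pr a si)) => z ->; rewrite !mul0r.
have Za : {ae Pr, forall x, Z a x = xi x}.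
  by apply: (ae_mono2 _ (hZ a aab) Ia) => x <-; rewrite /Y tint_point => ->; rewrite !addr0.
exists Z; split=> //; split => //.
- split=> //; pose C := 2 * ip Pr xi xi + 2 * (2 * ((b - a) * ip M (cut a b be) (cut a b be))
      + 2 * ip M (cut a b si) (cut a b si)).
  apply: (@scut_bounded _ _ _ C); [exact: (measurable_cut hw b0 pZ)|exact: sZ|].
  move=> t tab; have /andP[at_ tb] := tab.
  have -> : ip Pr (Z t) (Z t) = ip Pr (Y t) (Y t).
    apply: ae_ip; try by [exact: sqint_meas (sZ t tab)|exact: sqint_meas (sY t tab)].
    by apply: (ae_mono _ (hZ t tab)) => x ->.
  have [sD hD] := increment_bound a0 at_ (W be t tb sbe) (W si t tb ssi) (hI t tab).1.
  apply: (le_trans (ip_sub_sq_le sxi sD)).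
  rewrite /C lerD2l ler_pM2l//; apply: (le_trans hD); apply: lerD; rewrite ler_pM2l//.
    by apply: ler_pM; rewrite ?subr_ge0 ?ip_ge0 ?lerD2r// ip_cut_le//; exact: sbe.2.
  by rewrite ip_cut_le//; exact: ssi.2.
- exact: sZ.
move=> t tab; have /andP[at_ tb] := tab.
have ms := sqint_meas (W si t tb ssi).2.
apply: (ito_ae hw a0 ms ms _ _ _ (hI t tab).1); first exact: aeW.
- apply: measurable_funB; last exact: sqint_meas (sB t tab).
  by apply: measurable_funB; apply: sqint_meas; exact: sZ.
by apply: (ae_mono2 _ (hZ t tab) Za) => x <- ->; rewrite /Y; ring.
Qed.

End sde_step.

Section ito_processes_more.
Context d (Omega : measurableType d) (R : realType).
Variables (Pr : probability Omega R) (w : R -> Omega -> R).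
Hypothesis hw : brownian_motion Pr w.
Local Notation leb := (@lebesgue_measure R).
Local Notation M := (leb \x Pr)%E.
Local Notation prog := (progressive Pr w).
Local Notation sL2 := (sL2 Pr w).
Local Notation itop := (itop Pr w).

Lemma cut_ae_of_sections a b (f g : R -> Omega -> R) : mcut a b f -> mcut a b g ->
  (forall s, a <= s <= b -> {ae Pr, forall x, f s x = g s x}) ->
  {ae M, forall z, cut a b f z = cut a b g z}.
Proof.
move=> mf mg h.
pose A := [set z | cut a b f z - cut a b g z != 0].
have mA : measurable A.
  have := (measurable_funB mf mg) measurableT [set~ 0] (measurableC (measurable_set1 0)).
  rewrite setTI; congr measurable; apply/seteqP; split=> z /=; first by move/eqP.
  by move=> ?; apply/eqP.
exists A; split=> //; last by move=> z /= hz; apply/eqP => /eqP; rewrite subr_eq0 => /eqP.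
rewrite /product_measure1/= integral0_eq// => s _ /=.
have [sab|sab] := boolP (a <= s <= b); last first.
  rewrite (_ : xsection A s = set0) ?measure0//.
  apply/seteqP; split=> x //; rewrite /xsection/= inE /A /cut/= (negbTE sab) subrr eqxx//.
have [N [mN N0 hN]] := h s sab.
apply: (@subset_measure0 _ _ _ Pr _ N) => //.
- exact: measurable_xsection.
- by move=> x; rewrite /xsection/= inE /A /cut/= sab => hx; apply: hN => /= e; move: hx; rewrite e subrr eqxx.
Qed.

Lemma itop_bound a b X be si : 0 <= a -> a <= b -> itop a b X be si ->
  exists C, forall t, a <= t <= b -> ip Pr (X t) (X t) <= C.
Proof.
move=> a0 ab hX; have [sX sbe ssi sXa h] := hX.
exists (2 * ip Pr (X a) (X a) + 2 * (2 * ((b - a) * ip M (cut a b be) (cut a b be))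
      + 2 * ip M (cut a b si) (cut a b si))) => t tab; have /andP[at_ tb] := tab.
have [sD hD] := increment_bound hw a0 at_ (sL2W (lexx a) tb sbe) (sL2W (lexx a) tb ssi) (h t tab).
set D := fun x => _ in sD hD.
have -> : X t = fun x => X a x + D x by apply/funext => x; rewrite /D; ring.
apply: (le_trans (ip_sub_sq_le sXa sD)).
rewrite lerD2l ler_pM2l//; apply: (le_trans hD); apply: lerD; rewrite ler_pM2l//.
  by apply: ler_pM; rewrite ?subr_ge0 ?ip_ge0 ?lerD2r// ip_cut_le//; exact: sbe.2.
by rewrite ip_cut_le//; exact: ssi.2.
Qed.

(** Used for the fixed point of the Picard map, whose coefficients are first obtained at a process
    that is only almost surely equal to the solution. *)
Lemma itop_ae a b X be si X' be' si' : 0 <= a -> a <= b -> itop a b X be si ->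
  prog a b X' -> sL2 a b be' -> sL2 a b si' ->
  (forall t, a <= t <= b -> {ae Pr, forall x, X t x = X' t x}) ->
  {ae M, forall z, cut a b be z = cut a b be' z} ->
  {ae M, forall z, cut a b si z = cut a b si' z} ->
  itop a b X' be' si'.
Proof.
move=> a0 ab hX pX' sbe' ssi' hXX hb hs; have sXt := itop_sqint hw a0 hX.
have b0 := le_trans a0 ab; have aab : a <= a <= b by rewrite lexx.
have [sX sbe ssi sXa h] := hX.
have sXt' t : a <= t <= b -> sqint Pr (X' t).
  move=> tab; apply: (sqint_aeT _ (hXX t tab) (sXt t tab)).
  by apply: (measurable_F hw _ (progressive_section tab pX')); case/andP: tab => /(le_trans a0).
have sX' : sL2 a b X'.
  split; first exact: pX'.
  have mX' := measurable_cut hw b0 pX'.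
  apply: (sqint_aeT mX' _ sX.2).
  by apply: cut_ae_of_sections; [exact: sqint_meas sX.2|exact: mX'|exact: hXX].
split; [exact: sX'|exact: sbe'|exact: ssi'|exact: (sXt' _ aab)|].
move=> t tab; have /andP[at_ tb] := tab.
have W f := @sL2W _ _ _ Pr w a b a t f (lexx a) tb.
have C f f' : {ae M, forall z, cut a b f z = cut a b f' z} -> {ae M, forall z, cut a t f z = cut a t f' z}.
  by apply: ae_mono => z e; rewrite !(cut_cut _ z (lexx a) tb) e.
apply: (ito_ae hw a0 (sqint_meas (W _ ssi).2) (sqint_meas (W _ ssi').2) (C _ _ hs) _ _ (h t tab)).
  apply: measurable_funB; last exact: (tint_measurable (W _ sbe').2).
  by apply: measurable_funB; apply: sqint_meas; exact: sXt'.
have hb' : {ae Pr, forall x, tint a t be x = tint a t be' x}.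
  have st := (tint_sqint at_ (W _ sbe).2).1; have st' := (tint_sqint at_ (W _ sbe').2).1.
  have cbb : sqd M (cut a t be) (cut a t be') = 0.
    rewrite (sqd_ae (W _ sbe).2 (sqint_meas (W _ sbe').2) (W _ sbe').2 (sqint_meas (W _ sbe').2) (C _ _ hb)).
      exact: sqdxx.
    exact: aeW.
  have sdiff : scut Pr a t (fun s x => be s x - be' s x).
    by rewrite /scut (_ : cut _ _ _ = fun z => cut a t be z - cut a t be' z);
      [exact: sqintB (W _ sbe).2 (W _ sbe').2|
       apply/funext => z; rewrite /cut; case: ifP; rewrite ?subr0].
  have [sd hd] := tint_sqint at_ sdiff.
  have : {ae Pr, forall x, tint a t (fun s x => be s x - be' s x) x = 0}.
    apply: ip_eq0_ae => //; apply/eqP; rewrite eq_le ip_ge0 andbT.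
    apply: (le_trans hd); rewrite (_ : ip M _ _ = 0) ?mulr0//.
    rewrite -cbb; apply: eq_ip => z.
    by rewrite /cut; case: ifP; rewrite ?subr0.
  move=> hz; have hz2 := ae_mono2 (fun x p q => conj p q) (scut_ae (W _ sbe).2) (scut_ae (W _ sbe').2).
  apply: (ae_mono2 _ hz hz2) => x e [/integrable_cutE i1 /integrable_cutE i2].
  apply/eqP; rewrite -subr_eq0 -e; apply/eqP.
  rewrite (_ : (fun s x => be s x - be' s x) = fun s x => -1 * be' s x + be s x); last first.
    by apply/funext => s; apply/funext => y; ring.
  by rewrite (tint_lin (-1) i2 i1); ring.
have hXX2 := ae_mono2 (fun x p q => conj p q) (hXX t tab) (hXX a aab).
by apply: (ae_mono2 _ hXX2 hb') => x [-> ->] ->.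
Qed.

End ito_processes_more.

(** * Classes of deterministic functions of time *)

Section deterministic_coefficients.
Context (R : realType).
Local Notation leb := (@lebesgue_measure R).
Implicit Types (a b : R) (f g : R -> R).

Lemma cutd_cutd (a b a' b' : R) f s : a <= a' -> b' <= b ->
  cutd a' b' f s = cutd a b f s * \1_(`[a', b']%classic) s.
Proof.
move=> aa bb; have [h|h] := boolP (a' <= s <= b').
  rewrite !cutd_in//; last by case/andP: h => h1 h2; rewrite (le_trans aa h1) (le_trans h2 bb).
  by rewrite indicE mem_set ?mulr1//= in_itv.
by rewrite cutd_out// indicE memNset ?mulr0//= in_itv/=; exact/negP.
Qed.

Lemma dL2W (a b a' b' : R) f : a <= a' -> b' <= b -> dL2 a b f -> dL2 a' b' f.
Proof.
move=> aa bb sf.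
have E : cutd a' b' f = fun s => cutd a b f s * \1_(`[a', b']%classic) s.
  by apply/funext => s; exact: cutd_cutd.
apply: (sqint_le _ sf); last first.
  move=> s; rewrite E normrM indicE.
  by case: (_ \in _); rewrite ?normr1 ?normr0 ?mulr1 ?mulr0.
rewrite E; apply: measurable_funM; first exact: sqint_meas sf.
exact: measurable_indic.
Qed.

Lemma dL2_integrable a b f : dL2 a b f -> leb.-integrable `[a, b] (EFin \o f).
Proof.
move=> sf; have := sqint_mul sf (indicc_sqint a b).
move=> h; apply/(@integrable_mkcond _ _ R leb `[a, b]%classic _ (measurable_itv _)).
move: h; apply: eq_integrable => // s _ /=.
rewrite patchE; have [sab|sab] := boolP (a <= s <= b).
  by rewrite cutd_in// indicE !mem_set ?mulr1//= in_itv.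
by rewrite cutd_out// mul0r memNset//= in_itv/=; exact/negP.
Qed.

Lemma Rintegral_cutd a b f : \int[leb]_(s in `[a, b]) f s = \int[leb]_s cutd a b f s.
Proof. by rewrite Rintegral_indic_itv; apply: eq_Rintegral => s _; rewrite /cutd mulrC. Qed.

Lemma measurable_cutd a b f : measurable_fun `[a, b]%classic f -> measurable_fun setT (cutd a b f).
Proof.
move=> mf; rewrite (_ : cutd a b f = f \_ `[a, b]).
  by apply/(measurable_restrictT _ (measurable_itv _)).
apply/funext => t; rewrite patchE /cutd indicE; case: ifPn => _; rewrite ?mul1r ?mul0r//.
Qed.

Definition dbd a b f := measurable_fun setT (cutd a b f) /\
  exists C, forall t, a <= t <= b -> `|f t| <= C.

(** Measurability comes from the kernel $1_{r\le s}$, the bound from $|f(a)|+\int|f'|$. *)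
Lemma primitive_dbd (a b : R) (f f' : R -> R) : leb.-integrable `[a, b] (EFin \o f') ->
  (forall t, a <= t <= b -> f t = f a + \int[leb]_(s in `[a, t]) f' s) -> dbd a b f.
Proof.
move=> if' hf.
have mf' : measurable_fun setT (cutd a b f').
  by apply: measurable_cutd; apply/measurable_EFinP; exact: measurable_int if'.
split.
  pose h (z : measurableTypeR R * measurableTypeR R) : R := cutd a b f' z.1 * (if z.1 <= z.2 then 1 else 0).
  have mh : measurable_fun setT h.
    apply: measurable_funM; first by apply: (measurableT_comp mf').
    by apply: measurable_fun_ifT => //; apply: measurable_fun_ler.
  have mk := measurable_Rintegral_param leb mh.
  rewrite (_ : cutd a b f = fun s => \1_(`[a, b]%classic) s * (f a + \int[leb]_r h (r, s))).
    by apply: measurable_funM; [exact: measurable_indic|apply: measurable_funD].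
  apply/funext => s; rewrite /cutd; have [sab|sab] := boolP (a <= s <= b); last first.
    by rewrite indicc_out// !mul0r.
  rewrite indicc_in// !mul1r (hf s sab) Rintegral_cutd; congr (_ + _); apply: eq_Rintegral => r _.
  have /andP[_ sb] := sab; rewrite /h/= (cutd_cutd _ _ (lexx a) sb).
  have [/andP[h1 h2]|h1] := boolP (a <= r <= s); first by rewrite indicc_in ?h1// h2.
  rewrite indicc_out// mulr0; case: ifPn => h2; rewrite ?mulr0//.
  by rewrite cutd_out ?mul0r//; apply: contra h1 => /andP[-> _].
have iabs : leb.-integrable `[a, b] (EFin \o (fun s => `|f' s|)).
  exact: integrable_abse if'.
exists (`|f a| + \int[leb]_(s in `[a, b]) `|f' s|) => t tab; have /andP[at_ tb] := tab.
rewrite (hf t tab); apply: (le_trans (ler_normD _ _)); rewrite lerD2l.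
apply: (le_trans (@le_normr_Rintegral _ _ _ leb _ _ (measurable_itv _) (integrable_itvW (lexx a) tb if'))).
rewrite !Rintegral_indic_itv; apply: le_Rintegral => //.
- exact/integrable_indic_mul/(integrable_itvW (lexx a) tb iabs).
- exact: integrable_indic_mul.
move=> r _; apply: ler_wpM2l => //.
have [h|h] := boolP (a <= r <= t); last by rewrite (indicc_out h) indicE.
by rewrite !indicc_in//; case/andP: h => -> /le_trans ->.
Qed.

(** Absolutely continuous with derivative in $L^2$: the regularity of the entries of $P$, whose
    derivative contains the gain. *)
Definition acf a b f f' := dL2 a b f' /\
  forall t, a <= t <= b -> f t = f a + \int[leb]_(s in `[a, t]) f' s.

Lemma acf_dbd a b f f' : acf a b f f' -> dbd a b f.
Proof. by move=> [sf' hf]; exact: primitive_dbd (dL2_integrable sf') hf. Qed.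

Lemma cutdD a b f g : cutd a b (fun t => f t + g t) = fun t => cutd a b f t + cutd a b g t.
Proof. by apply/funext => t; rewrite /cutd mulrDr. Qed.

Lemma cutdM a b f g : cutd a b (fun t => f t * g t) = fun t => cutd a b f t * cutd a b g t.
Proof.
apply/funext => t; have [h|h] := boolP (a <= t <= b); first by rewrite !cutd_in.
by rewrite !cutd_out// mul0r.
Qed.

Lemma cutd_sum a b (I : Type) (r : seq I) (f : I -> R -> R) :
  cutd a b (fun t => \sum_(i <- r) f i t) = fun t => \sum_(i <- r) cutd a b (f i) t.
Proof. by apply/funext => t; rewrite /cutd mulr_sumr. Qed.

Lemma dbdD a b f g : dbd a b f -> dbd a b g -> dbd a b (fun t => f t + g t).
Proof.
move=> [mf [C hC]] [mg [C' hC']]; split; first by rewrite cutdD; exact: measurable_funD.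
by exists (C + C') => t h; apply: (le_trans (ler_normD _ _)); rewrite lerD ?hC ?hC'.
Qed.

Lemma dbdM a b f g : dbd a b f -> dbd a b g -> dbd a b (fun t => f t * g t).
Proof.
move=> [mf [C hC]] [mg [C' hC']]; split; first by rewrite cutdM; exact: measurable_funM.
by exists (C * C') => t h; rewrite normrM ler_pM ?hC ?hC'.
Qed.

Lemma dbd_cst a b c : dbd a b (fun=> c).
Proof. by split; [exact: sqint_meas (indicc_dL2 a b c)|exists `|c|]. Qed.

Lemma dbd_sum a b (I : Type) (r : seq I) (f : I -> R -> R) : (forall i, dbd a b (f i)) ->
  dbd a b (fun t => \sum_(i <- r) f i t).
Proof.
move=> hf; elim: r => [|i r ih].
  by rewrite (_ : (fun t => _) = fun=> 0); [exact: dbd_cst|apply/funext => t; rewrite big_nil].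
rewrite (_ : (fun t => _) = fun t => f i t + \sum_(j <- r) f j t); first exact: dbdD.
by apply/funext => t; rewrite big_cons.
Qed.

Lemma dL2D a b f g : dL2 a b f -> dL2 a b g -> dL2 a b (fun t => f t + g t).
Proof. by move=> sf sg; rewrite /dL2 cutdD; exact: sqintD. Qed.

Lemma dL2_sum a b (I : Type) (r : seq I) (f : I -> R -> R) : (forall i, dL2 a b (f i)) ->
  dL2 a b (fun t => \sum_(i <- r) f i t).
Proof. by move=> hf; rewrite /dL2 cutd_sum; exact: sqint_sum. Qed.

Lemma dL2M a b f g : dbd a b f -> dL2 a b g -> dL2 a b (fun t => f t * g t).
Proof.
move=> [mf [C hC]] sg; rewrite /dL2 cutdM.
apply: (sqint_le _ (sqintZ C sg)); first by apply: measurable_funM => //; exact: sqint_meas sg.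
move=> t; have [h|h] := boolP (a <= t <= b); last by rewrite !cutd_out// !mulr0.
by rewrite !cutd_in// !normrM ler_wpM2r// (le_trans (hC t h) (ler_norm _)).
Qed.

Lemma dbd_dL2 a b f : dbd a b f -> dL2 a b f.
Proof.
move=> hf; have := dL2M hf (indicc_dL2 a b 1); congr dL2.
by apply/funext => t; rewrite mulr1.
Qed.

Lemma dbdW a b a' b' f : a <= a' -> b' <= b -> dbd a b f -> dbd a' b' f.
Proof.
move=> aa bb [mf [C hC]]; split; last first.
  by exists C => t /andP[h1 h2]; apply: hC; rewrite (le_trans aa h1) (le_trans h2 bb).
rewrite (_ : cutd a' b' f = fun s => cutd a b f s * \1_(`[a', b']%classic) s).
  by apply: measurable_funM => //; exact: measurable_indic.
by apply/funext => s; exact: cutd_cutd.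
Qed.

Definition mdbd a b k l (L : R -> 'M[R]_(k, l)) := forall i j, dbd a b (fun t => L t i j).
Definition mdL2 a b k l (L : R -> 'M[R]_(k, l)) := forall i j, dL2 a b (fun t => L t i j).

Lemma mdbdT a b k l (L : R -> 'M[R]_(k, l)) : mdbd a b L -> mdbd a b (fun t => (L t)^T).
Proof.
move=> h i j; rewrite (_ : (fun t => _) = fun t => L t j i); first exact: h.
by apply/funext => t; rewrite mxE.
Qed.

Lemma mdL2T a b k l (L : R -> 'M[R]_(k, l)) : mdL2 a b L -> mdL2 a b (fun t => (L t)^T).
Proof.
move=> h i j; rewrite (_ : (fun t => _) = fun t => L t j i); first exact: h.
by apply/funext => t; rewrite mxE.
Qed.

Lemma mdbdD a b k l (L L' : R -> 'M[R]_(k, l)) : mdbd a b L -> mdbd a b L' ->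
  mdbd a b (fun t => L t + L' t).
Proof.
move=> h h' i j; rewrite (_ : (fun t => _) = fun t => L t i j + L' t i j); first exact: dbdD.
by apply/funext => t; rewrite mxE.
Qed.

Lemma mdL2D a b k l (L L' : R -> 'M[R]_(k, l)) : mdL2 a b L -> mdL2 a b L' ->
  mdL2 a b (fun t => L t + L' t).
Proof.
move=> h h' i j; rewrite (_ : (fun t => _) = fun t => L t i j + L' t i j); first exact: dL2D.
by apply/funext => t; rewrite mxE.
Qed.

Lemma mdL2N a b k l (L : R -> 'M[R]_(k, l)) : mdL2 a b L -> mdL2 a b (fun t => - L t).
Proof.
move=> h i j; rewrite (_ : (fun t => _) = fun t => -1 * L t i j).
  exact: dL2M (dbd_cst a b (-1)) (h i j).
by apply/funext => t; rewrite mxE mulN1r.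
Qed.

Lemma mdbdM a b k l m (L : R -> 'M[R]_(k, l)) (L' : R -> 'M[R]_(l, m)) : mdbd a b L -> mdbd a b L' ->
  mdbd a b (fun t => L t *m L' t).
Proof.
move=> h h' i j; rewrite (_ : (fun t => _) = fun t => \sum_r L t i r * L' t r j).
  by apply: dbd_sum => r; exact: dbdM.
by apply/funext => t; rewrite mxE.
Qed.

Lemma mdL2M a b k l m (L : R -> 'M[R]_(k, l)) (L' : R -> 'M[R]_(l, m)) : mdbd a b L -> mdL2 a b L' ->
  mdL2 a b (fun t => L t *m L' t).
Proof.
move=> h h' i j; rewrite (_ : (fun t => _) = fun t => \sum_r L t i r * L' t r j).
  by apply: dL2_sum => r; exact: dL2M.
by apply/funext => t; rewrite mxE.
Qed.

Lemma mdbd_mdL2 a b k l (L : R -> 'M[R]_(k, l)) : mdbd a b L -> mdL2 a b L.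
Proof. by move=> h i j; exact: dbd_dL2. Qed.

Lemma mdbdW a b a' b' k l (L : R -> 'M[R]_(k, l)) : a <= a' -> b' <= b -> mdbd a b L -> mdbd a' b' L.
Proof. by move=> aa bb h i j; exact: dbdW (h i j). Qed.

Lemma mdL2W a b a' b' k l (L : R -> 'M[R]_(k, l)) : a <= a' -> b' <= b -> mdL2 a b L -> mdL2 a' b' L.
Proof. by move=> aa bb h i j; exact: dL2W (h i j). Qed.

Lemma bounded_measurable_mdbd a b k l (L : R -> 'M[R]_(k, l)) :
  bounded_measurable a b L -> mdbd a b L.
Proof. by move=> h i j; have [mf C] := h i j; split; [exact: measurable_cutd|]. Qed.

End deterministic_coefficients.

(** * Processes bounded in mean square *)

Section sup_bounded_processes.
Context d (Omega : measurableType d) (R : realType).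
Variables (Pr : probability Omega R) (w : R -> Omega -> R).
Hypothesis hw : brownian_motion Pr w.
Local Notation leb := (@lebesgue_measure R).
Local Notation M := (leb \x Pr)%E.
Local Notation prog := (progressive Pr w).
Local Notation sL2 := (sL2 Pr w).
Local Notation itop := (itop Pr w).

(** The space on which the Picard map acts: a bound on $EX_t^2$ uniform in time is what coefficients
    in $L^2(dt)$ can multiply. *)
Definition sB a b (X : R -> Omega -> R) := prog a b X /\
  exists C, forall t, a <= t <= b -> sqint Pr (X t) /\ ip Pr (X t) (X t) <= C.

Lemma itop_sB a b X be si : 0 <= a -> a <= b -> itop a b X be si -> sB a b X.
Proof.
move=> a0 ab hX; have [C hC] := itop_bound hw a0 ab hX.
have [[pX _] _ _ _ _] := hX; split=> //; exists C => t tab; split; last exact: hC.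
exact: (itop_sqint hw a0 hX).
Qed.

Lemma sB_scut_mul a b f X : 0 <= a -> a <= b -> dL2 a b f -> sB a b X ->
  scut Pr a b (fun s x => f s * X s x) /\
  ip M (cut a b (fun s x => f s * X s x)) (cut a b (fun s x => f s * X s x)) =
  \int[leb]_s (cutd a b f s ^+ 2 * ip Pr (X s) (X s)).
Proof.
move=> a0 ab sf [pX [C hC]]; apply: (@scut_mul_det _ _ _ _ _ _ _ _ C) => //; last first.
- by move=> s /hC[].
- by move=> s /hC[].
apply: (measurable_cut hw (le_trans a0 ab)); apply: progM => //; apply: prog_det; exact: sqint_meas sf.
Qed.

Lemma sB_sL2_mul a b f X : 0 <= a -> a <= b -> dL2 a b f -> sB a b X ->
  sL2 a b (fun s x => f s * X s x).
Proof.
move=> a0 ab sf hX; split; last exact: (sB_scut_mul a0 ab sf hX).1.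
by apply: progM; [apply: prog_det; exact: sqint_meas sf|exact: hX.1].
Qed.

Lemma sBW a b a' b' X : a <= a' -> b' <= b -> sB a b X -> sB a' b' X.
Proof.
move=> aa bb [pX [C hC]]; split; first exact: progressiveW pX.
by exists C => t /andP[h1 h2]; apply: hC; rewrite (le_trans aa h1) (le_trans h2 bb).
Qed.

Lemma sB_lin a b al X Y : sB a b X -> sB a b Y -> sB a b (fun s x => al * X s x + Y s x).
Proof.
move=> [pX [C hC]] [pY [C' hC']]; split.
  apply: progD => // t tab; apply: measurable_funM; last exact: pX.
  exact: measurable_cst.
exists (2 * (al ^+ 2 * C) + 2 * C') => t tab.
have [sX hX] := hC t tab; have [sY hY] := hC' t tab.
split; first by apply: sqintD => //; exact: sqintZ.
apply: (le_trans (ip_sub_sq_le (sqintZ al sX) sY)).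
rewrite (ipZl _ sX (sqintZ al sX)) (ipZr _ sX sX) [al * (_ * _)]mulrA -expr2.
by apply: lerD; rewrite ler_pM2l// ler_wpM2l// sqr_ge0.
Qed.

Lemma ip_mul_det_le a b f X p : 0 <= a -> a <= b -> dL2 a b f -> sB a b X ->
  (forall s, a <= s <= b -> ip Pr (X s) (X s) <= p s) ->
  leb.-integrable setT (EFin \o (fun s => cutd a b f s ^+ 2 * p s)) ->
  ip M (cut a b (fun s x => f s * X s x)) (cut a b (fun s x => f s * X s x)) <=
  \int[leb]_s (cutd a b f s ^+ 2 * p s).
Proof.
move=> a0 ab sf hX hp ip_; have [sfX E] := sB_scut_mul a0 ab sf hX; rewrite E.
apply: le_Rintegral => //.
  have := Rfubini1_integrable (sqint_mul sfX sfX); apply: eq_integrable => // s _ /=; congr EFin.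
  have [sab|sab] := boolP (a <= s <= b); last first.
    rewrite cutd_out// expr0n mul0r -[RHS](Rintegral0 Pr setT); apply: eq_Rintegral => x _.
    by rewrite /cut/= (negbTE sab) mul0r.
  have [_ [C hC]] := hX; have [sX _] := hC s sab.
  rewrite cutd_in// /ip -(RintegralZl _ measurableT (sqint_mul sX sX)).
  by apply: eq_Rintegral => x _; rewrite /cut/= sab; ring.
move=> s _; have [sab|sab] := boolP (a <= s <= b); last by rewrite cutd_out// expr0n !mul0r.
by rewrite ler_wpM2l ?sqr_ge0// hp.
Qed.

End sup_bounded_processes.

(** * Multiplying an Ito process by a deterministic function *)

Section deterministic_multiplication.
Context d (Omega : measurableType d) (R : realType).
Variables (Pr : probability Omega R) (w : R -> Omega -> R).
Hypothesis hw : brownian_motion Pr w.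
Local Notation leb := (@lebesgue_measure R).
Local Notation M := (leb \x Pr)%E.
Local Notation sL2 := (sL2 Pr w).
Local Notation itop := (itop Pr w).

Lemma sL2_mul_dbd a b f X : dbd a b f -> sL2 a b X -> sL2 a b (fun s x => f s * X s x).
Proof.
move=> [mf [C hC]] [ps ss].
split; first by apply: progM => //; exact: prog_det.
apply: (sqint_le _ (sqintZ C ss)).
  rewrite (_ : cut _ _ _ = fun z => cutd a b f z.1 * cut a b X z).
    apply: measurable_funM; last exact: sqint_meas ss.
    exact: (measurableT_comp mf measurable_fst).
  apply/funext => z; rewrite /cut; case: ifPn => h; first by rewrite cutd_in.
  by rewrite mulr0.
move=> z; rewrite /cut; case: ifPn => h; last by rewrite mulr0.
by rewrite !normrM ler_wpM2r// (le_trans (hC _ h) (ler_norm _)).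
Qed.

Lemma sL2_mul_acf a b f f' si : acf a b f f' -> sL2 a b si -> sL2 a b (fun s x => f s * si s x).
Proof. by move=> /acf_dbd; exact: sL2_mul_dbd. Qed.

Lemma sL2_mul_dL2 a b f X be si : 0 <= a -> a <= b -> dL2 a b f -> itop a b X be si ->
  sL2 a b (fun s x => f s * X s x).
Proof. by move=> a0 ab sf hX; exact: (sB_sL2_mul hw a0 ab sf (itop_sB hw a0 ab hX)). Qed.

(** Integration by parts of $f$ against $s\mapsto\langle1_{[a,s]}\sigma,\varphi\rangle$, which is
    the primitive of the section integral [g]. *)
Lemma acf_by_parts (a b t : R) f f' si phi : acf a b f f' -> a <= t <= b -> sL2 a b si -> sqint M phi ->
  f t * ip M (cut a t si) phi - \int[leb]_s (cutd a t f' s * ip M (cut a s si) phi) =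
  ip M (cut a t (fun s x => f s * si s x)) phi.
Proof.
move=> hf tab ssi sphi; have /andP[at_ tb] := tab; have [sf' fE] := hf.
have st := (sL2W (lexx a) tb ssi).2.
have [mbf [C hC]] := acf_dbd hf.
have sft := (sL2W (lexx a) tb (sL2_mul_acf hf ssi)).2.
pose k z := cut a t si z * phi z.
have ik : M.-integrable setT (EFin \o k) by exact: (sqint_mul st sphi).
pose g s := \int[Pr]_x k (s, x).
have mg : measurable_fun setT g by exact: measurable_Rintegral_param2 ik.
have ig : leb.-integrable setT (EFin \o g) by exact: Rfubini1_integrable.
have W s : a <= s <= t -> ip M (cut a s si) phi = \int[leb]_(r in `[a, s]) g r.
  move=> /andP[as_ st_].
  rewrite [LHS](Rfubini1 (sqint_mul (scutW (lexx a) st_ st) sphi)) Rintegral_indic_itv.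
  apply: eq_Rintegral => r _; have [h|h] := boolP (a <= r <= s).
    rewrite indicc_in// mulr1; apply: eq_Rintegral => x _.
    by rewrite /k (cut_cut _ _ (lexx a) st_) indicc_in// mulr1.
  rewrite indicc_out// mulr0 -[RHS](Rintegral0 Pr setT); apply: eq_Rintegral => x _.
  by rewrite (cut_cut _ _ (lexx a) st_) indicc_out// mulr0 mul0r.
have if' := dL2_integrable (dL2W (lexx a) tb sf').
have ig' : leb.-integrable `[a, t] (EFin \o g).
  by apply: (integrableS _ _ _ ig) => //; exact: measurable_itv.
have tri := triangular_fubini if' ig'.
have E1 : \int[leb]_(s in `[a, t]) (f' s * \int[leb]_(r in `[a, s]) g r) =
    \int[leb]_s (cutd a t f' s * ip M (cut a s si) phi).
  rewrite Rintegral_cutd; apply: eq_Rintegral => s _.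
  have [sat|sat] := boolP (a <= s <= t); last by rewrite !cutd_out// mul0r.
  by rewrite !cutd_in// W.
have mcf : measurable_fun setT (cutd a t f).
  rewrite (_ : cutd a t f = fun s => cutd a b f s * \1_(`[a, t]%classic) s).
    by apply: measurable_funM; [exact: mbf|exact: measurable_indic].
  by apply/funext => s; exact: cutd_cutd.
have E2 : ip M (cut a t (fun s x => f s * si s x)) phi = \int[leb]_(s in `[a, t]) (g s * f s).
  rewrite [LHS](Rfubini1 (sqint_mul sft sphi)) Rintegral_cutd.
  apply: ae_eq_Rintegral.
  - exact: measurable_Rintegral_param2 (sqint_mul sft sphi).
  - rewrite (_ : cutd a t _ = fun s => g s * cutd a t f s); first exact: measurable_funM.
    by apply/funext => s; rewrite /cutd mulrCA.
  apply: (ae_mono _ (ae_integrable1 ik)) => s iks.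
  have [sat|sat] := boolP (a <= s <= t); last first.
    rewrite cutd_out// -[RHS](Rintegral0 Pr setT); apply: eq_Rintegral => x _.
    by rewrite /cut/= (negbTE sat) mul0r.
  rewrite cutd_in// mulrC /g -RintegralZl//; apply: eq_Rintegral => x _.
  by rewrite /k /cut/= sat mulrA.
have iga : leb.-integrable `[a, t] (EFin \o (fun s => f a * g s)).
  exact: (@integrableZl _ _ _ leb _ (measurable_itv `[a, t]) (f a) _ ig').
have iCg : leb.-integrable `[a, t] (EFin \o (fun s => C * g s)).
  exact: (@integrableZl _ _ _ leb _ (measurable_itv `[a, t]) C _ ig').
have igf0 : leb.-integrable `[a, t] (EFin \o (fun s => g s * cutd a t f s)).
  apply: (@le_integrable _ _ _ leb _ (measurable_itv `[a, t]) _ _ _ _ iCg).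
    by apply/measurable_EFinP; apply: measurable_funTS; exact: measurable_funM.
  move=> s; rewrite /= in_itv/= => sat; rewrite lee_fin cutd_in// mulrC !normrM ler_wpM2r//.
  by apply: (le_trans (hC s _) (ler_norm _)); case/andP: sat => -> /le_trans ->.
have igf : leb.-integrable `[a, t] (EFin \o (fun s => g s * \int[leb]_(r in `[a, s]) f' r)).
  have := @integrableB _ _ _ leb _ (measurable_itv `[a, t]) _ _ igf0 iga.
  apply: eq_integrable; first exact: measurable_itv.
  move=> s; rewrite inE/= in_itv/= => sat; rewrite cutd_in// (fE s) -?EFinB.
    by congr EFin; ring.
  by case/andP: sat => -> /le_trans ->.
have E3 : \int[leb]_(s in `[a, t]) (g s * f s) = f a * \int[leb]_(s in `[a, t]) g s +
   \int[leb]_(s in `[a, t]) (g s * \int[leb]_(r in `[a, s]) f' r).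
  rewrite -RintegralZl// -RintegralD//.
  apply: eq_Rintegral => s; rewrite inE/= in_itv/= => /andP[as_ st_].
  by rewrite (fE s) ?as_ ?(le_trans st_ tb)//; ring.
rewrite E2 E3 -E1 W ?at_ ?lexx// (fE t tab).
by rewrite mulrDl tri; ring.
Qed.

End deterministic_multiplication.

Section deterministic_multiplication_ito.
Context d (Omega : measurableType d) (R : realType).
Variables (Pr : probability Omega R) (w : R -> Omega -> R).
Hypothesis hw : brownian_motion Pr w.
Local Notation leb := (@lebesgue_measure R).
Local Notation M := (leb \x Pr)%E.
Local Notation F := (filtration_type Pr w).
Local Notation is_ito := (is_ito_integral Pr w).
Local Notation prog := (progressive Pr w).
Local Notation sL2 := (sL2 Pr w).
Local Notation itop := (itop Pr w).

Lemma itop_martingale a b X be si : 0 <= a -> a <= b -> itop a b X be si ->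
  itop a b (fun s x => X s x - X a x - tint a s be x) (fun=> fun=> 0) si.
Proof.
move=> a0 ab hX; have sXt := itop_sqint hw a0 hX; have [sX sbe ssi sXa h] := hX.
have aab : a <= a <= b by rewrite lexx.
have pA : prog a b (fun=> X a).
  move=> t /andP[at_ _]; apply: (@measurable_comp _ _ _ _ _ _ setT (X a : F t -> R)) => //.
    exact: (measurable_F_le at_ (itop_F hX aab)).
  exact: measurable_funTS.
have sA : sL2 a b (fun=> X a) by split; [exact: pA|exact: sqint_cut_cst].
have sB : sL2 a b (fun s x => tint a s be x).
  split; last exact: scut_tint sbe.2.
  by apply/progressiveP => t tab; apply: measurable_cut_tint; move/progressiveP: sbe.1; exact.
have s0 : sL2 a b (fun=> fun=> 0).
  by have := sL2_lin (-1) sA sA; congr sL2; apply/funext => s; apply/funext => x; ring.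
have Aa x : tint a a be x = 0 by exact: tint_point.
have sI : sL2 a b (fun s x => X s x - X a x - tint a s be x).
  have := sL2_lin (-1) sB (sL2_lin (-1) sA sX).
  by congr sL2; apply/funext => s; apply/funext => x; ring.
split; [exact: sI|exact: s0|exact: ssi| |].
  by apply: sqintB; [exact: sqintB|exact: (tint_sqint (lexx a) (sL2W (lexx a) ab sbe).2).1].
move=> t tab; have := h t tab; congr (is_ito a t si); apply/funext => x.
rewrite Aa (_ : tint a t (fun=> fun=> 0) x = 0); first ring.
by rewrite /tint Rintegral0.
Qed.

(** The candidate for $\int f\sigma\,dw$ is $D=f_tI_t-\int f'I\,ds$, with $I$ the stochastic part of
    $X$. Its inner product with a variable whose products with all $I_s$ have the form
    $\langle1_{[a,s]}\sigma,\varphi\rangle$ is computed by [acf_by_parts]; this covers the true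
    integral [N] and [D] itself. The drift is treated path by path with [triangular_fubini]. *)
Lemma itop_mul_det a b f f' X be si : 0 <= a -> a <= b -> acf a b f f' -> itop a b X be si ->
  itop a b (fun s x => f s * X s x) (fun s x => f' s * X s x + f s * be s x)
    (fun s x => f s * si s x).
Proof.
move=> a0 ab hf hX; have sXt := itop_sqint hw a0 hX; have [sX sbe ssi sXa h] := hX.
have [sf' fE] := hf; have b0 := le_trans a0 ab.
have hI := itop_martingale a0 ab hX.
set I := fun s x => _ in hI; have sIt := itop_sqint hw a0 hI; have [sI _ _ _ _] := hI.
have sfX := sL2_mul_dL2 hw a0 ab sf' hX.
have sfI := sL2_mul_dL2 hw a0 ab sf' hI.
have sfsi := sL2_mul_acf hf ssi; have sfbe := sL2_mul_acf hf sbe.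
have sdr : sL2 a b (fun s x => f' s * X s x + f s * be s x).
  have := sL2_lin 1 sfX sfbe; rewrite (_ : (fun s x => 1 * _ + _) = fun s x => f' s * X s x + f s * be s x)//.
  by apply/funext => s; apply/funext => x; rewrite mul1r.
split; [exact: (sL2_mul_acf hf sX)|exact: sdr|exact: sfsi|exact: sqintZ|].
move=> t tab; have /andP[at_ tb] := tab.
have W g := @sL2W _ _ _ Pr w a b a t g (lexx a) tb.
have [N [hN _]] := ito_exists hw a0 at_ (W _ sfsi).1 (W _ sfsi).2.
have ms := sqint_meas (W _ sfsi).2; have sN := ito_sqint hw a0 ms hN.
pose C := tint a t (fun s x => f' s * I s x).
have sC : sqint Pr C := (tint_sqint at_ (W _ sfI).2).1.
pose D x := f t * I t x - C x.
have sIt' : sqint Pr (I t) by exact: sIt.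
have sftI : sqint Pr (fun x => f t * I t x) by exact: sqintZ.
have sD : sqint Pr D by exact: sqintB.
have CE xi : sqint Pr xi -> ip Pr C xi = \int[leb]_s (cutd a t f' s * ip Pr (I s) xi).
  move=> sxi; rewrite /C (ip_tint (W _ sfI).2 sxi).
  rewrite [LHS](Rfubini1 (sqint_mul (W _ sfI).2 (sqint_cut_cst a t sxi))).
  apply: eq_Rintegral => s _; have [sat|sat] := boolP (a <= s <= t); last first.
    rewrite cutd_out// mul0r -[RHS](Rintegral0 Pr setT); apply: eq_Rintegral => x _.
    by rewrite /cut/= (negbTE sat) mul0r.
  have sIs : sqint Pr (I s) by apply: sIt; case/andP: sat => -> /le_trans ->.
  rewrite cutd_in// /ip -(RintegralZl _ measurableT (sqint_mul sIs sxi)).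
  by apply: eq_Rintegral => x _; rewrite /cut/= sat mulrA.
have hIs s : a <= s <= b -> is_ito a s si (I s) by move=> sab; exact: h.
have msi s : s <= b -> measurable_fun setT (cut a s si).
  by move=> sb; exact: sqint_meas (sL2W (lexx a) sb ssi).2.
have DE xi phi : sqint Pr xi -> sqint M phi ->
    (forall s, a <= s <= t -> ip Pr (I s) xi = ip M (cut a s si) phi) ->
    ip Pr D xi = ip M (cut a t (fun s x => f s * si s x)) phi.
  move=> sxi sphi hxi; rewrite /D ipBl// ipZl// CE// hxi ?at_ ?lexx//.
  rewrite -(acf_by_parts hf tab ssi sphi); congr (_ - _); apply: eq_Rintegral => s _.
  have [sat|sat] := boolP (a <= s <= t); first by rewrite hxi.
  by rewrite cutd_out// !mul0r.
have sq := (W _ sfsi).2.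
have isoN s : a <= s <= t -> ip Pr (I s) N = ip M (cut a s si) (cut a t (fun s x => f s * si s x)).
  move=> /andP[as_ st]; have sb := le_trans st tb.
  by apply: (ito_isometry hw a0 a0 (msi s sb) ms _ hN); apply: hIs; rewrite as_.
(* D and N have the same inner products with N and with D, hence coincide. *)
have DN := DE N _ sN sq isoN.
have DI s : a <= s <= t -> ip Pr (I s) D = ip M (cut a s si) (cut a t (fun s x => f s * si s x)).
  move=> /andP[as_ st]; have sb := le_trans st tb.
  have sas : a <= s <= b by rewrite as_.
  have ss := (sL2W (lexx a) sb ssi).2.
  rewrite (ipC Pr (I s) D) (ipC M (cut a s si)); apply: (DE _ _ (sIt s sas) ss).
  move=> r /andP[ar rt]; have rb := le_trans rt tb.
  by apply: (ito_isometry hw a0 a0 (msi r rb) (msi s sb)); apply: hIs => //; rewrite ar.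
have DD := DE D _ sD sq DI.
have E : {ae Pr, forall x, D x = N x}.
  apply: (sqd_eq0 sD sN); rewrite sqdE// DN DD (ito_isometry hw a0 a0 ms ms hN hN); ring.
have sXt' : sqint Pr (X t) by exact: sXt.
apply: (ito_ae hw a0 ms ms _ _ _ hN); first exact: aeW.
- apply: measurable_funB; last exact: (tint_measurable (W _ sdr).2).
  exact: (sqint_meas (sqintB (sqintZ (f t) sXt') (sqintZ (f a) sXa))).
have iX := scut_ae (W _ sfX).2; have ifb := scut_ae (W _ sfbe).2.
have ibe := scut_ae (W _ sbe).2; have ifI := scut_ae (W _ sfI).2.
have A1 := ae_mono2 (fun x p q => conj p q) iX ifb.
have A2 := ae_mono2 (fun x p q => conj p q) ibe ifI.
have A3 := ae_mono2 (fun x p q => conj p q) A1 A2.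
apply: (ae_mono2 _ E A3) => x <- [[/integrable_cutE i1 /integrable_cutE i2] [/integrable_cutE i3 /integrable_cutE i4]].
have if' := dL2_integrable (dL2W (lexx a) tb sf').
have tri := triangular_fubini if' i3.
have i5 : leb.-integrable `[a, t] (EFin \o (fun s => f' s * X a x)).
  have := @integrableZr _ _ _ leb _ (measurable_itv `[a, t]) (X a x) _ if'.
  by apply.
have E1 : \int[leb]_(s in `[a, t]) (f' s * \int[leb]_(r in `[a, s]) be r x) =
   tint a t (fun s x => f' s * X s x) x - C x - (\int[leb]_(s in `[a, t]) f' s) * X a x.
  rewrite /tint /C /tint -RintegralZr// -RintegralB// -RintegralB//.
    by apply: eq_Rintegral => s _; rewrite /I /tint; ring.
  exact: (@integrableB _ _ _ leb _ (measurable_itv `[a, t]) _ _ i1 i4).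
have i6 : leb.-integrable `[a, t] (EFin \o (fun s => f a * be s x)).
  exact: (@integrableZl _ _ _ leb _ (measurable_itv `[a, t]) (f a) _ i3).
have E2 : \int[leb]_(s in `[a, t]) (be s x * \int[leb]_(r in `[a, s]) f' r) =
   tint a t (fun s x => f s * be s x) x - f a * tint a t be x.
  rewrite /tint -RintegralZl// -RintegralB//.
  apply: eq_Rintegral => s; rewrite inE/= in_itv/= => /andP[as_ st].
  by rewrite (fE s) ?as_ ?(le_trans st tb)//; ring.
have E3 : tint a t (fun s x => f' s * X s x + f s * be s x) x =
   tint a t (fun s x => f' s * X s x) x + tint a t (fun s x => f s * be s x) x.
  by rewrite /tint RintegralD.
rewrite E3 /D /I; move: tri; rewrite E1 E2 -[\int[leb]_(s in `[a, t]) be s x]/(tint a t be x).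
have := fE t tab; set i0 := \int[leb]_(s in `[a, t]) f' s; move=> ->.
set B := tint a t be x; set T1 := tint a t _ x; set T2 := tint a t _ x; move=> tri.
by move: tri; lra.
Qed.

End deterministic_multiplication_ito.

(** * Linear stochastic differential equations *)

(** Iterating the doubled parallelogram bound costs a factor 2 per summand. *)
Lemma ip_sum_le d (T : measurableType d) (R : realType) (mu : {measure set T -> \bar R})
    (I : Type) (r : seq I) (f : I -> T -> R) : (forall i, sqint mu (f i)) ->
  ip mu (fun x => \sum_(i <- r) f i x) (fun x => \sum_(i <- r) f i x) <=
  2 ^+ size r * \sum_(i <- r) ip mu (f i) (f i).
Proof.
move=> sf; elim: r => [|i r ih].
  rewrite big_nil mulr0; under eq_fun do rewrite big_nil.
  by rewrite ip0l.
rewrite big_cons/=.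
rewrite (_ : (fun x => _) = fun x => f i x + \sum_(j <- r) f j x); last first.
  by apply/funext => x; rewrite big_cons.
have := ip_sub_sq_le (sf i) (sqint_sum r sf).
have h0 := ip_ge0 mu (f i).
have h1 : 1 <= 2 ^+ size r :> R by rewrite exprn_ege1// ler1n.
have h2 : ip mu (f i) (f i) <= 2 ^+ size r * ip mu (f i) (f i) by rewrite ler_peMl.
by move=> h3; rewrite exprS -mulrA mulrDr; apply: (le_trans h3); lra.
Qed.

Section primitive_powers.
Context (R : realType).
Local Notation leb := (@lebesgue_measure R).
Variables (a b : R) (k : R -> R).
Hypothesis ik : leb.-integrable `[a, b] (EFin \o k).
Hypothesis k0 : forall s, 0 <= k s.
Let K t := \int[leb]_(s in `[a, t]) k s.

Lemma primitive_ge0 t : 0 <= K t.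
Proof. by apply: Rintegral_ge0 => s _. Qed.

Lemma primitive_nd s t : s <= t -> t <= b -> K s <= K t.
Proof.
move=> st tb; rewrite /K !Rintegral_indic_itv; apply: le_Rintegral => //.
- exact/integrable_indic_mul/(integrable_itvW (lexx a) (le_trans st tb) ik).
- exact/integrable_indic_mul/(integrable_itvW (lexx a) tb ik).
move=> r _; apply: ler_wpM2l => //.
have [h|h] := boolP (a <= r <= s); last by rewrite (indicc_out h) indicE.
by rewrite !indicc_in//; case/andP: h => -> /le_trans ->.
Qed.

Lemma primitive_measurable : measurable_fun setT (cutd a b K).
Proof.
have [] // := primitive_dbd ik (f := K) => t _; rewrite /K [X in X + _](_ : _ = 0) ?add0r//.
by rewrite set_itv1 Rintegral_set1.
Qed.

(** The rule $(K^{j+1})'=(j+1)kK^j$ for an absolutely continuous $K$, by induction: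
    [triangular_fubini] applied to $K\cdot\int kK^j$ returns $\int kK^{j+1}$ with total weight
    $1+1/(j+1)$. *)
Lemma primitive_pow j t : a <= t <= b ->
  leb.-integrable `[a, t] (EFin \o (fun s => k s * K s ^+ j)) /\
  j.+1%:R * \int[leb]_(s in `[a, t]) (k s * K s ^+ j) = K t ^+ j.+1.
Proof.
move=> tab; have /andP[at_ tb] := tab.
have ikt : leb.-integrable `[a, t] (EFin \o k) := integrable_itvW (lexx a) tb ik.
have I j' t' : a <= t' <= b -> leb.-integrable `[a, t'] (EFin \o (fun s => k s * K s ^+ j')).
  move=> /andP[at' tb'].
  have ikC : leb.-integrable `[a, t'] (EFin \o (fun s => K b ^+ j' * k s)).
    exact: (@integrableZl _ _ _ leb _ (measurable_itv `[a, t']) (K b ^+ j') _ (integrable_itvW (lexx a) tb' ik)).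
  have ikb : leb.-integrable `[a, t'] (EFin \o (fun s => k s * cutd a b K s ^+ j')).
    apply: (@le_integrable _ _ _ leb _ (measurable_itv `[a, t']) _ _ _ _ ikC).
      apply/measurable_EFinP; apply: measurable_funM.
        by apply/measurable_EFinP; exact: measurable_int (integrable_itvW (lexx a) tb' ik).
      by apply: measurable_funTS; apply: measurable_funX; exact: primitive_measurable.
    move=> s; rewrite /= in_itv/= => /andP[h1 h2]; have sb := le_trans h2 tb'.
    rewrite lee_fin cutd_in ?h1// mulrC !normrM ler_wpM2r//.
    by rewrite !ger0_norm ?exprn_ge0 ?primitive_ge0// lerXn2r ?nnegrE ?primitive_ge0// primitive_nd.
  apply: eq_integrable ikb; first exact: measurable_itv.
  move=> s; rewrite inE/= in_itv/= => /andP[h1 h2].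
  by rewrite cutd_in// h1 (le_trans h2).
split; first exact: I.
elim: j t tab at_ tb ikt => [|j ih] t tab at_ tb ikt.
  by rewrite mul1r expr1; apply: eq_Rintegral => s _; rewrite expr0 mulr1.
have tri := triangular_fubini ikt (I j t tab).
rewrite exprS -(ih t tab at_ tb ikt) mulrCA.
rewrite -[K t]/(\int[leb]_(s in `[a, t]) k s) tri mulrDr.
have -> : \int[leb]_(s in `[a, t]) (k s * K s ^+ j * \int[leb]_(r in `[a, s]) k r) =
    \int[leb]_(s in `[a, t]) (k s * K s ^+ j.+1).
  by apply: eq_Rintegral => s _; rewrite exprSr mulrA.
have j0 : j.+1%:R != 0 :> R by rewrite pnatr_eq0.
have -> : \int[leb]_(s in `[a, t]) (k s * \int[leb]_(r in `[a, s]) (k r * K r ^+ j)) =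
    j.+1%:R^-1 * \int[leb]_(s in `[a, t]) (k s * K s ^+ j.+1).
  have Ij := I j.+1 t tab; rewrite -RintegralZl//.
  apply: eq_Rintegral => s; rewrite inE/= in_itv/= => /andP[as_ st].
  have sb := le_trans st tb.
  rewrite -ih ?as_ ?sb//; last exact: integrable_itvW (lexx a) sb ik.
  by rewrite mulrCA; congr (_ * _); rewrite mulKf.
by rewrite mulVKf// -[j.+2%:R]natr1; ring.
Qed.

End primitive_powers.

Lemma ae_forall_fin d (T : measurableType d) (R : realType) (mu : {measure set T -> \bar R})
    (I : finType) (P : I -> T -> Prop) : (forall i, {ae mu, forall x, P i x}) ->
  {ae mu, forall x, forall i, P i x}.
Proof.
move=> h; have h' k : {ae mu, forall x, forall i, enum_rank i = k :> nat -> P i x}.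
  have [[i ik]|no] := pselect (exists i : I, enum_rank i = k :> nat).
    apply: (ae_mono _ (h i)) => x hx j jk; suff -> : j = i by [].
    by apply: enum_rank_inj; apply: val_inj; rewrite /= jk ik.
  by apply: aeW => x i ik; exfalso; apply: no; exists i.
have := ae_foralln h'; apply: ae_mono => x hx i; exact: hx.
Qed.

Lemma exp_coeff_bounded (R : realType) (x : R) : 0 <= x ->
  exists2 B, 0 <= B & forall k, x ^+ k / k`!%:R <= B.
Proof.
move=> x0; have c : cvgn (exp_coeff x) by apply/cvg_ex; exists 0; exact: cvg_exp_coeff.
have /pinfty_ex_gt0[B B0 hB] := cvg_seq_bounded c.
exists B; first exact: ltW.
move=> k; have := hB k I; rewrite /= /exp_coeff/=; apply: le_trans; exact: ler_norm.
Qed.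

Section linear_sde.
Context d (Omega : measurableType d) (R : realType).
Variables (Pr : probability Omega R) (w : R -> Omega -> R).
Hypothesis hw : brownian_motion Pr w.
Local Notation leb := (@lebesgue_measure R).
Local Notation M := (leb \x Pr)%E.
Local Notation F := (filtration_type Pr w).
Local Notation sL2 := (sL2 Pr w).
Local Notation itop := (itop Pr w).
Local Notation sB := (sB Pr w).
Variables (n : nat) (a b : R) (FF GG : R -> 'M[R]_n).
Hypotheses (a0 : 0 <= a) (ab : a < b).
Hypotheses (hF : forall i j, dL2 a b (fun t => FF t i j))
  (hG : forall i j, dL2 a b (fun t => GG t i j)).

Definition affine (L : R -> 'M[R]_n) (c X : 'I_n -> R -> Omega -> R) i s x :=
  \sum_j L s i j * X j s x + c i s x.

(** [h] dominates every entry of both coefficient matrices, and [K], the primitive of its square, is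
    the clock of the Picard iteration. In [cn] the factor $2(b-a)+2$ comes from [increment_bound]
    and $2^nn$ from the sum over $n$ components. *)
Let h s := \sum_i \sum_j (`|FF s i j| + `|GG s i j|).
Let k s := cutd a b h s ^+ 2.
Let K t := \int[leb]_(s in `[a, t]) k s.
Let cn : R := (2 * (b - a) + 2) * (2 ^+ n * n%:R).

Let abs_dL2 f : dL2 a b f -> dL2 a b (fun s => `|f s|).
Proof.
move=> sf; have E : cutd a b (fun s => `|f s|) = fun s => `|cutd a b f s|.
  by apply/funext => s; rewrite /cutd normrM indicE; case: (_ \in _); rewrite ?normr1 ?normr0.
apply: (sqint_le _ sf); last by move=> s; rewrite E normr_id.
by rewrite E; apply: measurableT_comp => //; exact: sqint_meas sf.
Qed.

Let h_dL2 : dL2 a b h.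
Proof.
rewrite /dL2 (_ : cutd a b h = fun s => \sum_i \sum_j
    (cutd a b (fun s => `|FF s i j|) s + cutd a b (fun s => `|GG s i j|) s)).
  by apply: sqint_sum => i; apply: sqint_sum => j; apply: sqintD; exact: abs_dL2.
apply/funext => s; rewrite /cutd /h mulr_sumr; apply: eq_bigr => i _.
by rewrite mulr_sumr; apply: eq_bigr => j _; rewrite mulrDr.
Qed.

Let h_ge s i j : `|FF s i j| <= h s /\ `|GG s i j| <= h s.
Proof.
have : `|FF s i j| + `|GG s i j| <= h s.
  rewrite /h (bigD1 i)//= (bigD1 j)//= -addrA lerDl addr_ge0//.
    by apply: sumr_ge0 => *; exact: addr_ge0.
  by apply: sumr_ge0 => *; apply: sumr_ge0 => *; exact: addr_ge0.
by move=> H; split; apply: le_trans H; rewrite ?lerDl ?lerDr.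
Qed.

Let k0 s : 0 <= k s. Proof. exact: sqr_ge0. Qed.

Let ik : leb.-integrable `[a, b] (EFin \o k).
Proof.
have := sqint_mul h_dL2 h_dL2.
apply: integrableS => //; exact: measurable_itv.
Qed.

(** One Picard step. The matrices of drift and diffusion are treated alike ([key]): every entry is
    replaced by [h], and the bound $p$ on the input becomes $\int kp$ up to the constant [cn]. *)
Lemma picard_estimate Z Y p i t : (forall j, sB a b (Z j)) ->
  itop a b Y (fun s x => \sum_j FF s i j * Z j s x) (fun s x => \sum_j GG s i j * Z j s x) ->
  {ae Pr, forall x, Y a x = 0} ->
  (forall j s, a <= s <= b -> ip Pr (Z j s) (Z j s) <= p s) ->
  leb.-integrable `[a, b] (EFin \o (fun s => k s * p s)) -> a <= t <= b ->
  ip Pr (Y t) (Y t) <= cn * \int[leb]_(s in `[a, t]) (k s * p s).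
Proof.
move=> sZ hY Ya hp ikp tab; have /andP[at_ tb] := tab.
have sYt := itop_sqint hw a0 hY; have [_ sbe ssi _ hI] := hY.
have [sD hD] := increment_bound hw a0 at_ (sL2W (lexx a) tb sbe) (sL2W (lexx a) tb ssi) (hI t tab).
set D := fun x => _ in sD hD.
have YD : ip Pr (Y t) (Y t) = ip Pr D D.
  have [mY mD] := (sqint_meas (sYt t tab), sqint_meas sD).
  apply: (ae_ip mY mD mY mD); apply: (ae_mono _ Ya) => x e.
  by rewrite (_ : D x = Y t x) // /D e; ring.
pose J := \int[leb]_(s in `[a, t]) (k s * p s).
have key (L : R -> 'M[R]_n) : (forall j, dL2 a b (fun s => L s i j)) ->
    (forall s j, `|L s i j| <= h s) ->
    ip M (cut a t (fun s x => \sum_j L s i j * Z j s x)) (cut a t (fun s x => \sum_j L s i j * Z j s x))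
    <= 2 ^+ n * n%:R * J.
  move=> hL Lh.
  have sL j := sB_scut_mul hw a0 at_ (dL2W (lexx a) tb (hL j)) (sBW (lexx a) tb (sZ j)).
  have sh j := sB_scut_mul hw a0 at_ (dL2W (lexx a) tb h_dL2) (sBW (lexx a) tb (sZ j)).
  have -> : cut a t (fun s x => \sum_j L s i j * Z j s x) =
      fun z => \sum_(j <- index_enum 'I_n) cut a t (fun s x => L s i j * Z j s x) z.
    by apply/funext => z; rewrite /cut; case: ifP => // _; rewrite big1.
  apply: (le_trans (ip_sum_le _ _)); first by move=> j; exact: (sL j).1.
  rewrite -[X in 2 ^+ X]/(size (index_enum 'I_n)) [size _](_ : _ = n); last first.
    by rewrite -[RHS]card_ord cardT enumT.
  rewrite -mulrA ler_pM2l ?exprn_gt0// -[X in X%:R * _](card_ord n) mulr_natl -sumr_const.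
  apply: ler_sum => j _.
  apply: (@le_trans _ _ (ip M (cut a t (fun s x => h s * Z j s x)) (cut a t (fun s x => h s * Z j s x)))).
    apply: le_Rintegral => //; [exact: (sqint_mul (sL j).1 (sL j).1)|exact: (sqint_mul (sh j).1 (sh j).1)|].
    move=> z _; rewrite /cut; case: ifP => // _; rewrite -!expr2 -[leLHS]real_normK ?num_real//.
    rewrite -[leRHS]real_normK ?num_real// lerXn2r ?nnegrE// !normrM ler_wpM2r//.
    by apply: (le_trans (Lh _ _)); exact: ler_norm.
  have ikpt := integrable_itvW (lexx a) tb ikp.
  have E s : cutd a t h s ^+ 2 * p s = k s * p s * \1_(`[a, t]%classic) s.
    have [sat|sat] := boolP (a <= s <= t).
      by rewrite cutd_in// indicc_in// mulr1 /k cutd_in//; case/andP: sat => -> /le_trans ->.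
    by rewrite cutd_out// indicc_out// expr0n !(mul0r, mulr0).
  have -> : J = \int[leb]_s (cutd a t h s ^+ 2 * p s).
    by rewrite /J Rintegral_indic_itv; apply: eq_Rintegral => s _; rewrite E.
  apply: (ip_mul_det_le hw a0 at_ (dL2W (lexx a) tb h_dL2) (sBW (lexx a) tb (sZ j))).
    by move=> s /andP[as_ st]; apply: hp; rewrite as_ (le_trans st tb).
  by have := integrable_indic_mul ikpt; apply: eq_integrable => // s _ /=; rewrite E.
rewrite YD; apply: (le_trans hD).
have k1 := key FF (fun j => hF i j) (fun s j => (h_ge s i j).1).
have k2 := key GG (fun j => hG i j) (fun s j => (h_ge s i j).2).
rewrite -/J /cn; set A := 2 ^+ n * n%:R * J in k1 k2 *.
have k3 : (t - a) * ip M (cut a t (fun s x => \sum_j FF s i j * Z j s x)) (cut a t (fun s x => \sum_j FF s i j * Z j s x)) <= (b - a) * A.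
  by apply: ler_pM; rewrite ?subr_ge0 ?ip_ge0 ?lerD2r.
have -> : (2 * (b - a) + 2) * (2 ^+ n * n%:R) * J = 2 * ((b - a) * A) + 2 * A by rewrite /A; ring.
by apply: lerD; rewrite ler_pM2l.
Qed.

Lemma affine_sL2 (L : R -> 'M[R]_n) c X i : (forall i j, dL2 a b (fun t => L t i j)) -> (forall i, sL2 a b (c i)) ->
  (forall j, sB a b (X j)) -> sL2 a b (affine L c X i).
Proof.
move=> hL sc sX; have s1 := sL2_sum (index_enum 'I_n) (fun j => sB_sL2_mul hw a0 (ltW ab) (hL i j) (sX j)).
have := sL2_lin 1 s1 (sc i); congr sL2.
by apply/funext => s; apply/funext => x; rewrite mul1r.
Qed.

Lemma affine_diff (L : R -> 'M[R]_n) (c X Y : 'I_n -> R -> Omega -> R) i : (fun s x => -1 * affine L c X i s x + affine L c Y i s x) =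
  fun s x => \sum_j L s i j * (-1 * X j s x + Y j s x).
Proof.
apply/funext => s; apply/funext => x; rewrite /affine mulN1r opprD addrACA addNr addr0.
rewrite -sumrN -big_split; apply: eq_bigr => j _ /=; ring.
Qed.

Let ikc t c : t <= b -> leb.-integrable `[a, t] (EFin \o (fun s => k s * c)).
Proof.
move=> tb; exact: (@integrableZr _ _ _ leb _ (measurable_itv `[a, t]) c _ (integrable_itvW (lexx a) tb ik)).
Qed.

(** Coefficients in $L^2(dt)$ have no common Lipschitz constant; contraction is obtained in the
    clock [K], within the space [sB]. *)
Theorem linear_sde (bb ss : 'I_n -> R -> Omega -> R) (xi : 'I_n -> Omega -> R) :
  (forall i, sL2 a b (bb i)) -> (forall i, sL2 a b (ss i)) ->
  (forall i, measurable_fun [set: F a] (xi i : F a -> R)) -> (forall i, sqint Pr (xi i)) ->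
  exists X : 'I_n -> R -> Omega -> R, forall i,
    itop a b (X i) (affine FF bb X i) (affine GG ss X i) /\ {ae Pr, forall x, X i a x = xi i x}.
Proof.
move=> hbb hss mxi sxi; have ab' := ltW ab.
(* The Picard map, made total by choice; outside [sB] it returns its argument as a default. *)
have /choice[T hT] : forall X : 'I_n -> R -> Omega -> R, exists Y : 'I_n -> R -> Omega -> R,
    (forall j, sB a b (X j)) -> forall i, itop a b (Y i) (affine FF bb X i) (affine GG ss X i) /\
      {ae Pr, forall x, Y i a x = xi i x}.
  move=> X; have [sX|nX] := pselect (forall j, sB a b (X j)); last by exists X.
  have /choice[Y hY] : forall i, exists Yi, itop a b Yi (affine FF bb X i) (affine GG ss X i) /\
      {ae Pr, forall x, Yi a x = xi i x}.
    by move=> i; apply: (sde_step hw a0 ab (mxi i) (sxi i)); exact: affine_sL2.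
  by exists Y.
have sB0 : sB a b (fun=> fun=> 0).
  split; first by move=> t tab mD; exact: measurable_cst.
  by exists 0 => t _; split; [exact: sqint0|rewrite ip0l].
have hT0 := hT (fun=> fun=> fun=> 0) (fun=> sB0).
(* Starting from the first image of 0 gives all iterates the initial value [xi], so that their
   differences vanish at time $a$. *)
pose U l := iter l.+1 T (fun=> fun=> fun=> 0).
have sU l : forall j, sB a b (U l j).
  elim: l => [|l ih] j; first by have [h1 _] := hT0 j; exact: (itop_sB hw a0 ab' h1).
  by have [h1 _] := hT _ ih j; exact: (itop_sB hw a0 ab' h1).
have hU l i : itop a b (U l.+1 i) (affine FF bb (U l) i) (affine GG ss (U l) i) /\
   {ae Pr, forall x, U l.+1 i a x = xi i x} by exact: (hT _ (sU l)).
have U0a i : {ae Pr, forall x, U 0 i a x = xi i x} by exact: (hT0 i).2.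
have Ua l i : {ae Pr, forall x, U l i a x = xi i x} by case: l => [//|l]; exact: (hU l i).2.
pose De l i s x := -1 * U l i s x + U l.+1 i s x.
have sDe l j : sB a b (De l j) by exact: sB_lin.
have [Kc hKc] : exists Kc, 0 <= Kc /\ forall i t, a <= t <= b -> ip Pr (De 0 i t) (De 0 i t) <= Kc.
  have /choice[C hC] : forall i, exists C, forall t, a <= t <= b -> ip Pr (De 0 i t) (De 0 i t) <= C.
    by move=> i; have [_ [C hC]] := sDe 0%N i; exists C => t /hC[].
  exists (\sum_i `|C i|); split; first exact: sumr_ge0.
  move=> i t tab; apply: (le_trans (hC i t tab)); rewrite (bigD1 i)//=.
  by apply: (le_trans (ler_norm _)); rewrite lerDl sumr_ge0.
have [Kc0 hK] := hKc.
have cn0 : 0 <= cn.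
  by rewrite /cn mulr_ge0// ?mulr_ge0 ?exprn_ge0// addr_ge0// mulr_ge0// subr_ge0.
(* Picard iteration: the increments decay like (cn K)^l / l!. *)
have est l i t : a <= t <= b -> ip Pr (De l i t) (De l i t) <= Kc * (cn ^+ l / l`!%:R) * K t ^+ l.
  elim: l i t => [|l ih] i t tab.
    by rewrite !expr0 fact0 divr1 !mulr1; exact: hK.
  have [P1 P2] := primitive_pow ik k0 l tab.
  have bab : a <= b <= b by rewrite ab' lexx.
  have [Pb _] := primitive_pow ik k0 l bab.
  pose cl := Kc * (cn ^+ l / l`!%:R).
  have E s : k s * (cl * K s ^+ l) = cl * (k s * K s ^+ l) by ring.
  have iE t' : leb.-integrable `[a, t'] (EFin \o (fun s => k s * K s ^+ l)) ->
      leb.-integrable `[a, t'] (EFin \o (fun s => k s * (cl * K s ^+ l))).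
    move=> h1; have := @integrableZl _ _ _ leb _ (measurable_itv `[a, t']) cl _ h1.
    by apply: eq_integrable; [exact: measurable_itv|move=> s _ /=; rewrite E].
  have hi := itop_lin hw (-1) a0 (hU l i).1 (hU l.+1 i).1; rewrite !affine_diff in hi.
  have zi : {ae Pr, forall x, De l.+1 i a x = 0}.
    by apply: (ae_mono2 _ (Ua l.+1 i) (Ua l.+2 i)) => x; rewrite /De => -> ->; ring.
  apply: (le_trans (picard_estimate (sDe l) hi zi (fun j s sab => ih j s sab) (iE b Pb) tab)).
  have -> : \int[leb]_(s in `[a, t]) (k s * (Kc * (cn ^+ l / l`!%:R) * K s ^+ l)) =
      cl * \int[leb]_(s in `[a, t]) (k s * K s ^+ l).
    by rewrite -RintegralZl//; apply: eq_Rintegral => s _; rewrite -E.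
  rewrite le_eqVlt; apply/orP; left; apply/eqP; rewrite -[K t ^+ _]P2 /cl factS natrM exprS.
  have u0 : l.+1%:R != 0 :> R by rewrite pnatr_eq0.
  have v0 : l`!%:R != 0 :> R by rewrite pnatr_eq0 -lt0n fact_gt0.
  move: u0 v0; move: (l.+1%:R : R) (l`!%:R : R) => u v u0 v0.
  by field; rewrite u0 v0.
have Kb0 : 0 <= K b by exact: primitive_ge0.
(* Boundedness of $(8\,c_nK(b))^l/l!$, with $c_n$ for [cn], turns the factorial decay into the rate
   $8^{-l}$ required by [fast_limit]. *)
have [B B0 hB] := exp_coeff_bounded (mulr_ge0 (mulr_ge0 (ler0n R 8) cn0) Kb0).
have fast i t : a <= t <= b -> forall l, sqd Pr (U l.+1 i t) (U l i t) <= Kc * B * 8^-1 ^+ l.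
  move=> tab l; have -> : sqd Pr (U l.+1 i t) (U l i t) = ip Pr (De l i t) (De l i t).
    by apply: eq_ip => x; rewrite /De; ring.
  apply: (le_trans (est l i t tab)); have /andP[at_ tb] := tab.
  apply: (@le_trans _ _ (Kc * (cn ^+ l / l`!%:R) * K b ^+ l)).
    apply: ler_wpM2l; first by rewrite mulr_ge0// divr_ge0 ?exprn_ge0.
    rewrite lerXn2r ?nnegrE//; first exact: primitive_ge0.
    exact: (primitive_nd ik k0 tb).
  rewrite -!mulrA; apply: ler_wpM2l => //.
  have := ler_wpM2r (ltW (eighth_gt0 R l)) (hB l); apply: le_trans.
  have v0 : l`!%:R != 0 :> R by rewrite pnatr_eq0 -lt0n fact_gt0.
  have u0 : 8 ^+ l != 0 :> R by rewrite expf_neq0// pnatr_eq0.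
  rewrite !exprMn exprVn le_eqVlt; apply/orP; left; apply/eqP.
  move: u0 v0; move: (8 ^+ l : R) (l`!%:R : R) => u v u0 v0.
  by field; rewrite u0 v0.
have sUt l i t : a <= t <= b -> sqint Pr (U l i t) by move=> tab; have [_ [C hC]] := sU l i; exact: (hC t tab).1.
pose V i t x := rlim (fun l => U l i t x).
have hV i t : a <= t <= b -> sqint Pr (V i t) /\ forall l, sqd Pr (U l i t) (V i t) <= 4 * (Kc * B) * 8^-1 ^+ l.
  by move=> tab; apply: fast_limit => l; [exact: sUt|exact: fast].
have sV i : sB a b (V i).
  split; first by move=> t tab; apply: measurable_rlim => l; exact: (sU l i).1.
  have [_ [C hC]] := sU 0%N i.
  exists (2 * (4 * (Kc * B)) + 2 * C) => t tab; have [sVt hVt] := hV i t tab; split=> //.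
  have [sUt0 hUt0] := hC t tab.
  rewrite (_ : V i t = fun x => (V i t x - U 0%N i t x) + U 0%N i t x); last first.
    by apply/funext => x; rewrite subrK.
  apply: (le_trans (ip_sub_sq_le (sqintB sVt sUt0) sUt0)); apply: lerD; rewrite ler_pM2l//.
  by have := hVt 0%N; rewrite expr0 mulr1 sqdC.
(* [V] is known only as a mean-square limit at each time. Its image [W] is an Ito process by
   construction, and agrees with [V] almost surely at each time. *)
pose W := T V.
have hW i : itop a b (W i) (affine FF bb V i) (affine GG ss V i) /\
   {ae Pr, forall x, W i a x = xi i x} by exact: (hT _ sV).
have WV i t : a <= t <= b -> {ae Pr, forall x, V i t x = W i t x}.
  move=> tab; have [sVt hVt] := hV i t tab; have sWt := itop_sqint hw a0 (hW i).1 tab.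
  have /andP[at_ tb] := tab.
  apply: (sqd_eq0 sVt sWt); apply/eqP; rewrite eq_le sqd_ge0 andbT.
  apply: (@eighth_small _ _ (2 * (4 * (Kc * B)) + 2 * (cn * (K t * (4 * (Kc * B)))))) => l.
  apply: (le_trans (sqd_triangle sVt (sUt l.+1 i t tab) sWt)).
  set e8 := 8^-1 ^+ l.
  have -> : (2 * (4 * (Kc * B)) + 2 * (cn * (K t * (4 * (Kc * B))))) * e8 =
      2 * (4 * (Kc * B) * e8) + 2 * (cn * (K t * (4 * (Kc * B) * e8))) by ring.
  apply: lerD; rewrite ler_pM2l//.
    rewrite sqdC; apply: (le_trans (hVt l.+1)); apply: ler_wpM2l; first by rewrite !mulr_ge0.
    by rewrite exprS ler_piMl ?exprn_ge0// invf_le1// ler1n.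
  pose Z j s x := -1 * U l j s x + V j s x.
  have sZ j : sB a b (Z j) by exact: sB_lin.
  have hZ j s : a <= s <= b -> ip Pr (Z j s) (Z j s) <= 4 * (Kc * B) * 8^-1 ^+ l.
    move=> sab; have := (hV j s sab).2 l; apply: le_trans.
    by rewrite le_eqVlt; apply/orP; left; apply/eqP; apply: eq_ip => x; rewrite /Z; ring.
  have hi := itop_lin hw (-1) a0 (hU l i).1 (hW i).1; rewrite !affine_diff in hi.
  have zi : {ae Pr, forall x, -1 * U l.+1 i a x + W i a x = 0}.
    by apply: (ae_mono2 _ (Ua l.+1 i) (hW i).2) => x -> ->; ring.
  have := picard_estimate sZ hi zi hZ (ikc _ (lexx b)) tab.
  have ikt := integrable_itvW (lexx a) tb ik.
  rewrite RintegralZr//; apply: le_trans.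
  by rewrite le_eqVlt; apply/orP; left; apply/eqP; apply: eq_ip => x; ring.
exists W => i; split; last exact: (hW i).2.
have sW j : sB a b (W j) by exact: (itop_sB hw a0 ab' (hW j).1).
have [[pW _] _ _ _ _] := (hW i).1.
have aeq (L : R -> 'M[R]_n) c : (forall i j, dL2 a b (fun t => L t i j)) -> (forall i, sL2 a b (c i)) ->
    {ae M, forall z, cut a b (affine L c V i) z = cut a b (affine L c W i) z}.
  move=> hL hc; apply: cut_ae_of_sections.
  - exact: sqint_meas (affine_sL2 i hL hc sV).2.
  - exact: sqint_meas (affine_sL2 i hL hc sW).2.
  move=> s sab; apply: (ae_mono _ (ae_forall_fin (fun j => WV j s sab))) => x e.
  by rewrite /affine; congr (_ + _); apply: eq_bigr => j _; rewrite e.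
apply: (itop_ae hw a0 ab' (hW i).1 pW).
- exact: affine_sL2.
- exact: affine_sL2.
- by move=> t _; exact: aeW.
- exact: aeq.
- exact: aeq.
Qed.

End linear_sde.

(** * Vector-valued Ito processes and their pairings *)

Section vector_processes.
Context d (Omega : measurableType d) (R : realType).
Variables (Pr : probability Omega R) (w : R -> Omega -> R).
Hypothesis hw : brownian_motion Pr w.
Local Notation leb := (@lebesgue_measure R).
Local Notation M := (leb \x Pr)%E.
Local Notation sL2 := (sL2 Pr w).
Local Notation itop := (itop Pr w).

Definition vsL2 a b k (f : R -> Omega -> 'cV[R]_k) := forall i, sL2 a b (fun s x => f s x i 0).

Definition vitop a b k (X be si : R -> Omega -> 'cV[R]_k) := forall i,
  itop a b (fun s x => X s x i 0) (fun s x => be s x i 0) (fun s x => si s x i 0).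

Lemma L2_processP a b k (f : R -> Omega -> 'cV[R]_k) : 0 <= b ->
  L2_process Pr w a b f <-> vsL2 a b f.
Proof.
move=> b0; split=> h i; have [pf sf] := h i; split=> //.
  have mf := measurable_cut hw b0 pf.
  by split=> //; rewrite -(iterated_sqE Pr mf).
by rewrite (iterated_sqE Pr (sqint_meas sf)); exact: sf.2.
Qed.

Lemma vsL2D a b k (f g : R -> Omega -> 'cV[R]_k) : vsL2 a b f -> vsL2 a b g ->
  vsL2 a b (fun s x => f s x + g s x).
Proof.
move=> hf hg i; have := sL2_lin 1 (hf i) (hg i); congr sL2.
by apply/funext => s; apply/funext => x; rewrite mxE mul1r.
Qed.

Lemma vsL2N a b k (f : R -> Omega -> 'cV[R]_k) : vsL2 a b f -> vsL2 a b (fun s x => - f s x).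
Proof.
move=> hf i; have := sL2_mul_dbd (dbd_cst a b (-1)) (hf i); congr sL2.
by apply/funext => s; apply/funext => x; rewrite mxE mulN1r.
Qed.

Lemma vsL2M a b k l (L : R -> 'M[R]_(k, l)) (f : R -> Omega -> 'cV[R]_l) : mdbd a b L -> vsL2 a b f ->
  vsL2 a b (fun s x => L s *m f s x).
Proof.
move=> hL hf i; have := sL2_sum (index_enum 'I_l) (fun j => sL2_mul_dbd (hL i j) (hf j)).
by congr sL2; apply/funext => s; apply/funext => x; rewrite mxE.
Qed.

Lemma vsL2M_dL2 a b k l (L : R -> 'M[R]_(k, l)) (X be si : R -> Omega -> 'cV[R]_l) : 0 <= a -> a <= b ->
  mdL2 a b L -> vitop a b X be si -> vsL2 a b (fun s x => L s *m X s x).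
Proof.
move=> a0 ab hL hX i.
have := sL2_sum (index_enum 'I_l) (fun j => sB_sL2_mul hw a0 ab (hL i j) (itop_sB hw a0 ab (hX j))).
by congr sL2; apply/funext => s; apply/funext => x; rewrite mxE.
Qed.

Lemma vsL2W a b a' b' k (f : R -> Omega -> 'cV[R]_k) : a <= a' -> b' <= b ->
  vsL2 a b f -> vsL2 a' b' f.
Proof. by move=> aa bb h i; exact: sL2W (h i). Qed.

Lemma vitop_restrict a s b k (X be si : R -> Omega -> 'cV[R]_k) : 0 <= a -> a <= s -> s <= b ->
  vitop a b X be si -> vitop s b X be si.
Proof. by move=> a0 as_ sb h i; exact: itop_restrict (h i). Qed.

Lemma vitop_vsL2 a b k (X be si : R -> Omega -> 'cV[R]_k) : vitop a b X be si -> vsL2 a b X.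
Proof. by move=> h i; have [] := h i. Qed.

(** What has to be found is $E|X_a|^2<\infty$. The process is square integrable over time and
    $\Omega$, hence at some time $t$ of $[a,b]$, and the equation on $[a,t]$ carries this back to
    $a$. *)
Lemma vitopP a b k (X be si : R -> Omega -> 'cV[R]_k) : 0 <= a -> a < b ->
  vsL2 a b X -> vsL2 a b be -> vsL2 a b si -> ito_equation Pr w a b X be si ->
  vitop a b X be si.
Proof.
move=> a0 ab sX sbe ssi h i; split; [exact: sX|exact: sbe|exact: ssi| |by move=> t tab; exact: h].
have ae1 := ae_integrable1 (sqint_mul (sX i).2 (sX i).2).
have [t tab st] : exists2 t, a <= t <= b & sqint Pr (fun x => X t x i 0).
  (* Otherwise the interval $[a,b]$, of positive length, would lie in a null set. *)
  apply: contrapT => no.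
  have [N [mN N0 hN]] := ae1.
  have : (leb `[a, b]%classic <= leb N)%E.
    have mI : measurable (`[a, b]%classic : set (measurableTypeR R)) by exact: measurable_itv.
    apply: (le_measure leb (mem_set mI) (mem_set mN)).
    move=> t /=; rewrite in_itv/= => tab; apply: hN => /= it; apply: no; exists t => //.
    apply/sqintP; split.
      apply: (measurable_F hw _ (progressive_section tab (sX i).1)).
      by case/andP: tab => /(le_trans a0).
    by move: it; congr (integrable _ _ _); apply/funext => x; rewrite /cut/= tab.
  by rewrite N0 (leb_itv (ltW ab)) lee_fin subr_le0 leNgt ab.
have /andP[at_ tb] := tab.
have [sb' ss'] := ((sL2W (lexx a) tb (sbe i)).2, (sL2W (lexx a) tb (ssi i)).2).
have sI := ito_sqint hw a0 (sqint_meas ss') (h t tab i).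
have [sT _] := tint_sqint at_ sb'.
have := sqintB st (sqintD sI sT); congr sqint; apply/funext => x.
by rewrite /tint; ring.
Qed.

(** The entry of a $1\times1$ matrix product, so that matrix algebra applies under the integral. *)
Definition vdot k (f g : R -> Omega -> 'cV[R]_k) (s : R) (x : Omega) := ((f s x)^T *m g s x) 0 0.

Definition Em a b (h : R -> Omega -> R) := \int[M]_z cut a b h z.

Definition iL1 a b (h : R -> Omega -> R) := M.-integrable setT (EFin \o cut a b h).

Lemma EmD a b h h' : iL1 a b h -> iL1 a b h' ->
  iL1 a b (fun s x => h s x + h' s x) /\ Em a b (fun s x => h s x + h' s x) = Em a b h + Em a b h'.
Proof.
move=> i1 i2; have E : cut a b (fun s x => h s x + h' s x) = fun z => cut a b h z + cut a b h' z.
  by apply/funext => z; rewrite /cut; case: ifP => //; rewrite addr0.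
split; first by rewrite /iL1 E; exact: (@integrableD _ _ _ M _ measurableT _ _ i1 i2).
by rewrite /Em E (RintegralD measurableT i1 i2).
Qed.

Lemma eq_Em a b h h' : (forall s x, a <= s <= b -> h s x = h' s x) -> Em a b h = Em a b h'.
Proof.
move=> e; rewrite /Em; apply: eq_Rintegral => z _; rewrite /cut; case: ifP => // sab; exact: e.
Qed.

Lemma iL1_vdot a b k (f g : R -> Omega -> 'cV[R]_k) : vsL2 a b f -> vsL2 a b g ->
  iL1 a b (vdot f g) /\
  Em a b (vdot f g) = \sum_i ip M (cut a b (fun s x => f s x i 0)) (cut a b (fun s x => g s x i 0)).
Proof.
move=> sf sg.
have E : cut a b (vdot f g) = fun z => \sum_(i <- index_enum 'I_k)
    cut a b (fun s x => f s x i 0 * g s x i 0) z.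
  apply/funext => z; rewrite /cut; case: ifP => _; last by rewrite big1.
  by rewrite /vdot mxE; apply: eq_bigr => i _; rewrite mxE.
have H (r : seq 'I_k) : M.-integrable setT (EFin \o (fun z => \sum_(i <- r) cut a b (fun s x => f s x i 0 * g s x i 0) z)) /\
    \int[M]_z (\sum_(i <- r) cut a b (fun s x => f s x i 0 * g s x i 0) z) =
    \sum_(i <- r) ip M (cut a b (fun s x => f s x i 0)) (cut a b (fun s x => g s x i 0)).
  elim: r => [|i r [ih1 ih2]].
    rewrite (_ : (fun z => _) = fun=> 0); last by apply/funext => z; rewrite big_nil.
    split; first exact: integrable0.
    by rewrite big_nil Rintegral0.
  have i1 : M.-integrable setT (EFin \o cut a b (fun s x => f s x i 0 * g s x i 0)).
    by have := sqint_mul (sf i).2 (sg i).2; rewrite -cut_mul.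
  rewrite (_ : (fun z => _) = fun z => cut a b (fun s x => f s x i 0 * g s x i 0) z +
     \sum_(j <- r) cut a b (fun s x => f s x j 0 * g s x j 0) z); last first.
    by apply/funext => z; rewrite big_cons.
  split; first exact: (@integrableD _ _ _ M _ measurableT _ _ i1 ih1).
  by rewrite big_cons -ih2 /ip cut_mul -(RintegralD measurableT i1 ih1).
by rewrite /iL1 /Em E; exact: H.
Qed.

Definition edot k (f g : Omega -> 'cV[R]_k) := \int[Pr]_x ((f x)^T *m g x) 0 0.

Definition vsqint k (f : Omega -> 'cV[R]_k) := forall i, sqint Pr (fun x => f x i 0).

Lemma edot_integrable k (f g : Omega -> 'cV[R]_k) : vsqint f -> vsqint g ->
  Pr.-integrable setT (EFin \o (fun x => ((f x)^T *m g x) 0 0)) /\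
  edot f g = \sum_i ip Pr (fun x => f x i 0) (fun x => g x i 0).
Proof.
move=> sf sg.
have E : (fun x => ((f x)^T *m g x) 0 0) = fun x => \sum_(i <- index_enum 'I_k) f x i 0 * g x i 0.
  by apply/funext => x; rewrite mxE; apply: eq_bigr => i _; rewrite mxE.
rewrite /edot E; elim: (index_enum _) => [|i r [ih1 ih2]].
  rewrite (_ : (fun x => _) = fun=> 0); last by apply/funext => z; rewrite big_nil.
  by split; [exact: integrable0|rewrite big_nil Rintegral0].
have i1 := sqint_mul (sf i) (sg i).
rewrite (_ : (fun x => _) = fun x => f x i 0 * g x i 0 + \sum_(j <- r) f x j 0 * g x j 0); last first.
  by apply/funext => z; rewrite big_cons.
split; first exact: (@integrableD _ _ _ Pr _ measurableT _ _ i1 ih1).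
by rewrite big_cons -ih2 /ip -(RintegralD measurableT i1 ih1).
Qed.

Lemma edotC k (f g : Omega -> 'cV[R]_k) : edot f g = edot g f.
Proof.
apply: eq_Rintegral => om _.
have -> : (f om)^T *m g om = ((g om)^T *m f om)^T by rewrite trmx_mul trmxK.
by rewrite mxE.
Qed.

Lemma edotDl k (f f' g : Omega -> 'cV[R]_k) al : vsqint f -> vsqint f' -> vsqint g ->
  edot (fun x => al *: f x + f' x) g = al * edot f g + edot f' g.
Proof.
move=> sf sf' sg; have [i1 _] := edot_integrable sf sg; have [i2 _] := edot_integrable sf' sg.
have i3 := @integrableZl _ _ _ Pr _ measurableT al _ i1.
rewrite /edot -RintegralZl// -(RintegralD measurableT i3 i2); apply: eq_Rintegral => x _.
by rewrite linearD/= linearZ/= mulmxDl -scalemxAl !mxE.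
Qed.

Lemma vproduct_formula a b k (X be si Z ga ta : R -> Omega -> 'cV[R]_k) : 0 <= a -> a <= b ->
  vitop a b X be si -> vitop a b Z ga ta ->
  edot (X b) (Z b) = edot (X a) (Z a) + Em a b (vdot be Z) + Em a b (vdot X ga) + Em a b (vdot si ta).
Proof.
move=> a0 ab hX hZ.
have V (k' : nat) (Y b' s' : R -> Omega -> 'cV[R]_k') : vitop a b Y b' s' -> [/\ vsL2 a b Y, vsL2 a b b' & vsL2 a b s'].
  by move=> h; split=> i; have [] := h i.
have [sX sbe ssi] := V _ _ _ _ hX; have [sZ sga sta] := V _ _ _ _ hZ.
have bab : a <= b <= b by rewrite ab lexx.
have aab : a <= a <= b by rewrite lexx.
have S t : a <= t <= b -> vsqint (X t) /\ vsqint (Z t).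
  by move=> tab; split=> i; [exact: (itop_sqint hw a0 (hX i) tab)|exact: (itop_sqint hw a0 (hZ i) tab)].
rewrite (iL1_vdot sbe sZ).2 (iL1_vdot sX sga).2 (iL1_vdot ssi sta).2.
rewrite (edot_integrable (S b bab).1 (S b bab).2).2 (edot_integrable (S a aab).1 (S a aab).2).2 -!big_split.
by apply: eq_bigr => i _ /=; exact: product_formula (hX i) (hZ i).
Qed.

Lemma vitop_lin a b k al (X be si Y be' si' : R -> Omega -> 'cV[R]_k) : 0 <= a ->
  vitop a b X be si -> vitop a b Y be' si' ->
  vitop a b (fun s x => al *: X s x + Y s x) (fun s x => al *: be s x + be' s x)
    (fun s x => al *: si s x + si' s x).
Proof.
move=> a0 hX hY i; have := itop_lin hw al a0 (hX i) (hY i); congr itop;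
  by apply/funext => s; apply/funext => x; rewrite !mxE.
Qed.

(** The witness [j] serves the empty sum: the zero process is obtained as $-X_j+X_j$. *)
Lemma itop_sum a b (I : Type) (r : seq I) (X be si : I -> R -> Omega -> R) : 0 <= a -> a <= b ->
  (exists j, itop a b (X j) (be j) (si j)) ->
  (forall i, itop a b (X i) (be i) (si i)) ->
  itop a b (fun s x => \sum_(i <- r) X i s x) (fun s x => \sum_(i <- r) be i s x)
    (fun s x => \sum_(i <- r) si i s x).
Proof.
move=> a0 ab [j hj] h; elim: r => [|i r ih].
  have := itop_lin hw (-1) a0 hj hj; congr itop;
    by apply/funext => s; apply/funext => x; rewrite big_nil; ring.
have := itop_lin hw 1 a0 (h i) ih; congr itop;
  by apply/funext => s; apply/funext => x; rewrite big_cons mul1r.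
Qed.

Lemma vitop_mul_det a b k (P P' : R -> 'M[R]_k) (X be si : R -> Omega -> 'cV[R]_k) :
  0 <= a -> a <= b -> (forall i j, acf a b (fun t => P t i j) (fun t => P' t i j)) ->
  vitop a b X be si ->
  vitop a b (fun s x => P s *m X s x) (fun s x => P' s *m X s x + P s *m be s x)
    (fun s x => P s *m si s x).
Proof.
move=> a0 ab hP hX i.
have h j := itop_mul_det hw a0 ab (hP i j) (hX j).
have := itop_sum (index_enum 'I_k) a0 ab (ex_intro _ i (h i)) h; congr itop;
  apply/funext => s; apply/funext => x; rewrite !mxE// -big_split.
exact: eq_bigr.
Qed.

End vector_processes.

(** * The linear-quadratic problem *)

Lemma mx11D (R : realType) (X Y : 'M[R]_1) : (X + Y) 0 0 = X 0 0 + Y 0 0.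
Proof. by rewrite mxE. Qed.

Lemma mx11N (R : realType) (X : 'M[R]_1) : (- X) 0 0 = - X 0 0.
Proof. by rewrite mxE. Qed.

(** The transpose satisfies the four Penrose equations of the same symmetric matrix, and their
    solution is unique. *)
Lemma mpinv_sym (R : realType) (k : nat) (Y : 'M[R]_k) : Y^T = Y -> (mpinv Y)^T = mpinv Y.
Proof.
move=> sY; have [e1 e2 e3 e4] := mpinvP Y; apply: (@penrose_uniq _ _ _ Y); last exact: mpinvP.
have e5 : Y *m (mpinv Y)^T = mpinv Y *m Y by rewrite -e4 trmx_mul sY.
have e6 : (mpinv Y)^T *m Y = Y *m mpinv Y by rewrite -e3 trmx_mul sY.
split.
- transitivity ((Y *m mpinv Y *m Y)^T); last by rewrite e1.
  by rewrite !trmx_mul sY mulmxA.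
- transitivity ((mpinv Y *m Y *m mpinv Y)^T); last by rewrite e2.
  by rewrite !trmx_mul sY mulmxA.
- by rewrite e5 e4.
- by rewrite e6 e3.
Qed.

(** * The Riccati solution, its gain and its defect *)

Section lq_riccati.
Variables (R : realType) (n m : nat) (t0 T : R) (D : lq_data R n m) (P : R -> 'M[R]_n).
Hypotheses (htT : t0 < T) (hD : lq_coefficients t0 T D)
  (hP : riccati_solution t0 T D P) (hK : square_integrable_gain t0 T D P).
Local Notation leb := (@lebesgue_measure R).
Local Notation Up := (Upsilon0 D P).
Local Notation Ga := (Gamma0 D P).

Definition gain t : 'M[R]_(m, n) := - (mpinv (Up t) *m Ga t).

Definition defect t : 'M[R]_(m, n) := Ga t + Up t *m gain t.

Lemma lq_mdbd : [/\ [/\ mdbd t0 T (lqA D), mdbd t0 T (lqAbar D), mdbd t0 T (lqB D) & mdbd t0 T (lqBbar D)],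
  mdbd t0 T (lqQ D) & mdbd t0 T (lqR D)].
Proof.
have [[hA hAb hB hBb] hQ hR _] := hD.
by split; [split|..]; exact: bounded_measurable_mdbd.
Qed.

Lemma riccati_primitive i j t : t0 <= t <= T ->
  P t i j = P t0 i j + \int[leb]_(s in `[t0, t]) (- riccati_rhs D P s i j).
Proof.
move=> /andP[t0t tT]; have [_ hi hPt] := hP.
have ht : t0 <= t <= T by rewrite t0t.
have h0 : t0 <= t0 <= T by rewrite lexx ltW.
have iN : leb.-integrable `[t0, t] (EFin \o (fun s => riccati_rhs D P s i j)).
  exact: integrable_itvW (lexx t0) tT (hi i j).
rewrite (hPt t ht) (hPt t0 h0).
have := @tint_split _ unit R t0 t T (fun s _ => riccati_rhs D P s i j) tt t0t tT (hi i j).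
rewrite /tint => ->.
have -> : \int[leb]_(s in `[t0, t]) (- riccati_rhs D P s i j) = - \int[leb]_(s in `[t0, t]) riccati_rhs D P s i j.
  rewrite -mulN1r -RintegralZl//; apply: eq_Rintegral => s _; by rewrite mulN1r.
ring.
Qed.

Lemma P_mdbd : mdbd t0 T P.
Proof.
move=> i j; have [_ hi _] := hP.
apply: (@primitive_dbd _ _ _ _ (fun s => - riccati_rhs D P s i j)) => [|t tab].
  exact: integrableN (hi i j).
exact: riccati_primitive.
Qed.

Lemma Up_mdbd : mdbd t0 T Up.
Proof.
have [[hA hAb hB hBb] hQ hR] := lq_mdbd.
apply: mdbdD => //; apply: mdbdM => //; apply: mdbdM P_mdbd; exact: mdbdT.
Qed.

Lemma Ga_mdbd : mdbd t0 T Ga.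
Proof.
have [[hA hAb hB hBb] hQ hR] := lq_mdbd.
apply: mdbdD; first by apply: mdbdM P_mdbd; exact: mdbdT.
apply: mdbdM => //; apply: mdbdM P_mdbd; exact: mdbdT.
Qed.

Lemma gain_mdL2 : mdL2 t0 T gain.
Proof.
apply: mdL2N => i j; have [mf /integrableP[_ If]] := hK i j.
have mc := measurable_cutd mf; split=> //.
apply: le_lt_trans If; rewrite le_eqVlt; apply/orP; left; apply/eqP.
rewrite [RHS]integral_mkcond; apply: eq_integral => t _; rewrite patchE.
have [h|h] := boolP (t0 <= t <= T).
  by rewrite cutd_in// mem_set/= ?in_itv//= ger0_norm ?sqr_ge0.
by rewrite cutd_out// memNset/= ?expr0n// in_itv/=; exact/negP.
Qed.

Lemma defect_mdL2 : mdL2 t0 T defect.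
Proof. by apply: mdL2D; [exact/mdbd_mdL2/Ga_mdbd|exact: mdL2M Up_mdbd gain_mdL2]. Qed.

(** The quadratic term $-\Gamma_0'\Upsilon_0^\dagger\Gamma_0$ is rewritten as $\Gamma_0'K$, a
    bounded factor times a square-integrable one; this puts $\dot P$ into $L^2$. *)
Lemma riccati_acf i j : acf t0 T (fun t => P t i j) (fun t => (- riccati_rhs D P t) i j).
Proof.
have [[hA hAb hB hBb] hQ hR] := lq_mdbd.
split; last first.
  move=> t tab; rewrite riccati_primitive//; congr (_ + _); apply: eq_Rintegral => s _.
  by rewrite [in RHS]mxE.
suff : mdL2 t0 T (fun t => - riccati_rhs D P t) by exact.
apply: mdL2N; rewrite /riccati_rhs.
rewrite (_ : (fun t => _) = fun t => ((lqA D t)^T *m P t + (lqAbar D t)^T *m P t *m lqAbar D t +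
   P t *m lqA D t + lqQ D t) + (Ga t)^T *m gain t); last first.
  by apply/funext => t; rewrite /gain mulmxN mulmxA.
apply: mdL2D; last by apply: mdL2M gain_mdL2; exact: mdbdT Ga_mdbd.
apply: mdbd_mdL2; apply: mdbdD => //; apply: mdbdD; last exact: mdbdM P_mdbd hA.
apply: mdbdD; first by apply: mdbdM P_mdbd; exact: mdbdT.
apply: mdbdM => //; apply: mdbdM P_mdbd; exact: mdbdT.
Qed.

Lemma P_sym t : t0 <= t <= T -> (P t)^T = P t.
Proof. by have [h _ _] := hP; exact: h. Qed.

Lemma P_end : P T = lqH D.
Proof.
have [_ _ h] := hP; apply/matrixP => i j; rewrite h ?lexx ?ltW//.
by rewrite set_itv1 Rintegral_set1 addr0.
Qed.

Lemma Up_sym t : t0 <= t <= T -> (Up t)^T = Up t.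
Proof.
move=> tT; have [_ _ _ [_ hR _]] := hD.
by rewrite /Upsilon0 linearD/= hR// !trmx_mul trmxK P_sym// mulmxA.
Qed.

Lemma Ga_tr t : t0 <= t <= T ->
  (Ga t)^T = P t *m lqB D t + (lqAbar D t)^T *m P t *m lqBbar D t.
Proof.
by move=> tT; rewrite /Gamma0 linearD/= !trmx_mul !trmxK P_sym// mulmxA.
Qed.

Lemma defectE t : defect t = Ga t - Up t *m mpinv (Up t) *m Ga t.
Proof. by rewrite /defect /gain mulmxN mulmxA. Qed.

(** $\Upsilon_0^\dagger(1-\Upsilon_0\Upsilon_0^\dagger)=0$, and $\Upsilon_0^\dagger$ is symmetric.
    Consequently a control of feedback form is orthogonal to $L\eta$ for every $\eta$. *)
Lemma mpinv_gain t : t0 <= t <= T -> (gain t)^T *m defect t = 0.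
Proof.
move=> tT; have [e1 e2 e3 e4] := mpinvP (Up t).
rewrite defectE /gain linearN/= trmx_mul mulNmx mulmxBr.
suff -> : (Ga t)^T *m (mpinv (Up t))^T *m Ga t =
   (Ga t)^T *m (mpinv (Up t))^T *m (Up t *m mpinv (Up t) *m Ga t) by rewrite subrr oppr0.
have h : (mpinv (Up t))^T *m (Up t *m mpinv (Up t)) = (mpinv (Up t))^T.
  by rewrite mpinv_sym ?Up_sym// mulmxA e2.
by rewrite -[in RHS]mulmxA (mulmxA (mpinv (Up t))^T) h mulmxA.
Qed.

End lq_riccati.

(** * Pointwise identities behind the two evaluations of the cost *)

Section pointwise_identities.
Context (R : realType) (n m : nat).
Implicit Types (x p q e v : 'cV[R]_n) (u z : 'cV[R]_m).

Lemma trmxDE k l (X Y : 'M[R]_(k, l)) : (X + Y)^T = X^T + Y^T.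
Proof. exact: linearD. Qed.

Lemma trmxNE k l (X : 'M[R]_(k, l)) : (- X)^T = - X^T.
Proof. exact: linearN. Qed.

(** Integrand of the polarized cost plus the three drift terms of the product formula for $p'e$:
    everything cancels except the stationarity expression paired with the control $z$. *)
Lemma duality_identity (A Ab Q : 'M[R]_n) (B Bb : 'M[R]_(n, m)) (S : 'M[R]_m) x p q e u z :
  ((Q *m x)^T *m e) 0 0 + ((S *m u)^T *m z) 0 0 +
  (((- (A^T *m p + Ab^T *m q + Q *m x))^T *m e) 0 0 + (p^T *m (A *m e + B *m z)) 0 0 +
   (q^T *m (Ab *m e + Bb *m z)) 0 0) =
  ((S *m u + B^T *m p + Bb^T *m q)^T *m z) 0 0.
Proof.
rewrite !trmxNE !trmxDE mulNmx !mulmxDl !mulmxDr !trmx_mul !trmxK !mulmxA !(mx11D, mx11N).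
ring.
Qed.

(** The analogue for $x'Pe$. [N] stands for $\Gamma_0'\Upsilon_0^\dagger\Gamma_0$ and enters through
    its value on $e$, which is $-\Gamma_0'z$ when $z=Ke$; the identity is thus polynomial, free of
    pseudoinverses, and its right side becomes $u'Le$. *)
Lemma completion_identity (A Ab P Q N : 'M[R]_n) (B Bb : 'M[R]_(n, m)) (S : 'M[R]_m) x e u z :
  Q^T = Q -> S^T = S -> N *m e = - ((P *m B + Ab^T *m P *m Bb) *m z) ->
  ((Q *m x)^T *m e) 0 0 + ((S *m u)^T *m z) 0 0 +
  (((A *m x + B *m u)^T *m (P *m e)) 0 0 +
   (x^T *m ((- (A^T *m P + Ab^T *m P *m Ab + P *m A + Q - N)) *m e + P *m (A *m e + B *m z))) 0 0 +
   ((Ab *m x + Bb *m u)^T *m (P *m (Ab *m e + Bb *m z))) 0 0) =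
  (u^T *m ((B^T *m P + Bb^T *m P *m Ab) *m e + (S + Bb^T *m P *m Bb) *m z)) 0 0.
Proof.
move=> sQ sS hN.
have -> : (- (A^T *m P + Ab^T *m P *m Ab + P *m A + Q - N)) *m e =
    - ((A^T *m P + Ab^T *m P *m Ab + P *m A + Q) *m e) - (P *m B + Ab^T *m P *m Bb) *m z.
  by rewrite mulNmx mulmxBl hN opprB addrC.
rewrite !(trmx_mul, trmxDE, mulmxDl, mulmxDr, mulmxN) sQ sS !mulmxA !(mx11D, mx11N).
ring.
Qed.

Lemma add_cancel5 (c e1 e2 e3 e4 e5 : R) : e1 + e2 + (e3 + e4 + e5) = 0 ->
  e1 + e2 + (c + e3 + e4 + e5) = c.
Proof. by move=> h; rewrite -[RHS]addr0 -h; ring. Qed.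

Lemma regroup5 (c e1 e2 e3 e4 e5 : R) :
  e1 + e2 + (c + e3 + e4 + e5) = c + (e1 + e2 + (e3 + e4 + e5)).
Proof. by ring. Qed.

End pointwise_identities.

(** * The two evaluations of the polar form *)

Section lq_forms.
Context d (Omega : measurableType d) (R : realType).
Variables (Pr : probability Omega R) (w : R -> Omega -> R).
Hypothesis hw : brownian_motion Pr w.
Variables (n m : nat) (t0 T : R) (D : lq_data R n m) (P : R -> 'M[R]_n).
Hypotheses (t00 : 0 <= t0) (htT : t0 < T) (hD : lq_coefficients t0 T D)
  (hP : riccati_solution t0 T D P) (hK : square_integrable_gain t0 T D P).
Variable a : R.
Hypotheses (t0a : t0 <= a) (aT : a < T).
Local Notation vsL2 := (vsL2 Pr w a T).
Local Notation vitop := (vitop Pr w a T).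
Local Notation Em := (Em Pr a T).
Local Notation edot := (edot Pr).
Local Notation vsqint := (vsqint Pr).
Local Notation Up := (Upsilon0 D P).
Local Notation Ga := (Gamma0 D P).
Local Notation K := (gain D P).
Local Notation L := (defect D P).
Implicit Types (x p q eta : R -> Omega -> 'cV[R]_n) (u ze : R -> Omega -> 'cV[R]_m).

Definition dyn x u s om := lqA D s *m x s om + lqB D s *m u s om.
Definition dif x u s om := lqAbar D s *m x s om + lqBbar D s *m u s om.
Definition adj x p q s om :=
  - ((lqA D s)^T *m p s om + (lqAbar D s)^T *m q s om + lqQ D s *m x s om).
Definition feedback x s om := K s *m x s om.

(* The polar form of the cost: cost x u = jf t0 x u x u, see cost_jf. *)
Definition jf x u eta ze := Em (vdot (fun s om => lqQ D s *m x s om) eta) +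
  Em (vdot (fun s om => lqR D s *m u s om) ze) + edot (fun om => lqH D *m x T om) (eta T).

Let a0 : 0 <= a. Proof. exact: le_trans t0a. Qed.
Let aT' : a <= T. Proof. exact: ltW. Qed.
Let W k l (Z : R -> 'M[R]_(k, l)) : mdbd t0 T Z -> mdbd a T Z.
Proof. by move=> h; exact: mdbdW h. Qed.

Lemma coeffs : [/\ [/\ mdbd a T (lqA D), mdbd a T (lqAbar D), mdbd a T (lqB D) & mdbd a T (lqBbar D)],
  mdbd a T (lqQ D) & mdbd a T (lqR D)].
Proof.
by have [[hA hAb hB hBb] hQ hR] := lq_mdbd hD; split; [split|..]; exact: W.
Qed.

Lemma dyn_sL2 x u : vsL2 x -> vsL2 u -> vsL2 (dyn x u) /\ vsL2 (dif x u).
Proof.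
have [[hA hAb hB hBb] hQ hR] := coeffs.
by move=> sx su; split; apply: vsL2D; exact: vsL2M.
Qed.

Lemma vitop_sqint x b s t : vitop x b s -> a <= t <= T -> vsqint (x t).
Proof. by move=> h tT i; exact: itop_sqint (h i) tT. Qed.

Lemma edot_eq (f g f' g' : Omega -> 'cV[R]_n) : (forall om, (f om)^T *m g om = (f' om)^T *m g' om) ->
  edot f g = edot f' g'.
Proof. by move=> e; apply: eq_Rintegral => om _; rewrite e. Qed.

(** Product formula for $p'\eta$ on $[a,T]$ with [duality_identity] under the integral; the terminal
    term matches because $p(T)=Hx(T)$. Stationarity is assumed in integrated form, tested against
    the control [ze]. *)
Lemma fbsde_duality x p q u eta ze : vsL2 x -> vsL2 q -> vsL2 u -> vsL2 ze ->
  vitop p (adj x p q) q -> vitop eta (dyn eta ze) (dif eta ze) ->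
  Em (vdot (fun s om => lqR D s *m u s om + (lqB D s)^T *m p s om + (lqBbar D s)^T *m q s om) ze) = 0 ->
  {ae Pr, forall om, p T om = lqH D *m x T om} -> vsqint (x T) ->
  jf x u eta ze = edot (p a) (eta a).
Proof.
move=> sx sq su sz hp he st pT sxT; have [[hA hAb hB hBb] hQ hR] := coeffs.
have se := vitop_vsL2 he; have sp := vitop_vsL2 hp.
have pf := vproduct_formula hw a0 aT' hp he.
have TT : a <= T <= T by rewrite aT' lexx.
have spT := vitop_sqint hp TT; have seT := vitop_sqint he TT.
have sadj : vsL2 (adj x p q).
  apply: vsL2N; apply: vsL2D; last exact: vsL2M.
  by apply: vsL2D; apply: vsL2M => //; exact: mdbdT.
have [sd sf] := dyn_sL2 se sz.
have eT : edot (fun om => lqH D *m x T om) (eta T) = edot (p T) (eta T).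
  have sHx : vsqint (fun om => lqH D *m x T om).
    move=> i; rewrite (_ : (fun om => _) = fun om => \sum_j lqH D i j * x T om j 0).
      by apply: sqint_sum => j; exact: sqintZ.
    by apply/funext => om; rewrite mxE.
  rewrite (edot_integrable sHx seT).2 (edot_integrable spT seT).2; apply: eq_bigr => i _.
  have [m1 m2 m3] := And3 (sqint_meas (sHx i)) (sqint_meas (spT i)) (sqint_meas (seT i)).
  by apply: (ae_ip m1 m2 m3 m3); apply: (ae_mono _ pT) => om ->.
have [i1 _] := iL1_vdot (vsL2M hQ sx) se.
have [i2 _] := iL1_vdot (vsL2M hR su) sz.
have [i3 _] := iL1_vdot sadj se.
have [i4 _] := iL1_vdot sp sd.
have [i5 _] := iL1_vdot sq sf.
have [i12 e12] := EmD i1 i2; have [i34 e34] := EmD i3 i4; have [i345 e345] := EmD i34 i5.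
have [iall eall] := EmD i12 i345.
have z0 : Em (vdot (fun s om => lqQ D s *m x s om) eta) + Em (vdot (fun s om => lqR D s *m u s om) ze) +
    (Em (vdot (adj x p q) eta) + Em (vdot p (dyn eta ze)) + Em (vdot q (dif eta ze))) = 0.
  rewrite -e12 -e34 -e345 -eall -[RHS]st; apply: eq_Em => s om sT.
  exact: duality_identity.
by rewrite /jf eT pf; exact: add_cancel5.
Qed.

Lemma feedback_sL2 eta b s : vitop eta b s -> vsL2 (feedback eta).
Proof. move=> h; apply: (vsL2M_dL2 hw a0 aT' _ h); exact: mdL2W (gain_mdL2 hK). Qed.

(** Product formula for $x'(P\eta)$, where $P\eta$ is an Ito process by [vitop_mul_det]. The
    feedback control of the second pair is what lets [completion_identity] absorb the quadratic
    Riccati term; the first pair is arbitrary. *)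
Lemma jf_feedback x u eta : vsL2 u -> vitop x (dyn x u) (dif x u) ->
  vitop eta (dyn eta (feedback eta)) (dif eta (feedback eta)) ->
  jf x u eta (feedback eta) = edot (x a) (fun om => P a *m eta a om) +
    Em (vdot u (fun s om => L s *m eta s om)).
Proof.
move=> su hx he; have [[hA hAb hB hBb] hQ hR] := coeffs.
have se := vitop_vsL2 he; have sx := vitop_vsL2 hx.
have sz := feedback_sL2 he; set ze := feedback eta in he sz *.
have hacf i j : acf a T (fun t => P t i j) (fun t => (- riccati_rhs D P t) i j).
  have [s1 s2] := riccati_acf htT hD hP hK i j; split; first exact: dL2W s1.
  move=> t /andP[at_ tT]; have ht : t0 <= t <= T by rewrite (le_trans t0a).
  have ha : t0 <= a <= T by rewrite t0a ltW.
  have i1 := integrable_itvW (lexx t0) tT (dL2_integrable s1).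
  have := @tint_split _ unit R t0 a t (fun s _ => (- riccati_rhs D P s) i j) tt t0a at_ i1.
  by rewrite /tint (s2 t ht) (s2 a ha) => ->; rewrite addrA.
have hPe := vitop_mul_det hw a0 aT' hacf he.
have pf := vproduct_formula hw a0 aT' hx hPe.
have TT : a <= T <= T by rewrite aT' lexx.
have [sd sf] := dyn_sL2 se sz; have [sd' sf'] := dyn_sL2 sx su.
have hPa : mdbd a T P := W (P_mdbd htT hP).
have eT : edot (fun om => lqH D *m x T om) (eta T) = edot (x T) (fun om => P T *m eta T om).
  have [_ _ _ [_ _ sH]] := hD.
  by apply: edot_eq => om; rewrite (P_end htT hP) trmx_mul sH mulmxA.
have [i1 _] := iL1_vdot (vsL2M hQ sx) se.
have [i2 _] := iL1_vdot (vsL2M hR su) sz.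
have [i3 _] := iL1_vdot sd' (vsL2M hPa se).
have s4 : vsL2 (fun s om => (- riccati_rhs D P s) *m eta s om + P s *m dyn eta ze s om).
  apply: vsL2D; last exact: vsL2M.
  by apply: (vsL2M_dL2 hw a0 aT' _ he) => i j; exact: (hacf i j).1.
have [i4 _] := iL1_vdot sx s4.
have [i5 _] := iL1_vdot sf' (vsL2M hPa sf).
have [i12 e12] := EmD i1 i2; have [i34 e34] := EmD i3 i4; have [i345 e345] := EmD i34 i5.
have [iall eall] := EmD i12 i345.
have zE : Em (vdot (fun s om => lqQ D s *m x s om) eta) + Em (vdot (fun s om => lqR D s *m u s om) ze) +
  (Em (vdot (dyn x u) (fun s om => P s *m eta s om)) +
   Em (vdot x (fun s om => (- riccati_rhs D P s) *m eta s om + P s *m dyn eta ze s om)) +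
   Em (vdot (dif x u) (fun s om => P s *m dif eta ze s om))) =
  Em (vdot u (fun s om => L s *m eta s om)).
  rewrite -e12 -e34 -e345 -eall; apply: eq_Em => s om /andP[as_ sT].
  have ts : t0 <= s <= T by rewrite (le_trans t0a).
  have [_ _ _ [sQ sR _]] := hD.
  have -> : vdot u (fun s om => L s *m eta s om) s om =
      ((u s om)^T *m (Ga s *m eta s om + Up s *m ze s om)) 0 0.
    by rewrite /vdot /defect mulmxDl -[Up s *m K s *m _]mulmxA.
  apply: completion_identity; [exact: sQ|exact: sR|].
  rewrite -(Ga_tr hP ts) /ze /feedback /gain mulNmx mulmxN opprK.
  by rewrite !mulmxA.
by rewrite /jf eT pf -zE; exact: regroup5.
Qed.

End lq_forms.

Section lq_cost.
Context d (Omega : measurableType d) (R : realType).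
Variables (Pr : probability Omega R) (w : R -> Omega -> R).
Hypothesis hw : brownian_motion Pr w.
Variables (n m : nat) (t0 T : R) (D : lq_data R n m) (P : R -> 'M[R]_n).
Hypotheses (t00 : 0 <= t0) (htT : t0 < T) (hD : lq_coefficients t0 T D).
Local Notation leb := (@lebesgue_measure R).
Local Notation M := (leb \x Pr)%E.
Local Notation vsL2 := (vsL2 Pr w).
Local Notation vitop := (vitop Pr w).
Local Notation Em := (Em Pr).
Local Notation edot := (edot Pr).
Local Notation vsqint := (vsqint Pr).
Local Notation jf := (jf Pr T D).
Local Notation dyn := (dyn D).
Local Notation dif := (dif D).
Implicit Types (x p q eta : R -> Omega -> 'cV[R]_n) (u ze : R -> Omega -> 'cV[R]_m).

Lemma jf_sym a x u eta ze : t0 <= a -> jf a x u eta ze = jf a eta ze x u.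
Proof.
move=> t0a; have [_ _ _ [sQ sR sH]] := hD.
have S k (Z : 'M[R]_k) (y z : 'cV[R]_k) : Z^T = Z -> ((Z *m y)^T *m z) 0 0 = ((Z *m z)^T *m y) 0 0.
  move=> sZ; have -> : (Z *m y)^T *m z = ((Z *m z)^T *m y)^T by rewrite !trmx_mul !trmxK sZ mulmxA.
  by rewrite mxE.
congr (_ + _ + _).
- by apply: eq_Em => s om /andP[h1 h2]; apply: S; apply: sQ; rewrite (le_trans t0a).
- by apply: eq_Em => s om /andP[h1 h2]; apply: S; apply: sR; rewrite (le_trans t0a).
- by apply: eq_Rintegral => om _; exact: S.
Qed.

Lemma EmZ a b h c : iL1 Pr a b h -> iL1 Pr a b (fun s om => c * h s om) /\
  Em a b (fun s om => c * h s om) = c * Em a b h.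
Proof.
move=> i1; have E : cut a b (fun s om => c * h s om) = fun z => c * cut a b h z.
  by apply/funext => z; rewrite /cut; case: ifP => //; rewrite mulr0.
split; first by rewrite /iL1 E; exact: (@integrableZl _ _ _ M _ measurableT c _ i1).
by rewrite /Em E (RintegralZl _ measurableT i1).
Qed.

Lemma Em_vdot_linl a b k c (f f' g : R -> Omega -> 'cV[R]_k) : vsL2 a b f -> vsL2 a b f' -> vsL2 a b g ->
  Em a b (vdot (fun s om => c *: f s om + f' s om) g) = c * Em a b (vdot f g) + Em a b (vdot f' g).
Proof.
move=> sf sf' sg; have [i1 _] := iL1_vdot sf sg; have [i2 _] := iL1_vdot sf' sg.
have [i3 e3] := EmZ c i1; have [_ e4] := EmD i3 i2; rewrite -e3 -e4.
apply: eq_Em => s om _; rewrite /vdot linearD/= linearZ/= mulmxDl -scalemxAl !mxE//.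
Qed.

Lemma vsqint_mul k l (Z : 'M[R]_(k, l)) (f : Omega -> 'cV[R]_l) : vsqint f ->
  vsqint (fun om => Z *m f om).
Proof.
move=> sf i; rewrite (_ : (fun om => _) = fun om => \sum_j Z i j * f om j 0).
  by apply: sqint_sum => j; exact: sqintZ.
by apply/funext => om; rewrite mxE.
Qed.

Lemma jf_linl a c x u x' u' eta ze : t0 <= a -> a < T -> vsL2 a T x -> vsL2 a T u -> vsL2 a T x' ->
  vsL2 a T u' -> vsL2 a T eta -> vsL2 a T ze ->
  vsqint (x T) -> vsqint (x' T) -> vsqint (eta T) ->
  jf a (fun s om => c *: x s om + x' s om) (fun s om => c *: u s om + u' s om) eta ze =
  c * jf a x u eta ze + jf a x' u' eta ze.
Proof.
move=> t0a aT sx su sx' su' se sz xT xT' eT.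
have [_ hQ hR] := lq_mdbd hD.
have hQa := mdbdW t0a (lexx T) hQ; have hRa := mdbdW t0a (lexx T) hR.
rewrite /jf.
have -> : (fun s om => lqQ D s *m (c *: x s om + x' s om)) =
    fun s om => c *: (lqQ D s *m x s om) + lqQ D s *m x' s om.
  by apply/funext => s; apply/funext => om; rewrite mulmxDr -scalemxAr.
have -> : (fun s om => lqR D s *m (c *: u s om + u' s om)) =
    fun s om => c *: (lqR D s *m u s om) + lqR D s *m u' s om.
  by apply/funext => s; apply/funext => om; rewrite mulmxDr -scalemxAr.
have -> : (fun om => lqH D *m (c *: x T om + x' T om)) =
    fun om => c *: (lqH D *m x T om) + lqH D *m x' T om.
  by apply/funext => om; rewrite mulmxDr -scalemxAr.
rewrite (Em_vdot_linl c (vsL2M hQa sx) (vsL2M hQa sx') se).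
rewrite (Em_vdot_linl c (vsL2M hRa su) (vsL2M hRa su') sz).
rewrite (edotDl c (vsqint_mul _ xT) (vsqint_mul _ xT') eT); ring.
Qed.

Lemma Em_fubini a b h : iL1 Pr a b h ->
  (\int[Pr]_om \int[leb]_(s in `[a, b]) (h s om)%:E = (Em a b h)%:E)%E.
Proof.
move=> ih; transitivity (\int[M]_z (cut a b h z)%:E)%E; last first.
  by rewrite /Em /Rintegral fineK//; apply: integrable_fin_num => //; exact: ih.
rewrite -(integral21_prod_meas1 ih); apply: eq_integral => x _.
rewrite [LHS]integral_mkcond; apply: eq_integral => s _.
rewrite patchE /cut/=; case: ifPn; rewrite ?inE ?notin_setE/= in_itv/=; first by move=> ->.
by move/negP/negbTE => ->.
Qed.

Lemma cost_jf x u : vsL2 t0 T x -> vsL2 t0 T u -> vsqint (x T) ->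
  cost Pr t0 T D x u = (jf t0 x u x u)%:E.
Proof.
move=> sx su xT; have [_ hQ hR] := lq_mdbd hD; have [_ _ _ [sQ sR sH]] := hD.
have [i1 _] := iL1_vdot (vsL2M hQ sx) sx.
have [i2 _] := iL1_vdot (vsL2M hR su) su.
have [i3 e3] := EmD i1 i2.
have [i4 _] := edot_integrable (vsqint_mul (lqH D) xT) xT.
rewrite /jf -e3 EFinD /cost; congr (_ + _)%E.
  rewrite -(Em_fubini i3); apply: eq_integral => om _; apply: eq_integral => s.
  rewrite inE/= in_itv/= => sT; congr EFin.
  by rewrite /vdot !trmx_mul sQ// sR.
rewrite /edot /Rintegral fineK; last exact: integrable_fin_num i4.
by apply: eq_integral => om _; rewrite trmx_mul sH.
Qed.

Lemma vitop_equation a b k (X be si : R -> Omega -> 'cV[R]_k) : vitop a b X be si ->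
  ito_equation Pr w a b X be si.
Proof. by move=> h t tab i; have [_ _ _ _ hI] := h i; exact: hI. Qed.

Lemma vae_eq k (f g : Omega -> 'cV[R]_k) : (forall i, {ae Pr, forall om, f om i 0 = g om i 0}) ->
  {ae Pr, forall om, f om = g om}.
Proof.
move=> h; apply: (ae_mono _ (ae_forall_fin h)) => om e.
by apply/matrixP => i j; rewrite (ord1 j).
Qed.

Lemma convex_jf_ge0 x u : convexity Pr w t0 T D -> vsL2 t0 T u ->
  vitop t0 T x (dyn x u) (dif x u) -> {ae Pr, forall om, x t0 om = 0} -> 0 <= jf t0 x u x u.
Proof.
move=> hJ su hx x0; have sx := vitop_vsL2 hx; have T0 : 0 <= T by rewrite (le_trans t00) ?ltW.
have TT : t0 <= T <= T by rewrite lexx ltW.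
rewrite -lee_fin -(cost_jf sx su (vitop_sqint hw t00 (lexx t0) hx TT)).
apply: hJ; [by apply/(L2_processP hw)|by apply/(L2_processP hw)|].
by split=> //; exact: vitop_equation.
Qed.

Hypotheses (hP : riccati_solution t0 T D P) (hK : square_integrable_gain t0 T D P).

(** The control is the feedback plus a prescribed [z], which becomes the inhomogeneity $Bz$, $\bar
    Bz$ of a linear equation with the $L^2(dt)$ matrices $A+BK$ and $\bar A+\bar BK$. *)
Lemma closed_loop a (xi : Omega -> 'cV[R]_n) (z : R -> Omega -> 'cV[R]_m) : t0 <= a -> a < T ->
  (forall i, measurable_fun [set: filtration_type Pr w a] ((fun om => xi om i 0) : filtration_type Pr w a -> R)) ->
  vsqint xi -> vsL2 a T z ->
  exists X, let v := fun s om => feedback D P X s om + z s om in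
    [/\ vitop a T X (dyn X v) (dif X v), {ae Pr, forall om, X a om = xi om} & vsL2 a T v].
Proof.
move=> t0a aT mxi sxi sz; have a0 := le_trans t00 t0a.
have [[hA hAb hB hBb] _ _] := lq_mdbd hD.
have W k l (Z : R -> 'M[R]_(k, l)) : mdbd t0 T Z -> mdbd a T Z by move=> h; exact: mdbdW h.
have gL2 := mdL2W t0a (lexx T) (gain_mdL2 hK).
have hF : mdL2 a T (fun t => lqA D t + lqB D t *m gain D P t).
  by apply: mdL2D; [exact/mdbd_mdL2/W|apply: mdL2M gL2; exact: W].
have hG : mdL2 a T (fun t => lqAbar D t + lqBbar D t *m gain D P t).
  by apply: mdL2D; [exact/mdbd_mdL2/W|apply: mdL2M gL2; exact: W].
have sBz := vsL2M (W _ _ _ hB) sz; have sBbz := vsL2M (W _ _ _ hBb) sz.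
have [X hX] := linear_sde hw a0 aT hF hG sBz sBbz mxi sxi.
pose Y s om : 'cV[R]_n := \col_i X i s om.
have E (Z : R -> 'M[R]_n) (Zb : R -> 'M[R]_(n, m)) i :
    affine (fun t => Z t + Zb t *m gain D P t) (fun i s om => (Zb s *m z s om) i 0) X i =
    fun s om => (Z s *m Y s om + Zb s *m (feedback D P Y s om + z s om)) i 0.
  apply/funext => s; apply/funext => om; rewrite /affine /feedback.
  rewrite mulmxDr (mulmxA (Zb s)) addrA -mulmxDl [RHS]mxE; congr (_ + _).
  by rewrite [RHS]mxE; apply: eq_bigr => j _; rewrite [Y s om j 0]mxE.
have hY : vitop a T Y (dyn Y (fun s om => feedback D P Y s om + z s om))
    (dif Y (fun s om => feedback D P Y s om + z s om)).
  move=> i; have := (hX i).1; rewrite (E (lqA D) (lqB D) i) (E (lqAbar D) (lqBbar D) i).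
  by congr itop; apply/funext => s; apply/funext => om; rewrite /Y mxE.
exists Y; split=> //.
  by apply: vae_eq => i; apply: (ae_mono _ (hX i).2) => om; rewrite /Y mxE.
by apply: vsL2D => //; exact: (feedback_sL2 hw t00 hK t0a aT hY).
Qed.

End lq_cost.

(** * Means of linear systems *)

Section means.
Context d (Omega : measurableType d) (R : realType).
Variables (Pr : probability Omega R) (w : R -> Omega -> R).
Hypothesis hw : brownian_motion Pr w.
Local Notation leb := (@lebesgue_measure R).
Local Notation M := (leb \x Pr)%E.
Local Notation F := (filtration_type Pr w).
Local Notation sL2 := (sL2 Pr w).
Local Notation vsL2 := (vsL2 Pr w).
Local Notation itop := (itop Pr w).
Local Notation vitop := (vitop Pr w).
Local Notation mean X := (\int[Pr]_om X om).

Lemma sL2_cst a b (c : R) : sL2 a b (fun=> fun=> c).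
Proof.
split; last exact: sqint_cut_cst (sqint_cst Pr c).
by move=> t tab mD; exact: measurable_cst.
Qed.

Lemma itop_cst a b (c : R) : 0 <= a -> itop a b (fun=> fun=> c) (fun=> fun=> 0) (fun=> fun=> 0).
Proof.
move=> a0; split; [exact: sL2_cst|exact: sL2_cst|exact: sL2_cst|exact: sqint_cst|].
move=> t /andP[at_ tb]; have s0 := sL2_cst a t 0.
have [I [hI _]] := ito_exists hw a0 at_ s0.1 s0.2.
have e1 : (fun (_ : R) (_ : Omega) => -1 * 0 + 0 : R) = fun=> fun=> 0.
  by apply/funext => s; apply/funext => x; rewrite mulr0 addr0.
(* The stochastic integral of 0 is exhibited as $-I+I$. *)
have e2 : (fun x => -1 * I x + I x) = fun x => c - c - tint a t (fun=> fun=> 0) x.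
  by apply/funext => x; rewrite /tint Rintegral0; ring.
by move: (ito_lin hw (-1) a0 at_ s0 s0 hI hI); rewrite e1 e2.
Qed.

Lemma vitop_restrictr a t b k (X be si : R -> Omega -> 'cV[R]_k) : t <= b ->
  vitop a b X be si -> vitop a t X be si.
Proof.
move=> tb h i; have [s1 s2 s3 s4 s5] := h i.
split; [exact: sL2W s1|exact: sL2W s2|exact: sL2W s3|exact: s4|].
by move=> s /andP[as_ st]; apply: s5; rewrite as_ (le_trans st).
Qed.

Lemma sqint_mean X : sqint Pr X -> mean X = ip Pr X (fun=> 1).
Proof. by move=> _; apply: eq_Rintegral => om _; rewrite mulr1. Qed.

Lemma mean_ae_cst X c : sqint Pr X -> {ae Pr, forall om, X om = c} -> mean X = c.
Proof.
move=> sX Xc; rewrite (ae_eq_Rintegral (sqint_meas sX) (measurable_cst c) Xc).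
by rewrite Rintegral_cst// [X in fine X]probability_setT mulr1.
Qed.

(** The stochastic integral has mean 0, by [ito_mean] with the constant variable 1; Fubini exchanges
    drift integral and expectation. *)
Lemma mean_primitive a b X be si : 0 <= a -> a <= b -> itop a b X be si ->
  leb.-integrable `[a, b] (EFin \o (fun s => mean (be s))) /\
  forall t, a <= t <= b -> mean (X t) = mean (X a) + \int[leb]_(s in `[a, t]) mean (be s).
Proof.
move=> a0 ab hX; have sXt := itop_sqint hw a0 hX; have [sX sbe ssi sXa h] := hX.
have s1 := sqint_cst Pr 1.
have aab : a <= a <= b by rewrite lexx.
have E t s om : a <= s <= t -> cut a t be (s, om) * cut a t (fun=> fun=> 1) (s, om) = be s om.
  by move=> sat; rewrite /cut/= sat mulr1.
have E0 t s om : ~~ (a <= s <= t) -> cut a t be (s, om) * cut a t (fun=> fun=> 1) (s, om) = 0.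
  by move=> /negbTE sat; rewrite /cut/= sat mul0r.
split.
  have := Rfubini1_integrable (sqint_mul sbe.2 (sqint_cut_cst a b s1)).
  move=> ii; have := @integrableS _ _ _ leb _ _ _ measurableT (measurable_itv `[a, b]) (@subsetT _ _) ii.
  apply: eq_integrable; first exact: measurable_itv.
  move=> s; rewrite inE/= in_itv/= => sab; congr EFin.
  by apply: eq_Rintegral => om _; exact: E.
move=> t tab; have /andP[at_ tb] := tab.
have W f := @sL2W _ _ _ Pr w a b a t f (lexx a) tb.
have sI := ito_sqint hw a0 (sqint_meas (W _ ssi).2) (h t tab).
have [sT _] := tint_sqint at_ (W _ sbe).2.
rewrite !sqint_mean//; last exact: sXt.
have XE : X t = fun x => X a x + tint a t be x + (X t x - X a x - tint a t be x).
  by apply/funext => x; ring.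
rewrite {1}XE (ipDl (sqintD sXa sT) sI s1) (ipDl sXa sT s1).
have m1 : measurable_fun [set: F a] ((fun=> 1) : F a -> R) by exact: measurable_cst.
rewrite [ip Pr _ _ in X in _ + X]ipC (ito_mean hw a0 (sqint_meas (W _ ssi).2) (h t tab) m1 s1) addr0.
congr (_ + _); rewrite (ip_tint (W _ sbe).2 s1).
rewrite [LHS](Rfubini1 (sqint_mul (W _ sbe).2 (sqint_cut_cst a t s1))) Rintegral_indic_itv.
apply: eq_Rintegral => s _; have [sat|sat] := boolP (a <= s <= t).
  by rewrite indicc_in// mulr1; apply: eq_Rintegral => om _; exact: E.
by rewrite indicc_out// mulr0 -[RHS](Rintegral0 Pr setT); apply: eq_Rintegral => om _; exact: E0.
Qed.

Lemma vmean_primitive a b k (FF : R -> 'M[R]_k) (X si : R -> Omega -> 'cV[R]_k) :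
  0 <= a -> a <= b -> mdL2 a b FF -> vitop a b X (fun s om => FF s *m X s om) si ->
  let xb s : 'cV[R]_k := \col_i mean (fun om => X s om i 0) in
  forall i, acf a b (fun s => xb s i 0) (fun s => (FF s *m xb s) i 0).
Proof.
move=> a0 ab hF hX xb.
have sXt t i : a <= t <= b -> sqint Pr (fun om => X t om i 0) by move=> tab; exact: (itop_sqint hw a0 (hX i) tab).
have E i s : a <= s <= b -> mean (fun om => (FF s *m X s om) i 0) = (FF s *m xb s) i 0.
  move=> sab; rewrite mxE.
  have sF j : sqint Pr (fun om => FF s i j * X s om j 0) by apply: sqintZ; exact: sXt.
  transitivity (ip Pr (fun om => \sum_j FF s i j * X s om j 0) (fun=> 1)).
    by apply: eq_Rintegral => om _; rewrite mulr1 mxE.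
  rewrite ip_suml//; last exact: sqint_cst.
  apply: eq_bigr => j _; rewrite (ipZl _ (sXt s j sab) (sqint_cst Pr 1)) mxE sqint_mean//.
  exact: sXt.
have prim i t : a <= t <= b -> xb t i 0 = xb a i 0 + \int[leb]_(s in `[a, t]) (FF s *m xb s) i 0.
  move=> tab; have [_ h] := mean_primitive a0 ab (hX i); rewrite !mxE (h t tab).
  congr (_ + _); apply: eq_Rintegral => s; rewrite inE/= in_itv/= => /andP[as_ st].
  by apply: E; rewrite as_ (le_trans st)//; case/andP: tab.
have bd i : dbd a b (fun s => xb s i 0).
  have [h1 _] := mean_primitive a0 ab (hX i).
  apply: (primitive_dbd _ (prim i)).
  move: h1; apply: eq_integrable; first exact: measurable_itv.
  by move=> s; rewrite inE/= in_itv/= => sab /=; rewrite E.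
move=> i; split; last exact: prim.
rewrite (_ : (fun s => _) = fun s => \sum_j xb s j 0 * FF s i j).
  by apply: dL2_sum => j; exact: dL2M.
by apply/funext => s; rewrite mxE; apply: eq_bigr => j _; rewrite mulrC.
Qed.

(* The mean of a linear system is the fundamental matrix of the averaged
   equation; the adjoint system provides its inverse. *)
Lemma mean_matrix_unit a b k (FF : R -> 'M[R]_k) (X si : 'I_k -> R -> Omega -> 'cV[R]_k) :
  0 <= a -> a < b -> mdL2 a b FF ->
  (forall i, vitop a b (X i) (fun s om => FF s *m X i s om) (si i)) ->
  (forall i, {ae Pr, forall om, X i a om = delta_mx i 0}) ->
  forall t, a <= t <= b -> (\matrix_(j, i) mean (fun om => X i t om j 0)) \in unitmx.
Proof.
move=> a0 ab hF hX Xa t tab; have ab' := ltW ab; have /andP[at_ tb] := tab.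
have hNF : mdL2 a b (fun s => - (FF s)^T) by apply: mdL2N; exact: mdL2T.
have h0 : mdL2 a b (fun=> 0 : 'M[R]_k).
  by move=> i j; rewrite (_ : (fun s => _) = fun=> 0); [exact: indicc_dL2|apply/funext => s; rewrite mxE].
(* The adjoint equation $\dot z=-F'z$ is solved by the same existence theorem with zero diffusion;
   the means [zb] of the solutions are then deterministic and absolutely continuous. *)
have /choice[Z hZ] : forall j : 'I_k, exists Z : R -> Omega -> 'cV[R]_k,
    (exists si', vitop a b Z (fun s om => - (FF s)^T *m Z s om) si') /\
    {ae Pr, forall om, Z a om = delta_mx j 0}.
  move=> j.
  have [Z hZ] := linear_sde hw a0 ab hNF h0 (fun i : 'I_k => sL2_cst a b 0) (fun i : 'I_k => sL2_cst a b 0)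
    (fun i => @measurable_cst _ _ (F a) R setT ((delta_mx j 0 : 'cV[R]_k) i 0))
    (fun i => sqint_cst Pr ((delta_mx j 0 : 'cV[R]_k) i 0)).
  exists (fun s om => \col_i Z i s om); split; last first.
    by apply: vae_eq => i; apply: (ae_mono _ (hZ i).2) => om; rewrite mxE.
  exists (fun s om => \col_i affine (fun=> 0) (fun=> fun=> fun=> 0) Z i s om) => i.
  have := (hZ i).1; congr itop; apply/funext => s; apply/funext => om; rewrite ?mxE//.
  by rewrite /affine addr0; apply: eq_bigr => l _; rewrite [(\col_i0 _) l 0]mxE.
pose zb j s : 'cV[R]_k := \col_i mean (fun om => Z j s om i 0).
have hzb j i : acf a b (fun s => zb j s i 0) (fun s => (- (FF s)^T *m zb j s) i 0).
  have [[si' h] _] := hZ j; exact: (vmean_primitive a0 ab' hNF h).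
(* The deterministic function [zb] is turned into an Ito process by multiplying the constant process
   1. *)
have hdet j : vitop a b (fun s om => zb j s) (fun s om => - (FF s)^T *m zb j s) (fun s om => 0).
  move=> i; have := itop_mul_det hw a0 ab' (hzb j i) (itop_cst b 1 a0).
  congr itop; apply/funext => s; apply/funext => om; rewrite ?mxE; ring.
(* The pairing of [zb j] with the mean of [X i] is constant in time, since the two drift terms of
   the product formula are opposite; at time $a$ it is a Kronecker symbol. *)
have key j i : \sum_l zb j t l 0 * mean (fun om => X i t om l 0) = (i == j)%:R.
  have pf := vproduct_formula hw a0 at_ (vitop_restrictr tb (hdet j)) (vitop_restrictr tb (hX i)).
  have sX s : a <= s <= b -> vsqint Pr (X i s).
    by move=> sab l; exact: (itop_sqint hw a0 (hX i l) sab).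
  have sz s : vsqint Pr (fun=> zb j s) by move=> l; exact: sqint_cst.
  have E s : a <= s <= b -> edot Pr (fun=> zb j s) (X i s) = \sum_l zb j s l 0 * mean (fun om => X i s om l 0).
    move=> sab; rewrite (edot_integrable (sz s) (sX s sab)).2; apply: eq_bigr => l _.
    rewrite (sqint_mean (sX s sab l)) -(ipZr _ (sqint_cst Pr 1) (sX s sab l)) ipC.
    by apply: eq_ip => om; rewrite mulr1.
  have aab : a <= a <= b by rewrite lexx.
  rewrite -(E t tab) pf (E a aab).
  have Zal l : zb j a l 0 = (l == j)%:R.
    have [[si' h] ha] := hZ j; rewrite mxE (mean_ae_cst (itop_sqint hw a0 (h l) aab) (c := (l == j)%:R))//.
    by apply: (ae_mono _ ha) => om ->; rewrite mxE eqxx andbT.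
  have Xal l : mean (fun om => X i a om l 0) = (l == i)%:R.
    rewrite (mean_ae_cst (sX a aab l) (c := (l == i)%:R))//.
    by apply: (ae_mono _ (Xa i)) => om ->; rewrite mxE eqxx andbT.
  have -> : \sum_l zb j a l 0 * mean (fun om => X i a om l 0) = (i == j)%:R.
    rewrite (bigD1 j)//= big1 ?addr0; last by move=> l /negbTE lj; rewrite Zal lj mul0r.
    by rewrite Zal Xal eqxx mul1r eq_sym.
  have sz1 : vsL2 a t (fun s om => zb j s) by apply: vitop_vsL2; exact: vitop_restrictr (hdet j).
  have sFX : vsL2 a t (fun s om => FF s *m X i s om).
    by move=> l; have [_ s1 _ _ _] := vitop_restrictr tb (hX i) l.
  have [i1 _] := iL1_vdot sz1 sFX; have [_ e1] := EmZ (-1) i1.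
  have -> : Em Pr a t (vdot (fun s om => - (FF s)^T *m zb j s) (X i)) =
      - Em Pr a t (vdot (fun s om => zb j s) (fun s om => FF s *m X i s om)).
    rewrite -mulN1r -e1; apply: eq_Em => s om _; rewrite /vdot mulNmx linearN/= trmx_mul trmxK.
    by rewrite mulNmx mulmxA mxE mulN1r.
  have -> : Em Pr a t (vdot (fun s om => 0) (si i)) = 0.
    rewrite (@eq_Em _ _ _ _ _ _ _ (fun=> fun=> 0)); last by move=> s om _; rewrite /vdot linear0 mul0mx mxE.
    rewrite /Em -[RHS](Rintegral0 M setT); apply: eq_Rintegral => z _.
    by rewrite /cut; case: ifP.
  by rewrite addr0 subrK.
have E1 : (\matrix_(j, l) zb j t l 0) *m (\matrix_(j, i) mean (fun om => X i t om j 0)) = 1%:M.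
  apply/matrixP => j i; rewrite !mxE -[RHS](congr1 (fun b : bool => b%:R) (eq_sym i j)) -key.
  by apply: eq_bigr => l _; rewrite [X in X * _]mxE [X in _ * X]mxE.
by have [] := mulmx1_unit E1.
Qed.

End means.

Section averages.
Context d (Omega : measurableType d) (R : realType).
Variables (Pr : probability Omega R) (w : R -> Omega -> R).
Local Notation leb := (@lebesgue_measure R).
Local Notation mean X := (\int[Pr]_om X om).

Lemma Rintegral_eq0_ae d' (S : measurableType d') (mu : {measure set S -> \bar R}) (f : S -> R) :
  mu.-integrable setT (EFin \o f) -> (forall x, 0 <= f x) -> \int[mu]_x f x = 0 ->
  {ae mu, forall x, f x = 0}.
Proof.
move=> if_ f0 e0.
have h : (\int[mu]_x `|(f x)%:E| = 0)%E.
  rewrite (eq_integral (EFin \o f)) => [|x _]; last by rewrite /= ger0_norm.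
  by rewrite -(fineK (integrable_fin_num measurableT if_)) -[fine _]/(\int[mu]_x f x) e0.
have := (ae_eq_integral_abs mu measurableT (measurable_int _ if_)).1 h.
by apply: ae_mono => x /(_ I) [].
Qed.

Lemma Em_ae0 a b h : iL1 Pr a b h ->
  {ae leb, forall t : R, a <= t <= b -> {ae Pr, forall om, h t om = 0}} -> Em Pr a b h = 0.
Proof.
move=> ih h0; rewrite /Em [LHS](Rfubini1 ih) -[RHS](Rintegral0 leb setT).
have mh : measurable_fun setT (cut a b h) by apply/measurable_EFinP; exact: measurable_int ih.
apply: ae_eq_Rintegral; [exact: (measurable_Rintegral_param2 ih)|exact: measurable_cst|].
apply: (ae_mono _ h0) => t ht; rewrite -[RHS](Rintegral0 Pr setT).
apply: ae_eq_Rintegral; [|exact: measurable_cst|].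
  by apply: (measurableT_comp mh); exact: pair1_measurable.
have [tab|tab] := boolP (a <= t <= b).
  by apply: (ae_mono _ (ht tab)) => om; rewrite /cut/= tab.
by apply: aeW => om; rewrite /cut/= (negbTE tab).
Qed.

(** For almost every $s$ each component has $E(z_s^i)^2=0$, and $(Ez_s^i)^2\le E(z_s^i)^2$ by
    Cauchy-Schwarz with the constant 1. *)
Lemma mean_eq0_of_norm a b k (z : R -> Omega -> 'cV[R]_k) : vsL2 Pr w a b z ->
  (forall s, a <= s <= b -> forall i, measurable_fun setT (fun om => z s om i 0)) ->
  Em Pr a b (vdot z z) = 0 ->
  {ae leb, forall s : R, a <= s <= b -> forall i, mean (fun om => z s om i 0) = 0}.
Proof.
move=> sz mz; rewrite (iL1_vdot sz sz).2 => /eqP.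
rewrite psumr_eq0 => [/allP h|i _]; last exact: ip_ge0.
have hi i : {ae leb, forall s : R, a <= s <= b -> mean (fun om => z s om i 0) = 0}.
  have /eqP zi := h i (mem_index_enum i).
  have s2 := sqint_mul (sz i).2 (sz i).2.
  have := Rintegral_eq0_ae (Rfubini1_integrable s2) _; rewrite -(Rfubini1 s2) => /(_ _ zi) h1.
  have h3 := ae_integrable1 s2.
  apply: (ae_mono2 _ (h1 _) h3) => [s e is_ sab|s].
    have szs : sqint Pr (fun om => z s om i 0).
      apply/sqintP; split; first exact: mz.
      by move: is_; congr (integrable _ _ _); apply/funext => om; rewrite /cut/= sab.
    have := cauchy_schwarz szs (sqint_cst Pr 1).
    have -> : ip Pr (fun om => z s om i 0) (fun om => z s om i 0) = 0.
      by rewrite -[RHS]e; apply: eq_Rintegral => om _; rewrite /cut/= sab.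
    rewrite mul0r -(sqint_mean szs) => h4.
    by apply/eqP; rewrite -sqrf_eq0 eq_le h4 sqr_ge0.
  by apply: Rintegral_ge0 => om _; rewrite -expr2 sqr_ge0.
by apply: (ae_mono _ (ae_forall_fin hi)) => s hs sab i; exact: hs.
Qed.

End averages.

(** A nonnegative parabola through the origin has no linear term. The test point is $c=S/(|N|+1)$,
    where the value is at most $-S^2/(|N|+1)$; the summand 1 keeps the denominator positive. *)
Lemma nonneg_parabola_linear_term (R : realType) (N S : R) : 0 <= S ->
  (forall c, 0 <= c ^+ 2 * N - 2 * c * S) -> S = 0.
Proof.
move=> S0 h; pose N' := `|N| + 1.
have N'0 : 0 < N' by rewrite ltr_wpDl.
have NN : N <= N' by rewrite (le_trans (ler_norm N))// lerDl.
have h1 := h (S / N').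
have h2 : (S / N') ^+ 2 * N <= (S / N') ^+ 2 * N' by rewrite ler_wpM2l// sqr_ge0.
have h3 : (S / N') ^+ 2 * N' = S ^+ 2 / N' by field; rewrite gt_eqF.
have h4 : 2 * (S / N') * S = 2 * (S ^+ 2 / N') by field; rewrite gt_eqF.
have h5 : S ^+ 2 / N' <= 0 by move: h1 h2; rewrite h3 h4; lra.
apply/eqP; rewrite -sqrf_eq0 eq_le sqr_ge0 andbT.
by move: h5; rewrite ler_pdivrMr// mul0r.
Qed.

Lemma mulmx_eq0_cV (R : realType) (k l : nat) (A : 'M[R]_(k, l)) :
  (forall v : 'cV_l, A *m v = 0) -> A = 0.
Proof.
move=> h; apply/matrixP => i j; have := congr1 (fun B : 'cV_k => B i 0) (h (delta_mx j 0)).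
by rewrite -colE !mxE.
Qed.

(** With $p=Px$ and $q=P(\bar Ax+\bar Bu)$, the drift of $Px$ is that of the costate equation. [N]
    is again the quadratic Riccati term, known through its action on $x$ when $u=Kx$. *)
Lemma adjoint_identity (R : realType) (n m : nat) (A Ab P Q N : 'M[R]_n) (B Bb : 'M[R]_(n, m))
    (x : 'cV[R]_n) (u : 'cV[R]_m) :
  N *m x = - ((P *m B + Ab^T *m P *m Bb) *m u) ->
  (- (A^T *m P + Ab^T *m P *m Ab + P *m A + Q - N)) *m x + P *m (A *m x + B *m u) =
  - (A^T *m (P *m x) + Ab^T *m (P *m (Ab *m x + Bb *m u)) + Q *m x).
Proof.
move=> hN; rewrite mulNmx mulmxBl hN opprB !mulmxDl !mulmxDr !mulmxA.
move: (A^T *m P *m x) (Ab^T *m P *m Ab *m x) (P *m A *m x) (Q *m x) (P *m B *m u) (Ab^T *m P *m Bb *m u).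
move=> a b c e f g; apply/matrixP => i j; rewrite !mxE; ring.
Qed.

(** For the same $p$ and $q$ the stationarity condition reads $\Gamma_0x+\Upsilon_0u=0$, that is
    $Lx=0$ when $u=Kx$. *)
Lemma stationarity_identity (R : realType) (n m : nat) (Ab P : 'M[R]_n) (B Bb : 'M[R]_(n, m))
    (S : 'M[R]_m) (x : 'cV[R]_n) (u : 'cV[R]_m) :
  S *m u + B^T *m (P *m x) + Bb^T *m (P *m (Ab *m x + Bb *m u)) =
  (B^T *m P + Bb^T *m P *m Ab) *m x + (S + Bb^T *m P *m Bb) *m u.
Proof.
rewrite !mulmxDl !mulmxDr !mulmxA.
move: (S *m u) (B^T *m P *m x) (Bb^T *m P *m Ab *m x) (Bb^T *m P *m Bb *m u).
move=> a b c e; apply/matrixP => i j; rewrite !mxE; ring.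
Qed.

(** * Regularity implies homogeneity *)

Section main_directions.
Context d (Omega : measurableType d) (R : realType).
Variables (Pr : probability Omega R) (w : R -> Omega -> R).
Hypothesis hw : brownian_motion Pr w.
Variables (n m : nat) (t0 T : R) (D : lq_data R n m) (P : R -> 'M[R]_n).
Hypotheses (t00 : 0 <= t0) (htT : t0 < T) (hD : lq_coefficients t0 T D)
  (hJ : convexity Pr w t0 T D)
  (hP : riccati_solution t0 T D P) (hK : square_integrable_gain t0 T D P).
Local Notation leb := (@lebesgue_measure R).
Local Notation F := (filtration_type Pr w).
Local Notation vsL2 := (vsL2 Pr w).
Local Notation vitop := (vitop Pr w).
Local Notation Em := (Em Pr).
Local Notation edot := (edot Pr).
Local Notation vsqint := (vsqint Pr).
Local Notation dyn := (dyn D).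
Local Notation dif := (dif D).
Local Notation adj := (adj D).
Local Notation L := (defect D P).
Local Notation fb := (feedback D P).

Definition defect_vanishes := {ae leb, forall t : R, t0 <= t <= T -> L t = 0}.

(** $\Upsilon_0\Upsilon_0^\dagger$ fixes exactly the vectors in the range of $\Upsilon_0$, so the
    inclusion of ranges means $\Upsilon_0\Upsilon_0^\dagger\Gamma_0=\Gamma_0$, that is $L=0$, at
    each time. *)
Lemma regularP : regular t0 T D P <-> defect_vanishes.
Proof.
split; apply: ae_mono => t h tT; have [e1 e2 e3 e4] := mpinvP (Upsilon0 D P t).
  apply: mulmx_eq0_cV => v; have [] := h tT (Gamma0 D P t *m v); first by exists v.
  move=> y _ /= yv; rewrite defectE mulmxBl -yv -!mulmxA -yv.
  by rewrite !mulmxA e1 subrr.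
move=> _ [v _ <-]; exists (mpinv (Upsilon0 D P t) *m Gamma0 D P t *m v) => //.
have := h tT; rewrite defectE => /eqP; rewrite subr_eq0 => /eqP h1.
by rewrite !mulmxA -h1.
Qed.

Let T0 : 0 <= T. Proof. by rewrite (le_trans t00)// ltW. Qed.

Lemma const_F a (c : R) : measurable_fun [set: F a] ((fun=> c) : F a -> R).
Proof. exact: measurable_cst. Qed.

Lemma free_closed_loop a (xi : Omega -> 'cV[R]_n) : t0 <= a -> a < T ->
  (forall i, measurable_fun [set: F a] ((fun om => xi om i 0) : F a -> R)) -> vsqint xi ->
  exists2 X, vitop a T X (dyn X (fb X)) (dif X (fb X)) & {ae Pr, forall om, X a om = xi om}.
Proof.
move=> t0a aT mxi sxi.
have s0 : vsL2 a T (fun _ _ => 0 : 'cV[R]_m).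
  move=> i; have := @sL2_cst _ _ _ Pr w a T 0; congr sL2.
  by apply/funext => s; apply/funext => om; rewrite mxE.
have [X [hX Xa _]] := closed_loop hw t00 hD hK t0a aT mxi sxi s0.
have E : (fun s om => fb X s om + 0) = fb X.
  by apply/funext => s; apply/funext => om; rewrite addr0.
by rewrite E in hX; exists X; [exact: hX|exact: Xa].
Qed.

Lemma dif_sL2 a x u : t0 <= a -> vsL2 a T x -> vsL2 a T u -> vsL2 a T (dyn x u) /\ vsL2 a T (dif x u).
Proof. by move=> t0a; exact: (dyn_sL2 hD t0a). Qed.

Lemma regular_solution x0 : defect_vanishes -> exists x p q u, fbsde_solution Pr w t0 T D x0 x p q u.
Proof.
move=> L0.
have sx0 : vsqint (fun=> x0) by move=> i; exact: sqint_cst.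
have [x hx xa] := free_closed_loop (lexx t0) htT (fun i => @const_F t0 (x0 i 0)) sx0.
have sx := vitop_vsL2 hx; have su := feedback_sL2 hw t00 hK (lexx t0) htT hx.
have [sd sf] := dif_sL2 (lexx t0) sx su.
have hp := vitop_mul_det hw t00 (ltW htT) (riccati_acf htT hD hP hK) hx.
have hPb := P_mdbd htT hP.
have sq := vsL2M hPb sf; have sp := vsL2M hPb sx.
exists x, (fun s om => P s *m x s om), (fun s om => P s *m dif x (fb x) s om), (fb x).
split.
- by split; apply/(L2_processP hw).
- apply: (ae_mono _ L0) => t h tT; apply: aeW => om.
  rewrite stationarity_identity -[RHS](_ : L t *m x t om = _); first by rewrite h// mul0mx.
  by rewrite /defect [LHS]mulmxDl -[in LHS](mulmxA (Upsilon0 D P t)).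
- by split=> //; exact: (vitop_equation hx).
- move=> t tT i; have [_ _ _ _] := hp i; move=> /(_ t tT).
  congr (is_ito_integral _ _ _ _ _ _); apply/funext => om; congr (_ - _).
  apply: eq_Rintegral => s; rewrite inE/= in_itv/= => /andP[ts st].
  have sT : t0 <= s <= T by rewrite ts (le_trans st)//; case/andP: tT.
  congr (fun Z : 'cV_n => Z i 0); apply: adjoint_identity.
  by rewrite -(Ga_tr hP sT) /feedback /gain mulNmx mulmxN opprK !mulmxA.
- by apply: aeW => om; rewrite (P_end htT hP).
Qed.

(** Translation of a solution into Ito processes, with the stationarity condition in the integrated
    form that [fbsde_duality] takes, on every $[a,T]$. *)
Lemma solution_vitop x0 x p q u : fbsde_solution Pr w t0 T D x0 x p q u ->
  [/\ vitop t0 T x (dyn x u) (dif x u), vitop t0 T p (adj x p q) q, vsL2 t0 T q & vsL2 t0 T u] /\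
  forall a ze, t0 <= a -> a < T -> vsL2 a T ze ->
    Em a T (vdot (fun s om => lqR D s *m u s om + (lqB D s)^T *m p s om + (lqBbar D s)^T *m q s om) ze) = 0.
Proof.
move=> [[hx hp hq hu] st [ex x0E] ep pT].
have LP k (y : R -> Omega -> 'cV[R]_k) : L2_process Pr w t0 T y -> vsL2 t0 T y.
  by move=> h; apply/(L2_processP hw).
have [sx sp sq su] := And4 (LP _ _ hx) (LP _ _ hp) (LP _ _ hq) (LP _ _ hu).
have [sd sf] := dif_sL2 (lexx t0) sx su.
have [[hA hAb hB hBb] hQ hR] := lq_mdbd hD.
have sadj : vsL2 t0 T (adj x p q).
  apply: vsL2N; apply: vsL2D; last exact: vsL2M.
  by apply: vsL2D; apply: vsL2M => //; exact: mdbdT.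
have ix := vitopP hw t00 htT sx sd sf ex; have ip_ := vitopP hw t00 htT sp sadj sq ep.
split; first by split; [exact: ix|exact: ip_|exact: sq|exact: su].
move=> a ze t0a aT sz.
have sS : vsL2 t0 T (fun s om => lqR D s *m u s om + (lqB D s)^T *m p s om + (lqBbar D s)^T *m q s om).
  apply: vsL2D; first apply: vsL2D; apply: vsL2M => //; exact: mdbdT.
have [i1 _] := iL1_vdot (vsL2W t0a (lexx T) sS) sz.
apply: (Em_ae0 i1); apply: (ae_mono _ st) => t ht /andP[at_ tT].
have tT' : t0 <= t <= T by rewrite (le_trans t0a).
by apply: (ae_mono _ (ht tT')) => om e; rewrite /vdot -e linear0 mul0mx mxE.
Qed.

Lemma edot_aeE k (f f' g g' : Omega -> 'cV[R]_k) : vsqint f -> vsqint f' -> vsqint g -> vsqint g' ->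
  {ae Pr, forall om, f om = f' om} -> {ae Pr, forall om, g om = g' om} -> edot f g = edot f' g'.
Proof.
move=> sf sf' sg sg' ef eg; rewrite (edot_integrable sf sg).2 (edot_integrable sf' sg').2.
apply: eq_bigr => i _; have [m1 m2] := (sqint_meas (sf i), sqint_meas (sf' i)).
have [m3 m4] := (sqint_meas (sg i), sqint_meas (sg' i)).
by apply: (ae_ip m1 m2 m3 m4); apply: (ae_mono2 _ ef eg) => om -> ->.
Qed.

Lemma edot_eq0 k (f : Omega -> 'cV[R]_k) : vsqint f -> edot f f = 0 -> {ae Pr, forall om, f om = 0}.
Proof.
move=> sf; rewrite (edot_integrable sf sf).2 => /eqP; rewrite psumr_eq0 => [/allP h|i _]; last exact: ip_ge0.
apply: vae_eq => i; have /eqP zi := h i (mem_index_enum i).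
by apply: (ae_mono _ (ip_eq0_ae (sf i) zi)) => om ->; rewrite mxE.
Qed.

Lemma Em_defect a u Y b s : defect_vanishes -> t0 <= a -> a < T -> vsL2 a T u -> vitop a T Y b s ->
  Em a T (vdot u (fun s om => L s *m Y s om)) = 0.
Proof.
move=> L0 t0a aT su hY.
have sL := vsL2M_dL2 hw (le_trans t00 t0a) (ltW aT) (mdL2W t0a (lexx T) (defect_mdL2 htT hD hP hK)) hY.
have [i1 _] := iL1_vdot su sL.
apply: (Em_ae0 i1); apply: (ae_mono _ L0) => t ht /andP[at_ tT]; apply: aeW => om.
by rewrite /vdot ht ?(le_trans t0a)// mul0mx mulmx0 mxE.
Qed.

Lemma regular_homogeneous x0 x p q u t1 : defect_vanishes -> fbsde_solution Pr w t0 T D x0 x p q u ->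
  t0 <= t1 <= T -> {ae Pr, forall om, p t1 om - P t1 *m x t1 om = 0}.
Proof.
move=> L0 hs t1T; have [[hx hp sq su] hst] := solution_vitop hs.
have [_ _ _ _ pT] := hs; have /andP[t01 t1T'] := t1T.
(* At $t_1=T$ no interval is left for a closed loop; the terminal conditions of $p$ and $P$ give the
   claim. *)
have [t1E|t1lt] := eqVneq t1 T.
  by apply: (ae_mono _ pT) => om e; rewrite t1E e (P_end htT hP) subrr.
have t1lt' : t1 < T by rewrite lt_neqAle t1lt.
have a0 := le_trans t00 t01.
have hx1 := vitop_restrict hw t00 t01 t1T' hx; have hp1 := vitop_restrict hw t00 t01 t1T' hp.
have sq1 := vsL2W t01 (lexx T) sq; have su1 := vsL2W t01 (lexx T) su.
have sx1 := vitop_vsL2 hx1.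
have t11 : t1 <= t1 <= T by rewrite lexx.
have sxt := vitop_sqint hw t00 t01 hx1 t11; have spt := vitop_sqint hw t00 t01 hp1 t11.
have sPx := vsqint_mul (P t1) sxt.
pose xi om := p t1 om - P t1 *m x t1 om.
have sxi : vsqint xi.
  move=> i; rewrite (_ : (fun om => _) = fun om => p t1 om i 0 - (P t1 *m x t1 om) i 0); first exact: sqintB.
  by apply/funext => om; rewrite /xi !mxE.
(* The value of $\Theta$ at $t_1$ is known at that time, hence an admissible initial state. *)
have mxi i : measurable_fun [set: F t1] ((fun om => xi om i 0) : F t1 -> R).
  have mp := itop_F (hp1 i) t11.
  have mx j := itop_F (hx1 j) t11.
  rewrite (_ : (fun om => _) = fun om => p t1 om i 0 - \sum_j P t1 i j * x t1 om j 0).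
    apply: measurable_funB => //; apply: measurable_sum => j; apply: measurable_funM => //.
  by apply/funext => om; rewrite /xi !mxE.
have [Y hY Ya] := free_closed_loop t01 t1lt' mxi sxi.
have sv := feedback_sL2 hw t00 hK t01 t1lt' hY.
have TT : t1 <= T <= T by rewrite t1T' lexx.
have sxT := vitop_sqint hw t00 t01 hx1 TT.
have dual := fbsde_duality hw t00 hD t01 t1lt' sx1 sq1 su1 sv hp1 hY (hst _ _ t01 t1lt' sv) pT sxT.
have comp := jf_feedback hw t00 htT hD hP hK t01 t1lt' su1 hx1 hY.
(* The defect term vanishes, and the two evaluations of the same value of $J$ give
   $E\,p(t_1)'Y(t_1)=E\,x(t_1)'P(t_1)Y(t_1)$. *)
rewrite (Em_defect L0 t01 t1lt' su1 hY) addr0 dual in comp.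
have sYt := vitop_sqint hw t00 t01 hY t11.
have e1 : edot (x t1) (fun om => P t1 *m Y t1 om) = edot (fun om => P t1 *m x t1 om) (Y t1).
  by apply: eq_Rintegral => om _; rewrite trmx_mul (P_sym hP)// mulmxA.
have e2 : edot xi (Y t1) = 0.
  rewrite (_ : xi = fun om => -1 *: (P t1 *m x t1 om) + p t1 om).
    by rewrite (edotDl (-1) sPx spt sYt) comp e1; ring.
  by apply/funext => om; rewrite /xi scaleN1r addrC.
have e3 : edot xi xi = 0.
  rewrite -[RHS]e2; apply: edot_aeE => //; first exact: aeW.
  by apply: (ae_mono _ Ya) => om ->.
exact: (edot_eq0 sxi e3).
Qed.

End main_directions.

(** * Homogeneity implies regularity *)

Section necessity.
Context d (Omega : measurableType d) (R : realType).
Variables (Pr : probability Omega R) (w : R -> Omega -> R).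
Hypothesis hw : brownian_motion Pr w.
Variables (n m : nat) (t0 T : R) (D : lq_data R n m) (P : R -> 'M[R]_n).
Hypotheses (t00 : 0 <= t0) (htT : t0 < T) (hD : lq_coefficients t0 T D)
  (hJ : convexity Pr w t0 T D)
  (hP : riccati_solution t0 T D P) (hK : square_integrable_gain t0 T D P).
Local Notation leb := (@lebesgue_measure R).
Local Notation M := (leb \x Pr)%E.
Local Notation F := (filtration_type Pr w).
Local Notation vsL2 := (vsL2 Pr w t0 T).
Local Notation vitop := (vitop Pr w t0 T).
Local Notation Em := (Em Pr t0 T).
Local Notation edot := (edot Pr).
Local Notation vsqint := (vsqint Pr).
Local Notation jf := (jf Pr T D t0).
Local Notation dyn := (dyn D).
Local Notation dif := (dif D).
Local Notation L := (defect D P).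
Local Notation fb := (feedback D P).

Lemma state_lin c x u x' u' : vitop x (dyn x u) (dif x u) -> vitop x' (dyn x' u') (dif x' u') ->
  vitop (fun s om => c *: x s om + x' s om)
    (dyn (fun s om => c *: x s om + x' s om) (fun s om => c *: u s om + u' s om))
    (dif (fun s om => c *: x s om + x' s om) (fun s om => c *: u s om + u' s om)).
Proof.
move=> h h'; have := vitop_lin hw c t00 h h'.
have E k l (A : R -> 'M[R]_(k, n)) (B : R -> 'M[R]_(k, l)) (v v' : R -> Omega -> 'cV[R]_l) :
    (fun s om => c *: (A s *m x s om + B s *m v s om) + (A s *m x' s om + B s *m v' s om)) =
    (fun s om => A s *m (c *: x s om + x' s om) + B s *m (c *: v s om + v' s om)).
  apply/funext => s; apply/funext => om.
  by rewrite !mulmxDr -!scalemxAr scalerDr addrACA.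
by rewrite /dyn /dif !E.
Qed.

Lemma vsL2_lin c k (f g : R -> Omega -> 'cV[R]_k) : vsL2 f -> vsL2 g ->
  vsL2 (fun s om => c *: f s om + g s om).
Proof.
move=> sf sg i; have := sL2_lin c (sf i) (sg i); congr sL2.
by apply/funext => s; apply/funext => om; rewrite !mxE.
Qed.

Lemma edot0 k (f g : Omega -> 'cV[R]_k) : vsqint f -> vsqint g ->
  {ae Pr, forall om, f om = 0} -> edot f g = 0.
Proof.
move=> sf sg f0; have s0 : vsqint (fun=> 0 : 'cV[R]_k) by move=> i; exact: sqint_cst.
rewrite (edot_aeE sf s0 sg sg f0 (aeW _ (fun=> erefl))).
rewrite -[RHS](Rintegral0 Pr setT); apply: eq_Rintegral => om _.
by rewrite linear0 mul0mx mxE.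
Qed.

Lemma homogeneous_defect_mean x0 Phi : homogeneous Pr w t0 T D P ->
  vitop Phi (dyn Phi (fb Phi)) (dif Phi (fb Phi)) -> {ae Pr, forall om, Phi t0 om = x0} ->
  Em (vdot (fun s om => L s *m Phi s om) (fun s om => L s *m Phi s om)) = 0.
Proof.
move=> [/(_ x0)[X [p [q [u hs]]]] /(_ x0 X p q u hs) hom] hPhi Phi0.
have t0T : t0 <= T := ltW htT.
have b0 : t0 <= t0 <= T by rewrite lexx.
have bT : t0 <= T <= T by rewrite t0T lexx.
have [[hX hp sq su] hst] := solution_vitop hw t00 htT hD hs.
have [_ _ [_ X0] _ pT] := hs.
(* [v] is the control of $\Phi$ and [z] the defect along $\Phi$; [eta] below is the closed loop from
   0 with control $K\eta+z$. *)
pose v := fb Phi; pose z s om : 'cV[R]_m := L s *m Phi s om.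
have sv : vsL2 v := feedback_sL2 hw t00 hK (lexx t0) htT hPhi.
have sz : vsL2 z := vsL2M_dL2 hw t00 t0T (defect_mdL2 htT hD hP hK) hPhi.
have s0 : vsqint (fun=> 0 : 'cV[R]_n) by move=> i; exact: sqint_cst.
have m0 i : measurable_fun [set: F t0] ((fun=> (0 : 'cV[R]_n) i 0) : F t0 -> R) by exact: measurable_cst.
have [eta [heta eta0 szeta]] := closed_loop hw t00 hD hK (lexx t0) htT m0 s0 sz.
set ze := fun s om => _ in heta szeta.
pose y s om : 'cV[R]_n := -1 *: Phi s om + X s om.
pose th s om : 'cV[R]_m := -1 *: v s om + u s om.
have hy : vitop y (dyn y th) (dif y th) := state_lin (-1) hPhi hX.
have sth : vsL2 th := vsL2_lin (-1) sv su.
have [sX sPhi seta sy] := And4 (vitop_vsL2 hX) (vitop_vsL2 hPhi) (vitop_vsL2 heta) (vitop_vsL2 hy).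
have Q (Y b s : R -> Omega -> 'cV[R]_n) t : vitop Y b s -> t0 <= t <= T -> vsqint (Y t).
  by move=> h; exact: (vitop_sqint hw t00 (lexx t0) h).
have y0 : {ae Pr, forall om, y t0 om = 0}.
  by apply: (ae_mono2 _ Phi0 X0) => om; rewrite /y => -> ->; rewrite scaleN1r addNr.
have dual Y zz : vsL2 zz -> vitop Y (dyn Y zz) (dif Y zz) -> jf X u Y zz = edot (p t0) (Y t0).
  move=> szz hY; exact: (fbsde_duality hw t00 hD (lexx t0) htT sX sq su szz hp hY
    (hst _ _ (lexx t0) htT szz) pT (Q _ _ _ _ hX bT)).
have comp Y zz : vsL2 zz -> vitop Y (dyn Y zz) (dif Y zz) ->
    jf Y zz Phi v = edot (Y t0) (fun om => P t0 *m Phi t0 om) + Em (vdot zz z).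
  by move=> szz hY; exact: (jf_feedback hw t00 htT hD hP hK (lexx t0) htT szz hY hPhi).
have sPPhi := vsqint_mul (P t0) (Q _ _ _ _ hPhi b0).
(* The two evaluations of $J((X,u),(\Phi,K\Phi))$: homogeneity at time $t_0$ equates their boundary
   terms and leaves $E\int u'L\Phi=0$. *)
have uz : Em (vdot u z) = 0.
  have := comp X u su hX; rewrite (dual Phi v sv hPhi).
  have -> : edot (p t0) (Phi t0) = edot (X t0) (fun om => P t0 *m Phi t0 om).
    have -> : edot (X t0) (fun om => P t0 *m Phi t0 om) = edot (fun om => P t0 *m X t0 om) (Phi t0).
      by apply: eq_Rintegral => om _; rewrite trmx_mul (P_sym hP)// mulmxA.
    apply: (edot_aeE (Q _ _ _ _ hp b0) (vsqint_mul _ (Q _ _ _ _ hX b0)) (Q _ _ _ _ hPhi b0) (Q _ _ _ _ hPhi b0)).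
      by apply: (ae_mono _ (hom t0 b0)) => om /eqP; rewrite subr_eq0 => /eqP.
    exact: aeW.
  by move=> h; apply: (addrI (edot (X t0) (fun om => P t0 *m Phi t0 om))); rewrite -h addr0.
(* Feedback controls are orthogonal to [z], by $K'L=0$. *)
have vz Y b s : vitop Y b s -> Em (vdot (fb Y) z) = 0.
  move=> hY; rewrite (@eq_Em _ _ _ _ _ _ _ (fun=> fun=> 0)).
    by rewrite /Em -[RHS](Rintegral0 M setT); apply: eq_Rintegral => zz _; rewrite /cut; case: ifP.
  move=> r om rT; rewrite /vdot /z /feedback trmx_mul mulmxA -[X in X *m _]mulmxA.
  by rewrite (mpinv_gain hD hP rT) mulmx0 mul0mx mxE.
have thz : Em (vdot th z) = 0.
  by rewrite (Em_vdot_linl (-1) sv su sz) (vz _ _ _ hPhi) uz mulr0 addr0.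
(* As [y] starts from 0, both $\Phi$ and $X$ turn out to be orthogonal to it for $J$; hence so is
   their difference, [y] itself. *)
have j1 : jf y th Phi v = 0.
  by rewrite (comp y th sth hy) thz addr0; exact: edot0 (Q _ _ _ _ hy b0) sPPhi y0.
have j2 : jf X u y th = 0.
  rewrite (dual y th sth hy); rewrite edotC; exact: edot0 (Q _ _ _ _ hy b0) (Q _ _ _ _ hp b0) y0.
have lin Y zz : vsL2 zz -> vitop Y (dyn Y zz) (dif Y zz) ->
    jf y th Y zz = - jf Phi v Y zz + jf X u Y zz.
  move=> szz hY.
  by rewrite /y /th (jf_linl hD (-1) (lexx t0) htT sPhi sv sX su (vitop_vsL2 hY) szz
    (Q _ _ _ _ hPhi bT) (Q _ _ _ _ hX bT) (Q _ _ _ _ hY bT)) mulN1r.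
have j3 : jf y th y th = 0.
  by rewrite (lin y th sth hy) (jf_sym Pr hD _ _ _ _ (lexx t0)) j1 j2 oppr0 addr0.
pose S := Em (vdot z z).
(* Against $\Phi$ only the part [z] of the control of [eta] contributes. *)
have j4 : jf eta ze Phi v = S.
  rewrite (comp eta ze szeta heta) (edot0 (Q _ _ _ _ heta b0) sPPhi eta0) add0r.
  have -> : Em (vdot ze z) = Em (vdot (fun s om => 1 *: fb eta s om + z s om) z).
    by congr (Em (vdot _ z)); apply/funext => s; apply/funext => om; rewrite scale1r.
  have sfb := feedback_sL2 hw t00 hK (lexx t0) htT heta.
  by rewrite (Em_vdot_linl 1 sfb sz sz) (vz _ _ _ heta) mulr0 add0r.
(* The costate evaluation is 0 because [eta] starts from 0; with [j4] this gives $J(y,\eta)=-S$. *)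
have j5 : jf X u eta ze = 0.
  rewrite (dual eta ze szeta heta); rewrite edotC; exact: edot0 (Q _ _ _ _ heta b0) (Q _ _ _ _ hp b0) eta0.
have j6 : jf y th eta ze = - S.
  by rewrite (lin eta ze szeta heta) j5 addr0 (jf_sym Pr hD _ _ _ _ (lexx t0)) j4.
have sS : 0 <= S.
  rewrite /S (iL1_vdot sz sz).2; apply: sumr_ge0 => i _; exact: ip_ge0.
(* The pair $c\,\eta+y$ starts from 0, so convexity applies to it; its cost is $c^2J(\eta,\eta)-2cS$
   since $J(y,y)=0$. *)
apply: (@nonneg_parabola_linear_term _ (jf eta ze eta ze) S sS) => c.
pose x1 s om : 'cV[R]_n := c *: eta s om + y s om.
pose u1 s om : 'cV[R]_m := c *: ze s om + th s om.
have h1 : vitop x1 (dyn x1 u1) (dif x1 u1) := state_lin c heta hy.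
have su1 : vsL2 u1 := vsL2_lin c szeta sth.
have x10 : {ae Pr, forall om, x1 t0 om = 0}.
  by apply: (ae_mono2 _ eta0 y0) => om; rewrite /x1 => -> ->; rewrite scaler0 addr0.
have := convex_jf_ge0 hw t00 htT hD hJ su1 h1 x10.
have lin1 Y zz : vsL2 zz -> vitop Y (dyn Y zz) (dif Y zz) ->
    jf x1 u1 Y zz = c * jf eta ze Y zz + jf y th Y zz.
  move=> szz hY.
  exact: (jf_linl hD c (lexx t0) htT seta szeta sy sth (vitop_vsL2 hY) szz
    (Q _ _ _ _ heta bT) (Q _ _ _ _ hy bT) (Q _ _ _ _ hY bT)).
rewrite (lin1 x1 u1 su1 h1) (jf_sym Pr hD eta ze x1 u1 (lexx t0)) (jf_sym Pr hD y th x1 u1 (lexx t0)).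
rewrite (lin1 eta ze szeta heta) (lin1 y th sth hy) (jf_sym Pr hD eta ze y th (lexx t0)) j3 j6.
by congr (_ <= _); ring.
Qed.

Lemma homogeneous_defect : homogeneous Pr w t0 T D P -> defect_vanishes t0 T D P.
Proof.
move=> hom; have t0T := ltW htT.
have /choice[Phi hPhi] : forall i : 'I_n, exists Phi : R -> Omega -> 'cV[R]_n,
    vitop Phi (dyn Phi (fb Phi)) (dif Phi (fb Phi)) /\
    {ae Pr, forall om, Phi t0 om = delta_mx i 0}.
  move=> i.
  have mi j : measurable_fun [set: F t0] ((fun=> (delta_mx i 0 : 'cV[R]_n) j 0) : F t0 -> R).
    exact: measurable_cst.
  have si : vsqint (fun=> delta_mx i 0) by move=> j; exact: sqint_cst.
  by have [X hX X0] := free_closed_loop hw t00 hD hK (lexx t0) htT mi si; exists X.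
pose FF s := lqA D s + lqB D s *m gain D P s.
have [[hA _ hB _] _ _] := lq_mdbd hD.
have hFF : mdL2 t0 T FF.
  by apply: mdL2D; [exact: mdbd_mdL2|exact: mdL2M hB (gain_mdL2 hK)].
have hPhi' i : vitop (Phi i) (fun s om => FF s *m Phi i s om) (dif (Phi i) (fb (Phi i))).
  have := (hPhi i).1; congr vitop; apply/funext => s; apply/funext => om.
  by rewrite /dyn /FF /feedback mulmxDl mulmxA.
have unit t := mean_matrix_unit hw t00 htT hFF hPhi' (fun i => (hPhi i).2) (t := t).
have sPhi i t : t0 <= t <= T -> vsqint (Phi i t).
  by move=> tT; exact: (vitop_sqint hw t00 (lexx t0) (hPhi i).1 tT).
have sLP i t : t0 <= t <= T -> vsqint (fun om => L t *m Phi i t om).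
  by move=> tT; exact/vsqint_mul/sPhi.
have h i : {ae leb, forall s : R, t0 <= s <= T -> forall j, \int[Pr]_om (L s *m Phi i s om) j 0 = 0}.
  apply: (@mean_eq0_of_norm _ _ _ _ w).
  - exact: (vsL2M_dL2 hw t00 t0T (defect_mdL2 htT hD hP hK) (hPhi i).1).
  - by move=> s sT j; exact: sqint_meas (sLP i s sT j).
  - exact: (homogeneous_defect_mean hom (hPhi i).1 (hPhi i).2).
apply: (ae_mono _ (ae_forall_fin h)) => s hs sT.
(* Column $i$ of the matrix is $E\Phi_i(s)$, and the deterministic [L s] comes out of the
   expectation. *)
have LE : L s *m (\matrix_(j, i) \int[Pr]_om Phi i s om j 0) = 0.
  apply/matrixP => j i; rewrite [RHS]mxE -[RHS](hs i sT j) mxE.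
  rewrite (sqint_mean (sLP i s sT j)).
  have -> : ip Pr (fun om => (L s *m Phi i s om) j 0) (fun=> 1) =
      ip Pr (fun om => \sum_k L s j k * Phi i s om k 0) (fun=> 1).
    by apply: eq_ip => om; rewrite mxE.
  rewrite ip_suml; last exact: sqint_cst; last by move=> k; apply: sqintZ; exact: sPhi.
  apply: eq_bigr => k _; rewrite (ipZl _ (sPhi i s sT k) (sqint_cst Pr 1)).
  by rewrite [X in _ * X = _]mxE (sqint_mean (sPhi i s sT k)).
by rewrite -[L s]mulmx1 -(mulmxV (unit s sT)) mulmxA LE mul0mx.
Qed.

End necessity.

Theorem mainTheorem3 (d : measure_display) (Omega : measurableType d)
  (R : realType) (Pr : probability Omega R) (w : R -> Omega -> R)
  (n m : nat) (t0 T : R) (D : lq_data R n m) (P : R -> 'M[R]_n)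
  (ht0 : 0 <= t0) (htT : t0 < T)
  (hw : brownian_motion Pr w)
  (hD : lq_coefficients t0 T D)
  (hJ : convexity Pr w t0 T D)
  (hP : riccati_solution t0 T D P)
  (hK : square_integrable_gain t0 T D P) :
  homogeneous Pr w t0 T D P <-> regular t0 T D P.
Proof.
split=> [hom|reg].
  exact/regularP/(homogeneous_defect hw ht0 htT hD hJ hP hK hom).
have L0 := (regularP t0 T D P).1 reg.
split=> [x0|x0 x p q u hs t tT].
  exact: (regular_solution hw ht0 htT hD hP hK x0 L0).
exact: (regular_homogeneous hw ht0 htT hD hP hK L0 hs tT).
Qed.
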